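(* Assume $D=D_K$ is prime, let $p>2$ be a prime split in $K$, and let $k>0$ with $\#\mathcal O^\times\mid k$. There is an injective $\mathbf C$-linear map $S^+_{k-1}(Dp,\chi_K)^{p\text{-old}}\to\mathcal M_k^*(p)$, $f\mapsto F_f$, such that for every $f=\sum a_\ell(f)q^\ell$ the form $F_f$ satisfies $$\alpha^*_{F_f}(\ell)=\frac{\sqrt D\,a_\ell(f)}{i\,a_D(\ell)}\qquad\text{for all integers }\ell\ge0\text{ with }a_D(\ell)\ne0.$$
   Context: Let $K$ be an imaginary quadratic field of class number one with discriminant $-D_K$, $\mathcal O$ its ring of integers, $\chi_K$ the associated quadratic character, $N(a)=a\bar a$, $\mathcal D^{-1}=\mathcal O/\sqrt{-D_K}$, $e[z]=e^{2\pi i z}$. $a_D(\ell)=\#\{u\in\mathcal D^{-1}/\mathcal O:D_KN(u)\equiv-\ell\pmod{D_K}\}$. Elliptic forms: $S^+_{k-1}(M,\chi_K)$ is the space of cusp forms of weight $k-1$ on $\Gamma_0(M)$ with character $\chi_K$ whose $n$-th coefficients vanish whenever $\chi_K(n)=1$; $S^+_{k-1}(Dp,\chi_K)^{p\text{-old}}$ is its intersection (for $M=Dp$) with the span of $h(\tau),h(p\tau)$, $h\in S_{k-1}(D,\chi_K)$. Hermitian forms: $\mathrm U(2,2)(\mathbf Z)=\{M\in \mathrm{GL}_4(\mathcal O):{}^t\bar M\begin{pmatrix}0&-I_2\\ I_2&0\end{pmatrix}M=\begin{pmatrix}0&-I_2\\ I_2&0\end{pmatrix}\}$, and $\Gamma_0^{(2)}(N)$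 is its subgroup of matrices whose lower-left $2\times2$ block lies in $N M_2(\mathcal O)$. $\mathbf H_2=\{Z\in M_2(\mathbf C):(Z-{}^t\bar Z)/(2i)>0\}$. $\mathcal M_k(N)$ is the space of holomorphic $F$ on $\mathbf H_2$ with $F((AZ+B)(CZ+E)^{-1})=\det(CZ+E)^kF(Z)$ for all $\begin{pmatrix}A&B\\ C&E\end{pmatrix}\in\Gamma_0^{(2)}(N)$. Let $\mathcal S=\{\begin{pmatrix}\ell&t\\ \bar t&m\end{pmatrix}:\ell,m\in\mathbf Z,\ t\in\mathcal D^{-1}\}$; each $F\in\mathcal M_k(N)$ has an expansion $F(Z)=\sum_{T\in\mathcal S,T\ge0}C_F(T)e[\mathrm{tr}(TZ)]$. For $T\in\mathcal S$ let $\epsilon(T)=\max\{q\in\mathbf Z_{>0}:T/q\in\mathcal S\}$. The Maass space $\mathcal M_k^*(N)$ is the set of $F\in\mathcal M_k(N)$ for which there is a function $\alpha_F^*:\mathbf Z_{\ge0}\to\mathbf C$ with $C_F(T)=\sum_{d\ge1,\ d\mid\epsilon(T),\ \gcd(d,N)=1}d^{k-1}\alpha_F^*(D_K\det T/d^2)$ for all $T\in\mathcal S$, $T\ge0$, $T\neq0$. *)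

(* Defs.v *)
From Stdlib Require Import Reals ZArith List Znumtheory Bool.
Open Scope R_scope.

Record Cx := mkC { Re : R ; Im : R }.

Definition C0 : Cx := mkC 0 0.
Definition C1 : Cx := mkC 1 0.
Definition Ci : Cx := mkC 0 1.
Definition RtoC (x : R) : Cx := mkC x 0.
Definition ZtoC (z : Z) : Cx := RtoC (IZR z).
Definition Cadd (z w : Cx) : Cx := mkC (Re z + Re w) (Im z + Im w).
Definition Copp (z : Cx) : Cx := mkC (- Re z) (- Im z).
Definition Csub (z w : Cx) : Cx := Cadd z (Copp w).
Definition Cmul (z w : Cx) : Cx :=
  mkC (Re z * Re w - Im z * Im w) (Re z * Im w + Im z * Re w).
Definition Cconj (z : Cx) : Cx := mkC (Re z) (- Im z).
Definition Cnorm2 (z : Cx) : R := Re z * Re z + Im z * Im z.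
Definition Cabs (z : Cx) : R := sqrt (Cnorm2 z).
Definition Cinv (z : Cx) : Cx := mkC (Re z / Cnorm2 z) (- Im z / Cnorm2 z).
Definition Cdiv (z w : Cx) : Cx := Cmul z (Cinv w).
Fixpoint Cpow (z : Cx) (n : nat) : Cx :=
  match n with O => C1 | S n => Cmul z (Cpow z n) end.
Definition Cexp (z : Cx) : Cx :=
  mkC (exp (Re z) * cos (Im z)) (exp (Re z) * sin (Im z)).
Definition e (z : Cx) : Cx := Cexp (Cmul (mkC 0 (2 * PI)) z).
Definition Csum (l : list Cx) : Cx := fold_right Cadd C0 l.

Definition Cconv (s : nat -> Cx) (l : Cx) : Prop :=
  forall eps, 0 < eps -> exists N, forall n, (N <= n)%nat -> Cabs (Csub (s n) l) < eps.

Definition inH (t : Cx) : Prop := 0 < Im t.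

Definition holo1 (f : Cx -> Cx) : Prop :=
  forall t, inH t -> exists c : Cx, forall eps, 0 < eps -> exists del, 0 < del /\
    forall h, Cabs h < del ->
      Cabs (Csub (Csub (f (Cadd t h)) (f t)) (Cmul c h)) <= eps * Cabs h.

Record M2 (A : Type) := mkM2 { m11 : A ; m12 : A ; m21 : A ; m22 : A }.
Arguments mkM2 {A}. Arguments m11 {A}. Arguments m12 {A}.
Arguments m21 {A}. Arguments m22 {A}.

Definition M2map {A B} (f : A -> B) (M : M2 A) : M2 B :=
  mkM2 (f (m11 M)) (f (m12 M)) (f (m21 M)) (f (m22 M)).

Definition Madd (M N : M2 Cx) : M2 Cx :=
  mkM2 (Cadd (m11 M) (m11 N)) (Cadd (m12 M) (m12 N))
       (Cadd (m21 M) (m21 N)) (Cadd (m22 M) (m22 N)).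
Definition Msub (M N : M2 Cx) : M2 Cx := Madd M (M2map Copp N).
Definition Mmul (M N : M2 Cx) : M2 Cx :=
  mkM2 (Cadd (Cmul (m11 M) (m11 N)) (Cmul (m12 M) (m21 N)))
       (Cadd (Cmul (m11 M) (m12 N)) (Cmul (m12 M) (m22 N)))
       (Cadd (Cmul (m21 M) (m11 N)) (Cmul (m22 M) (m21 N)))
       (Cadd (Cmul (m21 M) (m12 N)) (Cmul (m22 M) (m22 N))).
Definition Mstar (M : M2 Cx) : M2 Cx :=
  mkM2 (Cconj (m11 M)) (Cconj (m21 M)) (Cconj (m12 M)) (Cconj (m22 M)).
Definition Mdet (M : M2 Cx) : Cx :=
  Csub (Cmul (m11 M) (m22 M)) (Cmul (m12 M) (m21 M)).
Definition Minv (M : M2 Cx) : M2 Cx :=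
  let d := Mdet M in
  mkM2 (Cdiv (m22 M) d) (Cdiv (Copp (m12 M)) d)
       (Cdiv (Copp (m21 M)) d) (Cdiv (m11 M) d).
Definition Mtr (M : M2 Cx) : Cx := Cadd (m11 M) (m22 M).
Definition Mscal (c : Cx) (M : M2 Cx) : M2 Cx := M2map (Cmul c) M.
Definition Mnorm (M : M2 Cx) : R :=
  Cabs (m11 M) + Cabs (m12 M) + Cabs (m21 M) + Cabs (m22 M).

Definition Mquad (M : M2 Cx) (v1 v2 : Cx) : Cx :=
  Cadd (Cmul (Cconj v1) (Cadd (Cmul (m11 M) v1) (Cmul (m12 M) v2)))
       (Cmul (Cconj v2) (Cadd (Cmul (m21 M) v1) (Cmul (m22 M) v2))).

Definition posdef (M : M2 Cx) : Prop :=
  forall v1 v2, (v1 <> C0 \/ v2 <> C0) -> 0 < Re (Mquad M v1 v2).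
Definition possemidef (M : M2 Cx) : Prop :=
  forall v1 v2, 0 <= Re (Mquad M v1 v2).

Definition inH2 (Z : M2 Cx) : Prop :=
  posdef (Mscal (Cinv (mkC 0 2)) (Msub Z (Mstar Z))).

Definition holo2 (F : M2 Cx -> Cx) : Prop :=
  forall Z, inH2 Z -> exists L : M2 Cx, forall eps, 0 < eps -> exists del, 0 < del /\
    forall H, Mnorm H < del ->
      Cabs (Csub (Csub (F (Madd Z H)) (F Z))
                 (Csum (Cmul (m11 L) (m11 H) :: Cmul (m12 L) (m12 H)
                        :: Cmul (m21 L) (m21 H) :: Cmul (m22 L) (m22 H) :: nil))) <= eps * Mnorm H.

(* The field K = Q(sqrt(-D)), D prime, D = 3 mod 4 (so disc K = -D),   *)
(* and its ring of integers O = Z[w], w = (1 + sqrt(-D))/2,            *)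
(* w^2 = w - (1+D)/4.  An element (a,b) stands for a + b w.            *)
Definition OK := (Z * Z)%type.
Definition qD (D : Z) : Z := ((1 + D) / 4)%Z.
Definition O0 : OK := (0%Z, 0%Z).
Definition O1 : OK := (1%Z, 0%Z).
Definition Oadd (x y : OK) : OK := (fst x + fst y, snd x + snd y)%Z.
Definition Oopp (x : OK) : OK := (- fst x, - snd x)%Z.
Definition Omul (D : Z) (x y : OK) : OK :=
  let '(a, b) := x in let '(c, d) := y in
  (a * c - b * d * qD D, a * d + b * c + b * d)%Z.
(* Galois conjugation: conj w = 1 - w *)
Definition Oconj (x : OK) : OK := (fst x + snd x, - snd x)%Z.
Definition Onorm (D : Z) (x : OK) : Z :=
  let '(a, b) := x in (a * a + a * b + qD D * b * b)%Z.
Definition OtoC (D : Z) (x : OK) : Cx :=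
  mkC (IZR (fst x) + IZR (snd x) / 2) (IZR (snd x) * sqrt (IZR D) / 2).
Definition sqrtmD (D : Z) : Cx := mkC 0 (sqrt (IZR D)).

Definition Omultiple (N : Z) (x : OK) : Prop := (N | fst x)%Z /\ (N | snd x)%Z.

Definition Oideal (D : Z) (I : OK -> Prop) : Prop :=
  I O0 /\ (forall x y, I x -> I y -> I (Oadd x y)) /\
  (forall r x, I x -> I (Omul D r x)).
Definition class_number_one (D : Z) : Prop :=
  forall I, Oideal D I -> exists g, forall x, I x <-> exists y, x = Omul D g y.

Definition Ounit (D : Z) (u : OK) : Prop := exists v, Omul D u v = O1.
Definition card_units_divides (D : Z) (k : nat) : Prop :=
  exists L : list OK, NoDup L /\ (forall u, In u L <-> Ounit D u) /\
    (Z.of_nat (length L) | Z.of_nat k)%Z.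

(* an odd prime p splits in K (Dedekind-Kummer criterion for O = Z[w],
   whose minimal polynomial is X^2 - X + (1+D)/4): p is unramified and
   the minimal polynomial of w has a root mod p *)
Definition splits_in_K (D p : Z) : Prop :=
  ~ (p | D)%Z /\ exists x : Z, (p | x * x - x + qD D)%Z.

(* the quadratic character chi_K of K; for D prime, D = 3 mod 4, the
   Kronecker symbol (-D / .) is the Legendre symbol ( . / D) *)
Definition is_square_mod (D n : Z) : bool :=
  existsb (fun x => Z.eqb ((Z.of_nat x * Z.of_nat x - n) mod D) 0)
          (seq 0 (Z.to_nat D)).
Definition chiK (D n : Z) : Z :=
  if Z.eqb (n mod D) 0 then 0%Z else if is_square_mod D n then 1%Z else (-1)%Z.

(* a_D(l) = #{u in D^{-1}/O : D N(u) = -l mod D}.  Writing u = x/sqrt(-D),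
   x in O/sqrt(-D)O, one has D N(u) = N(x), and the integers 0..D-1 form a
   system of representatives of O/sqrt(-D)O = D^{-1}/O *)
Definition aD (D : Z) (l : nat) : nat :=
  length (filter (fun a => Z.eqb ((Onorm D (Z.of_nat a, 0%Z) + Z.of_nat l) mod D) 0)
                 (seq 0 (Z.to_nat D))).

Definition mobius (a b c d : Z) (t : Cx) : Cx :=
  Cdiv (Cadd (Cmul (ZtoC a) t) (ZtoC b)) (Cadd (Cmul (ZtoC c) t) (ZtoC d)).

Definition is_cusp_form (D : Z) (w : nat) (M : Z) (f : Cx -> Cx) : Prop :=
  holo1 f /\
  (forall a b c d : Z, (a * d - b * c = 1)%Z -> (M | c)%Z ->
     forall t, inH t ->
       f (mobius a b c d t) =
       Cmul (ZtoC (chiK D d)) (Cmul (Cpow (Cadd (Cmul (ZtoC c) t) (ZtoC d)) w) (f t))) /\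
  (forall a b c d : Z, (a * d - b * c = 1)%Z ->
     forall eps, 0 < eps -> exists Y, forall t, inH t -> Y < Im t ->
       Cabs (Cdiv (f (mobius a b c d t)) (Cpow (Cadd (Cmul (ZtoC c) t) (ZtoC d)) w)) < eps).

Definition qexp (f : Cx -> Cx) (a : nat -> Cx) : Prop :=
  forall t, inH t ->
    Cconv (fun N => Csum (map (fun n => Cmul (a n) (e (Cmul (RtoC (INR n)) t))) (seq 0 N)))
          (f t).

Definition is_plus_cusp_form (D : Z) (w : nat) (M : Z) (f : Cx -> Cx) : Prop :=
  is_cusp_form D w M f /\
  forall a, qexp f a -> forall n : nat, chiK D (Z.of_nat n) = 1%Z -> a n = C0.

Definition is_plus_pold (D p : Z) (w : nat) (f : Cx -> Cx) : Prop :=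
  is_plus_cusp_form D w (D * p) f /\
  exists h1 h2, is_cusp_form D w D h1 /\ is_cusp_form D w D h2 /\
    forall t, inH t -> f t = Cadd (h1 t) (h2 (Cmul (ZtoC p) t)).

Definition M2O := M2 OK.
Definition MOtoC (D : Z) (M : M2O) : M2 Cx := M2map (OtoC D) M.
Definition MOmul (D : Z) (M N : M2O) : M2O :=
  mkM2 (Oadd (Omul D (m11 M) (m11 N)) (Omul D (m12 M) (m21 N)))
       (Oadd (Omul D (m11 M) (m12 N)) (Omul D (m12 M) (m22 N)))
       (Oadd (Omul D (m21 M) (m11 N)) (Omul D (m22 M) (m21 N)))
       (Oadd (Omul D (m21 M) (m12 N)) (Omul D (m22 M) (m22 N))).
Definition MOsub (M N : M2O) : M2O :=
  mkM2 (Oadd (m11 M) (Oopp (m11 N))) (Oadd (m12 M) (Oopp (m12 N)))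
       (Oadd (m21 M) (Oopp (m21 N))) (Oadd (m22 M) (Oopp (m22 N))).
Definition MOstar (M : M2O) : M2O :=
  mkM2 (Oconj (m11 M)) (Oconj (m21 M)) (Oconj (m12 M)) (Oconj (m22 M)).
Definition MO0 : M2O := mkM2 O0 O0 O0 O0.
Definition MO1 : M2O := mkM2 O1 O0 O0 O1.

(* (A B; Cb E) in U(2,2)(Z): with J = (0 -1; 1 0) (blocks), the identity
   ^t conj(M) J M = J written out blockwise.  (Such M is automatically in
   GL_4(O), its inverse being J^{-1} ^t conj(M) J.) *)
Definition inU22 (D : Z) (A B Cb E : M2O) : Prop :=
  MOsub (MOmul D (MOstar Cb) A) (MOmul D (MOstar A) Cb) = MO0 /\
  MOsub (MOmul D (MOstar Cb) B) (MOmul D (MOstar A) E) = MOsub MO0 MO1 /\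
  MOsub (MOmul D (MOstar E) A) (MOmul D (MOstar B) Cb) = MO1 /\
  MOsub (MOmul D (MOstar E) B) (MOmul D (MOstar B) E) = MO0.

Definition inGamma0_2 (D N : Z) (A B Cb E : M2O) : Prop :=
  inU22 D A B Cb E /\
  Omultiple N (m11 Cb) /\ Omultiple N (m12 Cb) /\
  Omultiple N (m21 Cb) /\ Omultiple N (m22 Cb).

Definition is_herm_form (D : Z) (k : nat) (N : Z) (F : M2 Cx -> Cx) : Prop :=
  holo2 F /\
  forall A B Cb E, inGamma0_2 D N A B Cb E -> forall Z, inH2 Z ->
    let CZE := Madd (Mmul (MOtoC D Cb) Z) (MOtoC D E) in
    F (Mmul (Madd (Mmul (MOtoC D A) Z) (MOtoC D B)) (Minv CZE)) =
    Cmul (Cpow (Mdet CZE) k) (F Z).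

Definition Sidx := (Z * Z * OK)%type.
Definition Tmat (D : Z) (T : Sidx) : M2 Cx :=
  let '(l, m, x) := T in
  let t := Cdiv (OtoC D x) (sqrtmD D) in
  mkM2 (ZtoC l) t (Cconj t) (ZtoC m).
Definition DdetT (D : Z) (T : Sidx) : Z :=
  let '(l, m, x) := T in (D * l * m - Onorm D x)%Z.
(* eps(T) = max{q > 0 : T/q in S} = gcd(l, m, x1, x2) *)
Definition epsT (T : Sidx) : Z :=
  let '(l, m, x) := T in Z.gcd (Z.gcd l m) (Z.gcd (fst x) (snd x)).

Definition Zrange (N : nat) : list Z :=
  map (fun j => (Z.of_nat j - Z.of_nat N)%Z) (seq 0 (2 * N + 1)).
Definition Sbox (N : nat) : list Sidx :=
  flat_map (fun l => flat_map (fun m => flat_map (fun a =>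
    map (fun b => (l, m, (a, b))) (Zrange N)) (Zrange N)) (Zrange N)) (Zrange N).

Definition fourier (D : Z) (F : M2 Cx -> Cx) (Cf : Sidx -> Cx) : Prop :=
  (forall T, ~ possemidef (Tmat D T) -> Cf T = C0) /\
  forall Z, inH2 Z ->
    let term := fun T => Cmul (Cf T) (e (Mtr (Mmul (Tmat D T) Z))) in
    (exists Bd, forall N, fold_right Rplus 0 (map (fun T => Cabs (term T)) (Sbox N)) <= Bd) /\
    Cconv (fun N => Csum (map term (Sbox N))) (F Z).

Definition maass_rel (D : Z) (k : nat) (N : Z) (Cf : Sidx -> Cx) (alpha : nat -> Cx) : Prop :=
  forall T, possemidef (Tmat D T) -> T <> (0%Z, 0%Z, O0) ->
    Cf T = Csum (map (fun d =>
                   Cmul (Cpow (RtoC (INR d)) (k - 1))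
                        (alpha (Z.to_nat (DdetT D T / (Z.of_nat d * Z.of_nat d)))))
                 (filter (fun d => Z.eqb (epsT T mod Z.of_nat d) 0
                                   && Z.eqb (Z.gcd (Z.of_nat d) N) 1)
                         (seq 1 (Z.to_nat (epsT T))))).

Definition is_maass_form (D : Z) (k : nat) (N : Z) (F : M2 Cx -> Cx) : Prop :=
  is_herm_form D k N F /\
  exists Cf alpha, fourier D F Cf /\ maass_rel D k N Cf alpha.

(* Main.v *)
(* The plus condition makes the coefficients of [f] vanish at every [n] with [chi_K n = 1], so the
   quadratic Gauss sums modulo [D] express the twist of [f] by [chi_K] through the sum of its shifts
   [f (t + v/D)].  The matrix [(D a, b; p, D)] of determinant [1] exchanges these two functions, and
   this determines how [ft = sum_v f ((t + v)/D) / D] transforms under it.  Let [th 0] be the theta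
   series of the lattice [sqrt(-D) O]; its transformation law under [SL2 Z] comes from a theta
   inversion formula.  Summing the translates of [ft * th 0] over [Gamma_0(Dp)] in [Gamma_0(p)] gives
   a Hermitian Jacobi form of index 1 on [Gamma_0(p)] whose coefficients are
   [sqrt D a_l / (i a_D l)].  The Hecke operators [V_m] (over divisors prime to [p]) turn it
   into the Fourier-Jacobi coefficients of [F_f], which is therefore invariant under the embedded
   [Gamma_0(p)], under the translations, and, its coefficients depending only on [det T] and
   [eps T], under the diagonal [GL_2(O)].  As [O] is principal these matrices generate
   [Gamma_0^(2)(p)].  The coefficients of [F_f] determine those of [f], whence injectivity. *)
From Coquelicot Require Import AutoDerive Rcomplements Rbar Hierarchy Continuity Derive RInt RInt_analysis.
From Stdlib Require Import Reals ZArith List Znumtheory Lra Lia Psatz Permutation.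
From Stdlib Require Import Classical ClassicalEpsilon FunctionalExtensionality.
Require Import Defs.
Open Scope R_scope.

(** * Complex numbers *)

(** The lattice of the theta series has rank 2, so its inversion consists of two one-variable
    inversions, each contributing a square root of tau. No branch is ever chosen: the one-variable
    factor [Kth] is defined as a quotient, its scaling law Kth(n^2 tau) = n Kth(tau) forces the
    logarithmic derivative 1/(2 tau), and hence the product of two such factors is a constant times
    tau. Nor is that constant integrated: relations between S and T in SL2(Z), applied at a nonzero
    value of the theta series, give C^2 D = -1 and C g = 1 for the Gauss sum g. So g^2 = -D, and the
    fact that -1 is a nonsquare modulo D, are consequences of the theta series. The factor 1/a_D(l)
    is the weight (1 + [D | l])/2 that the D + 1 cosets produce together. In the generation argument
    the obstacle is a column whose common factor is divisible by p, since no matrix of level p can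
    then clear it; it is excluded by reducing a unitarity relation modulo p and taking norms. For
    injectivity, the coefficients with a_D(l) = 0, which the lift cannot see, are exactly ones
    killed by the plus condition. *)

Ltac mcbn := cbn [m11 m12 m21 m22].
Ltac pcbn := cbn [fst snd].

Declare Scope cx_scope.
Delimit Scope cx_scope with C.
Infix "+" := Cadd : cx_scope.
Infix "-" := Csub : cx_scope.
Infix "*" := Cmul : cx_scope.
Infix "/" := Cdiv : cx_scope.
Notation "- z" := (Copp z) : cx_scope.
Bind Scope cx_scope with Cx.
Arguments Cabs _%_C.
Arguments Cexp _%_C.
Arguments e _%_C.
Arguments Cpow _%_C _%_nat.
Arguments Cinv _%_C.
Arguments Cconj _%_C.
Arguments Cnorm2 _%_C.
Arguments Re _%_C.
Arguments Im _%_C.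
Arguments Cadd _%_C _%_C.
Arguments Csub _%_C _%_C.
Arguments Cmul _%_C _%_C.
Arguments Cdiv _%_C _%_C.
Arguments Copp _%_C.

Lemma Cx_eq (z w : Cx) : Re z = Re w -> Im z = Im w -> z = w.
Proof. destruct z, w; simpl; congruence. Qed.

Lemma Cnorm2_pos (z : Cx) : 0 <= Cnorm2 z.
Proof. unfold Cnorm2; nra. Qed.

Lemma Cnorm2_eq0 (z : Cx) : Cnorm2 z = 0 -> z = C0.
Proof. unfold Cnorm2; intros H; apply Cx_eq; simpl; nra. Qed.

Lemma Cnorm2_gt0 (z : Cx) : z <> C0 -> 0 < Cnorm2 z.
Proof. intros H. destruct (Cnorm2_pos z) as [|E]; auto. exfalso. now apply H, Cnorm2_eq0. Qed.

Lemma Cx_ring_theory : ring_theory C0 C1 Cadd Cmul Csub Copp (@eq Cx).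
Proof.
 split; intros; try reflexivity; apply Cx_eq; simpl; ring.
Qed.

Lemma Cinv_l (z : Cx) : z <> C0 -> Cmul (Cinv z) z = C1.
Proof.
 intros H. assert (Cnorm2 z <> 0) by (intro E; apply H, Cnorm2_eq0, E).
 unfold Cnorm2 in H0.
 apply Cx_eq; simpl; unfold Cnorm2; field; exact H0.
Qed.

Lemma C1_neq_C0 : C1 <> C0.
Proof. intro H. apply (f_equal Re) in H. simpl in H. lra. Qed.

Lemma Cx_field_theory : field_theory C0 C1 Cadd Cmul Csub Copp Cdiv Cinv (@eq Cx).
Proof.
 split; [apply Cx_ring_theory | apply C1_neq_C0 | reflexivity | apply Cinv_l].
Qed.

Lemma ZtoC_morph :
 ring_morph C0 C1 Cadd Cmul Csub Copp (@eq Cx) 0%Z 1%Z Z.add Z.mul Z.sub Z.opp Z.eqb ZtoC.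
Proof.
 split; try reflexivity; intros; unfold ZtoC, RtoC.
 - rewrite plus_IZR; apply Cx_eq; simpl; ring.
 - rewrite minus_IZR; apply Cx_eq; simpl; ring.
 - rewrite mult_IZR; apply Cx_eq; simpl; ring.
 - rewrite opp_IZR; apply Cx_eq; simpl; ring.
 - apply Z.eqb_eq in H; now subst.
Qed.

Lemma Cpow_power_theory : power_theory C1 Cmul (@eq Cx) nat_of_N Cpow.
Proof.
 split. intros r n. destruct n; simpl; [reflexivity|].
 induction p using Pos.peano_ind; simpl.
 - apply Cx_eq; simpl; ring.
 - rewrite Pos2Nat.inj_succ. simpl. rewrite IHp.
  now rewrite (pow_pos_succ (Eqsth Cx)
   (Eq_ext Cadd Cmul Copp).(Rmul_ext)
   Cx_ring_theory.(Rmul_assoc)).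
Qed.

Ltac Cx_cst t :=
 match t with
 | C0 => constr:(0%Z)
 | C1 => constr:(1%Z)
 | ZtoC ?z => match isZcst z with true => z | _ => constr:(InitialRing.NotConstant) end
 | RtoC (IZR ?z) => match isZcst z with true => z | _ => constr:(InitialRing.NotConstant) end
 | _ => constr:(InitialRing.NotConstant)
 end.
Ltac Cpow_tac t :=
 match isnatcst t with
 | true => constr:(N_of_nat t)
 | _ => constr:(InitialRing.NotConstant)
 end.

Lemma ZtoC_eqb_complete (x y : Z) : ZtoC x = ZtoC y -> Z.eqb x y = true.
Proof.
 intros H. apply (f_equal Re) in H. simpl in H. apply eq_IZR in H. subst. apply Z.eqb_refl.
Qed.

Add Field Cx_field : Cx_field_theory
 (morphism ZtoC_morph, completeness ZtoC_eqb_complete, constants [Cx_cst],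
 power_tac Cpow_power_theory [Cpow_tac]).

Lemma ZtoC_add x y : ZtoC (x + y) = (ZtoC x + ZtoC y)%C.
Proof. apply ZtoC_morph. Qed.
Lemma ZtoC_sub x y : ZtoC (x - y) = (ZtoC x - ZtoC y)%C.
Proof. apply ZtoC_morph. Qed.
Lemma ZtoC_mul x y : ZtoC (x * y) = (ZtoC x * ZtoC y)%C.
Proof. apply ZtoC_morph. Qed.
Lemma ZtoC_opp x : ZtoC (- x) = (- ZtoC x)%C.
Proof. apply ZtoC_morph. Qed.
Lemma ZtoC_inj x y : ZtoC x = ZtoC y -> x = y.
Proof. intros H. apply Z.eqb_eq, ZtoC_eqb_complete, H. Qed.
Lemma ZtoC_neq0 x : x <> 0%Z -> ZtoC x <> C0.
Proof. intros H E. apply H, (ZtoC_inj x 0 E). Qed.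

Lemma RtoC_add x y : RtoC (x + y) = (RtoC x + RtoC y)%C.
Proof. apply Cx_eq; simpl; ring. Qed.
Lemma RtoC_sub x y : RtoC (x - y) = (RtoC x - RtoC y)%C.
Proof. apply Cx_eq; simpl; ring. Qed.
Lemma RtoC_opp x : RtoC (- x) = (- RtoC x)%C.
Proof. apply Cx_eq; simpl; ring. Qed.
Lemma RtoC_mul x y : RtoC (x * y) = (RtoC x * RtoC y)%C.
Proof. apply Cx_eq; simpl; ring. Qed.
Lemma RtoC_inj x y : RtoC x = RtoC y -> x = y.
Proof. intros H; apply (f_equal Re) in H; exact H. Qed.
Lemma RtoC_neq0 x : x <> 0 -> RtoC x <> C0.
Proof. intros H E; apply H, (RtoC_inj x 0 E). Qed.
Lemma RtoC_inv x : x <> 0 -> RtoC (/ x) = Cinv (RtoC x).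
Proof. intros H. apply Cx_eq; simpl; unfold Cnorm2; simpl; field; auto. Qed.
Lemma RtoC_div x y : y <> 0 -> RtoC (x / y) = (RtoC x / RtoC y)%C.
Proof. intros H. unfold Rdiv, Cdiv. rewrite RtoC_mul, RtoC_inv; auto. Qed.
Lemma RtoC_pow x n : RtoC (x ^ n) = Cpow (RtoC x) n.
Proof. induction n; simpl; [reflexivity|]. rewrite RtoC_mul, IHn. reflexivity. Qed.
Lemma RtoC_INR_Z n : RtoC (INR n) = ZtoC (Z.of_nat n).
Proof. unfold ZtoC. now rewrite INR_IZR_INZ. Qed.

Lemma Cabs_pos z : 0 <= Cabs z.
Proof. apply sqrt_pos. Qed.
Lemma Cabs_sqr z : Cabs z * Cabs z = Cnorm2 z.
Proof. apply sqrt_sqrt, Cnorm2_pos. Qed.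
Lemma Cabs_mul z w : Cabs (z * w) = Cabs z * Cabs w.
Proof.
 unfold Cabs. rewrite <- sqrt_mult by apply Cnorm2_pos. f_equal.
 unfold Cnorm2; simpl; ring.
Qed.
Lemma Cabs_RtoC x : Cabs (RtoC x) = Rabs x.
Proof.
 unfold Cabs, Cnorm2; simpl. replace (x * x + 0 * 0) with (Rsqr x) by (unfold Rsqr; ring).
 apply sqrt_Rsqr_abs.
Qed.
Lemma Cabs_0 : Cabs C0 = 0.
Proof. change C0 with (RtoC 0). rewrite Cabs_RtoC. apply Rabs_R0. Qed.
Lemma Cabs_1 : Cabs C1 = 1.
Proof. change C1 with (RtoC 1). rewrite Cabs_RtoC. apply Rabs_R1. Qed.
Lemma Cabs_eq0 z : Cabs z = 0 -> z = C0.
Proof. intros H. apply Cnorm2_eq0. rewrite <- Cabs_sqr, H. ring. Qed.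
Lemma Cabs_gt0 z : z <> C0 -> 0 < Cabs z.
Proof.
 intros H. destruct (Rle_lt_or_eq_dec _ _ (Cabs_pos z)) as [h|h]; auto.
 exfalso; apply H, Cabs_eq0; auto.
Qed.
Lemma Cabs_opp z : Cabs (- z) = Cabs z.
Proof. unfold Cabs, Cnorm2; simpl; f_equal; ring. Qed.
Lemma Cabs_conj z : Cabs (Cconj z) = Cabs z.
Proof. unfold Cabs, Cnorm2; simpl; f_equal; ring. Qed.
Lemma Re_le_Cabs z : Rabs (Re z) <= Cabs z.
Proof.
 unfold Cabs. rewrite <- sqrt_Rsqr_abs. apply sqrt_le_1_alt. unfold Cnorm2, Rsqr. nra.
Qed.
Lemma Im_le_Cabs z : Rabs (Im z) <= Cabs z.
Proof.
 unfold Cabs. rewrite <- sqrt_Rsqr_abs. apply sqrt_le_1_alt. unfold Cnorm2, Rsqr. nra.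
Qed.
Lemma Cabs_le_sum z : Cabs z <= Rabs (Re z) + Rabs (Im z).
Proof.
 pose proof (Rabs_pos (Re z)); pose proof (Rabs_pos (Im z)).
 apply Rsqr_incr_0_var; [|lra]. unfold Rsqr. rewrite Cabs_sqr. unfold Cnorm2.
 rewrite <- (Rabs_right (Re z * Re z)), <- (Rabs_right (Im z * Im z)) by nra.
 rewrite !Rabs_mult. nra.
Qed.
Lemma Cabs_triang z w : Cabs (z + w) <= Cabs z + Cabs w.
Proof.
 pose proof (Cabs_pos z) as Hz; pose proof (Cabs_pos w) as Hw.
 apply Rsqr_incr_0_var; [|lra]. unfold Rsqr.
 replace ((Cabs z + Cabs w) * (Cabs z + Cabs w))
  with (Cabs z * Cabs z + Cabs w * Cabs w + 2 * (Cabs z * Cabs w)) by ring.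
 rewrite !Cabs_sqr.
 assert (Re z * Re w + Im z * Im w <= Cabs z * Cabs w).
 { replace (Cabs z * Cabs w) with (Cabs (Cmul (Cconj z) w)) by (rewrite Cabs_mul, Cabs_conj; ring).
  eapply Rle_trans; [|apply Re_le_Cabs]. simpl.
  eapply Rle_trans; [apply Rle_abs|]. right; f_equal; ring. }
 unfold Cnorm2 in *; simpl; nra.
Qed.
Lemma Cabs_sub_le z w : Cabs (z - w) <= Cabs z + Cabs w.
Proof. unfold Csub. rewrite <- (Cabs_opp w). apply Cabs_triang. Qed.
Lemma Cabs_sub_sym z w : Cabs (z - w) = Cabs (w - z).
Proof. rewrite <- Cabs_opp. f_equal. ring. Qed.
Lemma Cabs_triang_inv z w : Cabs z - Cabs w <= Cabs (z - w).
Proof.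
 assert (Cabs z <= Cabs (z - w) + Cabs w); [|lra].
 replace z with ((z - w) + w)%C at 1 by ring. apply Cabs_triang.
Qed.
Lemma Cabs_inv z : z <> C0 -> Cabs (Cinv z) = / Cabs z.
Proof.
 intros H. pose proof (Cabs_gt0 _ H).
 apply Rmult_eq_reg_r with (Cabs z); [|lra].
 rewrite <- Cabs_mul, Cinv_l, Cabs_1, Rinv_l; auto; lra.
Qed.
Lemma Cabs_div z w : w <> C0 -> Cabs (z / w) = Cabs z / Cabs w.
Proof. intros. unfold Cdiv. rewrite Cabs_mul, Cabs_inv; auto. Qed.
Lemma Cabs_pow z n : Cabs (Cpow z n) = Cabs z ^ n.
Proof. induction n; simpl; [apply Cabs_1|]. now rewrite Cabs_mul, IHn. Qed.
Lemma Cx_eq_eps z w : (forall eps, 0 < eps -> Cabs (z - w) <= eps) -> z = w.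
Proof.
 intros H. assert (E : Cabs (z - w) = 0).
 { apply Rle_antisym; [|apply Cabs_pos]. apply le_epsilon. intros eps He.
  rewrite Rplus_0_l. auto. }
 apply Cabs_eq0 in E. replace z with ((z - w) + w)%C by ring. rewrite E. ring.
Qed.
Lemma Cmul_integral z w : Cmul z w = C0 -> z = C0 \/ w = C0.
Proof.
 intros H. destruct (classic (z = C0)) as [h|h]; auto. right.
 replace w with (Cmul (Cinv z) (Cmul z w)) by (field; auto). rewrite H. ring.
Qed.
Lemma Cmul_neq0 z w : z <> C0 -> w <> C0 -> Cmul z w <> C0.
Proof. intros H1 H2 E. destruct (Cmul_integral _ _ E); auto. Qed.
Lemma Cinv_neq0 z : z <> C0 -> Cinv z <> C0.
Proof.
 intros H E. pose proof (Cinv_l z H) as K. rewrite E in K.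
 apply C1_neq_C0. rewrite <- K. ring.
Qed.
Lemma Cpow_neq0 z n : z <> C0 -> Cpow z n <> C0.
Proof. intros H; induction n; simpl; [apply C1_neq_C0|now apply Cmul_neq0]. Qed.
Lemma Cpow_mul z w n : Cpow (z * w) n = (Cpow z n * Cpow w n)%C.
Proof. induction n; simpl; [ring|]. rewrite IHn; ring. Qed.
Lemma Cpow_add z m n : Cpow z (m + n) = (Cpow z m * Cpow z n)%C.
Proof. induction m; simpl; [ring|]. rewrite IHm; ring. Qed.
Lemma Cpow_inv z n : z <> C0 -> Cpow (Cinv z) n = Cinv (Cpow z n).
Proof. intros H. induction n; simpl; [|rewrite IHn; pose proof (Cpow_neq0 z n H)]; field; auto using C1_neq_C0. Qed.
Lemma Cpow_1_l n : Cpow C1 n = C1.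
Proof. induction n; simpl; [reflexivity|]. rewrite IHn; ring. Qed.
Lemma Im_neq0 z : Im z <> 0 -> z <> C0.
Proof. intros H E; apply H; now rewrite E. Qed.
Lemma Ci_neq0 : Ci <> C0.
Proof. apply Im_neq0. simpl. lra. Qed.

(** * The exponential function and its Taylor bounds *)

Lemma Cexp_add z w : Cexp (z + w) = (Cexp z * Cexp w)%C.
Proof.
 unfold Cexp; apply Cx_eq; simpl; rewrite exp_plus, ?cos_plus, ?sin_plus; ring.
Qed.
Lemma Cexp_0 : Cexp C0 = C1.
Proof. unfold Cexp; apply Cx_eq; simpl; rewrite exp_0, ?cos_0, ?sin_0; ring. Qed.
Lemma Cabs_Cexp z : Cabs (Cexp z) = exp (Re z).
Proof.
 unfold Cabs, Cnorm2, Cexp; simpl.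
 replace (_ + _) with (Rsqr (exp (Re z)) * (Rsqr (sin (Im z)) + Rsqr (cos (Im z))))
  by (unfold Rsqr; ring).
 rewrite sin2_cos2, Rmult_1_r. apply sqrt_Rsqr. left; apply exp_pos.
Qed.
Lemma Cexp_neq0 z : Cexp z <> C0.
Proof.
 intros H. pose proof (Cabs_Cexp z). rewrite H, Cabs_0 in H0.
 pose proof (exp_pos (Re z)). lra.
Qed.
Lemma Cexp_opp z : Cexp (- z) = Cinv (Cexp z).
Proof.
 pose proof (Cexp_neq0 z).
 assert (E : Cmul (Cexp (- z)) (Cexp z) = C1).
 { rewrite <- Cexp_add. replace (- z + z)%C with C0 by ring. apply Cexp_0. }
 replace (Cexp (- z)) with (Cmul (Cmul (Cexp (- z)) (Cexp z)) (Cinv (Cexp z))) by (field; auto).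
 rewrite E. field; auto.
Qed.

Lemma e_add z w : e (z + w) = (e z * e w)%C.
Proof. unfold e. rewrite <- Cexp_add. f_equal. ring. Qed.
Lemma e_0 : e C0 = C1.
Proof. unfold e. rewrite <- Cexp_0. f_equal. ring. Qed.
Lemma e_neq0 z : e z <> C0.
Proof. apply Cexp_neq0. Qed.
Lemma e_opp z : e (- z) = Cinv (e z).
Proof. unfold e. rewrite <- Cexp_opp. f_equal. ring. Qed.
Lemma e_sub z w : e (z - w) = (e z / e w)%C.
Proof. unfold Csub. rewrite e_add, e_opp. reflexivity. Qed.
Lemma Cabs_e z : Cabs (e z) = exp (- (2 * PI * Im z)).
Proof. unfold e. rewrite Cabs_Cexp. simpl. f_equal. ring. Qed.
Lemma Cabs_e_real x : Cabs (e (RtoC x)) = 1.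
Proof. rewrite Cabs_e. simpl. rewrite Rmult_0_r, Ropp_0. apply exp_0. Qed.
Lemma e_1 : e C1 = C1.
Proof.
 unfold e, Cexp; apply Cx_eq; simpl.
 - replace (0 * 1 - 2 * PI * 0) with 0 by ring. replace (0 * 0 + 2 * PI * 1) with (2 * PI) by ring.
  rewrite exp_0, cos_2PI; ring.
 - replace (0 * 0 + 2 * PI * 1) with (2 * PI) by ring. rewrite sin_2PI; ring.
Qed.
Lemma e_nat n : e (RtoC (INR n)) = C1.
Proof.
 induction n; [apply e_0|]. rewrite S_INR, RtoC_add, e_add, IHn. rewrite (e_1 : e (RtoC 1) = C1). ring.
Qed.
Lemma e_Z z : e (ZtoC z) = C1.
Proof.
 destruct (Z_le_gt_dec 0 z).
 - rewrite <- (Z2Nat.id z) by auto. rewrite <- RtoC_INR_Z. apply e_nat.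
 - replace z with (- (Z.of_nat (Z.to_nat (- z))))%Z by lia.
  rewrite ZtoC_opp, e_opp, <- RtoC_INR_Z, e_nat.
  apply Cx_eq; simpl; unfold Cnorm2; simpl; field.
Qed.
Lemma e_add_Z z n : e (z + ZtoC n) = e z.
Proof. rewrite e_add, e_Z. ring. Qed.
Lemma e_mulnat z n : e (ZtoC (Z.of_nat n) * z) = Cpow (e z) n.
Proof.
 induction n. simpl. replace (ZtoC 0 * z)%C with C0 by ring. apply e_0.
 rewrite Nat2Z.inj_succ. unfold Z.succ. rewrite ZtoC_add.
 replace ((ZtoC (Z.of_nat n) + ZtoC 1) * z)%C with (z + ZtoC (Z.of_nat n) * z)%C by ring.
 rewrite e_add, IHn. reflexivity.
Qed.
Lemma e_conj_real x : Cconj (e (RtoC x)) = e (- RtoC x).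
Proof.
 replace (- RtoC x)%C with (RtoC (- x)) by (apply Cx_eq; simpl; ring).
 unfold e, Cexp, Cconj; simpl.
 replace (0 * x - 2 * PI * 0) with 0 by ring. replace (0 * - x - 2 * PI * 0) with 0 by ring.
 replace (0 * 0 + 2 * PI * x) with (2 * PI * x) by ring.
 replace (0 * 0 + 2 * PI * - x) with (- (2 * PI * x)) by ring.
 rewrite cos_neg, sin_neg. apply Cx_eq; simpl; ring.
Qed.

Lemma exp_le_mono x y : x <= y -> exp x <= exp y.
Proof. intros [H|H]; [left; now apply exp_increasing|right; now subst]. Qed.

Lemma exp_ge_1_x x : 1 + x <= exp x.
Proof. destruct (Req_dec x 0) as [->|h]; [rewrite exp_0; lra|]. left; now apply exp_ineq1. Qed.

Lemma exp_sub1_bound x : Rabs (exp x - 1) <= Rabs x * exp (Rabs x).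
Proof.
 pose proof (exp_ge_1_x x). pose proof (exp_ge_1_x (- x)). pose proof (exp_pos x).
 assert (E : exp x * exp (- x) = 1) by (rewrite <- exp_plus, Rplus_opp_r; apply exp_0).
 destruct (Rle_dec 0 x).
 - rewrite (Rabs_right x) by lra. rewrite Rabs_right by lra. nra.
 - rewrite (Rabs_left x) by lra. assert (1 < exp (- x)) by lra. assert (exp x < 1) by nra.
  rewrite (Rabs_left1 (exp x - 1)) by lra. nra.
Qed.

Lemma exp_sub1x_bound x : Rabs (exp x - 1 - x) <= x * x * exp (Rabs x).
Proof.
 pose proof (exp_ge_1_x x). rewrite Rabs_right by lra.
 pose proof (exp_ge_1_x (- x)). pose proof (exp_pos x).
 assert (E : exp x * exp (- x) = 1) by (rewrite <- exp_plus, Rplus_opp_r; apply exp_0).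
 destruct (Rle_dec 0 x).
 - rewrite Rabs_right by lra. assert (exp x * (1 - x) <= 1) by nra.
  assert (exp x - 1 <= x * exp x) by nra.
  assert (x * (exp x - 1) <= x * (x * exp x)) by (apply Rmult_le_compat_l; lra). nra.
 - rewrite (Rabs_left x) by lra. assert (1 <= exp (- x)) by lra.
  assert (exp x <= 1) by nra.
  assert (exp x * (1 - x) <= 1) by nra.
  assert (exp x - 1 - x <= x * x); [|nra].
  assert (exp x <= 1 / (1 - x)).
  { apply Rmult_le_reg_r with (1 - x); [lra|]. replace (1 / (1 - x) * (1 - x)) with 1 by (field; lra). lra. }
  assert (1 / (1 - x) <= 1 + x + x * x); [|lra].
  apply Rmult_le_reg_r with (1 - x); [lra|]. replace (1 / (1 - x) * (1 - x)) with 1 by (field; lra). nra.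
Qed.

Lemma sin_abs_le x : Rabs (sin x) <= Rabs x.
Proof.
 destruct (MVT_gen sin 0 x cos) as [c [_ Hc]].
 - intros; apply is_derive_Reals, derivable_pt_lim_sin.
 - intros; apply continuity_sin.
 - rewrite sin_0, !Rminus_0_r in Hc. rewrite Hc, Rabs_mult.
  pose proof (COS_bound c). pose proof (Rabs_pos x).
  assert (Rabs (cos c) <= 1) by (apply Rabs_le; lra). nra.
Qed.

Lemma cos_sub1_bound x : Rabs (cos x - 1) <= x * x / 2.
Proof.
 replace x with (2 * (x / 2)) at 1 by field. rewrite cos_2a_sin.
 replace (1 - 2 * sin (x / 2) * sin (x / 2) - 1) with (- (2 * (sin (x / 2) * sin (x / 2)))) by ring.
 rewrite Rabs_Ropp, Rabs_right by nra.
 pose proof (sin_abs_le (x / 2)).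
 pose proof (Rsqr_le_abs_1 _ _ H). unfold Rsqr in H0. nra.
Qed.

Lemma cos_sub1_bound1 x : Rabs (cos x - 1) <= Rabs x.
Proof.
 destruct (Rle_dec (Rabs x) 2).
 - eapply Rle_trans; [apply cos_sub1_bound|].
  rewrite <- (Rabs_right (x * x)) by nra. rewrite Rabs_mult. pose proof (Rabs_pos x). nra.
 - pose proof (COS_bound x). apply Rle_trans with 2; [apply Rabs_le; lra|lra].
Qed.

Lemma sin_subx_bound x : Rabs (sin x - x) <= x * x.
Proof.
 destruct (MVT_gen (fun y => sin y - y) 0 x (fun y => cos y - 1)) as [c [Hc1 Hc]].
 - intros; apply is_derive_Reals. apply derivable_pt_lim_minus;
  [apply derivable_pt_lim_sin|apply derivable_pt_lim_id].
 - intros. apply continuity_pt_minus; [apply continuity_sin|apply derivable_continuous, derivable_id].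
 - rewrite sin_0, !Rminus_0_r in Hc. rewrite Hc, Rabs_mult.
  pose proof (cos_sub1_bound1 c). pose proof (Rabs_pos x). pose proof (Rabs_pos (cos c - 1)).
  assert (Rabs c <= Rabs x).
  { unfold Rmin, Rmax in Hc1. destruct (Rle_dec 0 x).
   - rewrite !Rabs_right; lra.
   - rewrite !Rabs_left1; lra. }
  rewrite <- (Rabs_right (x * x)) by nra. rewrite Rabs_mult. nra.
Qed.

(** The quadratic remainder behind every termwise differentiation below. The factor exp |h| makes it
    valid for all h, which matters when h is replaced by an unbounded frequency times an increment.
    With h = x + iy the remainder splits as e^x (e^(iy) - 1 - iy) + (e^x - 1 - x) + iy (e^x - 1). *)
Lemma Cexp_sub1_bound (h : Cx) : Cabs ((Cexp h - C1 - h)%C) <= 4 * (Cabs h * Cabs h) * exp (Cabs h).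
Proof.
 destruct h as [x y].
 set (A := Cmul (RtoC (exp x)) (mkC (cos y - 1) (sin y - y))).
 set (B := RtoC (exp x - 1 - x)).
 set (E := mkC 0 (y * (exp x - 1))).
 replace (Cexp (mkC x y) - C1 - mkC x y)%C with (A + B + E)%C
  by (unfold A, B, E, Cexp; apply Cx_eq; simpl; ring).
 pose proof (Re_le_Cabs (mkC x y)) as Hx. pose proof (Im_le_Cabs (mkC x y)) as Hy. simpl in Hx, Hy.
 set (r := Cabs (mkC x y)) in *.
 pose proof (Rabs_pos x). pose proof (Rabs_pos y).
 pose proof (exp_le_mono _ _ Hx) as He. pose proof (exp_pos (Rabs x)).
 assert (HA : Cabs A <= 3 / 2 * (y * y) * exp r).
 { unfold A. rewrite Cabs_mul, Cabs_RtoC, Rabs_right by (pose proof (exp_pos x); lra).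
  pose proof (Cabs_le_sum (mkC (cos y - 1) (sin y - y))) as K. simpl in K.
  pose proof (cos_sub1_bound y). pose proof (sin_subx_bound y).
  assert (exp x <= exp r) by (apply exp_le_mono; pose proof (Rle_abs x); lra).
  pose proof (exp_pos x).
  apply Rle_trans with (exp x * (3 / 2 * (y * y))).
  - apply Rmult_le_compat_l; lra.
  - assert (0 <= y * y) by nra. nra. }
 assert (HB : Cabs B <= x * x * exp r).
 { unfold B. rewrite Cabs_RtoC. eapply Rle_trans; [apply exp_sub1x_bound|].
  apply Rmult_le_compat_l; [nra|auto]. }
 assert (HC : Cabs E <= Rabs y * Rabs x * exp r).
 { unfold E. eapply Rle_trans; [apply Cabs_le_sum|]. simpl. rewrite Rabs_R0, Rplus_0_l, Rabs_mult.
  rewrite Rmult_assoc. apply Rmult_le_compat_l; [lra|]. eapply Rle_trans; [apply exp_sub1_bound|].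
  apply Rmult_le_compat_l; lra. }
 assert (Hr : r * r = x * x + y * y).
 { unfold r; rewrite Cabs_sqr; unfold Cnorm2; simpl; ring. }
 eapply Rle_trans; [apply Cabs_triang|].
 apply Rle_trans with (Cabs A + Cabs B + Cabs E).
 { apply Rplus_le_compat_r, Cabs_triang. }
 assert (Rabs y * Rabs x <= r * r) by nra.
 pose proof (exp_pos r).
 apply Rle_trans with ((3 / 2 * (y * y) + x * x + Rabs y * Rabs x) * exp r); [lra|].
 apply Rmult_le_compat_r; nra.
Qed.
Lemma Cmul_comm z w : (z * w)%C = (w * z)%C.
Proof. ring. Qed.
Lemma Cmul_assoc x y z : (x * (y * z))%C = (x * y * z)%C.
Proof. ring. Qed.
(** Holds without hypotheses because [Cinv C0] is [C0]: its numerators are zero. *)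
Lemma Cinv_mul z w : Cinv (z * w)%C = (Cinv z * Cinv w)%C.
Proof.
 destruct (excluded_middle_informative (z = C0)) as [->|Hz]; [|destruct (excluded_middle_informative (w = C0)) as [->|Hw]].
 - replace (C0 * w)%C with C0 by ring. apply Cx_eq; simpl; unfold Rdiv; ring.
 - replace (z * C0)%C with C0 by ring. apply Cx_eq; simpl; unfold Rdiv; ring.
 - field. auto.
Qed.

(** * Unconditional summation *)

Definition Rsum (l : list R) : R := fold_right Rplus 0 l.

Lemma Csum_app l1 l2 : Csum (l1 ++ l2) = (Csum l1 + Csum l2)%C.
Proof. induction l1; simpl; [ring|]. rewrite IHl1; ring. Qed.
Lemma Csum_perm l1 l2 : Permutation l1 l2 -> Csum l1 = Csum l2.
Proof. induction 1; simpl; try congruence; ring. Qed.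
Lemma Csum_map_add {I} (f g : I -> Cx) l :
 Csum (map (fun i => (f i + g i)%C) l) = (Csum (map f l) + Csum (map g l))%C.
Proof. induction l; simpl; [ring|]. rewrite IHl; ring. Qed.
Lemma Csum_map_scal {I} (c : Cx) (f : I -> Cx) l :
 Csum (map (fun i => (c * f i)%C) l) = (c * Csum (map f l))%C.
Proof. induction l; simpl; [ring|]. rewrite IHl; ring. Qed.
Lemma Csum_map_0 {I} (f : I -> Cx) l : (forall i, In i l -> f i = C0) -> Csum (map f l) = C0.
Proof.
 induction l; simpl; intros H; [reflexivity|]. rewrite H, IHl by auto. ring.
Qed.
Lemma Csum_map_const {I} (c : Cx) (l : list I) :
 Csum (map (fun _ => c) l) = (ZtoC (Z.of_nat (length l)) * c)%C.
Proof.
 induction l; simpl length; [simpl; ring|]. rewrite Nat2Z.inj_succ. unfold Z.succ.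
 rewrite ZtoC_add. simpl map. simpl Csum. rewrite IHl. ring.
Qed.
Lemma Csum_list_prod {I J} (f : I * J -> Cx) l m :
 Csum (map f (list_prod l m)) = Csum (map (fun i => Csum (map (fun j => f (i, j)) m)) l).
Proof.
 induction l; simpl; [reflexivity|]. rewrite map_app, Csum_app, IHl, map_map. reflexivity.
Qed.
Lemma Csum_filter {I} (f : I -> Cx) (b : I -> bool) l :
 Csum (map f (filter b l)) = Csum (map (fun i => if b i then f i else C0) l).
Proof. induction l; simpl; [reflexivity|]. destruct (b a); simpl; rewrite IHl; ring. Qed.
Lemma Cabs_Csum {I} (f : I -> Cx) l : Cabs (Csum (map f l)) <= Rsum (map (fun i => Cabs (f i)) l).
Proof.
 induction l; simpl; [rewrite Cabs_0; lra|]. eapply Rle_trans; [apply Cabs_triang|]. lra.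
Qed.

Lemma Rsum_app l1 l2 : Rsum (l1 ++ l2) = Rsum l1 + Rsum l2.
Proof. induction l1; simpl; [ring|]. rewrite IHl1; ring. Qed.
Lemma Rsum_perm l1 l2 : Permutation l1 l2 -> Rsum l1 = Rsum l2.
Proof. induction 1; simpl; try congruence; ring. Qed.
Lemma Rsum_nonneg {I} (f : I -> R) l : (forall i, 0 <= f i) -> 0 <= Rsum (map f l).
Proof. intros H. induction l; simpl; [lra|]. specialize (H a). lra. Qed.
Lemma Rsum_le {I} (f g : I -> R) l :
 (forall i, In i l -> f i <= g i) -> Rsum (map f l) <= Rsum (map g l).
Proof.
 induction l; simpl; intros H; [lra|]. apply Rplus_le_compat; auto.
Qed.
Lemma Rsum_scal {I} c (f : I -> R) l : Rsum (map (fun i => c * f i) l) = c * Rsum (map f l).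
Proof. induction l; simpl; [ring|]. rewrite IHl; ring. Qed.
Lemma Rsum_add {I} (f g : I -> R) l :
 Rsum (map (fun i => f i + g i) l) = Rsum (map f l) + Rsum (map g l).
Proof. induction l; simpl; [ring|]. rewrite IHl; ring. Qed.
Lemma Rsum_list_prod {I J} (f : I * J -> R) l m :
 Rsum (map f (list_prod l m)) = Rsum (map (fun i => Rsum (map (fun j => f (i, j)) m)) l).
Proof.
 induction l; simpl; [reflexivity|]. rewrite map_app, Rsum_app, IHl, map_map. reflexivity.
Qed.

(** Classical equality test, so that finite lists over any index type can be freed of repetitions
    and compared. *)
Definition ceq {I} (x y : I) : {x = y} + {x <> y} := excluded_middle_informative (x = y).
Definition cnodup {I} (l : list I) := nodup ceq l.

Lemma NoDup_split_incl {I} (l m : list I) : NoDup l -> NoDup m -> incl l m ->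
 exists r, Permutation m (l ++ r) /\ NoDup r /\ forall x, In x r <-> In x m /\ ~ In x l.
Proof.
 intros Hl Hm Hi. set (r := filter (fun x => if in_dec ceq x l then false else true) m). exists r.
 assert (E : forall x, In x r <-> In x m /\ ~ In x l).
 { intros x. unfold r. rewrite filter_In. destruct (in_dec ceq x l); intuition discriminate. }
 assert (Hr : NoDup r) by now apply NoDup_filter.
 split; auto. apply NoDup_Permutation; auto.
 - apply NoDup_app; auto. intros x h1 h2. apply E in h2. tauto.
 - intros x. rewrite in_app_iff, E. destruct (in_dec ceq x l); intuition.
Qed.

Lemma preimage_list {I J} (h : J -> I) : (forall x y, h x = h y -> x = y) ->
 forall L, exists L', NoDup L' /\ forall j, In j L' <-> In (h j) L.
Proof.
 intros Hinj L. induction L as [|i L [L' [H1 H2]]]; [exists nil; split; [constructor|simpl; tauto]|].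
 destruct (classic (exists j, h j = i)) as [[j0 <-]|Hn].
 - exists (cnodup (j0 :: L')). split; [apply NoDup_nodup|]. intros j. unfold cnodup. rewrite nodup_In.
  simpl. rewrite H2. split; intros [E|E]; auto. subst; auto.
 - exists L'. split; auto. intros j. rewrite H2. simpl. split; [auto|intros [E|E]; auto].
  exfalso; eauto.
Qed.

Lemma Rsum_incl {I} (f : I -> R) l m : (forall i, 0 <= f i) -> NoDup l -> NoDup m -> incl l m ->
 Rsum (map f l) <= Rsum (map f m).
Proof.
 intros Hf Hl Hm Hi. destruct (NoDup_split_incl l m Hl Hm Hi) as [r [Hr _]].
 rewrite (Rsum_perm _ _ (Permutation_map f Hr)), map_app, Rsum_app.
 pose proof (Rsum_nonneg f r Hf). lra.
Qed.

Lemma NoDup_list_prod {I J} (l : list I) (m : list J) : NoDup l -> NoDup m -> NoDup (list_prod l m).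
Proof.
 induction 1 as [|x l Hx Hl IH]; intros Hm; simpl; [constructor|].
 apply NoDup_app; auto.
 - apply FinFun.Injective_map_NoDup; auto. intros a b E; congruence.
 - intros [a b] H1 H2. apply in_map_iff in H1. destruct H1 as [c [E H1]].
  apply in_prod_iff in H2. inversion E; subst. tauto.
Qed.

(* Unconditional convergence: the net of sums over finite subsets of [I]. *)
Definition HasSum {I} (f : I -> Cx) (s : Cx) : Prop :=
 forall eps, 0 < eps -> exists L0, forall L, NoDup L -> incl L0 L ->
  Cabs (Csum (map f L) - s) < eps.
Definition AbsSum {I} (f : I -> Cx) : Prop :=
 exists B, forall L, NoDup L -> Rsum (map (fun i => Cabs (f i)) L) <= B.

Lemma HasSum_unique {I} (f : I -> Cx) s t : HasSum f s -> HasSum f t -> s = t.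
Proof.
 intros H1 H2. apply Cx_eq_eps. intros eps He.
 destruct (H1 (eps / 2)) as [L1 K1]; [lra|]. destruct (H2 (eps / 2)) as [L2 K2]; [lra|].
 set (L := cnodup (L1 ++ L2)).
 assert (NoDup L) by apply NoDup_nodup.
 specialize (K1 L H). specialize (K2 L H).
 assert (incl L1 L) by (intros x Hx; apply nodup_In, in_or_app; auto).
 assert (incl L2 L) by (intros x Hx; apply nodup_In, in_or_app; auto).
 specialize (K1 H0). specialize (K2 H3).
 replace (s - t)%C with ((Csum (map f L) - t) - (Csum (map f L) - s))%C by ring.
 eapply Rle_trans; [apply Cabs_sub_le|]. lra.
Qed.

Lemma HasSum_ext {I} (f g : I -> Cx) s : (forall i, f i = g i) -> HasSum f s -> HasSum g s.
Proof. intros H. replace g with f; auto. now apply functional_extensionality. Qed.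
Lemma AbsSum_ext {I} (f g : I -> Cx) : (forall i, f i = g i) -> AbsSum f -> AbsSum g.
Proof. intros H. replace g with f; auto. now apply functional_extensionality. Qed.

Lemma HasSum_add {I} (f g : I -> Cx) s t :
 HasSum f s -> HasSum g t -> HasSum (fun i => (f i + g i)%C) (s + t)%C.
Proof.
 intros H1 H2 eps He.
 destruct (H1 (eps / 2)) as [L1 K1]; [lra|]. destruct (H2 (eps / 2)) as [L2 K2]; [lra|].
 exists (L1 ++ L2). intros L HL Hi.
 assert (incl L1 L) by (intros x Hx; apply Hi, in_or_app; auto).
 assert (incl L2 L) by (intros x Hx; apply Hi, in_or_app; auto).
 specialize (K1 L HL H). specialize (K2 L HL H0).
 rewrite Csum_map_add.
 replace (_ - _)%C with ((Csum (map f L) - s) + (Csum (map g L) - t))%C by ring.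
 eapply Rle_lt_trans; [apply Cabs_triang|]. lra.
Qed.

Lemma HasSum_scal {I} (c : Cx) (f : I -> Cx) s :
 HasSum f s -> HasSum (fun i => (c * f i)%C) (c * s)%C.
Proof.
 intros H eps He. pose proof (Cabs_pos c).
 destruct (H (eps / (Cabs c + 1))) as [L0 K].
 { apply Rdiv_lt_0_compat; lra. }
 exists L0. intros L HL Hi. specialize (K L HL Hi).
 rewrite Csum_map_scal. replace (_ - _)%C with (c * (Csum (map f L) - s))%C by ring.
 rewrite Cabs_mul. apply Rle_lt_trans with (Cabs c * (eps / (Cabs c + 1))).
 - apply Rmult_le_compat_l; lra.
 - apply Rmult_lt_reg_r with (Cabs c + 1); [lra|]. field_simplify; [|lra]. nra.
Qed.

Lemma HasSum_0 {I} (f : I -> Cx) : (forall i, f i = C0) -> HasSum f C0.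
Proof.
 intros H eps He. exists nil. intros L _ _. rewrite Csum_map_0 by auto.
 replace (C0 - C0)%C with C0 by ring. now rewrite Cabs_0.
Qed.

Lemma HasSum_sub {I} (f g : I -> Cx) s t :
 HasSum f s -> HasSum g t -> HasSum (fun i => (f i - g i)%C) (s - t)%C.
Proof.
 intros H1 H2. apply HasSum_ext with (fun i => (f i + (ZtoC (-1)) * g i)%C); [intros; ring|].
 replace (s - t)%C with (s + ZtoC (-1) * t)%C by ring. apply HasSum_add, HasSum_scal; auto.
Qed.

Lemma HasSum_Csum {I J} (f : J -> I -> Cx) (s : J -> Cx) (l : list J) :
 (forall j, In j l -> HasSum (f j) (s j)) ->
 HasSum (fun i => Csum (map (fun j => f j i) l)) (Csum (map s l)).
Proof.
 induction l; simpl; intros H; [apply HasSum_0; auto|].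
 apply HasSum_add; auto.
Qed.

Lemma AbsSum_le {I} (f g : I -> Cx) K :
 AbsSum g -> (forall i, Cabs (f i) <= K * Cabs (g i)) -> AbsSum f.
Proof.
 intros [B HB] H. exists (Rabs K * B). intros L HL.
 apply Rle_trans with (Rsum (map (fun i => Rabs K * Cabs (g i)) L)).
 - apply Rsum_le. intros. eapply Rle_trans; [apply H|].
  apply Rmult_le_compat_r; [apply Cabs_pos|apply Rle_abs].
 - rewrite Rsum_scal. apply Rmult_le_compat_l; [apply Rabs_pos|auto].
Qed.

Lemma AbsSum_scal {I} (c : Cx) (f : I -> Cx) : AbsSum f -> AbsSum (fun i => (c * f i)%C).
Proof. intros H. apply AbsSum_le with f (Cabs c); auto. intros; rewrite Cabs_mul; lra. Qed.

Lemma AbsSum_add {I} (f g : I -> Cx) : AbsSum f -> AbsSum g -> AbsSum (fun i => (f i + g i)%C).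
Proof.
 intros [B HB] [B' HB']. exists (B + B'). intros L HL.
 apply Rle_trans with (Rsum (map (fun i => Cabs (f i) + Cabs (g i)) L)).
 - apply Rsum_le. intros. apply Cabs_triang.
 - rewrite Rsum_add. specialize (HB L HL). specialize (HB' L HL). lra.
Qed.

Lemma AbsSum_0 {I} (f : I -> Cx) : (forall i, f i = C0) -> AbsSum f.
Proof.
 intros H. exists 0. intros L _. induction L; simpl; [lra|]. rewrite H, Cabs_0. lra.
Qed.

Lemma AbsSum_Csum {I J} (f : J -> I -> Cx) (l : list J) :
 (forall j, In j l -> AbsSum (f j)) -> AbsSum (fun i => Csum (map (fun j => f j i) l)).
Proof.
 induction l; simpl; intros H; [apply AbsSum_0; auto|]. apply AbsSum_add; auto.
Qed.

Lemma Rsum_sup {I} (f : I -> R) B : (forall L, NoDup L -> Rsum (map f L) <= B) ->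
 exists s, (forall L, NoDup L -> Rsum (map f L) <= s) /\
  forall eps, 0 < eps -> exists L, NoDup L /\ s - eps < Rsum (map f L).
Proof.
 intros HB. destruct (completeness (fun x => exists L, NoDup L /\ x = Rsum (map f L))) as [s [Hs1 Hs2]].
 - exists B. intros x [L [HL ->]]. auto.
 - exists 0, nil. split; [constructor|reflexivity].
 - exists s. split; [intros L HL; apply Hs1; eauto|]. intros eps He. apply NNPP. intros Hn.
  assert (s <= s - eps); [|lra]. apply Hs2.
  intros x [L [HL ->]]. apply Rnot_lt_le. intros Hx. apply Hn. eauto.
Qed.

Lemma HasSum_nonneg_ex {I} (f : I -> R) B : (forall i, 0 <= f i) ->
 (forall L, NoDup L -> Rsum (map f L) <= B) -> exists s, HasSum (fun i => RtoC (f i)) (RtoC s).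
Proof.
 intros Hf HB. destruct (Rsum_sup f B HB) as [s [Hs H]]. exists s. intros eps He.
 destruct (H eps He) as [L0 [HL0 H0]]. exists L0. intros L HL Hi.
 pose proof (Rsum_incl f L0 L Hf HL0 HL Hi). specialize (Hs L HL).
 replace (Csum (map (fun i => RtoC (f i)) L)) with (RtoC (Rsum (map f L))).
 - rewrite <- RtoC_sub, Cabs_RtoC. apply Rabs_def1; lra.
 - clear. induction L; simpl; [reflexivity|]. rewrite RtoC_add, IHL. reflexivity.
Qed.

(** Nonnegative families converge to the supremum of their finite sums; the positive and negative
    parts of the real and imaginary parts are four such families dominated by [Cabs (f i)]. *)
Lemma AbsSum_HasSum {I} (f : I -> Cx) : AbsSum f -> exists s, HasSum f s.
Proof.
 intros [B HB].
 assert (P : forall g : I -> R, (forall i, 0 <= g i <= Cabs (f i)) ->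
  exists s, HasSum (fun i => RtoC (g i)) (RtoC s)).
 { intros g Hg. apply HasSum_nonneg_ex with B; [apply Hg|]. intros L HL.
  eapply Rle_trans; [|apply (HB L HL)]. apply Rsum_le. intros; apply Hg. }
 assert (Q : forall h : I -> R, (forall i, Rabs (h i) <= Cabs (f i)) ->
  exists s, HasSum (fun i => RtoC (h i)) s).
 { intros h Hh.
  destruct (P (fun i => Rmax 0 (h i))) as [s1 H1].
  { intros i. specialize (Hh i). split; [apply Rmax_l|]. apply Rmax_lub; [apply Cabs_pos|].
   pose proof (Rle_abs (h i)); lra. }
  destruct (P (fun i => Rmax 0 (- h i))) as [s2 H2].
  { intros i. specialize (Hh i). split; [apply Rmax_l|]. apply Rmax_lub; [apply Cabs_pos|].
   pose proof (Rle_abs (- h i)). rewrite Rabs_Ropp in H. lra. }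
  exists (RtoC s1 - RtoC s2)%C. eapply HasSum_ext; [|apply (HasSum_sub _ _ _ _ H1 H2)].
  intros i. simpl. rewrite <- RtoC_sub. f_equal. unfold Rmax.
  destruct (Rle_dec 0 (h i)), (Rle_dec 0 (- h i)); lra. }
 destruct (Q (fun i => Re (f i))) as [s1 H1]; [intros; apply Re_le_Cabs|].
 destruct (Q (fun i => Im (f i))) as [s2 H2]; [intros; apply Im_le_Cabs|].
 exists (s1 + Ci * s2)%C.
 eapply HasSum_ext; [|apply (HasSum_add _ _ _ _ H1 (HasSum_scal Ci _ _ H2))].
 intros i. apply Cx_eq; simpl; ring.
Qed.

Lemma HasSum_le {I} (f : I -> Cx) s B : HasSum f s ->
 (forall L, NoDup L -> Rsum (map (fun i => Cabs (f i)) L) <= B) -> Cabs s <= B.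
Proof.
 intros H HB. apply le_epsilon. intros eps He. destruct (H eps He) as [L0 K].
 set (L := cnodup L0). assert (HL : NoDup L) by apply NoDup_nodup.
 assert (incl L0 L) by (intros x Hx; now apply nodup_In).
 specialize (K L HL H0). specialize (HB L HL).
 pose proof (Cabs_Csum f L).
 replace s with (Csum (map f L) - (Csum (map f L) - s))%C by ring.
 eapply Rle_trans; [apply Cabs_sub_le|]. lra.
Qed.

(** A total function by choice, meaningful only for summable families. This lets theta series and
    the lift be defined before their convergence is discussed. *)
Definition Sumv {I} (f : I -> Cx) : Cx := epsilon (inhabits C0) (fun s => HasSum f s).

Lemma Sumv_spec {I} (f : I -> Cx) : AbsSum f -> HasSum f (Sumv f).
Proof. intros H. unfold Sumv. apply epsilon_spec. now apply AbsSum_HasSum. Qed.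
Lemma Sumv_eq {I} (f : I -> Cx) s : HasSum f s -> Sumv f = s.
Proof.
 intros H. apply HasSum_unique with f; auto. unfold Sumv. apply epsilon_spec. eauto.
Qed.

Lemma HasSum_inj {I J} (h : J -> I) (f : I -> Cx) s :
 (forall x y, h x = h y -> x = y) -> (forall i, (forall j, h j <> i) -> f i = C0) ->
 HasSum f s -> HasSum (fun j => f (h j)) s.
Proof.
 intros Hinj H0 H eps He. destruct (H eps He) as [L0 K].
 destruct (preimage_list h Hinj L0) as [L0' [_ HL0]]. exists L0'. intros L HL Hi.
 set (M := cnodup (L0 ++ map h L)). assert (HM : NoDup M) by apply NoDup_nodup.
 assert (HhL : NoDup (map h L)) by (apply FinFun.Injective_map_NoDup; auto).
 specialize (K M HM).
 destruct (NoDup_split_incl (map h L) M HhL HM) as [r [Hr [_ Hr']]].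
 { intros x Hx. apply nodup_In, in_or_app; auto. }
 rewrite (Csum_perm _ _ (Permutation_map f Hr)), map_app, Csum_app, map_map, (Csum_map_0 f r) in K.
 - replace (Csum (map (fun j => f (h j)) L)) with (Csum (map (fun x => f (h x)) L) + C0)%C by ring.
  apply K. intros x Hx. apply nodup_In, in_or_app; auto.
 - intros i Hir. apply H0. intros j <-. apply Hr' in Hir as [HinM Hn].
  apply nodup_In, in_app_or in HinM. destruct HinM as [HinM|]; auto.
  now apply Hn, in_map, Hi, HL0.
Qed.

Lemma HasSum_reindex {I J} (h : J -> I) (h' : I -> J) (f : I -> Cx) s :
 (forall j, h' (h j) = j) -> (forall i, h (h' i) = i) ->
 HasSum f s -> HasSum (fun j => f (h j)) s.
Proof.
 intros H1 H2. apply HasSum_inj.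
 - intros x y E. rewrite <- (H1 x), <- (H1 y), E. reflexivity.
 - intros i Hi. exfalso. apply (Hi (h' i)). auto.
Qed.

Lemma AbsSum_inj {I J} (h : J -> I) (f : I -> Cx) :
 (forall x y, h x = h y -> x = y) -> AbsSum f -> AbsSum (fun j => f (h j)).
Proof.
 intros Hinj [B HB]. exists B. intros L HL. specialize (HB (map h L)).
 rewrite map_map in HB. apply HB. now apply FinFun.Injective_map_NoDup.
Qed.

Lemma HasSum_inj_conv {I J} (h : J -> I) (f : I -> Cx) s :
 (forall x y, h x = h y -> x = y) -> (forall i, (forall j, h j <> i) -> f i = C0) ->
 HasSum (fun j => f (h j)) s -> HasSum f s.
Proof.
 intros Hinj H0 H eps He. destruct (H eps He) as [L0 K].
 exists (map h L0). intros L HL Hi. destruct (preimage_list h Hinj L) as [L' [HL' E]].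
 destruct (NoDup_split_incl (map h L') L) as [r [Hr [_ Hr']]]; auto.
 { now apply FinFun.Injective_map_NoDup. }
 { intros x Hx. apply in_map_iff in Hx as [j [<- Hj]]. now apply E. }
 rewrite (Csum_perm _ _ (Permutation_map f Hr)), map_app, Csum_app, map_map, (Csum_map_0 f r).
 - replace (Csum (map (fun x => f (h x)) L') + C0)%C with (Csum (map (fun x => f (h x)) L')) by ring.
  apply K; auto. intros j Hj. apply E, Hi, in_map, Hj.
 - intros i Hir. apply H0. intros j <-. apply Hr' in Hir as [h1 h2]. apply h2, in_map, E, h1.
Qed.

Lemma AbsSum_inj_conv {I J} (h : J -> I) (f : I -> Cx) : (forall x y, h x = h y -> x = y) ->
 (forall i, (forall j, h j <> i) -> f i = C0) -> AbsSum (fun j => f (h j)) -> AbsSum f.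
Proof.
 intros Hinj H0 [B HB]. exists B. intros L HL. destruct (preimage_list h Hinj L) as [L' [HL' E]].
 destruct (NoDup_split_incl (map h L') L) as [r [Hr [_ Hr']]]; auto.
 { now apply FinFun.Injective_map_NoDup. }
 { intros x Hx. apply in_map_iff in Hx as [j [<- Hj]]. now apply E. }
 rewrite (Rsum_perm _ _ (Permutation_map (fun i => Cabs (f i)) Hr)), map_app, Rsum_app, map_map.
 specialize (HB L' HL'). assert (Rsum (map (fun i => Cabs (f i)) r) <= Rsum (map (fun i => 0 * 0) r)); [|rewrite Rsum_scal in *; lra].
 apply Rsum_le. intros i Hir. rewrite H0, Cabs_0; [lra|]. intros j <-.
 apply Hr' in Hir as [h1 h2]. apply h2, in_map, E, h1.
Qed.

Definition ASum {I} (f : I -> Cx) (s : Cx) : Prop := AbsSum f /\ HasSum f s.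
Lemma ASum_ext {I} (f g : I -> Cx) s : (forall i, f i = g i) -> ASum f s -> ASum g s.
Proof. intros E [A B]. split; [apply (AbsSum_ext f)|apply (HasSum_ext f)]; auto. Qed.
Lemma ASum_scal {I} c (f : I -> Cx) s : ASum f s -> ASum (fun i => (c * f i)%C) (c * s)%C.
Proof. intros [A B]. split; [apply AbsSum_scal|apply HasSum_scal]; auto. Qed.
Lemma ASum_Csum {I J} (f : J -> I -> Cx) (s : J -> Cx) (l : list J) :
 (forall j, In j l -> ASum (f j) (s j)) -> ASum (fun i => Csum (map (fun j => f j i) l)) (Csum (map s l)).
Proof. intros H. split; [apply AbsSum_Csum|apply HasSum_Csum]; intros j Hj; apply H; auto. Qed.
Lemma ASum_inj {I J} (h : J -> I) (f : I -> Cx) s : (forall x y, h x = h y -> x = y) ->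
 (forall i, (forall j, h j <> i) -> f i = C0) -> ASum f s -> ASum (fun j => f (h j)) s.
Proof. intros H1 H2 [A B]. split; [apply AbsSum_inj|apply HasSum_inj]; auto. Qed.
Lemma ASum_inj_conv {I J} (h : J -> I) (f : I -> Cx) s : (forall x y, h x = h y -> x = y) ->
 (forall i, (forall j, h j <> i) -> f i = C0) -> ASum (fun j => f (h j)) s -> ASum f s.
Proof. intros H1 H2 [A B]. split; [apply (AbsSum_inj_conv h)|apply (HasSum_inj_conv h)]; auto. Qed.
Lemma ASum_sub {I} (f g : I -> Cx) s t : ASum f s -> ASum g t -> ASum (fun i => (f i - g i)%C) (s - t)%C.
Proof.
 intros [A B] [A' B']. split; [|now apply HasSum_sub].
 eapply AbsSum_ext; [|apply (AbsSum_add _ _ A (AbsSum_scal (ZtoC (-1)) _ A'))]. intros; simpl; ring.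
Qed.

(** For a finite set A of rows one finite set B of columns serves all of them: it is large enough
    that every row in A is close to its sum and that the rectangle A x B contains the set
    controlling the double sum. The row sums are supplied as data, so the lemma also computes a
    double sum whose rows are known in closed form. *)
Lemma HasSum_fubini {I J} (f : I * J -> Cx) (r : I -> Cx) S :
 HasSum f S -> (forall i, HasSum (fun j => f (i, j)) (r i)) -> HasSum r S.
Proof.
 intros H Hr eps He. destruct (H (eps / 2)) as [L0 K]; [lra|].
 exists (map fst L0). intros A HA HiA.
 (* The error eps/2 is shared among the rows of A; the added 1 keeps the divisor positive when A is
    empty. *)
 set (n := INR (length A) + 1).
 assert (Hn : 0 < n) by (unfold n; pose proof (pos_INR (length A)); lra).
 assert (Hn' : 0 < eps / 2 / n) by (apply Rdiv_lt_0_compat; lra).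
 assert (Hc : forall i, {L1 : list J | forall L, NoDup L -> incl L1 L ->
  Cabs (Csum (map (fun j => f (i, j)) L) - r i) < eps / 2 / n}).
 { intros i. apply constructive_indefinite_description. apply Hr; auto. }
 set (B := cnodup (map snd L0 ++ flat_map (fun i => proj1_sig (Hc i)) A)).
 assert (HB : NoDup B) by apply NoDup_nodup.
 assert (E1 : Cabs (Csum (map f (list_prod A B)) - S) < eps / 2).
 { apply K; [now apply NoDup_list_prod|]. intros [i j] Hij. apply in_prod.
  - apply HiA. apply in_map_iff. exists (i, j); auto.
  - apply nodup_In, in_or_app. left. apply in_map_iff. exists (i, j); auto. }
 rewrite Csum_list_prod in E1.
 assert (E2 : Cabs (Csum (map r A) - Csum (map (fun i => Csum (map (fun j => f (i, j)) B)) A)) <= eps / 2).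
 { assert (E3 : forall A', incl A' A -> Cabs (Csum (map r A')
   - Csum (map (fun i => Csum (map (fun j => f (i, j)) B)) A')) <= INR (length A') * (eps / 2 / n)).
  { induction A' as [|i A' IH]; intros Hi; cbn [map Csum fold_right length].
   - replace (C0 - C0)%C with C0 by ring. rewrite Cabs_0. simpl. lra.
   - fold (Csum (map r A')). fold (Csum (map (fun i => Csum (map (fun j => f (i, j)) B)) A')).
    set (X := Csum (map (fun j => f (i, j)) B)).
    set (Y := Csum (map (fun i => Csum (map (fun j => f (i, j)) B)) A')) in *.
    replace (r i + Csum (map r A') - (X + Y))%C with ((Csum (map r A') - Y) - (X - r i))%C by ring.
    eapply Rle_trans; [apply Cabs_sub_le|]. rewrite S_INR.
    assert (Cabs (X - r i) < eps / 2 / n).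
    { apply (proj2_sig (Hc i)); auto. intros j Hj. apply nodup_In, in_or_app. right.
     apply in_flat_map. exists i. split; auto. apply Hi; left; auto. }
    assert (incl A' A) by (intros x Hx; apply Hi; right; auto). specialize (IH H1). lra. }
  eapply Rle_trans; [apply (E3 A); intros x; auto|].
  apply Rle_trans with (n * (eps / 2 / n)); [|right; field; lra].
  apply Rmult_le_compat_r; [lra|]. unfold n; lra. }
 replace (Csum (map r A) - S)%C with
  ((Csum (map r A) - Csum (map (fun i => Csum (map (fun j => f (i, j)) B)) A))
  + (Csum (map (fun i => Csum (map (fun j => f (i, j)) B)) A) - S))%C by ring.
 eapply Rle_lt_trans; [apply Cabs_triang|]. lra.
Qed.

Lemma AbsSum_row {I J} (f : I * J -> Cx) i : AbsSum f -> AbsSum (fun j => f (i, j)).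
Proof. apply (AbsSum_inj (fun j => (i, j))). congruence. Qed.

Lemma HasSum_fubini_abs {I J} (f : I * J -> Cx) S :
 AbsSum f -> HasSum f S -> HasSum (fun i => Sumv (fun j => f (i, j))) S.
Proof.
 intros Ha H. apply HasSum_fubini with f; auto. intros i. apply Sumv_spec. now apply AbsSum_row.
Qed.

Lemma AbsSum_prod {I J} (f : I -> Cx) (g : J -> Cx) :
 AbsSum f -> AbsSum g -> AbsSum (fun x : I * J => (f (fst x) * g (snd x))%C).
Proof.
 intros [A HA] [B HB]. exists (A * B). intros L HL.
 set (L1 := cnodup (map fst L)). set (L2 := cnodup (map snd L)).
 assert (H1 : NoDup L1) by apply NoDup_nodup. assert (H2 : NoDup L2) by apply NoDup_nodup.
 eapply Rle_trans; [apply (Rsum_incl _ L (list_prod L1 L2)); auto|].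
 - intros; apply Cabs_pos.
 - now apply NoDup_list_prod.
 - intros [i j] Hij. apply in_prod; apply nodup_In, in_map_iff; exists (i, j); auto.
 - rewrite Rsum_list_prod. simpl.
  replace (Rsum (map (fun i => Rsum (map (fun j => Cabs (f i * g j)) L2)) L1))
   with (Rsum (map (fun i => Cabs (f i)) L1) * Rsum (map (fun j => Cabs (g j)) L2)).
  + apply Rmult_le_compat; auto; apply Rsum_nonneg; intros; apply Cabs_pos.
  + clear. induction L1; simpl; [ring|]. rewrite <- IHL1, Rmult_plus_distr_r. f_equal.
   rewrite <- Rsum_scal. f_equal. apply map_ext. intros; now rewrite Cabs_mul.
Qed.

Lemma HasSum_prod {I J} (f : I -> Cx) (g : J -> Cx) s t :
 AbsSum f -> AbsSum g -> HasSum f s -> HasSum g t ->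
 HasSum (fun x : I * J => (f (fst x) * g (snd x))%C) (s * t)%C.
Proof.
 intros Af Ag Hf Hg. pose proof (AbsSum_prod f g Af Ag) as Afg.
 destruct (AbsSum_HasSum _ Afg) as [S HS].
 assert (HasSum (fun i => (f i * t)%C) S).
 { apply HasSum_fubini with (1 := HS). intros i. simpl. now apply HasSum_scal. }
 assert (HasSum (fun i => (f i * t)%C) (s * t)%C).
 { eapply HasSum_ext; [|replace (s * t)%C with (t * s)%C by ring; apply HasSum_scal, Hf].
  intros; simpl; ring. }
 rewrite (HasSum_unique _ _ _ H0 H). auto.
Qed.

Lemma AbsSum_restrict {I} (f : I -> Cx) (P : I -> Prop) (dec : forall i, {P i} + {~ P i}) :
 AbsSum f -> AbsSum (fun i => if dec i then f i else C0).
Proof.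
 intros H. apply AbsSum_le with f 1; auto. intros i. destruct (dec i); [lra|].
 rewrite Cabs_0. pose proof (Cabs_pos (f i)). lra.
Qed.

Lemma HasSum_finite {I} (f : I -> Cx) (l : list I) : NoDup l ->
 (forall i, ~ In i l -> f i = C0) -> HasSum f (Csum (map f l)).
Proof.
 intros Hl H eps He. exists l. intros L HL Hi.
 destruct (NoDup_split_incl l L Hl HL Hi) as [r [Hr [_ Hr']]].
 rewrite (Csum_perm _ _ (Permutation_map f Hr)), map_app, Csum_app.
 rewrite (Csum_map_0 f r).
 - replace (_ - _)%C with C0 by ring. now rewrite Cabs_0.
 - intros i Hir. apply H. now apply Hr'.
Qed.

Lemma AbsSum_tail {I} (f : I -> Cx) : AbsSum f -> forall eps, 0 < eps -> exists L0,
 forall L, NoDup L -> (forall i, In i L -> ~ In i L0) -> Rsum (map (fun i => Cabs (f i)) L) < eps.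
Proof.
 intros [B HB] eps He. destruct (Rsum_sup _ B HB) as [s [Hs H]]. destruct (H eps He) as [L0 [HL0 H0]].
 exists L0. intros L HL Hd.
 assert (ND : NoDup (L0 ++ L)) by (apply NoDup_app; auto; intros a H1 H2; eapply Hd; eauto).
 specialize (Hs _ ND). rewrite map_app, Rsum_app in Hs. lra.
Qed.

Lemma HasSum_tail_bound {I} (f : I -> Cx) s L0 eps : HasSum f s -> NoDup L0 ->
 (forall L, NoDup L -> (forall i, In i L -> ~ In i L0) -> Rsum (map (fun i => Cabs (f i)) L) <= eps) ->
 Cabs (s - Csum (map f L0)) <= eps.
Proof.
 intros H HL0 HT. apply le_epsilon. intros del Hd. destruct (H del Hd) as [L1 K].
 set (L := cnodup (L0 ++ L1)). assert (HL : NoDup L) by apply NoDup_nodup.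
 assert (I0 : incl L0 L) by (intros x Hx; apply nodup_In, in_or_app; auto).
 assert (I1 : incl L1 L) by (intros x Hx; apply nodup_In, in_or_app; auto).
 specialize (K L HL I1). destruct (NoDup_split_incl L0 L HL0 HL I0) as [r [Hr [Hr' Hdis]]].
 specialize (HT r Hr' (fun i h => proj2 (proj1 (Hdis i) h))).
 rewrite (Csum_perm _ _ (Permutation_map f Hr)), map_app, Csum_app in K.
 replace (s - Csum (map f L0))%C with
  (Csum (map f r) - ((Csum (map f L0) + Csum (map f r)) - s))%C by ring.
 eapply Rle_trans; [apply Cabs_sub_le|]. pose proof (Cabs_Csum f r). lra.
Qed.

(** The passage from the net of finite subsets to the ordered partial sums over initial segments or
    boxes. *)
Lemma HasSum_Cconv {I} (f : I -> Cx) s (Ln : nat -> list I) : HasSum f s ->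
 (forall n, NoDup (Ln n)) -> (forall i, exists N, forall n, (N <= n)%nat -> In i (Ln n)) ->
 Cconv (fun n => Csum (map f (Ln n))) s.
Proof.
 intros H Hn Hex eps He. destruct (H eps He) as [L0 K].
 assert (exists N, forall n, (N <= n)%nat -> incl L0 (Ln n)) as [N HN].
 { clear - Hex. induction L0 as [|i L0 [N HN]].
  - exists 0%nat. intros n _ x [].
  - destruct (Hex i) as [N' HN']. exists (N + N')%nat. intros n Hn x [<-|Hx].
   + apply HN'; lia.
   + apply HN; auto; lia. }
 exists N. intros n Hnn. apply K; auto.
Qed.

Lemma AbsSum_geom_nat r : 0 <= r < 1 -> AbsSum (fun n : nat => RtoC (r ^ n)).
Proof.
 intros Hr. exists (/ (1 - r)). intros L HL.
 assert (exists N, forall n, In n L -> (n < N)%nat) as [N HN].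
 { clear. induction L as [|a L [N HN]]; [exists 0%nat; intros n []|].
  exists (N + S a)%nat. intros n [<-|H]; [lia|]. specialize (HN n H). lia. }
 apply Rle_trans with (Rsum (map (fun i => Cabs (RtoC (r ^ i))) (seq 0 N))).
 - apply Rsum_incl; auto using seq_NoDup; [intros; apply Cabs_pos|].
  intros n Hn. apply in_seq. specialize (HN n Hn). lia.
 - assert (E : forall N, Rsum (map (fun i => Cabs (RtoC (r ^ i))) (seq 0 N)) * (1 - r) = 1 - r ^ N).
  { induction N0; [simpl; ring|]. rewrite seq_S, map_app, Rsum_app, Rmult_plus_distr_r, IHN0.
   cbn [map Rsum fold_right Nat.add]. rewrite Cabs_RtoC, Rabs_right.
   - simpl. ring.
   - apply Rle_ge, pow_le; lra. }
  apply Rmult_le_reg_r with (1 - r); [lra|]. rewrite E, Rinv_l by lra.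
  assert (0 <= r ^ N) by (apply pow_le; lra). lra.
Qed.

Lemma AbsSum_sum_type {I J} (f : I + J -> Cx) :
 AbsSum (fun i => f (inl i)) -> AbsSum (fun j => f (inr j)) -> AbsSum f.
Proof.
 intros [A HA] [B HB]. exists (A + B). intros L HL.
 set (l := fun x : I + J => match x with inl i => i :: nil | inr _ => nil end).
 set (r := fun x : I + J => match x with inr i => i :: nil | inl _ => nil end).
 assert (E : Rsum (map (fun i => Cabs (f i)) L) =
  Rsum (map (fun i => Cabs (f (inl i))) (flat_map l L)) + Rsum (map (fun i => Cabs (f (inr i))) (flat_map r L))).
 { clear. induction L as [|[i|j] L IH]; simpl; [ring| |]; rewrite IH; ring. }
 rewrite E. apply Rplus_le_compat; [apply HA|apply HB]; clear - HL;
  induction HL as [|[i|j] L Hx HL IH]; simpl; try constructor; auto;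
  intros Hc; apply in_flat_map in Hc; destruct Hc as [[a|a] [H1 H2]]; simpl in H2;
  intuition; subst; contradiction.
Qed.

Lemma AbsSum_geom_Z r : 0 <= r < 1 -> AbsSum (fun n : Z => RtoC (r ^ Z.abs_nat n)).
Proof.
 intros Hr.
 set (h := fun n : Z => if Z_le_gt_dec 0 n then inl (Z.abs_nat n) else inr (Z.abs_nat n) : nat + nat).
 apply AbsSum_ext with (fun n => (fun x : nat + nat =>
  RtoC (r ^ match x with inl i => i | inr i => i end)) (h n)).
 - intros n. unfold h. destruct (Z_le_gt_dec 0 n); reflexivity.
 - apply (AbsSum_inj h (fun x => RtoC (r ^ match x with inl i => i | inr i => i end))).
  + intros x y. unfold h. destruct (Z_le_gt_dec 0 x), (Z_le_gt_dec 0 y); intros E; inversion E; lia.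
  + apply AbsSum_sum_type; apply AbsSum_geom_nat; auto.
Qed.

Lemma AbsSum_exp_Z c : 0 < c -> AbsSum (fun n : Z => RtoC (exp (- c * Rabs (IZR n)))).
Proof.
 intros Hc. apply AbsSum_ext with (fun n : Z => RtoC (exp (- c) ^ Z.abs_nat n)).
 - intros n. f_equal. rewrite <- abs_IZR. rewrite <- (Zabs2Nat.id_abs n).
  rewrite <- INR_IZR_INZ. generalize (Z.abs_nat n). clear. induction n.
  + simpl. rewrite Rmult_0_r, exp_0. reflexivity.
  + rewrite S_INR, Rmult_plus_distr_l, exp_plus, <- IHn, Rmult_1_r. simpl. ring.
 - apply AbsSum_geom_Z. split; [left; apply exp_pos|].
  rewrite <- exp_0. apply exp_increasing. lra.
Qed.

(** * Termwise differentiation of exponential series *)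

Definition Mdot (l H : M2 Cx) : Cx :=
 (m11 l * m11 H + m12 l * m12 H + m21 l * m21 H + m22 l * m22 H)%C.

Lemma Mdot_add l Z H : Mdot l (Madd Z H) = (Mdot l Z + Mdot l H)%C.
Proof. unfold Mdot, Madd; simpl; ring. Qed.

Lemma Cabs_Mdot l H : Cabs (Mdot l H) <= Mnorm l * Mnorm H.
Proof.
 unfold Mdot, Mnorm.
 eapply Rle_trans; [apply Cabs_triang|]. rewrite Cabs_mul.
 eapply Rle_trans; [apply Rplus_le_compat_r, Cabs_triang|]. rewrite Cabs_mul.
 eapply Rle_trans; [apply Rplus_le_compat_r, Rplus_le_compat_r, Cabs_triang|]. rewrite !Cabs_mul.
 pose proof (Cabs_pos (m11 l)); pose proof (Cabs_pos (m12 l)); pose proof (Cabs_pos (m21 l));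
 pose proof (Cabs_pos (m22 l)); pose proof (Cabs_pos (m11 H)); pose proof (Cabs_pos (m12 H));
 pose proof (Cabs_pos (m21 H)); pose proof (Cabs_pos (m22 H)). nra.
Qed.

Lemma Mnorm_pos H : 0 <= Mnorm H.
Proof.
 unfold Mnorm. pose proof (Cabs_pos (m11 H)); pose proof (Cabs_pos (m12 H));
 pose proof (Cabs_pos (m21 H)); pose proof (Cabs_pos (m22 H)). lra.
Qed.

Lemma AbsSum_le_list {I J} (g : I -> Cx) (f : J -> I -> Cx) (l : list J) :
 (forall j, In j l -> AbsSum (f j)) ->
 (forall i, Cabs (g i) <= Rsum (map (fun j => Cabs (f j i)) l)) -> AbsSum g.
Proof.
 intros H Hg.
 apply AbsSum_le with (fun i => Csum (map (fun j => RtoC (Cabs (f j i))) l)) 1.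
 - apply AbsSum_Csum. intros j Hj. apply AbsSum_le with (f j) 1; auto.
  intros. rewrite Cabs_RtoC, Rabs_right; [lra|apply Rle_ge, Cabs_pos].
 - intros i. rewrite Rmult_1_l. eapply Rle_trans; [apply Hg|].
  replace (Csum (map (fun j => RtoC (Cabs (f j i))) l)) with (RtoC (Rsum (map (fun j => Cabs (f j i)) l))).
  + rewrite Cabs_RtoC. apply Rle_abs.
  + clear. induction l; simpl; [reflexivity|]. rewrite RtoC_add, IHl. reflexivity.
Qed.

(** Test shifts with a single nonzero entry, equal to plus or minus rho or i rho. At one of them the
    real part of [Mdot l H] is comparable with |l| rho. *)
Definition Mdirs (rho : R) : list (M2 Cx) :=
 flat_map (fun z => mkM2 z C0 C0 C0 :: mkM2 C0 z C0 C0 :: mkM2 C0 C0 z C0 :: mkM2 C0 C0 C0 z :: nil)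
  (mkC rho 0 :: mkC (- rho) 0 :: mkC 0 rho :: mkC 0 (- rho) :: nil).

Lemma Mdirs_norm rho H : 0 <= rho -> In H (Mdirs rho) -> Mnorm H = rho.
Proof.
 intros Hr. assert (E : forall z, In z (mkC rho 0 :: mkC (- rho) 0 :: mkC 0 rho :: mkC 0 (- rho) :: nil) ->
  Cabs z = rho).
 { intros z Hz. simpl in Hz. rewrite <- (sqrt_Rsqr rho) by auto. unfold Cabs, Cnorm2, Rsqr.
  intuition; subst; simpl; f_equal; ring. }
 unfold Mdirs. rewrite in_flat_map. intros [z [Hz HH]]. specialize (E z Hz). clear Hz.
 simpl in HH. intuition; subst H; unfold Mnorm; simpl; rewrite Cabs_0, E; ring.
Qed.

Lemma Rsum_ge_In {I} (f : I -> R) l i : (forall i, 0 <= f i) -> In i l -> f i <= Rsum (map f l).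
Proof.
 intros Hf. induction l as [|a l IH]; simpl; [tauto|]. intros [->|H].
 - pose proof (Rsum_nonneg f l Hf). lra.
 - specialize (IH H). specialize (Hf a). lra.
Qed.

(** [Mnorm l] is at most the sum of the absolute values of eight real numbers, the real and
    imaginary parts of the entries, so one of these is at least an eighth of it. This explains the
    radius 8 r of the test shifts. *)
Lemma exp_Mnorm_bound (r : R) (l : M2 Cx) : 0 < r ->
 exp (r * Mnorm l) <= Rsum (map (fun H => Cabs (Cexp (Mdot l H))) (Mdirs (8 * r))).
Proof.
 intros Hr.
 assert (HE : exists H, In H (Mdirs (8 * r)) /\ r * Mnorm l <= Re (Mdot l H)).
 { apply NNPP. intros Hn.
  assert (B : forall H, In H (Mdirs (8 * r)) -> Re (Mdot l H) < r * Mnorm l).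
  { intros H HH. apply Rnot_le_lt. intros Hc. apply Hn. eauto. }
  assert (A : forall q x, 8 * r * x < r * q -> - (8 * r * x) < r * q -> 8 * Rabs x < q).
  { intros q x h1 h2. unfold Rabs. destruct (Rcase_abs x); apply Rmult_lt_reg_l with r; lra. }
  assert (D : forall z, In z (mkC (8 * r) 0 :: mkC (- (8 * r)) 0 :: mkC 0 (8 * r) :: mkC 0 (- (8 * r)) :: nil) ->
   Re (m11 l * z) < r * Mnorm l /\ Re (m12 l * z) < r * Mnorm l /\
   Re (m21 l * z) < r * Mnorm l /\ Re (m22 l * z) < r * Mnorm l).
  { intros z Hz.
   assert (K : forall H, In H (mkM2 z C0 C0 C0 :: mkM2 C0 z C0 C0 :: mkM2 C0 C0 z C0 :: mkM2 C0 C0 C0 z :: nil) ->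
    Re (Mdot l H) < r * Mnorm l) by (intros H HH; apply B, in_flat_map; eauto).
   repeat split.
   - replace (m11 l * z)%C with (Mdot l (mkM2 z C0 C0 C0)) by (unfold Mdot; simpl; ring). apply K; simpl; auto.
   - replace (m12 l * z)%C with (Mdot l (mkM2 C0 z C0 C0)) by (unfold Mdot; simpl; ring). apply K; simpl; auto.
   - replace (m21 l * z)%C with (Mdot l (mkM2 C0 C0 z C0)) by (unfold Mdot; simpl; ring). apply K; simpl; auto.
   - replace (m22 l * z)%C with (Mdot l (mkM2 C0 C0 C0 z)) by (unfold Mdot; simpl; ring). apply K; simpl; auto. }
  clear B. set (q := Mnorm l) in *.
  assert (P : forall z, (forall w, In w (mkC (8 * r) 0 :: mkC (- (8 * r)) 0 :: mkC 0 (8 * r) :: mkC 0 (- (8 * r)) :: nil) ->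
   Re (z * w) < r * q) -> 8 * Cabs z < 2 * q).
  { intros z Hz. pose proof (Cabs_le_sum z).
   assert (8 * Rabs (Re z) < q).
   { apply A; [assert (h := Hz (mkC (8 * r) 0))|assert (h := Hz (mkC (- (8 * r)) 0))]; simpl in h;
     specialize (h ltac:(auto 6)); lra. }
   assert (8 * Rabs (Im z) < q).
   { apply A; [assert (h := Hz (mkC 0 (- (8 * r))))|assert (h := Hz (mkC 0 (8 * r)))]; simpl in h;
     specialize (h ltac:(auto 6)); lra. }
   lra. }
  assert (P1 := P (m11 l) ltac:(intros; now apply D)). assert (P2 := P (m12 l) ltac:(intros; now apply D)).
  assert (P3 := P (m21 l) ltac:(intros; now apply D)). assert (P4 := P (m22 l) ltac:(intros; now apply D)).
  unfold q, Mnorm in *. lra. }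
 destruct HE as [H [HH Hle]].
 eapply Rle_trans; [apply (exp_le_mono _ _ Hle)|]. rewrite <- Cabs_Cexp.
 apply (Rsum_ge_In (fun H => Cabs (Cexp (Mdot l H)))); auto. intros; apply Cabs_pos.
Qed.

Lemma sqr_le_exp x : 0 <= x -> x * x <= 4 * exp x.
Proof.
 intros H. pose proof (exp_ge_1_x (x / 2)).
 replace x with (x / 2 + x / 2) at 3 by field. rewrite exp_plus. nra.
Qed.

(* The hypothesis at the finitely many shifts [Mdirs] bounds the terms weighted by
 [exp (r |l|)], which absorbs the quadratic Taylor remainder. *)
Lemma expseries_deriv {I} (c : I -> Cx) (l : I -> M2 Cx) (Z : M2 Cx) (rho : R) (F : M2 Cx -> Cx) :
 0 < rho ->
 (forall H, Mnorm H <= rho -> ASum (fun i => (c i * Cexp (Mdot (l i) (Madd Z H)))%C) (F (Madd Z H))) ->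
 F (Madd Z (mkM2 C0 C0 C0 C0)) = F Z ->
 exists L : M2 Cx, forall eps, 0 < eps -> exists del, 0 < del /\
  forall H, Mnorm H < del ->
   Cabs (Csub (Csub (F (Madd Z H)) (F Z)) (Mdot L H)) <= eps * Mnorm H.
Proof.
 intros Hrho HS HF0.
 set (r := rho / 8). assert (Hr : 0 < r) by (unfold r; lra).
 set (u := fun i => (c i * Cexp (Mdot (l i) Z))%C).
 set (N := fun i => Mnorm (l i)).
 assert (HN : forall i, 0 <= N i) by (intros; apply Mnorm_pos).
 assert (Hg : AbsSum (fun i => RtoC (Cabs (u i) * exp (r * N i)))).
 { apply AbsSum_le_list with (f := fun H i => (c i * Cexp (Mdot (l i) (Madd Z H)))%C) (l := Mdirs rho).
  - intros H HH. apply HS. right. apply Mdirs_norm; auto; lra.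
  - intros i. rewrite Cabs_RtoC, Rabs_right.
   2:{ apply Rle_ge, Rmult_le_pos; [apply Cabs_pos|left; apply exp_pos]. }
   eapply Rle_trans; [apply Rmult_le_compat_l; [apply Cabs_pos|]; apply exp_Mnorm_bound; auto|].
   replace (8 * r) with rho by (unfold r; field).
   rewrite <- Rsum_scal. apply Rsum_le. intros H _.
   rewrite Mdot_add, Cexp_add. unfold u. rewrite !Cabs_mul. right. ring. }
 destruct Hg as [B0 HB0].
 assert (HL : forall q : M2 Cx -> Cx, (forall i, Cabs (q (l i)) <= N i) ->
  exists s, HasSum (fun i => (u i * q (l i))%C) s).
 { intros q Hq. apply AbsSum_HasSum.
  apply AbsSum_le with (fun i => RtoC (Cabs (u i) * exp (r * N i))) (/ r); [exists B0; auto|].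
  intros i. rewrite Cabs_RtoC, Rabs_right, Cabs_mul.
  2:{ apply Rle_ge, Rmult_le_pos; [apply Cabs_pos|left; apply exp_pos]. }
  replace (/ r * (Cabs (u i) * exp (r * N i))) with (Cabs (u i) * (/ r * exp (r * N i))) by ring.
  apply Rmult_le_compat_l; [apply Cabs_pos|]. eapply Rle_trans; [apply Hq|].
  pose proof (exp_ge_1_x (r * N i)).
  apply Rmult_le_reg_l with r; auto. rewrite <- Rmult_assoc, Rinv_r by lra. lra. }
 assert (Hb : forall i, Cabs (m11 (l i)) <= N i /\ Cabs (m12 (l i)) <= N i /\
  Cabs (m21 (l i)) <= N i /\ Cabs (m22 (l i)) <= N i).
 { intros i. unfold N, Mnorm. pose proof (Cabs_pos (m11 (l i))). pose proof (Cabs_pos (m12 (l i))).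
  pose proof (Cabs_pos (m21 (l i))). pose proof (Cabs_pos (m22 (l i))). lra. }
 destruct (HL m11) as [s11 H11]; [apply Hb|]. destruct (HL m12) as [s12 H12]; [apply Hb|].
 destruct (HL m21) as [s21 H21]; [apply Hb|]. destruct (HL m22) as [s22 H22]; [apply Hb|].
 exists (mkM2 s11 s12 s21 s22). intros eps He.
 (* With X = exp(r N/2), the remainder is at most 4 N^2 |H|^2 X, and (r N/2)^2 <= 4 X turns N^2 into
    16 X / r^2; the product is 64 / r^2 times |H|^2 exp(r N). *)
 set (K := 64 / (r * r)).
 assert (HK : 0 < K) by (unfold K; apply Rdiv_lt_0_compat; nra).
 assert (HB0' : 0 <= B0) by (apply (HB0 nil); constructor).
 exists (Rmin (r / 2) (eps / (K * B0 + 1))). split.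
 { apply Rmin_glb_lt; [lra|]. apply Rdiv_lt_0_compat; nra. }
 intros H HH.
 destruct (Rmin_Rgt_l _ _ _ HH) as [Hh1 Hh2].
 pose proof (Mnorm_pos H) as Hh0.
 assert (E : HasSum (fun i => (u i * (Cexp (Mdot (l i) H) - C1 - Mdot (l i) H))%C)
  (F (Madd Z H) - F Z - Mdot (mkM2 s11 s12 s21 s22) H)%C).
 { destruct (HS H ltac:(unfold r in *; lra)) as [_ S1].
  assert (S0 : HasSum u (F Z)).
  { rewrite <- HF0. eapply HasSum_ext; [|apply HS].
   - intros i. unfold u. simpl. do 2 f_equal. unfold Mdot, Madd; simpl; ring.
   - unfold Mnorm; simpl. rewrite Cabs_0. lra. }
  pose proof (HasSum_scal (m11 H) _ _ H11) as T1. pose proof (HasSum_scal (m12 H) _ _ H12) as T2.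
  pose proof (HasSum_scal (m21 H) _ _ H21) as T3. pose proof (HasSum_scal (m22 H) _ _ H22) as T4.
  pose proof (HasSum_sub _ _ _ _ (HasSum_sub _ _ _ _ S1 S0)
   (HasSum_add _ _ _ _ (HasSum_add _ _ _ _ (HasSum_add _ _ _ _ T1 T2) T3) T4)) as T.
  match type of T with HasSum _ ?s =>
   replace (F (Madd Z H) - F Z - Mdot (mkM2 s11 s12 s21 s22) H)%C with s by (unfold Mdot; simpl; ring) end.
  eapply HasSum_ext; [|apply T]. intros i. simpl. rewrite Mdot_add, Cexp_add. unfold u.
  set (E1 := Cexp (Mdot (l i) H)). set (E2 := Cexp (Mdot (l i) Z)). unfold Mdot. ring. }
 eapply Rle_trans; [apply (HasSum_le _ _ (K * B0 * (Mnorm H * Mnorm H)) E)|].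
 - intros L HL'. specialize (HB0 L HL').
  apply Rle_trans with (Rsum (map (fun i => K * (Mnorm H * Mnorm H) * Cabs (RtoC (Cabs (u i) * exp (r * N i)))) L)).
  + apply Rsum_le. intros i _. rewrite Cabs_mul, Cabs_RtoC, Rabs_right.
   2:{ apply Rle_ge, Rmult_le_pos; [apply Cabs_pos|left; apply exp_pos]. }
   replace (K * (Mnorm H * Mnorm H) * (Cabs (u i) * exp (r * N i)))
    with (Cabs (u i) * (K * (Mnorm H * Mnorm H) * exp (r * N i))) by ring.
   apply Rmult_le_compat_l; [apply Cabs_pos|].
   eapply Rle_trans; [apply Cexp_sub1_bound|].
   pose proof (Cabs_Mdot (l i) H) as Hd. fold (N i) in Hd. pose proof (Cabs_pos (Mdot (l i) H)).
   specialize (HN i).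
   assert (exp (Cabs (Mdot (l i) H)) <= exp (r * N i / 2)) by (apply exp_le_mono; nra).
   assert (Q : (r * N i / 2) * (r * N i / 2) <= 4 * exp (r * N i / 2)) by (apply sqr_le_exp; nra).
   assert (Q2 : exp (r * N i) = exp (r * N i / 2) * exp (r * N i / 2))
    by (rewrite <- exp_plus; f_equal; field).
   pose proof (exp_pos (r * N i / 2)).
   set (X := exp (r * N i / 2)) in *.
   apply Rle_trans with (4 * ((N i * Mnorm H) * (N i * Mnorm H)) * X).
   * apply Rmult_le_compat; try (left; apply exp_pos); auto; nra.
   * rewrite Q2.
    replace (4 * (N i * Mnorm H * (N i * Mnorm H)) * X)
     with ((16 / (r * r)) * (Mnorm H * Mnorm H) * ((r * N i / 2) * (r * N i / 2) * X)) by (field; lra).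
    replace (K * (Mnorm H * Mnorm H) * (X * X))
     with ((16 / (r * r)) * (Mnorm H * Mnorm H) * (4 * X * X)) by (unfold K; field; lra).
    apply Rmult_le_compat_l.
    -- apply Rmult_le_pos; [left; apply Rdiv_lt_0_compat; nra|nra].
    -- apply Rmult_le_compat_r; lra.
  + rewrite Rsum_scal.
   replace (K * B0 * (Mnorm H * Mnorm H)) with (K * (Mnorm H * Mnorm H) * B0) by ring.
   apply Rmult_le_compat_l; [nra|auto].
 - replace (K * B0 * (Mnorm H * Mnorm H)) with (K * B0 * Mnorm H * Mnorm H) by ring.
  apply Rmult_le_compat_r; auto.
  assert (0 <= K * B0) by nra.
  assert (Mnorm H * (K * B0 + 1) < eps).
  { apply Rlt_div_r in Hh2; lra. }
  nra.
Qed.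

Definition cderiv (f : Cx -> Cx) (t c : Cx) : Prop :=
 forall eps, 0 < eps -> exists del, 0 < del /\
  forall h, Cabs h < del -> Cabs (Csub (Csub (f (Cadd t h)) (f t)) (Cmul c h)) <= eps * Cabs h.

Lemma expseries_deriv1 {I} (c l : I -> Cx) (t : Cx) (rho : R) (f : Cx -> Cx) :
 0 < rho ->
 (forall h, Cabs h <= rho -> ASum (fun i => (c i * Cexp (l i * (t + h)))%C) (f (t + h)%C)) ->
 exists d, cderiv f t d.
Proof.
 intros Hr HA.
 set (emb := fun z => mkM2 z C0 C0 C0).
 destruct (expseries_deriv c (fun i => emb (l i)) (emb t) rho (fun Z => f (m11 Z))) as [L HL]; auto.
 - intros H HH. eapply ASum_ext; [|apply (HA (m11 H))].
  + intros i. simpl. do 2 f_equal. unfold Mdot, emb; simpl; ring.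
  + eapply Rle_trans; [|apply HH]. unfold Mnorm. pose proof (Cabs_pos (m12 H)).
   pose proof (Cabs_pos (m21 H)). pose proof (Cabs_pos (m22 H)). lra.
 - simpl. f_equal. ring.
 - exists (m11 L). intros eps He. destruct (HL eps He) as [del [Hd K]]. exists del. split; auto.
  intros h Hh. specialize (K (emb h)). unfold Mnorm, emb, Mdot in K; simpl in K.
  rewrite Cabs_0 in K. replace (Cabs h + 0 + 0 + 0) with (Cabs h) in K by ring.
  specialize (K Hh). eapply Rle_trans; [|apply K]. right. f_equal. ring.
Qed.

Lemma inH_near t h : inH t -> Cabs h < Im t -> inH (t + h)%C.
Proof.
 unfold inH; simpl. intros Ht Hh. pose proof (Im_le_Cabs h) as K. apply Rabs_le_between in K. lra.
Qed.

(** * Cauchy and Fourier expansions on the upper half-plane *)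

Lemma Cabs_Ci : Cabs Ci = 1.
Proof. unfold Cabs, Cnorm2; simpl. replace (0 * 0 + 1 * 1) with 1 by ring. apply sqrt_1. Qed.

Definition CI (f : R -> Cx) (a b : R) : Cx :=
 mkC (RInt (fun x => Re (f x)) a b) (RInt (fun x => Im (f x)) a b).
Definition ccont (f : R -> Cx) (a b : R) : Prop := forall x, a <= x <= b ->
 continuous (fun x => Re (f x)) x /\ continuous (fun x => Im (f x)) x.

Lemma ccont_ex (f : R -> Cx) a b : a <= b -> ccont f a b ->
 ex_RInt (fun x => Re (f x)) a b /\ ex_RInt (fun x => Im (f x)) a b.
Proof.
 intros Hab H. split; apply (ex_RInt_continuous (V := R_CompleteNormedModule)); intros z Hz;
 rewrite Rmin_left, Rmax_right in Hz by auto; apply H; auto.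
Qed.

Lemma ccont_add f g a b : ccont f a b -> ccont g a b -> ccont (fun x => (f x + g x)%C) a b.
Proof.
 intros H1 H2 x Hx. destruct (H1 x Hx), (H2 x Hx). simpl.
 split; apply (continuous_plus (V := R_NormedModule)); auto.
Qed.
Lemma ccont_mul f g a b : ccont f a b -> ccont g a b -> ccont (fun x => (f x * g x)%C) a b.
Proof.
 intros H1 H2 x Hx. destruct (H1 x Hx), (H2 x Hx). simpl. split.
 - apply (continuous_minus (V := R_NormedModule)); apply (continuous_mult (K := R_AbsRing)); auto.
 - apply (continuous_plus (V := R_NormedModule)); apply (continuous_mult (K := R_AbsRing)); auto.
Qed.
Lemma ccont_const c a b : ccont (fun _ => c) a b.
Proof. intros x Hx. split; apply continuous_const. Qed.
Lemma ccont_sub f g a b : ccont f a b -> ccont g a b -> ccont (fun x => (f x - g x)%C) a b.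
Proof.
 intros H1 H2 x Hx. destruct (H1 x Hx), (H2 x Hx). simpl.
 split; apply (continuous_minus (V := R_NormedModule)); auto.
Qed.
Lemma ccont_sub_int f a b c d : ccont f a b -> a <= c -> d <= b -> ccont f c d.
Proof. intros H Hc Hd x Hx. apply H. lra. Qed.

Lemma CI_ext f g a b : (forall x, a <= x <= b -> f x = g x) -> a <= b -> CI f a b = CI g a b.
Proof.
 intros H Hab. unfold CI. f_equal; apply RInt_ext; intros x Hx;
 rewrite Rmin_left, Rmax_right in Hx by auto; rewrite H; auto; lra.
Qed.
Lemma CI_add f g a b : a <= b -> ccont f a b -> ccont g a b ->
 CI (fun x => (f x + g x)%C) a b = (CI f a b + CI g a b)%C.
Proof.
 intros Hab Hf Hg. destruct (ccont_ex f a b Hab Hf), (ccont_ex g a b Hab Hg).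
 apply Cx_eq; simpl; apply (RInt_plus (V := R_CompleteNormedModule)); auto.
Qed.
Lemma CI_scal c f a b : a <= b -> ccont f a b -> CI (fun x => (c * f x)%C) a b = (c * CI f a b)%C.
Proof.
 intros Hab Hf. destruct (ccont_ex f a b Hab Hf) as [h1 h2].
 assert (S : forall k (u : R -> R), ex_RInt u a b -> RInt (fun x => k * u x) a b = k * RInt u a b).
 { intros k u Hu. apply (RInt_scal (V := R_CompleteNormedModule) u a b k Hu). }
 assert (X : forall k (u : R -> R), ex_RInt u a b -> ex_RInt (fun x => k * u x) a b).
 { intros k u Hu. apply (ex_RInt_scal (V := R_NormedModule) u a b k Hu). }
 apply Cx_eq; simpl.
 - rewrite <- !S by auto.
  apply (RInt_minus (V := R_CompleteNormedModule) (fun x => Re c * Re (f x)) (fun x => Im c * Im (f x))); auto.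
 - rewrite <- !S by auto.
  apply (RInt_plus (V := R_CompleteNormedModule) (fun x => Re c * Im (f x)) (fun x => Im c * Re (f x))); auto.
Qed.
Lemma CI_sub f g a b : a <= b -> ccont f a b -> ccont g a b ->
 CI (fun x => (f x - g x)%C) a b = (CI f a b - CI g a b)%C.
Proof.
 intros Hab Hf Hg. destruct (ccont_ex f a b Hab Hf), (ccont_ex g a b Hab Hg).
 apply Cx_eq; simpl; apply (RInt_minus (V := R_CompleteNormedModule)); auto.
Qed.
Lemma CI_Chasles f a b c : a <= b -> b <= c -> ccont f a c -> (CI f a b + CI f b c)%C = CI f a c.
Proof.
 intros H1 H2 H.
 destruct (ccont_ex f a b H1 (ccont_sub_int _ _ _ _ _ H (Rle_refl a) H2)).
 destruct (ccont_ex f b c H2 (ccont_sub_int _ _ _ _ _ H H1 (Rle_refl c))).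
 apply Cx_eq; simpl; apply (RInt_Chasles (V := R_CompleteNormedModule)); auto.
Qed.
(** The factor 2 comes from bounding the real and imaginary parts separately; it persists in the
    coefficient bounds and does no harm there. *)
Lemma CI_bound f a b M : a <= b -> ccont f a b -> (forall x, a <= x <= b -> Cabs (f x) <= M) ->
 Cabs (CI f a b) <= 2 * M * (b - a).
Proof.
 intros Hab Hf HM. destruct (ccont_ex f a b Hab Hf) as [h1 h2].
 eapply Rle_trans; [apply Cabs_le_sum|]. simpl.
 assert (Rabs (RInt (fun x => Re (f x)) a b) <= (b - a) * M).
 { apply abs_RInt_le_const; auto. intros t Ht. eapply Rle_trans; [apply Re_le_Cabs|auto]. }
 assert (Rabs (RInt (fun x => Im (f x)) a b) <= (b - a) * M).
 { apply abs_RInt_le_const; auto. intros t Ht. eapply Rle_trans; [apply Im_le_Cabs|auto]. }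
 lra.
Qed.
Lemma CI_Csum {I} (f : I -> R -> Cx) l a b : a <= b -> (forall i, ccont (f i) a b) ->
 ccont (fun x => Csum (map (fun i => f i x) l)) a b /\
 CI (fun x => Csum (map (fun i => f i x) l)) a b = Csum (map (fun i => CI (f i) a b) l).
Proof.
 intros Hab H. induction l as [|i l [IH1 IH2]]; simpl.
 - split; [apply ccont_const|]. apply Cx_eq; simpl; rewrite RInt_const; apply Rmult_0_r.
 - split; [apply ccont_add; auto|]. rewrite CI_add, IH2; auto.
Qed.

Lemma CI_derive (f F : R -> Cx) a b : a <= b -> ccont f a b ->
 (forall x, is_derive (fun x => Re (F x)) x (Re (f x)) /\ is_derive (fun x => Im (F x)) x (Im (f x))) ->
 CI f a b = (F b - F a)%C.
Proof.
 intros Hab Hf HF. apply Cx_eq; simpl; apply is_RInt_unique;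
 [apply (is_RInt_derive (V := R_CompleteNormedModule) (fun x => Re (F x)) (fun x => Re (f x)))
 |apply (is_RInt_derive (V := R_CompleteNormedModule) (fun x => Im (F x)) (fun x => Im (f x)))];
 intros x Hx; try apply HF; rewrite Rmin_left, Rmax_right in Hx by auto; apply Hf; auto.
Qed.

Lemma continuous_eps (u : R -> R) x :
 (forall eps, 0 < eps -> exists del, 0 < del /\ forall h, Rabs h < del -> Rabs (u (x + h) - u x) <= eps) ->
 continuous u x.
Proof.
 intros H. apply continuity_pt_filterlim. intros eps He.
 destruct (H (eps / 2)) as [del [Hd K]]; [lra|]. exists del. split; [apply Hd|].
 intros y [_ Hy]. simpl in *. unfold Rdist in *.
 specialize (K (y - x) Hy). replace (x + (y - x)) with y in K by ring. lra.
Qed.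

Definition ccts (f : Cx -> Cx) (t : Cx) : Prop := forall eps, 0 < eps -> exists del, 0 < del /\
 forall h, Cabs h < del -> Cabs (f (t + h) - f t)%C <= eps.

Lemma cderiv_ccts f t c : cderiv f t c -> ccts f t.
Proof.
 intros H eps He. destruct (H 1 Rlt_0_1) as [del [Hd K]].
 pose proof (Cabs_pos c).
 exists (Rmin del (eps / (1 + Cabs c))). split.
 { apply Rmin_glb_lt; auto. apply Rdiv_lt_0_compat; lra. }
 intros h Hh.
 destruct (Rmin_Rgt_l _ _ _ Hh) as [Hh1 Hh2].
 specialize (K h Hh1).
 replace (f (t + h) - f t)%C with ((f (t + h) - f t - c * h) + c * h)%C by ring.
 eapply Rle_trans; [apply Cabs_triang|]. rewrite (Cabs_mul c h).
 apply Rlt_div_r in Hh2; [|lra]. lra.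
Qed.

Lemma ccts_line f (t : R -> Cx) (u : Cx) x : Cabs u = 1 -> (forall h, t (x + h) = (t x + u * RtoC h)%C) ->
 ccts f (t x) ->
 continuous (fun x => Re (f (t x))) x /\ continuous (fun x => Im (f (t x))) x.
Proof.
 intros Hu Ht H.
 assert (K : forall eps, 0 < eps -> exists del, 0 < del /\ forall h, Rabs h < del ->
  Cabs (f (t (x + h)%R) - f (t x))%C <= eps).
 { intros eps He. destruct (H eps He) as [del [Hd K]]. exists del. split; auto.
  intros h Hh. rewrite Ht. apply K. rewrite Cabs_mul, Cabs_RtoC, Hu. lra. }
 split; apply continuous_eps; intros eps He; destruct (K eps He) as [del [Hd K']];
 exists del; split; auto; intros h Hh; specialize (K' h Hh).
 - eapply Rle_trans; [|apply K']. apply (Re_le_Cabs (f (t (x + h)%R) - f (t x))%C).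
 - eapply Rle_trans; [|apply K']. apply (Im_le_Cabs (f (t (x + h)%R) - f (t x))%C).
Qed.

Lemma ccont_h f y a b : (forall x, a <= x <= b -> ccts f (mkC x y)) -> ccont (fun x => f (mkC x y)) a b.
Proof.
 intros H x Hx. apply (ccts_line f (fun x => mkC x y) C1); auto using Cabs_1.
 intros h. apply Cx_eq; simpl; ring.
Qed.
Lemma ccont_v f x a b : (forall y, a <= y <= b -> ccts f (mkC x y)) -> ccont (fun y => f (mkC x y)) a b.
Proof.
 intros H y Hy. apply (ccts_line f (fun y => mkC x y) Ci); auto.
 - apply Cabs_Ci.
 - intros h. apply Cx_eq; simpl; ring.
Qed.

(** The contour integral along the boundary of the rectangle, counterclockwise: bottom minus top,
    plus i times right minus left. *)
Definition RI (f : Cx -> Cx) x1 x2 y1 y2 : Cx :=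
 (CI (fun x => f (mkC x y1)) x1 x2 - CI (fun x => f (mkC x y2)) x1 x2
 + Ci * (CI (fun y => f (mkC x2 y)) y1 y2 - CI (fun y => f (mkC x1 y)) y1 y2))%C.

Definition rcts (f : Cx -> Cx) x1 x2 y1 y2 := forall x y, x1 <= x <= x2 -> y1 <= y <= y2 -> ccts f (mkC x y).

Lemma RI_split f x1 x x2 y1 y y2 : x1 <= x -> x <= x2 -> y1 <= y -> y <= y2 -> rcts f x1 x2 y1 y2 ->
 RI f x1 x2 y1 y2 = (RI f x1 x y1 y + RI f x x2 y1 y + RI f x1 x y y2 + RI f x x2 y y2)%C.
Proof.
 intros Hx1 Hx2 Hy1 Hy2 H. unfold RI.
 rewrite <- (CI_Chasles (fun u => f (mkC u y1)) x1 x x2), <- (CI_Chasles (fun u => f (mkC u y2)) x1 x x2),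
  <- (CI_Chasles (fun u => f (mkC x2 u)) y1 y y2), <- (CI_Chasles (fun u => f (mkC x1 u)) y1 y y2)
  by (auto; first [apply ccont_h|apply ccont_v]; intros; apply H; lra).
 ring.
Qed.

Lemma RI_bound f x1 x2 y1 y2 M : x1 <= x2 -> y1 <= y2 -> rcts f x1 x2 y1 y2 ->
 (forall x y, x1 <= x <= x2 -> y1 <= y <= y2 -> Cabs (f (mkC x y)) <= M) ->
 Cabs (RI f x1 x2 y1 y2) <= 4 * M * ((x2 - x1) + (y2 - y1)).
Proof.
 intros Hx Hy H HM. unfold RI.
 eapply Rle_trans; [apply Cabs_triang|]. rewrite Cabs_mul.
 rewrite Cabs_Ci, Rmult_1_l.
 assert (B1 := Cabs_sub_le (CI (fun x => f (mkC x y1)) x1 x2) (CI (fun x => f (mkC x y2)) x1 x2)).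
 assert (B2 := Cabs_sub_le (CI (fun y => f (mkC x2 y)) y1 y2) (CI (fun y => f (mkC x1 y)) y1 y2)).
 assert (A : forall y, y1 <= y <= y2 -> Cabs (CI (fun x => f (mkC x y)) x1 x2) <= 2 * M * (x2 - x1))
  by (intros; apply CI_bound; auto; apply ccont_h; intros; apply H; lra).
 assert (A' : forall x, x1 <= x <= x2 -> Cabs (CI (fun y => f (mkC x y)) y1 y2) <= 2 * M * (y2 - y1))
  by (intros; apply CI_bound; auto; apply ccont_v; intros; apply H; lra).
 pose proof (A y1). pose proof (A y2). pose proof (A' x1). pose proof (A' x2).
 lra.
Qed.

Lemma cderiv_lin f t c : (forall h, f (t + h)%C = (f t + c * h)%C) -> cderiv f t c.
Proof.
 intros H eps He. exists 1. split; [lra|]. intros h _. rewrite H.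
 replace (f t + c * h - f t - c * h)%C with C0 by ring. rewrite Cabs_0. pose proof (Cabs_pos h). nra.
Qed.
Lemma ccts_affine a b t : ccts (fun z => (a + b * z)%C) t.
Proof. apply cderiv_ccts with b, cderiv_lin. intros; ring. Qed.

Lemma ccts_sub f g t : ccts f t -> ccts g t -> ccts (fun z => (f z - g z)%C) t.
Proof.
 intros H1 H2 eps He. destruct (H1 (eps / 2)) as [d1 [Hd1 K1]]; [lra|].
 destruct (H2 (eps / 2)) as [d2 [Hd2 K2]]; [lra|].
 exists (Rmin d1 d2). split; [now apply Rmin_glb_lt|]. intros h Hh.
 destruct (Rmin_Rgt_l _ _ _ Hh) as [? ?].
 replace (f (t + h) - g (t + h) - (f t - g t))%C with ((f (t + h) - f t) - (g (t + h) - g t))%C by ring.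
 eapply Rle_trans; [apply Cabs_sub_le|]. specialize (K1 h H). specialize (K2 h H0). lra.
Qed.

Lemma RI_affine a b x1 x2 y1 y2 : x1 <= x2 -> y1 <= y2 -> RI (fun z => (a + b * z)%C) x1 x2 y1 y2 = C0.
Proof.
 intros Hx Hy. unfold RI.
 assert (Eh : forall y, CI (fun x => (a + b * mkC x y)%C) x1 x2 =
  ((a + b * mkC 0 y) * RtoC x2 + b * RtoC (x2 * x2 / 2) - ((a + b * mkC 0 y) * RtoC x1 + b * RtoC (x1 * x1 / 2)))%C).
 { intros y. apply (CI_derive _ (fun x => ((a + b * mkC 0 y) * RtoC x + b * RtoC (x * x / 2))%C)); auto.
  - apply (ccont_h (fun z => (a + b * z)%C)). intros; apply ccts_affine.
  - intros x. simpl. split; auto_derive; auto; field. }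
 assert (Ev : forall x, CI (fun y => (a + b * mkC x y)%C) y1 y2 =
  ((a + b * mkC x 0) * RtoC y2 + b * mkC 0 (y2 * y2 / 2) - ((a + b * mkC x 0) * RtoC y1 + b * mkC 0 (y1 * y1 / 2)))%C).
 { intros x. apply (CI_derive _ (fun y => ((a + b * mkC x 0) * RtoC y + b * mkC 0 (y * y / 2))%C)); auto.
  - apply (ccont_v (fun z => (a + b * z)%C)). intros; apply ccts_affine.
  - intros y. simpl. split; auto_derive; auto; field. }
 rewrite !Eh, !Ev. apply Cx_eq; simpl; field.
Qed.

Lemma RI_sub f g x1 x2 y1 y2 : x1 <= x2 -> y1 <= y2 -> rcts f x1 x2 y1 y2 -> rcts g x1 x2 y1 y2 ->
 RI (fun z => (f z - g z)%C) x1 x2 y1 y2 = (RI f x1 x2 y1 y2 - RI g x1 x2 y1 y2)%C.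
Proof.
 intros Hx Hy Hf Hg. unfold RI.
 rewrite !CI_sub; auto; try (apply ccont_h; intros; (apply Hf || apply Hg); lra);
  try (apply ccont_v; intros; (apply Hf || apply Hg); lra).
 ring.
Qed.

(** Goursat's bisection. If the integral exceeds eps times the squared half-perimeter, so does the
    integral over one of the four quarters. The nested bad rectangles shrink to a point where f is
    affine up to a small multiple of the distance, and affine functions integrate to zero around a
    rectangle. *)
Lemma goursat_bound (f : Cx -> Cx) x1 y1 w h eps : 0 <= w -> 0 <= h -> 0 < eps ->
 (forall x y, x1 <= x <= x1 + w -> y1 <= y <= y1 + h -> exists c, cderiv f (mkC x y) c) ->
 Cabs (RI f x1 (x1 + w) y1 (y1 + h))%C <= eps * ((w + h) * (w + h)).
Proof.
 intros Hw Hh He Hf. apply Rnot_lt_le. intros Hbad.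
 set (p2 := fun n : nat => / 2 ^ n).
 assert (Hp : forall n, 0 < p2 n <= 1).
 { intros n. unfold p2. assert (1 <= 2 ^ n) by (apply pow_R1_Rle; lra).
  split; [apply Rinv_0_lt_compat; lra|]. rewrite <- Rinv_1. apply Rinv_le_contravar; lra. }
 assert (HpS : forall n, p2 (S n) = p2 n / 2).
 { intros n. unfold p2. simpl. field. apply pow_nonzero; lra. }
 set (Good := fun n (p : R * R) => x1 <= fst p /\ fst p + w * p2 n <= x1 + w /\
  y1 <= snd p /\ snd p + h * p2 n <= y1 + h /\
  eps * (((w + h) * p2 n) * ((w + h) * p2 n)) <
  Cabs (RI f (fst p) (fst p + w * p2 n) (snd p) (snd p + h * p2 n))%C).
 assert (Hc : rcts f x1 (x1 + w) y1 (y1 + h)).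
 { intros x y Hx Hy. destruct (Hf x y Hx Hy) as [c Hd]. eapply cderiv_ccts; eauto. }
 assert (step : forall n p, Good n p -> exists q, Good (S n) q /\
  fst p <= fst q /\ fst q + w * p2 (S n) <= fst p + w * p2 n /\
  snd p <= snd q /\ snd q + h * p2 (S n) <= snd p + h * p2 n).
 { intros n [x y] [G1 [G2 [G3 [G4 G5]]]]. simpl in *.
  specialize (Hp n). specialize (HpS n).
  set (a := w * p2 n) in *. set (b := h * p2 n) in *.
  assert (Ha : w * p2 (S n) = a / 2) by (rewrite HpS; unfold a; field).
  assert (Hb : h * p2 (S n) = b / 2) by (rewrite HpS; unfold b; field).
  assert (Ha0 : 0 <= a) by (unfold a; nra). assert (Hb0 : 0 <= b) by (unfold b; nra).
  assert (E : RI f x (x + a) y (y + b) = (RI f x (x + a / 2) y (y + b / 2) + RI f (x + a / 2) (x + a) y (y + b / 2)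
   + RI f x (x + a / 2) (y + b / 2) (y + b) + RI f (x + a / 2) (x + a) (y + b / 2) (y + b))%C).
  { apply RI_split; try lra. intros u v Hu Hv. apply Hc; lra. }
  apply NNPP. intros Hn.
  assert (Q : forall u v, (u = x \/ u = x + a / 2) -> (v = y \/ v = y + b / 2) ->
   Cabs (RI f u (u + a / 2) v (v + b / 2))%C <= eps * (((w + h) * p2 (S n)) * ((w + h) * p2 (S n)))).
  { intros u v Hu Hv. apply Rnot_lt_le. intros Hlt. apply Hn. exists (u, v). unfold Good; simpl.
   rewrite Ha, Hb. repeat split; try (destruct Hu, Hv; subst; lra). }
  pose proof (Q x y ltac:(auto) ltac:(auto)) as Q1.
  pose proof (Q (x + a / 2) y ltac:(auto) ltac:(auto)) as Q2.
  pose proof (Q x (y + b / 2) ltac:(auto) ltac:(auto)) as Q3.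
  pose proof (Q (x + a / 2) (y + b / 2) ltac:(auto) ltac:(auto)) as Q4.
  replace (x + a / 2 + a / 2) with (x + a) in * by field.
  replace (y + b / 2 + b / 2) with (y + b) in * by field.
  assert (T : Cabs (RI f x (x + a) y (y + b))%C <= 4 * (eps * (((w + h) * p2 (S n)) * ((w + h) * p2 (S n))))).
  { rewrite E.
   eapply Rle_trans; [apply Cabs_triang|]. eapply Rle_trans; [apply Rplus_le_compat_r, Cabs_triang|].
   eapply Rle_trans; [apply Rplus_le_compat_r, Rplus_le_compat_r, Cabs_triang|]. lra. }
  rewrite HpS in T. lra. }
 assert (G0 : Good 0%nat (x1, y1)).
 { unfold Good, p2; simpl. rewrite Rinv_1, !Rmult_1_r. repeat split; lra. }
 (* The corner chosen at stage n carries the proof that its rectangle is bad, so that the recursion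
    can call [step] again. *)
 set (next := fun n (p : {p | Good n p}) =>
  let q := constructive_indefinite_description _ (step n (proj1_sig p) (proj2_sig p)) in
  exist (Good (S n)) (proj1_sig q) (proj1 (proj2_sig q))).
 set (sq := nat_rect (fun n => {p | Good n p}) (exist _ (x1, y1) G0) next).
 set (xs := fun n => fst (proj1_sig (sq n))). set (ys := fun n => snd (proj1_sig (sq n))).
 assert (Hst : forall n, xs n <= xs (S n) /\ xs (S n) + w * p2 (S n) <= xs n + w * p2 n /\
  ys n <= ys (S n) /\ ys (S n) + h * p2 (S n) <= ys n + h * p2 n).
 { intros n. unfold xs, ys. simpl. unfold next. simpl.
  destruct (constructive_indefinite_description _ _) as [q [Hq1 Hq2]]. simpl. apply Hq2. }
 assert (Hlim : forall (u : nat -> R) (c : R), 0 <= c -> (forall n, u n <= u (S n) /\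
   u (S n) + c * p2 (S n) <= u n + c * p2 n) -> exists X, forall n, u n <= X <= u n + c * p2 n).
 { intros u c Hcc Hu.
  assert (mono : forall n k, u n <= u (n + k)%nat /\ u (n + k)%nat + c * p2 (n + k)%nat <= u n + c * p2 n).
  { intros n k. induction k; [rewrite Nat.add_0_r; lra|].
   rewrite Nat.add_succ_r. specialize (Hu (n + k)%nat). lra. }
  assert (ub : forall n m, u n <= u m + c * p2 m).
  { intros n m. pose proof (Hp n). pose proof (Hp m). destruct (Nat.le_ge_cases n m) as [Hl|Hl].
   - replace m with (n + (m - n))%nat by lia. destruct (mono n (m - n)%nat).
    replace (n + (m - n))%nat with m in * by lia. nra.
   - replace n with (m + (n - m))%nat by lia. destruct (mono m (n - m)%nat).
    replace (m + (n - m))%nat with n in * by lia. nra. }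
  destruct (completeness (fun x => exists n, x = u n)) as [X [HX1 HX2]].
  - exists (u 0%nat + c * p2 0%nat). intros x [n ->]. apply ub.
  - exists (u 0%nat), 0%nat. reflexivity.
  - exists X. intros n. split; [apply HX1; eauto|]. apply HX2. intros x [m ->]. apply ub. }
 destruct (Hlim xs w Hw) as [X HX]; [intros n; destruct (Hst n) as [a [b _]]; auto|].
 destruct (Hlim ys h Hh) as [Y HY]; [intros n; destruct (Hst n) as [_ [_ [a b]]]; auto|].
 assert (HG : forall n, Good n (xs n, ys n)).
 { intros n. unfold xs, ys. rewrite <- surjective_pairing. apply (proj2_sig (sq n)). }
 destruct (Hf X Y) as [c Hd].
 { destruct (HG 0%nat) as [a1 [a2 _]]. specialize (HX 0%nat). simpl in *. lra. }
 { destruct (HG 0%nat) as [_ [_ [a1 [a2 _]]]]. specialize (HY 0%nat). simpl in *. lra. }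
 (* [RI_bound] multiplies a uniform bound by four times the half-perimeter a + b. The error
    (eps/4)(a + b) of the affine approximation thus gives eps (a + b)^2, contradicting badness. *)
 destruct (Hd (eps / 4)) as [del [Hdel K]]; [lra|].
 assert (exists n, (w + h) * p2 n < del) as [n Hn].
 { destruct (pow_lt_1_zero (/ 2) ltac:(rewrite Rabs_right; lra) (del / (w + h + 1))) as [n Hn].
  { apply Rdiv_lt_0_compat; lra. }
  exists n. specialize (Hn n (le_n n)). rewrite pow_inv in Hn. fold (p2 n) in Hn.
  specialize (Hp n). rewrite Rabs_right in Hn by lra.
  apply Rlt_div_r in Hn; [|lra]. nra. }
 destruct (HG n) as [G1 [G2 [G3 [G4 G5]]]]. simpl in *.
 specialize (HX n). specialize (HY n). specialize (Hp n).
 set (x := xs n) in *. set (y := ys n) in *. set (a := w * p2 n) in *. set (b := h * p2 n) in *.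
 assert (Ha0 : 0 <= a) by (unfold a; nra). assert (Hb0 : 0 <= b) by (unfold b; nra).
 assert (Es : (w + h) * p2 n = a + b) by (unfold a, b; ring). rewrite Es in *.
 set (z0 := mkC X Y) in *.
 set (g := fun z => ((f z0 - c * z0) + c * z)%C).
 assert (Hrf : rcts f x (x + a) y (y + b)) by (intros u v Hu Hv; apply Hc; lra).
 assert (Hrg : rcts g x (x + a) y (y + b)) by (intros u v Hu Hv; apply ccts_affine).
 assert (E : RI f x (x + a) y (y + b) = RI (fun z => (f z - g z)%C) x (x + a) y (y + b)).
 { rewrite RI_sub by (auto; lra). unfold g. rewrite RI_affine by lra. ring. }
 rewrite E in G5.
 assert (B : Cabs (RI (fun z => (f z - g z)%C) x (x + a) y (y + b))%C <=
  4 * (eps / 4 * (a + b)) * ((x + a - x) + (y + b - y))).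
 { apply RI_bound; try lra.
  - intros u v Hu Hv. apply ccts_sub; auto.
  - intros u v Hu Hv.
   assert (D : Cabs (mkC (u - X) (v - Y))%C <= a + b).
   { eapply Rle_trans; [apply Cabs_le_sum|]. simpl.
    apply Rplus_le_compat; apply Rabs_le; lra. }
   specialize (K (mkC (u - X) (v - Y)) ltac:(lra)).
   replace (Cadd z0 (mkC (u - X) (v - Y))) with (mkC u v) in K by (apply Cx_eq; simpl; ring).
   replace (f (mkC u v) - g (mkC u v))%C with (f (mkC u v) - f z0 - c * mkC (u - X) (v - Y))%C.
   + eapply Rle_trans; [apply K|]. apply Rmult_le_compat_l; lra.
   + unfold g. replace (mkC u v) with (z0 + mkC (u - X) (v - Y))%C by (apply Cx_eq; simpl; ring).
    ring. }
 nra.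
Qed.

Lemma goursat (f : Cx -> Cx) x1 x2 y1 y2 : x1 <= x2 -> y1 <= y2 ->
 (forall x y, x1 <= x <= x2 -> y1 <= y <= y2 -> exists c, cderiv f (mkC x y) c) ->
 RI f x1 x2 y1 y2 = C0.
Proof.
 intros Hx Hy Hf. apply Cx_eq_eps. intros eps He.
 replace (RI f x1 x2 y1 y2 - C0)%C with (RI f x1 x2 y1 y2) by ring.
 set (s := (x2 - x1) + (y2 - y1)).
 assert (Hs : 0 <= s) by (unfold s; lra).
 pose proof (goursat_bound f x1 y1 (x2 - x1) (y2 - y1) (eps / (s * s + 1))) as K.
 replace (x1 + (x2 - x1)) with x2 in K by ring. replace (y1 + (y2 - y1)) with y2 in K by ring.
 eapply Rle_trans; [apply K|]; auto; try lra.
 - apply Rdiv_lt_0_compat; nra.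
 - fold s. unfold Rdiv. rewrite Rmult_assoc.
  apply Rmult_le_reg_r with (s * s + 1); [nra|].
  replace (eps * (/ (s * s + 1) * (s * s)) * (s * s + 1)) with (eps * (s * s)) by (field; nra). nra.
Qed.

Lemma cderiv_mul f g t c d : cderiv f t c -> cderiv g t d ->
 cderiv (fun z => (f z * g z)%C) t (c * g t + f t * d)%C.
Proof.
 intros Hf Hg eps He.
 pose proof (cderiv_ccts g t d Hg) as Cg.
 pose proof (Cabs_pos (f t)) as Pf. pose proof (Cabs_pos (g t)) as Pg. pose proof (Cabs_pos c) as Pc.
 set (M := Cabs (f t) + Cabs (g t) + Cabs c + 1).
 assert (HM : 0 < eps / M) by (apply Rdiv_lt_0_compat; unfold M; lra).
 destruct (Hf (eps / M) HM) as [d1 [Hd1 K1]]. destruct (Hg (eps / M) HM) as [d2 [Hd2 K2]].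
 destruct (Cg (Rmin 1 (eps / M))) as [d3 [Hd3 K3]]; [apply Rmin_glb_lt; lra|].
 exists (Rmin d1 (Rmin d2 d3)). split; [repeat apply Rmin_glb_lt; auto|].
 intros h Hh.
 destruct (Rmin_Rgt_l _ _ _ Hh) as [? [? ?]%Rmin_Rgt_l].
 specialize (K1 h H). specialize (K2 h H0). specialize (K3 h H1).
 assert (K3a : Cabs (g (t + h) - g t)%C <= 1) by (pose proof (Rmin_l 1 (eps / M)); lra).
 assert (K3b : Cabs (g (t + h) - g t)%C <= eps / M) by (pose proof (Rmin_r 1 (eps / M)); lra).
 assert (Hg' : Cabs (g (t + h)%C)%C <= Cabs (g t) + 1).
 { replace (g (t + h)%C) with (g t + (g (t + h) - g t))%C by ring.
  eapply Rle_trans; [apply Cabs_triang|]. lra. }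
 pose proof (Cabs_pos h) as Ph.
 replace (f (t + h) * g (t + h) - f t * g t - (c * g t + f t * d) * h)%C with
  ((f (t + h) - f t - c * h) * g (t + h) + c * h * (g (t + h) - g t) + f t * (g (t + h) - g t - d * h))%C by ring.
 eapply Rle_trans; [apply Cabs_triang|]. eapply Rle_trans; [apply Rplus_le_compat_r, Cabs_triang|].
 rewrite !Cabs_mul.
 apply Rle_trans with ((eps / M * Cabs h) * (Cabs (g t) + 1) + Cabs c * Cabs h * (eps / M) + Cabs (f t) * (eps / M * Cabs h)).
 - repeat apply Rplus_le_compat.
  + apply Rmult_le_compat; auto using Cabs_pos.
  + apply Rmult_le_compat_l; auto. nra.
  + apply Rmult_le_compat_l; auto.
 - right. unfold M. field. unfold M in *. lra.
Qed.

Lemma cderiv_const c t : cderiv (fun _ => c) t C0.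
Proof. apply cderiv_lin. intros; ring. Qed.

Lemma cderiv_Cexp (l t : Cx) : cderiv (fun z => Cexp (l * z)%C) t (l * Cexp (l * t)%C)%C.
Proof.
 intros eps He.
 pose proof (Cabs_pos l) as Pl. pose proof (exp_pos (Cabs l)) as Pe.
 set (E := Cexp (l * t)%C). pose proof (Cabs_pos E) as PE.
 set (M := 4 * Cabs E * (Cabs l * Cabs l) * exp (Cabs l) + 1).
 assert (HM0 : 0 <= Cabs E * (Cabs l * Cabs l)) by (apply Rmult_le_pos; nra).
 assert (HM : 0 < M) by (unfold M; nra).
 exists (Rmin 1 (eps / M)). split; [apply Rmin_glb_lt; [lra|now apply Rdiv_lt_0_compat]|].
 intros h Hh.
 destruct (Rmin_Rgt_l _ _ _ Hh) as [H1 H2].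
 pose proof (Cabs_pos h) as Ph.
 replace (l * (t + h))%C with (l * t + l * h)%C by ring. rewrite Cexp_add. fold E.
 replace (E * Cexp (l * h)%C - E - l * E * h)%C with (E * (Cexp (l * h)%C - C1 - l * h))%C by ring.
 rewrite Cabs_mul.
 apply Rle_trans with (Cabs E * (4 * ((Cabs l * Cabs h) * (Cabs l * Cabs h)) * exp (Cabs l))).
 - apply Rmult_le_compat_l; auto. eapply Rle_trans; [apply Cexp_sub1_bound|].
  rewrite !Cabs_mul. apply Rmult_le_compat_l; [|apply exp_le_mono; nra].
  assert (0 <= Cabs l * Cabs h) by nra. nra.
 - replace (Cabs E * (4 * (Cabs l * Cabs h * (Cabs l * Cabs h)) * exp (Cabs l)))
   with ((M - 1) * Cabs h * Cabs h) by (unfold M; ring).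
  apply Rmult_le_compat_r; auto.
  apply Rlt_div_r in H2; [|lra].
  assert (0 <= (M - 1)) by (unfold M; nra). nra.
Qed.

Lemma cderiv_e (l t : Cx) : exists d, cderiv (fun z => e (l * z)%C) t d.
Proof.
 exists ((mkC 0 (2 * PI) * l) * Cexp ((mkC 0 (2 * PI) * l) * t)%C)%C.
 assert (E : (fun z => e (l * z)%C) = (fun z => Cexp ((mkC 0 (2 * PI) * l) * z)%C)).
 { apply functional_extensionality. intros z. unfold e. f_equal. ring. }
 rewrite E. apply cderiv_Cexp.
Qed.

Lemma e_RtoC x : e (RtoC x) = mkC (cos (2 * PI * x)) (sin (2 * PI * x)).
Proof.
 unfold e, Cexp; simpl. replace (0 * x - 2 * PI * 0) with 0 by ring.
 replace (0 * 0 + 2 * PI * x) with (2 * PI * x) by ring. rewrite exp_0. apply Cx_eq; simpl; ring.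
Qed.

Lemma ccont_e (l : Cx) a b : ccont (fun x => e (l * RtoC x)%C) a b.
Proof.
 apply (ccont_h (fun z => e (l * z)%C) 0). intros x _. destruct (cderiv_e l (mkC x 0)) as [d Hd].
 eapply cderiv_ccts; eauto.
Qed.

Lemma CI_e_Z (m : Z) : CI (fun x => e (ZtoC m * RtoC x)%C) 0 1 = if Z.eq_dec m 0 then C1 else C0.
Proof.
 destruct (Z.eq_dec m 0) as [->|Hm].
 - rewrite (CI_ext _ (fun _ => C1)); [|intros; replace (ZtoC 0 * RtoC x)%C with C0 by ring; apply e_0|lra].
  apply Cx_eq; simpl; rewrite RInt_const; unfold scal; simpl; unfold mult; simpl; ring.
 - assert (Hm' : IZR m <> 0) by (apply not_0_IZR; auto). pose proof PI_RGT_0.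
  set (k := 2 * PI * IZR m). assert (Hk : k <> 0) by (unfold k; apply Rmult_integral_contrapositive; split; [lra|auto]).
  assert (Ee : forall x, e (ZtoC m * RtoC x)%C = mkC (cos (k * x)) (sin (k * x))).
  { intros x. unfold ZtoC. rewrite <- RtoC_mul, e_RtoC. unfold k. rewrite <- !Rmult_assoc. reflexivity. }
  rewrite (CI_derive _ (fun x => mkC (sin (k * x) / k) (- cos (k * x) / k))).
  + assert (e (ZtoC m) = C1) by apply e_Z. unfold ZtoC in H0. rewrite e_RtoC in H0.
   fold k in H0. assert (H2 := f_equal Re H0). assert (H3 := f_equal Im H0). simpl in H2, H3. rewrite Rmult_0_r, Rmult_1_r, sin_0, cos_0, H2, H3.
   apply Cx_eq; simpl; field; auto.
  + lra.
  + apply ccont_e.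
  + intros x. rewrite Ee. simpl. split; auto_derive; auto; field; auto.
Qed.

(* The kernel [cos (pi u) ^ (2 N)] is a trigonometric polynomial that concentrates at [u = 0]. *)
Definition kapc (x0 x : R) : Cx := ((ZtoC 2 + e (RtoC (x - x0))%C + e (RtoC (x0 - x))%C) / ZtoC 4)%C.

Lemma kapc_real x0 x : kapc x0 x = RtoC ((1 + cos (2 * PI * (x - x0))) / 2).
Proof.
 unfold kapc. rewrite !e_RtoC. replace (2 * PI * (x0 - x)) with (- (2 * PI * (x - x0))) by ring.
 rewrite cos_neg, sin_neg. apply Cx_eq; simpl; unfold Cnorm2; simpl; field.
Qed.

(** Multiplication by [kapc] shifts frequencies by -1, 0 and 1 only, so the vanishing of all Fourier
    integrals passes from one power to the next. *)
Lemma kernel_vanish (d : R -> Cx) x0 : ccont d 0 1 ->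
 (forall m, CI (fun x => (d x * e (ZtoC m * RtoC x)%C)%C) 0 1 = C0) ->
 forall N, ccont (fun x => (d x * Cpow (kapc x0 x) N)%C) 0 1 /\
  forall m, CI (fun x => (d x * Cpow (kapc x0 x) N * e (ZtoC m * RtoC x)%C)%C) 0 1 = C0.
Proof.
 intros Hd H. induction N as [|N [IH1 IH2]].
 - split.
  + apply ccont_mul; auto. apply (ccont_const C1).
  + intros m. rewrite <- (H m). apply CI_ext; [|lra]. intros x _. simpl. ring.
 - set (q := fun x => (d x * Cpow (kapc x0 x) N)%C) in *.
  assert (E : forall x, (d x * Cpow (kapc x0 x) (S N))%C =
   (Cdiv C1 (ZtoC 2) * q x * e (ZtoC 0 * RtoC x)%C + e (RtoC (- x0)) / ZtoC 4 * q x * e (ZtoC 1 * RtoC x)%C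
   + e (RtoC x0) / ZtoC 4 * q x * e (ZtoC (-1) * RtoC x)%C)%C).
  { intros x. simpl Cpow. replace (d x * (kapc x0 x * Cpow (kapc x0 x) N))%C with (q x * kapc x0 x)%C by (unfold q; ring).
   replace (ZtoC 0 * RtoC x)%C with C0 by ring. rewrite e_0.
   unfold kapc. unfold Rminus. rewrite !RtoC_add, !e_add.
   replace (ZtoC 1 * RtoC x)%C with (RtoC x) by ring.
   replace (ZtoC (-1) * RtoC x)%C with (RtoC (- x)) by (rewrite RtoC_opp; ring).
   field. }
  assert (Cq : forall c k, ccont (fun x => (c * q x * e (ZtoC k * RtoC x)%C)%C) 0 1).
  { intros c k. apply ccont_mul; [apply ccont_mul; [apply ccont_const|auto]|apply ccont_e]. }
  assert (Iq : forall c k m, CI (fun x => (c * q x * e (ZtoC k * RtoC x)%C * e (ZtoC m * RtoC x)%C)%C) 0 1 = C0).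
  { intros c k m. rewrite (CI_ext _ (fun x => (c * (q x * e (ZtoC (k + m) * RtoC x)%C))%C)).
   - rewrite CI_scal, IH2; [ring|lra|]. apply ccont_mul; auto using ccont_e.
   - intros x _. rewrite ZtoC_add.
    replace ((ZtoC k + ZtoC m) * RtoC x)%C with (ZtoC k * RtoC x + ZtoC m * RtoC x)%C by ring.
    rewrite e_add. ring.
   - lra. }
  assert (Ef : (fun x => (d x * Cpow (kapc x0 x) (S N))%C) = (fun x => (Cdiv C1 (ZtoC 2) * q x * e (ZtoC 0 * RtoC x)%C + e (RtoC (- x0)) / ZtoC 4 * q x * e (ZtoC 1 * RtoC x)%C
   + e (RtoC x0) / ZtoC 4 * q x * e (ZtoC (-1) * RtoC x)%C)%C)) by (apply functional_extensionality; auto).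
  split.
  + rewrite Ef. apply ccont_add; [apply ccont_add|]; apply Cq.
  + intros m.
   rewrite (CI_ext _ (fun x => (Cdiv C1 (ZtoC 2) * q x * e (ZtoC 0 * RtoC x)%C * e (ZtoC m * RtoC x)%C
   + e (RtoC (- x0)) / ZtoC 4 * q x * e (ZtoC 1 * RtoC x)%C * e (ZtoC m * RtoC x)%C
   + e (RtoC x0) / ZtoC 4 * q x * e (ZtoC (-1) * RtoC x)%C * e (ZtoC m * RtoC x)%C)%C)).
   * assert (Cq' : forall c k, ccont (fun x => (c * q x * e (ZtoC k * RtoC x)%C * e (ZtoC m * RtoC x)%C)%C) 0 1)
     by (intros; apply ccont_mul; auto using ccont_e).
    rewrite CI_add, CI_add, !Iq; try lra; auto; [ring|]. apply ccont_add; auto.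
   * intros x _. rewrite E. ring.
   * lra.
Qed.

Lemma cos_mono_2pi u v : 0 <= u -> u <= v -> v <= / 2 -> cos (2 * PI * v) <= cos (2 * PI * u).
Proof.
 intros H0 H1 H2. pose proof PI_RGT_0. apply cos_decr_1; nra.
Qed.

(** Suppose d(x0) is nonzero; then r = Re(conj(d(x0)) d) exceeds r(x0)/2 near x0. Integrated against
    the N-th power of the kernel, the part within del/2 of x0 contributes at least (r(x0)/2) sig^N
    del, while the rest contributes at least - M rho^N with rho < sig. For large N the integral
    cannot vanish. *)
Lemma fourier_uniq (d : R -> Cx) x0 : ccont d 0 1 -> 0 < x0 < 1 ->
 (forall m, CI (fun x => (d x * e (ZtoC m * RtoC x)%C)%C) 0 1 = C0) -> d x0 = C0.
Proof.
 intros Hd Hx0 H. apply NNPP. intros Hne.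
 set (r := fun x => Re (Cconj (d x0) * d x)%C).
 assert (Cr : forall x, 0 <= x <= 1 -> continuous r x).
 { assert (Q : ccont (fun x => (Cconj (d x0) * d x)%C) 0 1) by (apply ccont_mul; auto using ccont_const).
  intros x Hx. apply Q; auto. }
 assert (Hr0 : 0 < r x0).
 { unfold r. simpl. pose proof (Cabs_gt0 _ Hne) as P. pose proof (Cabs_sqr (d x0)). unfold Cnorm2 in H0. nra. }
 set (kap := fun u => (1 + cos (2 * PI * u)) / 2).
 assert (Hint : forall N, RInt (fun x => r x * kap (x - x0) ^ N) 0 1 = 0).
 { intros N. destruct (kernel_vanish d x0 Hd H N) as [K1 K2].
  assert (E : CI (fun x => (Cconj (d x0) * (d x * Cpow (kapc x0 x) N))%C) 0 1 = C0).
  { rewrite CI_scal by (auto; lra). specialize (K2 0%Z). rewrite (CI_ext _ (fun x => (d x * Cpow (kapc x0 x) N)%C)) in K2.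
   - rewrite K2. ring.
   - intros x _. replace (ZtoC 0 * RtoC x)%C with C0 by ring. rewrite e_0. ring.
   - lra. }
  apply (f_equal Re) in E. simpl in E. etransitivity; [|exact E]. apply RInt_ext. intros x _.
  rewrite kapc_real, <- RtoC_pow. unfold r, kap. simpl. ring. }
 destruct (continuity_ab_maj (fun x => - r x) 0 1 ltac:(lra)) as [xm [Hm _]].
 { intros c Hc. apply continuity_pt_opp, continuity_pt_filterlim, Cr; auto. }
 set (M := Rmax 0 (- r xm)).
 assert (HM : forall x, 0 <= x <= 1 -> - M <= r x).
 { intros x Hx. specialize (Hm x Hx). unfold M. pose proof (Rmax_r 0 (- r xm)). lra. }
 assert (HM0 : 0 <= M) by apply Rmax_l.
 assert (exists d0, 0 < d0 /\ forall x, Rabs (x - x0) < d0 -> r x0 / 2 < r x) as [d0 [Hd0 Hd0']].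
 { assert (C0' : continuity_pt r x0) by (apply continuity_pt_filterlim, Cr; lra).
  destruct (C0' (r x0 / 2)) as [al [Hal K]]; [lra|]. exists al. split; [apply Hal|].
  intros x Hx. destruct (Req_dec x x0) as [->|Hn]; [lra|].
  specialize (K x). simpl in K. unfold Rdist in K.
  assert (Rabs (r x - r x0) < r x0 / 2).
  { apply K. split; auto. split; [exact Logic.I|auto]. }
  apply Rabs_def2 in H0. lra. }
 (* The bounds x0 and 1 - x0 ensure |x - x0| <= 1 - del on [0, 1], so that the kernel, which has
    period 1, does not peak again at the far end. *)
 set (del := Rmin (d0 / 2) (Rmin (/ 4) (Rmin x0 (1 - x0)))).
 assert (Hdel : 0 < del) by (unfold del; repeat apply Rmin_glb_lt; lra).
 assert (Hdel1 : del < d0) by (unfold del; pose proof (Rmin_l (d0 / 2) (Rmin (/ 4) (Rmin x0 (1 - x0)))); lra).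
 assert (Hdel2 : del <= / 4 /\ del <= x0 /\ del <= 1 - x0).
 { unfold del. pose proof (Rmin_r (d0 / 2) (Rmin (/ 4) (Rmin x0 (1 - x0)))).
  pose proof (Rmin_l (/ 4) (Rmin x0 (1 - x0))). pose proof (Rmin_r (/ 4) (Rmin x0 (1 - x0))).
  pose proof (Rmin_l x0 (1 - x0)). pose proof (Rmin_r x0 (1 - x0)). lra. }
 set (rho := kap del). set (sig := kap (del / 2)). pose proof PI_RGT_0 as HPI.
 assert (Hkap0 : forall u, 0 <= kap u) by (intros u; unfold kap; pose proof (COS_bound (2 * PI * u)); lra).
 assert (Hks : forall u, kap u = kap (Rabs u)).
 { intros u. unfold kap, Rabs. destruct (Rcase_abs u); auto.
  replace (2 * PI * - u) with (- (2 * PI * u)) by ring. now rewrite cos_neg. }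
 assert (Hrho : 0 <= rho < sig).
 { split; [apply Hkap0|]. unfold rho, sig, kap. assert (cos (2 * PI * del) < cos (2 * PI * (del / 2))); [|lra].
  apply cos_decreasing_1; nra. }
 assert (Hout : forall x, 0 <= x <= 1 -> del <= Rabs (x - x0) -> kap (x - x0) <= rho).
 { intros x Hx Hl. rewrite Hks. unfold rho, kap.
  assert (Hu : Rabs (x - x0) <= 1 - del) by (apply Rabs_le; lra).
  set (u := Rabs (x - x0)) in *.
  destruct (Rle_dec u (/ 2)).
  - pose proof (cos_mono_2pi del u). lra.
  - pose proof (cos_mono_2pi del (1 - u)).
   replace (cos (2 * PI * u)) with (cos (2 * PI * (1 - u))); [lra|].
   replace (2 * PI * (1 - u)) with (- (2 * PI * u) + 2 * PI) by ring.
   rewrite cos_plus, cos_2PI, sin_2PI, cos_neg. ring. }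
 assert (Hin : forall x, Rabs (x - x0) <= del / 2 -> sig <= kap (x - x0)).
 { intros x Hl. rewrite (Hks (x - x0)). unfold sig, kap. pose proof (Rabs_pos (x - x0)).
  pose proof (cos_mono_2pi (Rabs (x - x0)) (del / 2)). lra. }
 assert (Hlow : forall N x, 0 <= x <= 1 -> - (M * rho ^ N) <= r x * kap (x - x0) ^ N).
 { intros N x Hx. assert (0 <= kap (x - x0) ^ N) by (apply pow_le; auto).
  assert (0 <= rho ^ N) by (apply pow_le; apply Hrho).
  destruct (Rle_dec del (Rabs (x - x0))) as [Hl|Hl].
  - assert (kap (x - x0) ^ N <= rho ^ N) by (apply pow_incr; split; auto).
   specialize (HM x Hx). nra.
  - assert (r x0 / 2 < r x) by (apply Hd0'; lra). nra. }
 assert (Ccon : forall N x, 0 <= x <= 1 -> continuous (fun x => r x * kap (x - x0) ^ N) x).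
 { intros N x Hx. apply (continuous_mult (K := R_AbsRing)); auto.
  apply (ex_derive_continuous (V := R_NormedModule)). unfold kap. auto_derive; auto. }
 assert (Key : forall N, r x0 / 2 * sig ^ N * del <= M * rho ^ N).
 { intros N. specialize (Hint N). set (u := fun x => r x * kap (x - x0) ^ N) in *.
  assert (Xu : forall a b, 0 <= a -> a <= b -> b <= 1 -> ex_RInt u a b).
  { intros a b Ha Hab Hb. apply (ex_RInt_continuous (V := R_CompleteNormedModule)). intros z Hz.
   rewrite Rmin_left, Rmax_right in Hz by auto. apply Ccon. lra. }
  rewrite <- (RInt_Chasles (V := R_CompleteNormedModule) u 0 (x0 - del / 2) 1) in Hint by (apply Xu; lra).
  rewrite <- (RInt_Chasles (V := R_CompleteNormedModule) u (x0 - del / 2) (x0 + del / 2) 1) in Hint by (apply Xu; lra).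
  unfold plus in Hint; simpl in Hint.
  assert (Lc : forall a b c, 0 <= a -> a <= b -> b <= 1 -> (forall x, a < x < b -> c <= u x) -> c * (b - a) <= RInt u a b).
  { intros a b c Ha Hab Hb Hu. replace (c * (b - a)) with (RInt (fun _ => c) a b).
   - apply RInt_le; auto. apply ex_RInt_const.
   - rewrite RInt_const. unfold scal; simpl; unfold mult; simpl; ring. }
  assert (I1 := Lc 0 (x0 - del / 2) (- (M * rho ^ N)) ltac:(lra) ltac:(lra) ltac:(lra) ltac:(intros; apply Hlow; lra)).
  assert (I3 := Lc (x0 + del / 2) 1 (- (M * rho ^ N)) ltac:(lra) ltac:(lra) ltac:(lra) ltac:(intros; apply Hlow; lra)).
  assert (I2 : r x0 / 2 * sig ^ N * (x0 + del / 2 - (x0 - del / 2)) <= RInt u (x0 - del / 2) (x0 + del / 2)).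
  { apply Lc; try lra. intros x Hx. assert (Rabs (x - x0) <= del / 2) by (apply Rabs_le; lra).
   assert (r x0 / 2 < r x) by (apply Hd0'; lra).
   assert (sig ^ N <= kap (x - x0) ^ N) by (apply pow_incr; split; [lra|auto]).
   assert (0 <= sig ^ N) by (apply pow_le; lra). unfold u. nra. }
  assert (0 <= M * rho ^ N) by (apply Rmult_le_pos; auto; apply pow_le; lra). nra. }
 assert (Hq : Rabs (rho / sig) < 1).
 { rewrite Rabs_right; [|apply Rle_ge, Rdiv_le_0_compat; lra].
  apply Rmult_lt_reg_r with sig; [lra|]. unfold Rdiv. rewrite Rmult_assoc, Rinv_l; lra. }
 destruct (pow_lt_1_zero _ Hq (r x0 / 2 * del / (M + 1))) as [N HN].
 { apply Rdiv_lt_0_compat; nra. }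
 specialize (HN N (le_n N)). specialize (Key N).
 assert (Hsig : 0 < sig ^ N) by (apply pow_lt; lra).
 assert (E : rho ^ N = (rho / sig) ^ N * sig ^ N).
 { rewrite <- Rpow_mult_distr. f_equal. field. lra. }
 rewrite E in Key. apply Rabs_def2 in HN.
 assert (HN' : (rho / sig) ^ N * (M + 1) < r x0 / 2 * del).
 { destruct HN as [HN _]. apply Rlt_div_r in HN; lra. }
 assert (0 <= (rho / sig) ^ N).
 { apply pow_le. apply Rdiv_le_0_compat; lra. }
 assert (Hf : sig ^ N * (r x0 / 2 * del) <= sig ^ N * (M * (rho / sig) ^ N)) by lra.
 apply Rmult_le_reg_l in Hf; auto. nra.
Qed.

Lemma Csum_map_scal2 {I} (c : Cx) (f : I -> Cx) l :
 Csum (map (fun i => (f i * c)%C) l) = (Csum (map f l) * c)%C.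
Proof. induction l; simpl; [ring|]. rewrite IHl; ring. Qed.

Lemma ccont_bounded f a b : a <= b -> ccont f a b -> exists M, 0 <= M /\ forall x, a <= x <= b -> Cabs (f x) <= M.
Proof.
 intros Hab H. destruct (continuity_ab_maj (fun x => Rabs (Re (f x)) + Rabs (Im (f x))) a b Hab) as [x1 [H1 _]].
 { intros c Hc. apply continuity_pt_plus; apply (continuity_pt_comp _ Rabs); try apply Rcontinuity_abs;
  apply continuity_pt_filterlim, H; auto. }
 eexists. split; [|intros x Hx; eapply Rle_trans; [apply Cabs_le_sum|apply (H1 x Hx)]].
 apply Rplus_le_le_0_compat; apply Rabs_pos.
Qed.

Lemma inH_shift t (n : Z) : inH t -> inH (t + ZtoC n)%C.
Proof. unfold inH; simpl; intros; lra. Qed.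

Lemma periodic_Z (f : Cx -> Cx) : (forall t, inH t -> f (t + C1)%C = f t) ->
 forall (n : Z) t, inH t -> f (t + ZtoC n)%C = f t.
Proof.
 intros H. assert (Hn : forall (n : nat) t, inH t -> f (t + ZtoC (Z.of_nat n))%C = f t).
 { induction n; intros t Ht.
  - simpl. f_equal. ring.
  - rewrite Nat2Z.inj_succ. unfold Z.succ. rewrite ZtoC_add.
   replace (t + (ZtoC (Z.of_nat n) + ZtoC 1))%C with ((t + ZtoC (Z.of_nat n)) + C1)%C by ring.
   rewrite H, IHn; auto. now apply inH_shift. }
 intros n t Ht. destruct (Z_le_gt_dec 0 n).
 - rewrite <- (Z2Nat.id n) by auto. apply Hn; auto.
 - rewrite <- (Hn (Z.to_nat (- n)) (t + ZtoC n)%C) by (now apply inH_shift).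
  rewrite Z2Nat.id by lia. f_equal. rewrite ZtoC_opp. ring.
Qed.

Lemma AbsSum_two_sided (a : Z -> Cx) (M1 M2 c : R) : 0 < c ->
 (forall n, Cabs (a n) <= M1 * exp (- (c * IZR n))) ->
 (forall n, Cabs (a n) <= M2 * exp (c * IZR n)) -> AbsSum a.
Proof.
 intros Hc H1 H2.
 apply AbsSum_le with (fun n : Z => RtoC (exp (- c * Rabs (IZR n)))) (Rabs M1 + Rabs M2).
 - now apply AbsSum_exp_Z.
 - intros n. rewrite Cabs_RtoC, (Rabs_right (exp _)) by (left; apply exp_pos).
  specialize (H1 n). specialize (H2 n).
  pose proof (Rle_abs M1). pose proof (Rle_abs M2). pose proof (Rabs_pos M1). pose proof (Rabs_pos M2).
  pose proof (exp_pos (- c * Rabs (IZR n))).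
  unfold Rabs in *. fold (Rabs M1) in *. fold (Rabs M2) in *.
  destruct (Rcase_abs (IZR n)).
  + replace (- c * - IZR n) with (c * IZR n) in * by ring. nra.
  + replace (- c * IZR n) with (- (c * IZR n)) in * by ring. nra.
Qed.

Lemma e_as_Cexp z : e z = Cexp (mkC 0 (2 * PI) * z)%C.
Proof. reflexivity. Qed.

Lemma Zseries_holo (a : Z -> Cx) (v : Cx -> Cx) :
 (forall t, inH t -> AbsSum (fun n => (a n * e (ZtoC n * t)%C)%C)) ->
 (forall t, inH t -> HasSum (fun n => (a n * e (ZtoC n * t)%C)%C) (v t)) -> holo1 v.
Proof.
 intros HA HS t Ht. unfold inH in Ht.
 apply (expseries_deriv1 a (fun n => (mkC 0 (2 * PI) * ZtoC n)%C) t (Im t / 2)); [lra|].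
 intros h Hh. assert (Hi : inH (t + h)%C) by (apply inH_near; [auto|lra]).
 eapply ASum_ext; [|exact (conj (HA _ Hi) (HS _ Hi))]. intros n. simpl. rewrite e_as_Cexp.
 do 2 f_equal. ring.
Qed.

Lemma Cabs_e_ZtoC n t : Cabs (e (ZtoC n * t)%C)%C = exp (- (2 * PI * IZR n * Im t)).
Proof. rewrite Cabs_e. simpl. f_equal. ring. Qed.

(** On a rectangle of width 1 the vertical sides cancel by periodicity, so by Goursat the
    coefficient integral is the same at every height. The series then defines a second function with
    the same coefficients on each horizontal line, and [fourier_uniq] identifies the two. The bound
    at a single height is kept in the conclusion: it later removes the frequencies n <= 0 of a cusp
    form and yields the growth of its coefficients. *)
Theorem fourier_H (f : Cx -> Cx) : holo1 f -> (forall t, inH t -> f (t + C1)%C = f t) ->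
 exists a : Z -> Cx,
  (forall t, inH t -> ASum (fun n => (a n * e (ZtoC n * t)%C)%C) (f t)) /\
  (forall n y M, 0 < y -> (forall x, 0 <= x <= 1 -> Cabs (f (mkC x y)) <= M) ->
   Cabs (a n) <= 2 * M * exp (2 * PI * IZR n * y)).
Proof.
 intros Hf Hper.
 set (g := fun n z => (f z * e (ZtoC (- n) * z)%C)%C).
 assert (Hg : forall n t, inH t -> exists c, cderiv (g n) t c).
 { intros n t Ht. destruct (Hf t Ht) as [c Hc]. destruct (cderiv_e (ZtoC (- n)) t) as [d Hd].
  eexists. apply (cderiv_mul f (fun z => e (ZtoC (- n) * z)%C)); eauto. }
 assert (Cf : forall t, inH t -> ccts f t).
 { intros t Ht. destruct (Hf t Ht) as [c Hc]. eapply cderiv_ccts; eauto. }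
 assert (Cg : forall n t, inH t -> ccts (g n) t).
 { intros n t Ht. destruct (Hg n t Ht) as [c Hc]. eapply cderiv_ccts; eauto. }
 set (fc := fun n y => CI (fun x => g n (mkC x y)) 0 1).
 assert (fcle : forall n y1 y2, 0 < y1 -> y1 <= y2 -> fc n y1 = fc n y2).
 { intros n y1 y2 H1 H2.
  assert (G : RI (g n) 0 1 y1 y2 = C0).
  { apply goursat; auto; try lra. intros x y Hx Hy. apply Hg. unfold inH; simpl; lra. }
  unfold RI in G.
  assert (E : CI (fun y => g n (mkC 1 y)) y1 y2 = CI (fun y => g n (mkC 0 y)) y1 y2).
  { apply CI_ext; auto. intros y Hy. unfold g.
   replace (mkC 1 y) with (mkC 0 y + C1)%C by (apply Cx_eq; simpl; ring).
   rewrite Hper by (unfold inH; simpl; lra).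
   replace (ZtoC (- n) * (mkC 0 y + C1))%C with (ZtoC (- n) * mkC 0 y + ZtoC (- n))%C by ring.
   now rewrite e_add_Z. }
  rewrite E in G. fold (fc n y1) (fc n y2) in G.
  replace (fc n y1) with ((fc n y1 - fc n y2 + Ci * (CI (fun y => g n (mkC 0 y)) y1 y2 - CI (fun y => g n (mkC 0 y)) y1 y2)) + fc n y2)%C by ring.
  rewrite G. ring. }
 assert (fceq : forall n y1 y2, 0 < y1 -> 0 < y2 -> fc n y1 = fc n y2).
 { intros n y1 y2 H1 H2. destruct (Rle_dec y1 y2); [apply fcle; auto|symmetry; apply fcle; auto; lra]. }
 set (a := fun n => fc n 1). exists a.
 assert (Hb : forall n y M, 0 < y -> (forall x, 0 <= x <= 1 -> Cabs (f (mkC x y)) <= M) ->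
   Cabs (a n) <= 2 * M * exp (2 * PI * IZR n * y)).
 { intros n y M Hy HM. unfold a. rewrite (fceq n 1 y) by lra. unfold fc.
  replace (2 * M * exp (2 * PI * IZR n * y)) with (2 * (M * exp (2 * PI * IZR n * y)) * (1 - 0)) by ring.
  apply CI_bound; [lra| |].
  - apply ccont_h. intros x _. apply Cg. exact Hy.
  - intros x Hx. unfold g. rewrite Cabs_mul, Cabs_e_ZtoC. simpl.
   replace (- (2 * PI * IZR (- n) * y)) with (2 * PI * IZR n * y) by (rewrite opp_IZR; ring).
   apply Rmult_le_compat_r; [left; apply exp_pos|auto]. }
 assert (Hab : forall y, 0 < y -> exists M, 0 <= M /\ forall n, Cabs (a n) <= M * exp (2 * PI * IZR n * y)).
 { intros y Hy. destruct (ccont_bounded (fun x => f (mkC x y)) 0 1) as [M [HM0 HM]]; [lra| |].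
  - apply ccont_h. intros x _. apply Cf. exact Hy.
  - exists (2 * M). split; [lra|]. intros n. apply Hb; auto. }
 assert (HA : forall t, inH t -> AbsSum (fun n => (a n * e (ZtoC n * t)%C)%C)).
 { intros t Ht. pose proof PI_RGT_0. unfold inH in Ht.
  (* A height below Im t gives decay as n tends to plus infinity, a height above it gives decay
     towards minus infinity. *)
  destruct (Hab (Im t / 2)) as [M1 [_ H1]]; [lra|].
  destruct (Hab (Im t * 3 / 2)) as [M2 [_ H2]]; [lra|].
  apply AbsSum_two_sided with M1 M2 (PI * Im t); [nra| |].
  - intros n. rewrite Cabs_mul, Cabs_e_ZtoC. specialize (H1 n).
   replace (- (PI * Im t * IZR n)) with (2 * PI * IZR n * (Im t / 2) + - (2 * PI * IZR n * Im t)) by field.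
   rewrite exp_plus, <- Rmult_assoc. apply Rmult_le_compat_r; [left; apply exp_pos|auto].
  - intros n. rewrite Cabs_mul, Cabs_e_ZtoC. specialize (H2 n).
   replace (PI * Im t * IZR n) with (2 * PI * IZR n * (Im t * 3 / 2) + - (2 * PI * IZR n * Im t)) by field.
   rewrite exp_plus, <- Rmult_assoc. apply Rmult_le_compat_r; [left; apply exp_pos|auto]. }
 split; auto.
 set (v := fun t => Sumv (fun n => (a n * e (ZtoC n * t)%C)%C)).
 assert (Hv : forall t, inH t -> HasSum (fun n => (a n * e (ZtoC n * t)%C)%C) (v t))
  by (intros t Ht; apply Sumv_spec; auto).
 assert (Cv : forall t, inH t -> ccts v t).
 { intros t Ht. destruct (Zseries_holo a v HA Hv t Ht) as [c Hc]. eapply cderiv_ccts; eauto. }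
 assert (Hd : forall x y, 0 < y -> 0 < x < 1 -> f (mkC x y) = v (mkC x y)).
 { intros x0 y Hy Hx0.
  assert (cf : ccont (fun x => f (mkC x y)) 0 1) by (apply ccont_h; intros; apply Cf; exact Hy).
  assert (cv : ccont (fun x => v (mkC x y)) 0 1) by (apply ccont_h; intros; apply Cv; exact Hy).
  pose proof (fourier_uniq (fun x => f (mkC x y) - v (mkC x y))%C x0 (ccont_sub _ _ _ _ cf cv) Hx0) as U.
  simpl in U. replace (f (mkC x0 y)) with ((f (mkC x0 y) - v (mkC x0 y)) + v (mkC x0 y))%C by ring.
  rewrite U; [ring|]. clear U. intros m.
  rewrite (CI_ext _ (fun x => f (mkC x y) * e (ZtoC m * RtoC x)%C - v (mkC x y) * e (ZtoC m * RtoC x)%C)%C);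
   [|intros; ring|lra].
  rewrite CI_sub; [|lra|apply ccont_mul; auto using ccont_e|apply ccont_mul; auto using ccont_e].
  set (b := fun n => (a n * e (ZtoC n * mkC 0 y)%C)%C).
  assert (E1 : CI (fun x => (f (mkC x y) * e (ZtoC m * RtoC x)%C)%C) 0 1 = b (- m)%Z).
  { unfold b, a. rewrite (fceq _ 1 y) by lra.
   transitivity (CI (fun x => (e (ZtoC (- m) * mkC 0 y)%C * g (- m)%Z (mkC x y))%C) 0 1).
   - apply CI_ext; [|lra]. intros x _. unfold g. rewrite Z.opp_involutive.
    replace (ZtoC m * RtoC x)%C with (ZtoC (- m) * mkC 0 y + ZtoC m * mkC x y)%C
     by (rewrite ZtoC_opp; apply Cx_eq; simpl; ring).
    rewrite e_add. ring.
   - rewrite CI_scal; [unfold fc; ring|lra|]. apply ccont_h. intros; apply Cg. exact Hy. }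
  assert (E2 : CI (fun x => (v (mkC x y) * e (ZtoC m * RtoC x)%C)%C) 0 1 = b (- m)%Z).
  { apply Cx_eq_eps. intros eps He.
   assert (Ab : AbsSum b) by (apply HA; exact Hy).
   destruct (AbsSum_tail b Ab (eps / 2)) as [L0 HL0]; [lra|].
   (* A finite partial sum that contains the frequency -m approximates v uniformly on the line, and
      its integral against e(m x) is exactly b(-m). *)
   set (L := cnodup (- m :: L0)%Z).
   assert (HL : NoDup L) by apply NoDup_nodup.
   set (s := fun x => Csum (map (fun n => (b n * e (ZtoC n * RtoC x)%C)%C) L)).
   assert (Ht : forall x, Cabs (v (mkC x y) - s x)%C <= eps / 2).
   { intros x. apply HasSum_tail_bound with (f := fun n => (b n * e (ZtoC n * RtoC x)%C)%C); auto.
    - eapply HasSum_ext; [|apply (Hv (mkC x y)); exact Hy]. intros n. unfold b.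
     replace (ZtoC n * mkC x y)%C with (ZtoC n * mkC 0 y + ZtoC n * RtoC x)%C by (apply Cx_eq; simpl; ring).
     rewrite e_add. ring.
    - intros L' HL' Hdis. left. eapply Rle_lt_trans; [|apply (HL0 L' HL')].
     + apply Rsum_le. intros n _. rewrite Cabs_mul. unfold ZtoC. rewrite <- RtoC_mul, Cabs_e_real. lra.
     + intros n Hn Hc. apply (Hdis n Hn). apply nodup_In. right; auto. }
   assert (Cs : forall i, ccont (fun x => (b i * e (ZtoC i * RtoC x)%C * e (ZtoC m * RtoC x)%C)%C) 0 1).
   { intros i. apply ccont_mul; [apply ccont_mul; [apply (ccont_const (b i))|apply ccont_e]|apply ccont_e]. }
   destruct (CI_Csum (fun i x => (b i * e (ZtoC i * RtoC x)%C * e (ZtoC m * RtoC x)%C)%C) L 0 1 ltac:(lra) Cs) as [Cs1 Cs2].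
   assert (Ese : (fun x => (s x * e (ZtoC m * RtoC x)%C)%C) =
     (fun x => Csum (map (fun i => (b i * e (ZtoC i * RtoC x)%C * e (ZtoC m * RtoC x)%C)%C) L)))
    by (apply functional_extensionality; intros x; unfold s; now rewrite <- Csum_map_scal2).
   assert (Es : CI (fun x => (s x * e (ZtoC m * RtoC x)%C)%C) 0 1 = b (- m)%Z).
   { rewrite Ese, Cs2. rewrite (map_ext _ (fun i => if Z.eq_dec (i + m) 0 then b i else C0)).
     + assert (HinL : In (- m)%Z L) by (apply nodup_In; left; auto).
      clear - HL HinL. induction L as [|i L IH]; [destruct HinL|]. inversion HL; subst. simpl.
      destruct (Z.eq_dec (i + m) 0) as [Ei|Ei].
      * replace i with (- m)%Z in * by lia. rewrite Csum_map_0; [ring|].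
       intros j Hj. destruct (Z.eq_dec (j + m) 0); auto. replace j with (- m)%Z in Hj by lia. contradiction.
      * destruct HinL as [Hc|HinL]; [lia|]. rewrite IH; auto. ring.
     + intros i. rewrite (CI_ext _ (fun x => (b i * e (ZtoC (i + m) * RtoC x)%C)%C)).
      * rewrite CI_scal, CI_e_Z; [|lra|apply ccont_e]. destruct (Z.eq_dec (i + m) 0); ring.
      * intros x _. rewrite ZtoC_add.
       replace ((ZtoC i + ZtoC m) * RtoC x)%C with (ZtoC i * RtoC x + ZtoC m * RtoC x)%C by ring.
       rewrite e_add; ring.
      * lra. }
   rewrite <- Es.
   assert (Cse : ccont (fun x => (s x * e (ZtoC m * RtoC x)%C)%C) 0 1) by (rewrite Ese; exact Cs1).
   rewrite <- CI_sub; [|lra|apply ccont_mul; auto using ccont_e|auto].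
   eapply Rle_trans; [apply (CI_bound _ 0 1 (eps / 2)); [lra| |]|lra].
   - apply ccont_sub; auto. apply ccont_mul; auto using ccont_e.
   - intros x _. replace (v (mkC x y) * e (ZtoC m * RtoC x)%C - s x * e (ZtoC m * RtoC x)%C)%C
     with ((v (mkC x y) - s x) * e (ZtoC m * RtoC x)%C)%C by ring.
    rewrite Cabs_mul. unfold ZtoC at 1. rewrite <- RtoC_mul, Cabs_e_real, Rmult_1_r. apply Ht. }
  rewrite E1, E2. ring. }
 intros t Ht.
 enough (Ev : f t = v t) by (rewrite Ev; split; auto).
 assert (Hvper : forall t, inH t -> v (t + C1)%C = v t).
 { intros t' Ht'. unfold v. f_equal. apply functional_extensionality. intros n.
  replace (ZtoC n * (t' + C1))%C with (ZtoC n * t' + ZtoC n)%C by ring. now rewrite e_add_Z. }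
 destruct (archimed (Re t)) as [A1 A2]. set (k := up (Re t)) in *.
 rewrite <- (periodic_Z f Hper (1 - k) t Ht), <- (periodic_Z v Hvper (1 - k) t Ht).
 set (t' := (t + ZtoC (1 - k))%C).
 assert (Ht' : inH t') by (now apply inH_shift).
 assert (HR : 0 <= Re t' < 1) by (unfold t', ZtoC; rewrite minus_IZR; simpl; lra).
 (* [fourier_uniq] speaks only of interior points of [0, 1]; on the line Re t' = 0 the equality is
    obtained by continuity from the right. *)
 destruct (Req_dec (Re t') 0) as [H0|H0].
 - apply Cx_eq_eps. intros eps He.
  destruct (ccts_sub f v t' (Cf t' Ht') (Cv t' Ht') eps He) as [del [Hdel K]].
  set (h := Rmin (del / 2) (/ 2)).
  assert (0 < h) by (unfold h; apply Rmin_glb_lt; lra).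
  assert (h <= del / 2) by apply Rmin_l. assert (h <= / 2) by apply Rmin_r.
  specialize (K (RtoC h)). rewrite Cabs_RtoC, Rabs_right in K by lra. specialize (K ltac:(lra)). simpl in K.
  replace (t' + RtoC h)%C with (mkC h (Im t')) in K by (apply Cx_eq; [change (h = Re t' + h); rewrite H0; ring|change (Im t' = Im t' + 0); ring]).
  rewrite Hd in K by (auto; lra).
  replace (v (mkC h (Im t')) - v (mkC h (Im t')) - (f t' - v t'))%C with (- (f t' - v t'))%C in K by ring.
  now rewrite Cabs_opp in K.
 - replace t' with (mkC (Re t') (Im t')) by (destruct t'; reflexivity). apply Hd; auto. lra.
Qed.

(** * Separation of integer frequencies by averaging over roots of unity *)

Lemma Zrange_avg (n : Z) (M : nat) : (0 < M)%nat ->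
 Csum (map (fun j => e (RtoC (IZR n * INR j / INR M))%C) (seq 0 M)) =
 if Z.eq_dec (n mod Z.of_nat M) 0 then ZtoC (Z.of_nat M) else C0.
Proof.
 intros HM. assert (HM' : INR M <> 0) by (apply not_0_INR; lia).
 set (w := e (RtoC (IZR n / INR M))%C).
 assert (Ew : forall j, e (RtoC (IZR n * INR j / INR M))%C = Cpow w j).
 { intros j. unfold w. rewrite <- e_mulnat. f_equal. rewrite <- RtoC_INR_Z, <- RtoC_mul. f_equal. field; auto. }
 rewrite (map_ext _ _ Ew).
 assert (HwM : Cpow w M = C1).
 { rewrite <- Ew. replace (IZR n * INR M / INR M) with (IZR n) by (field; auto). apply (e_Z n). }
 destruct (Z.eq_dec (n mod Z.of_nat M) 0) as [H|H].
 - assert (w = C1).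
  { unfold w. apply Z.mod_divide in H; [|lia]. destruct H as [q ->].
   rewrite mult_IZR, <- INR_IZR_INZ. replace (IZR q * INR M / INR M) with (IZR q) by (field; auto). apply (e_Z q). }
  rewrite (map_ext _ (fun _ => C1)) by (intros; rewrite H0; apply Cpow_1_l).
  rewrite Csum_map_const, length_seq. ring.
 - assert (Hw1 : w <> C1).
  { intros E. apply H. unfold w in E. rewrite e_RtoC in E.
   assert (Ec := f_equal Re E). simpl in Ec.
   set (x := IZR n / INR M) in *.
   assert (Es : sin (PI * x) = 0).
   { replace (2 * PI * x) with (2 * (PI * x)) in Ec by ring. rewrite cos_2a_sin in Ec. nra. }
   destruct (sin_eq_0_0 _ Es) as [k Hk].
   assert (x = IZR k) by (apply Rmult_eq_reg_l with PI; [lra|pose proof PI_RGT_0; lra]).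
   unfold x in H0. assert (IZR n = IZR (k * Z.of_nat M)).
   { rewrite mult_IZR, <- INR_IZR_INZ, <- H0. field; auto. }
   apply eq_IZR in H1. rewrite H1. apply Z.mod_mul. lia. }
  assert (G : forall N, (Csum (map (Cpow w) (seq 0 N)) * (w - C1))%C = (Cpow w N - C1)%C).
  { induction N; [simpl; ring|]. rewrite seq_S, map_app, Csum_app. simpl.
   replace ((Csum (map (Cpow w) (seq 0 N)) + (Cpow w N + C0)) * (w - C1))%C
    with (Csum (map (Cpow w) (seq 0 N)) * (w - C1) + Cpow w N * (w - C1))%C by ring.
   rewrite IHN. ring. }
  specialize (G M). rewrite HwM in G.
  destruct (Cmul_integral (Csum (map (Cpow w) (seq 0 M))) (w - C1)%C) as [E|E]; auto.
  + rewrite G. ring.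
  + exfalso. apply Hw1. replace w with ((w - C1) + C1)%C by ring. rewrite E. ring.
Qed.

(* Averaging over [M]-th roots of unity isolates the frequencies congruent to [n] mod [M]; let [M] grow. *)
Lemma freq_isolate {I} (c : I -> Cx) (nu : I -> Z) : AbsSum c ->
 (forall (j M : nat), (0 < M)%nat -> HasSum (fun i => (c i * e (RtoC (IZR (nu i) * INR j / INR M))%C)%C) C0) ->
 forall n, HasSum (fun i => if Z.eq_dec (nu i) n then c i else C0) C0.
Proof.
 intros Ha H n.
 assert (P : forall M, (0 < M)%nat -> HasSum (fun i => if Z.eq_dec ((nu i - n) mod Z.of_nat M) 0 then c i else C0) C0).
 { intros M HM.
  pose proof (HasSum_Csum (fun j i => (e (- RtoC (IZR n * INR j / INR M))%C * (c i * e (RtoC (IZR (nu i) * INR j / INR M))%C))%C)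
   (fun j => (e (- RtoC (IZR n * INR j / INR M))%C * C0)%C) (seq 0 M)) as K.
  specialize (K ltac:(intros j _; apply HasSum_scal, H; auto)).
  rewrite (Csum_map_0 (fun j => (e (- RtoC (IZR n * INR j / INR M))%C * C0)%C)) in K by (intros; ring).
  apply (HasSum_scal (Cdiv C1 (ZtoC (Z.of_nat M)))) in K.
  replace (C1 / ZtoC (Z.of_nat M) * C0)%C with C0 in K by ring.
  eapply HasSum_ext; [|apply K]. intros i. cbv beta.
  assert (HM' : ZtoC (Z.of_nat M) <> C0) by (apply ZtoC_neq0; lia).
  rewrite (map_ext _ (fun j => (c i * e (RtoC (IZR (nu i - n) * INR j / INR M))%C)%C)).
  - rewrite Csum_map_scal, Zrange_avg by auto.
   destruct (Z.eq_dec ((nu i - n) mod Z.of_nat M) 0); field; auto.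
  - intros j. rewrite minus_IZR.
   replace ((IZR (nu i) - IZR n) * INR j / INR M) with (- (IZR n * INR j / INR M) + IZR (nu i) * INR j / INR M)
    by (field; apply not_0_INR; lia).
   rewrite RtoC_add, e_add, RtoC_opp. ring. }
 assert (Har : AbsSum (fun i => if Z.eq_dec (nu i) n then c i else C0))
  by (apply (AbsSum_restrict c (fun i => nu i = n)); auto).
 destruct (AbsSum_HasSum _ Har) as [s Hs].
 enough (Es : s = C0) by (rewrite Es in Hs; exact Hs). apply Cx_eq_eps. intros eps He. replace (s - C0)%C with s by ring.
 destruct (AbsSum_tail c Ha eps He) as [L0 HL0].
 (* Once M exceeds all |nu i - n| with i in L0, congruence to n modulo M is equality there, and only
    the small tail outside L0 can differ. *)
 assert (exists M, (0 < M)%nat /\ forall i, In i L0 -> (Z.abs (nu i - n) < Z.of_nat M)%Z) as [M [HM HML]].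
 { clear. induction L0 as [|i L0 [M [HM IH]]].
  - exists 1%nat. split; [lia|]. intros i [].
  - exists (M + S (Z.to_nat (Z.abs (nu i - n))))%nat. split; [lia|]. intros j [<-|Hj]; [lia|].
   specialize (IH j Hj). lia. }
 pose proof (HasSum_sub _ _ _ _ Hs (P M HM)) as K. replace (s - C0)%C with s in K by ring.
 apply (HasSum_le _ _ eps K). intros L HL.
 set (bad := fun i => if in_dec ceq i L0 then false else true).
 apply Rle_trans with (Rsum (map (fun i => Cabs (c i)) (filter bad L))).
 - clear - HML HM. induction L as [|i L IH]; simpl; [lra|].
  unfold bad at 1. destruct (in_dec ceq i L0) as [Hi|Hi]; simpl.
  + specialize (HML i Hi).
   replace ((if Z.eq_dec (nu i) n then c i else C0) - (if Z.eq_dec ((nu i - n) mod Z.of_nat M) 0 then c i else C0))%C with C0.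
   * rewrite Cabs_0. lra.
   * destruct (Z.eq_dec (nu i) n) as [E|E].
    -- rewrite E, Z.sub_diag, Z.mod_0_l by lia. simpl. ring.
    -- destruct (Z.eq_dec ((nu i - n) mod Z.of_nat M) 0) as [E'|E']; [|ring].
     exfalso. apply Z.mod_divide in E'; [|lia]. destruct E' as [q Hq].
     assert (q = 0 \/ 1 <= Z.abs q)%Z by lia. destruct H as [->|Hq']; [lia|]. nia.
  + apply Rplus_le_compat; auto.
   destruct (Z.eq_dec (nu i) n) as [E|E].
   * rewrite E, Z.sub_diag, Z.mod_0_l by lia. simpl. replace (c i - c i)%C with C0 by ring. rewrite Cabs_0. apply Cabs_pos.
   * destruct (Z.eq_dec ((nu i - n) mod Z.of_nat M) 0).
    -- replace (C0 - c i)%C with (- c i)%C by ring. rewrite Cabs_opp. lra.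
    -- replace (C0 - C0)%C with C0 by ring. rewrite Cabs_0. apply Cabs_pos.
 - left. apply HL0; [now apply NoDup_filter|].
  intros i Hi. apply filter_In in Hi. destruct Hi as [_ Hi]. unfold bad in Hi.
  destruct (in_dec ceq i L0); [discriminate|auto].
Qed.

(** * One-dimensional theta inversion *)

Lemma gauss_AbsSum (al be : R) : 0 < al ->
 AbsSum (fun n : Z => RtoC (exp (- al * (IZR n * IZR n) + be * IZR n))).
Proof.
 (* The constant is the exponential of the maximum of (|be| + 1) x - al x^2; the extra 1 leaves room
    for the factor exp(-|n|). *)
 intros Hal. set (M := exp ((Rabs be + 1) * (Rabs be + 1) / (4 * al))).
 apply AbsSum_le with (fun n : Z => RtoC (exp (- (1) * Rabs (IZR n)))) M; [exact (AbsSum_exp_Z 1 Rlt_0_1)|].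
 intros n. rewrite !Cabs_RtoC, !Rabs_right by (left; apply exp_pos). unfold M.
 rewrite <- exp_plus. apply exp_le_mono.
 set (x := IZR n). set (b := Rabs be + 1).
 assert (be * x <= Rabs be * Rabs x) by (rewrite <- Rabs_mult; apply Rle_abs).
 assert (Ex : x * x = Rabs x * Rabs x) by (rewrite <- Rabs_mult, Rabs_right; [reflexivity|nra]).
 assert (0 <= (2 * al * Rabs x - b) * (2 * al * Rabs x - b)) by apply Rle_0_sqr.
 assert (b * Rabs x <= b * b / (4 * al) + al * (Rabs x * Rabs x)).
 { apply Rmult_le_reg_r with (4 * al); [lra|].
  replace ((b * b / (4 * al) + al * (Rabs x * Rabs x)) * (4 * al)) with (b * b + 4 * al * al * (Rabs x * Rabs x)) by (field; lra).
  apply Rminus_le.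
  replace (b * Rabs x * (4 * al) - (b * b + 4 * al * al * (Rabs x * Rabs x)))
   with (- ((2 * al * Rabs x - b) * (2 * al * Rabs x - b))) by ring. lra. }
 unfold b in *. rewrite Ex. lra.
Qed.

(** [Lterm] and [Rterm] are the summands on the two sides of Poisson summation for the Gaussian
    e(tau x^2 + x z). *)
Definition Lterm (tau z : Cx) (n : Z) : Cx := e (tau * (ZtoC n * ZtoC n) + ZtoC n * z)%C.
Definition Rterm (tau z : Cx) (m : Z) : Cx :=
 e (- ((z - ZtoC m) * (z - ZtoC m)) / (ZtoC 4 * tau))%C.
Definition Lth (tau z : Cx) : Cx := Sumv (Lterm tau z).

Lemma inH_neq0 t : inH t -> t <> C0.
Proof. intros H E. unfold inH in H. rewrite E in H. simpl in H. lra. Qed.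

Lemma Lterm_AbsSum tau z : inH tau -> AbsSum (Lterm tau z).
Proof.
 intros Ht. unfold inH in Ht. pose proof PI_RGT_0.
 apply AbsSum_le with (fun n : Z => RtoC (exp (- (2 * PI * Im tau) * (IZR n * IZR n) + (- (2 * PI * Im z)) * IZR n))) 1.
 - apply gauss_AbsSum. nra.
 - intros n. rewrite Cabs_RtoC, Rabs_right by (left; apply exp_pos). unfold Lterm. rewrite Cabs_e. simpl.
  rewrite Rmult_1_l. apply exp_le_mono. right. ring.
Qed.
Lemma Lth_spec tau z : inH tau -> HasSum (Lterm tau z) (Lth tau z).
Proof. intros. apply Sumv_spec. now apply Lterm_AbsSum. Qed.

Definition inv4 (tau : Cx) : Cx := (ZtoC (-1) / (ZtoC 4 * tau))%C.
Lemma inv4_inH tau : inH tau -> inH (inv4 tau).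
Proof.
 intros H. assert (Hn := inH_neq0 _ H). unfold inH in *.
 pose proof (Cnorm2_gt0 tau Hn).
 replace (inv4 tau) with (mkC (- Re tau / (4 * Cnorm2 tau)) (Im tau / (4 * Cnorm2 tau))).
 - simpl. apply Rdiv_lt_0_compat; lra.
 - unfold inv4, Cdiv, Cinv. unfold Cnorm2 in *. apply Cx_eq; simpl; unfold Cnorm2; simpl; field; nra.
Qed.

Lemma Rterm_Lterm tau z m : tau <> C0 ->
 Rterm tau z m = (e (inv4 tau * (z * z))%C * Lterm (inv4 tau) (z / (ZtoC 2 * tau)) m)%C.
Proof.
 intros H. unfold Rterm, Lterm. rewrite <- e_add. f_equal. unfold inv4. field. auto.
Qed.
Lemma Rterm_AbsSum tau z : inH tau -> AbsSum (Rterm tau z).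
Proof.
 intros H. eapply AbsSum_ext; [intros n; symmetry; apply Rterm_Lterm, inH_neq0; auto|].
 apply AbsSum_scal, Lterm_AbsSum, inv4_inH; auto.
Qed.
Definition Rth (tau z : Cx) : Cx := Sumv (Rterm tau z).
Lemma Rth_spec tau z : inH tau -> HasSum (Rterm tau z) (Rth tau z).
Proof. intros. apply Sumv_spec. now apply Rterm_AbsSum. Qed.
Lemma Rth_Lth tau z : inH tau -> Rth tau z = (e (inv4 tau * (z * z))%C * Lth (inv4 tau) (z / (ZtoC 2 * tau)))%C.
Proof.
 intros H. apply Sumv_eq.
 eapply HasSum_ext; [intros n; symmetry; apply Rterm_Lterm, inH_neq0; auto|].
 apply HasSum_scal, Lth_spec, inv4_inH; auto.
Qed.

Lemma Zseries_zero (a : Z -> Cx) :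
 (forall t, inH t -> ASum (fun n => (a n * e (ZtoC n * t)%C)%C) C0) ->
 forall n, a n = C0.
Proof.
 intros H n. assert (Hi : inH Ci) by (unfold inH; simpl; lra).
 pose proof (freq_isolate (fun n => (a n * e (ZtoC n * Ci)%C)%C) (fun n => n) (proj1 (H Ci Hi))) as K.
 assert (Q : HasSum (fun i => if Z.eq_dec i n then (a i * e (ZtoC i * Ci)%C)%C else C0) C0).
 { apply K. intros j M HM.
  eapply HasSum_ext; [|apply (H (Ci + RtoC (INR j / INR M))%C)].
  - intros i. cbv beta. replace (RtoC (IZR i * INR j / INR M)) with (ZtoC i * RtoC (INR j / INR M))%C.
   + replace (ZtoC i * (Ci + RtoC (INR j / INR M)))%C with (ZtoC i * Ci + ZtoC i * RtoC (INR j / INR M))%C by ring.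
    rewrite e_add. ring.
   + unfold ZtoC. rewrite <- RtoC_mul. f_equal. unfold Rdiv. ring.
  - unfold inH; simpl; lra. }
 assert (F : HasSum (fun i => if Z.eq_dec i n then (a i * e (ZtoC i * Ci))%C else C0)
  (Csum (map (fun i => if Z.eq_dec i n then (a i * e (ZtoC i * Ci))%C else C0) (n :: nil)))).
 { apply HasSum_finite; [repeat constructor; simpl; tauto|]. intros i Hi'.
  destruct (Z.eq_dec i n); auto. subst. exfalso. apply Hi'. left; auto. }
 pose proof (HasSum_unique _ _ _ F Q) as E. simpl in E. destruct (Z.eq_dec n n) as [_|]; [|congruence].
 destruct (Cmul_integral (a n) (e (ZtoC n * Ci)%C)) as [E'|E']; auto.
 - rewrite <- E. ring.
 - exfalso. now apply (e_neq0 (ZtoC n * Ci)%C).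
Qed.

Lemma Zseries_uniq (a b : Z -> Cx) (f : Cx -> Cx) :
 (forall t, inH t -> ASum (fun n => (a n * e (ZtoC n * t)%C)%C) (f t)) ->
 (forall t, inH t -> ASum (fun n => (b n * e (ZtoC n * t)%C)%C) (f t)) ->
 forall n, a n = b n.
Proof.
 intros Ha Hb n.
 assert (E : (a n - b n)%C = C0).
 { apply (Zseries_zero (fun n => (a n - b n)%C)). intros t Ht. replace C0 with (f t - f t)%C by ring.
  eapply ASum_ext; [|exact (ASum_sub _ _ _ _ (Ha t Ht) (Hb t Ht))]. intros; simpl; ring. }
 replace (a n) with ((a n - b n) + b n)%C by ring. rewrite E. ring.
Qed.

Lemma Lth_nonzero tau : inH tau -> exists z, inH z /\ Lth tau z <> C0.
Proof.
 intros Ht. apply NNPP. intros Hn.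
 assert (E : e (tau * (ZtoC 0 * ZtoC 0))%C = C0).
 { apply (Zseries_zero (fun n => e (tau * (ZtoC n * ZtoC n))%C)). intros t Hint.
  assert (Et : forall n, Lterm tau t n = (e (tau * (ZtoC n * ZtoC n))%C * e (ZtoC n * t)%C)%C)
   by (intros; unfold Lterm; apply e_add).
  split; [apply (AbsSum_ext _ _ Et), Lterm_AbsSum; auto|].
  apply (HasSum_ext _ _ _ Et).
  replace C0 with (Lth tau t); [apply Lth_spec; auto|]. apply NNPP. intros Hc. apply Hn. eauto. }
 now apply e_neq0 in E.
Qed.

Lemma Lth_quasi tau z : inH tau -> Lth tau (z + ZtoC 2 * tau)%C = (e (- tau - z)%C * Lth tau z)%C.
Proof.
 intros Ht. apply Sumv_eq.
 pose proof (HasSum_scal (e (- tau - z)%C) _ _ (Lth_spec tau z Ht)) as K.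
 apply (HasSum_reindex (fun n => (n + 1)%Z) (fun n => (n - 1)%Z)) in K; try (intros; lia).
 eapply HasSum_ext; [|apply K]. intros n. cbv beta. unfold Lterm. rewrite <- e_add. f_equal.
 rewrite ZtoC_add. ring.
Qed.
Lemma Rth_quasi tau z : inH tau -> Rth tau (z + ZtoC 2 * tau)%C = (e (- tau - z)%C * Rth tau z)%C.
Proof.
 intros Ht. apply Sumv_eq.
 eapply HasSum_ext; [|apply (HasSum_scal (e (- tau - z)%C) _ _ (Rth_spec tau z Ht))].
 intros n. cbv beta. unfold Rterm. rewrite <- e_add.
 rewrite <- (e_add_Z _ n). f_equal. field. now apply inH_neq0.
Qed.
Lemma Rth_periodic tau z : inH tau -> Rth tau (z + C1)%C = Rth tau z.
Proof.
 intros Ht. apply Sumv_eq. pose proof (Rth_spec tau z Ht) as K.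
 apply (HasSum_reindex (fun n => (n - 1)%Z) (fun n => (n + 1)%Z)) in K; try (intros; lia).
 eapply HasSum_ext; [|apply K]. intros n. cbv beta. unfold Rterm. rewrite ZtoC_sub.
 do 4 f_equal; ring.
Qed.

Lemma cderiv_id t : cderiv (fun z => z) t C1.
Proof. apply cderiv_lin. intros; ring. Qed.

Lemma cderiv_comp f g t c d : cderiv f (g t) c -> cderiv g t d -> cderiv (fun z => f (g z)) t (c * d)%C.
Proof.
 intros Hf Hg eps He. pose proof (Cabs_pos c) as Pc. pose proof (Cabs_pos d) as Pd.
 set (M := Cabs c + Cabs d + 1).
 assert (HM : 0 < eps / M) by (apply Rdiv_lt_0_compat; unfold M; lra).
 destruct (Hf (eps / M) HM) as [d1 [Hd1 K1]].
 destruct (Hg (Rmin 1 (eps / M))) as [d2 [Hd2 K2]]; [apply Rmin_glb_lt; lra|].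
 exists (Rmin d2 (d1 / (Cabs d + 1))). split.
 { apply Rmin_glb_lt; auto. apply Rdiv_lt_0_compat; lra. }
 intros h Hh. pose proof (Cabs_pos h) as Ph.
 destruct (Rmin_Rgt_l _ _ _ Hh) as [h1 h2].
 apply Rlt_div_r in h2; [|lra].
 specialize (K2 h h1). set (k := (g (t + h) - g t)%C) in *.
 assert (K2a : Cabs (k - d * h)%C <= 1 * Cabs h)
  by (eapply Rle_trans; [apply K2|apply Rmult_le_compat_r; auto; apply Rmin_l]).
 assert (K2b : Cabs (k - d * h)%C <= eps / M * Cabs h)
  by (eapply Rle_trans; [apply K2|apply Rmult_le_compat_r; auto; apply Rmin_r]).
 assert (Hk : Cabs k <= (Cabs d + 1) * Cabs h).
 { replace k with ((k - d * h) + d * h)%C by ring. eapply Rle_trans; [apply Cabs_triang|].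
  rewrite (Cabs_mul d h). lra. }
 specialize (K1 k ltac:(lra)). replace (g t + k)%C with (g (t + h)%C) in K1 by (unfold k; ring).
 replace (f (g (t + h)) - f (g t) - c * d * h)%C with ((f (g (t + h)) - f (g t) - c * k) + c * (k - d * h))%C by ring.
 eapply Rle_trans; [apply Cabs_triang|]. rewrite (Cabs_mul c).
 apply Rle_trans with (eps / M * ((Cabs d + 1) * Cabs h) + Cabs c * (eps / M * Cabs h)).
 - apply Rplus_le_compat; [eapply Rle_trans; [apply K1|]; apply Rmult_le_compat_l; lra|apply Rmult_le_compat_l; auto].
 - right. unfold M. field. unfold M in HM. lra.
Qed.

Lemma cderiv_Cinv t : t <> C0 -> cderiv Cinv t (- (Cinv t * Cinv t))%C.
Proof.
 intros Ht eps He. pose proof (Cabs_gt0 _ Ht) as P. set (r := Cabs t) in *.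
 assert (Pr : 0 < r * r * r) by (apply Rmult_lt_0_compat; nra).
 exists (Rmin (r / 2) (eps * (r * r * r) / 2)). split; [apply Rmin_glb_lt; nra|].
 intros h Hh. pose proof (Cabs_pos h) as Ph.
 destruct (Rmin_Rgt_l _ _ _ Hh) as [h1 h2].
 assert (Hth : r / 2 <= Cabs (t + h)%C).
 { pose proof (Cabs_triang_inv t (- h)%C) as K. rewrite Cabs_opp in K.
  replace (t - - h)%C with (t + h)%C in K by ring. fold r in K. lra. }
 assert (Hn : (t + h)%C <> C0) by (intros E; rewrite E, Cabs_0 in Hth; lra).
 replace (Cinv (t + h) - Cinv t - - (Cinv t * Cinv t) * h)%C with (h * h / (t * t * (t + h)))%C by (field; auto).
 rewrite Cabs_div by (repeat apply Cmul_neq0; auto). rewrite !Cabs_mul. fold r.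
 apply Rmult_le_reg_r with (r * r * Cabs (t + h)%C); [repeat apply Rmult_lt_0_compat; lra|].
 unfold Rdiv. rewrite Rmult_assoc, Rinv_l, Rmult_1_r by (apply Rgt_not_eq; repeat apply Rmult_lt_0_compat; lra).
 replace (eps * Cabs h * (r * r * Cabs (t + h)%C)) with (Cabs h * (eps * (r * r) * Cabs (t + h)%C)) by ring.
 apply Rmult_le_compat_l; auto.
 assert (eps * (r * r) * (r / 2) <= eps * (r * r) * Cabs (t + h)%C) by (apply Rmult_le_compat_l; nra). lra.
Qed.

Lemma cderiv_scal_id c t : cderiv (fun z => (c * z)%C) t c.
Proof. apply cderiv_lin. intros; ring. Qed.

Definition cdiff (f : Cx -> Cx) (t : Cx) : Prop := exists d, cderiv f t d.
Lemma cdiff_mul f g t : cdiff f t -> cdiff g t -> cdiff (fun z => (f z * g z)%C) t.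
Proof. intros [c Hc] [d Hd]. eexists. apply cderiv_mul; eauto. Qed.
Lemma cdiff_comp f g t : cdiff f (g t) -> cdiff g t -> cdiff (fun z => f (g z)) t.
Proof. intros [c Hc] [d Hd]. eexists. apply cderiv_comp; eauto. Qed.
Lemma cdiff_e_mul (c : Cx) g t : cdiff g t -> cdiff (fun z => e (c * g z)%C) t.
Proof. apply (cdiff_comp (fun w => e (c * w)%C) g). apply cderiv_e. Qed.

Lemma cdiff_near f g t : cdiff g t -> (exists r, 0 < r /\ forall h, Cabs h < r -> f (t + h)%C = g (t + h)%C) -> cdiff f t.
Proof.
 intros [c Hc] [r [Hr E]]. exists c. intros eps He. destruct (Hc eps He) as [del [Hdel K]].
 exists (Rmin del r). split; [now apply Rmin_glb_lt|]. intros h Hh.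
 destruct (Rmin_Rgt_l _ _ _ Hh) as [h1 h2].
 assert (E0 : f t = g t).
 { specialize (E C0). rewrite Cabs_0 in E. specialize (E Hr). replace (t + C0)%C with t in E by ring. exact E. }
 rewrite (E h h2), E0. apply K; auto.
Qed.

Lemma Lth_holo_z tau z : inH tau -> cdiff (Lth tau) z.
Proof.
 intros Ht. apply (expseries_deriv1 (fun m => e (tau * (ZtoC m * ZtoC m))%C)
  (fun m => (mkC 0 (2 * PI) * ZtoC m)%C) z 1); [lra|].
 intros h _. eapply ASum_ext; [|exact (conj (Lterm_AbsSum tau (z + h)%C Ht) (Lth_spec tau (z + h)%C Ht))].
 intros m. unfold Lterm. rewrite e_add. f_equal. rewrite e_as_Cexp. f_equal. ring.
Qed.

Lemma Lth_holo_tau tau z : inH tau -> cdiff (fun tau => Lth tau z) tau.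
Proof.
 intros Ht. unfold inH in Ht. apply (expseries_deriv1 (fun m => e (ZtoC m * z)%C)
  (fun m => (mkC 0 (2 * PI) * (ZtoC m * ZtoC m))%C) tau (Im tau / 2)); [lra|].
 intros h Hh. assert (Hi : inH (tau + h)%C) by (apply inH_near; [auto|lra]).
 eapply ASum_ext; [|exact (conj (Lterm_AbsSum _ z Hi) (Lth_spec _ z Hi))].
 intros m. unfold Lterm. rewrite e_add, Cmul_comm. f_equal. rewrite e_as_Cexp. f_equal. ring.
Qed.

Lemma Rth_holo tau : inH tau -> holo1 (Rth tau).
Proof.
 intros Ht z Hz. assert (Hn := inH_neq0 _ Ht). change (cdiff (Rth tau) z).
 replace (Rth tau) with (fun z => (e (inv4 tau * (z * z))%C * Lth (inv4 tau) (Cinv (ZtoC 2 * tau) * z))%C).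
 - apply cdiff_mul.
  + apply (cdiff_e_mul (inv4 tau) (fun z => (z * z)%C)). apply cdiff_mul; eexists; apply cderiv_id.
  + apply (cdiff_comp (Lth (inv4 tau)) (fun z => (Cinv (ZtoC 2 * tau) * z)%C)).
   * apply Lth_holo_z, inv4_inH; auto.
   * eexists. apply cderiv_scal_id.
 - apply functional_extensionality. intros w. rewrite Rth_Lth by auto. do 2 f_equal. unfold Cdiv. ring.
Qed.

Lemma inv4_cdiff tau : tau <> C0 -> cdiff inv4 tau.
Proof.
 intros H. replace inv4 with (fun t => (ZtoC (-1) * Cinv (ZtoC 4 * t))%C) by (apply functional_extensionality; reflexivity).
 apply cdiff_mul; [eexists; apply cderiv_const|].
 apply (cdiff_comp Cinv (fun t => (ZtoC 4 * t)%C)); [|eexists; apply cderiv_scal_id].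
 eexists. apply cderiv_Cinv. apply Cmul_neq0; auto. apply ZtoC_neq0; lia.
Qed.

(* For fixed [z] write [Rth] through the exponential series [sum_m e(u (z-m)^2)] in [u = -1/(4 tau)]. *)
Lemma Rth_holo_tau tau z : inH tau -> cdiff (fun tau => Rth tau z) tau.
Proof.
 intros Ht. assert (Hn := inH_neq0 _ Ht).
 set (S := fun u => Sumv (fun m => e (u * ((z - ZtoC m) * (z - ZtoC m)))%C)).
 assert (Et : forall t m, t <> C0 -> Rterm t z m = e (inv4 t * ((z - ZtoC m) * (z - ZtoC m)))%C).
 { intros t m Hnz. unfold Rterm, inv4. f_equal. field. auto. }
 assert (AS : forall u, inH u -> AbsSum (fun m => e (u * ((z - ZtoC m) * (z - ZtoC m)))%C)).
 { intros u Hu. eapply AbsSum_ext; [|apply (Rterm_AbsSum (inv4 u) z), inv4_inH; auto].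
  intros m. rewrite Et; [|apply inH_neq0, inv4_inH; auto]. f_equal. unfold inv4. field.
  apply inH_neq0; auto. }
 assert (HS : forall u, inH u -> cdiff S u).
 { intros u Hu. unfold inH in Hu.
  apply (expseries_deriv1 (fun m : Z => C1) (fun m => (mkC 0 (2 * PI) * ((z - ZtoC m) * (z - ZtoC m)))%C) u (Im u / 2)); [lra|].
  intros h Hh. assert (Hi : inH (u + h)%C) by (apply inH_near; [auto|lra]).
  eapply ASum_ext; [|exact (conj (AS _ Hi) (Sumv_spec _ (AS _ Hi)))].
  intros m. cbv beta. rewrite e_as_Cexp. transitivity (C1 * Cexp (mkC 0 (2 * PI) * ((u + h) * ((z - ZtoC m) * (z - ZtoC m)))))%C; [ring|].
  do 2 f_equal. ring. }
 apply cdiff_near with (fun t => S (inv4 t)).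
 - apply (cdiff_comp S inv4); [apply HS, inv4_inH; auto|apply inv4_cdiff; auto].
 - exists (Im tau). split; [exact Ht|]. intros h Hh. unfold Rth, S. f_equal.
  apply functional_extensionality. intros m. apply Et.
  now apply inH_neq0, inH_near.
Qed.

(** Both sides have period 1 in z and the same multiplier under z -> z + 2 tau. For the Fourier
    coefficients of [Rth] the multiplier is the recursion a(n+1) = e((2n+1) tau) a(n), whose only
    solutions are a(n) = a(0) e(n^2 tau), the coefficients of [Lth] up to a factor. *)
Lemma Rth_eq_Lth_H tau : inH tau -> exists K, forall z, inH z -> Rth tau z = (K * Lth tau z)%C.
Proof.
 intros Ht. destruct (fourier_H (Rth tau) (Rth_holo tau Ht)) as [a [Ha _]].
 { intros z _. apply Rth_periodic; auto. }
 assert (Hrec : forall n, (a n * e (ZtoC (2 * n) * tau)%C)%C = (e (- tau)%C * a (n + 1)%Z)%C).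
 { apply (Zseries_uniq _ _ (fun z => Rth tau (z + ZtoC 2 * tau)%C)).
  - intros z Hz. assert (Hz' : inH (z + ZtoC 2 * tau)%C) by (unfold inH in *; simpl; lra).
   assert (E : forall n, (a n * e (ZtoC n * (z + ZtoC 2 * tau))%C)%C = (a n * e (ZtoC (2 * n) * tau)%C * e (ZtoC n * z)%C)%C).
   { intros n. rewrite ZtoC_mul. replace (ZtoC n * (z + ZtoC 2 * tau))%C with (ZtoC 2 * ZtoC n * tau + ZtoC n * z)%C by ring.
    rewrite e_add. ring. }
   exact (ASum_ext _ _ _ E (Ha _ Hz')).
  - intros z Hz. assert (A : ASum (fun n => (a (n + 1)%Z * e (ZtoC (n + 1) * z)%C)%C) (Rth tau z)).
   { apply (ASum_inj (fun n => (n + 1)%Z) (fun n => (a n * e (ZtoC n * z)%C)%C)); auto; [intros; lia|]. intros i Hi. destruct (Hi (i - 1)%Z). lia. }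
   rewrite Rth_quasi by auto.
   assert (E : forall n, (e (- tau - z)%C * (a (n + 1)%Z * e (ZtoC (n + 1) * z)%C))%C = (e (- tau)%C * a (n + 1)%Z * e (ZtoC n * z)%C)%C).
   { intros n. rewrite ZtoC_add. replace ((ZtoC n + ZtoC 1) * z)%C with (ZtoC n * z + z)%C by ring.
    rewrite e_sub, e_add. field. apply e_neq0. }
   exact (ASum_ext _ _ _ E (ASum_scal _ _ _ A)). }
 assert (Hn : forall n, a n = (a 0%Z * e (tau * (ZtoC n * ZtoC n))%C)%C).
 { assert (Hs : forall n, a (n + 1)%Z = (e tau * e (ZtoC (2 * n) * tau)%C * a n)%C).
  { intros n. specialize (Hrec n). rewrite e_opp in Hrec. pose proof (e_neq0 tau).
   replace (a (n + 1)%Z) with (e tau * (Cinv (e tau) * a (n + 1)%Z))%C by (field; auto).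
   rewrite <- Hrec. ring. }
  assert (Hb : forall n, a n = (a 0%Z * e (tau * (ZtoC n * ZtoC n))%C)%C <->
    a (n + 1)%Z = (a 0%Z * e (tau * (ZtoC (n + 1) * ZtoC (n + 1)))%C)%C).
  { intros n. rewrite Hs, ZtoC_add.
   replace (tau * ((ZtoC n + ZtoC 1) * (ZtoC n + ZtoC 1)))%C with (tau + (ZtoC (2 * n) * tau + tau * (ZtoC n * ZtoC n)))%C
    by (rewrite ZtoC_mul; ring).
   rewrite !e_add. pose proof (e_neq0 tau). pose proof (e_neq0 (ZtoC (2 * n) * tau)%C). split; intros E.
   - rewrite E. ring.
   - replace (a n) with (e tau * e (ZtoC (2 * n) * tau)%C * a n / (e tau * e (ZtoC (2 * n) * tau)%C))%C by (field; auto).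
    rewrite E. field; auto. }
  assert (H0 : a 0%Z = (a 0%Z * e (tau * (ZtoC 0 * ZtoC 0))%C)%C).
  { replace (tau * (ZtoC 0 * ZtoC 0))%C with C0 by ring. rewrite e_0. ring. }
  intros n. destruct (Z_le_gt_dec 0 n).
  - revert n l. apply natlike_ind; auto. intros n _ IH. unfold Z.succ. apply (proj1 (Hb n)); auto.
  - replace n with (- (Z.of_nat (Z.to_nat (- n))))%Z by lia. induction (Z.to_nat (- n)); auto.
   apply (proj2 (Hb _)). replace (- Z.of_nat (S n0) + 1)%Z with (- Z.of_nat n0)%Z by lia. auto. }
 exists (a 0%Z). intros z Hz. destruct (Ha z Hz) as [_ A2].
 apply (HasSum_unique _ _ _ A2).
 eapply HasSum_ext; [|apply (HasSum_scal (a 0%Z) _ _ (Lth_spec tau z Ht))].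
 intros n. cbv beta. rewrite (Hn n). unfold Lterm. rewrite e_add. ring.
Qed.

Lemma Rth_eq_Lth_ex tau : exists K, inH tau -> forall z, Rth tau z = (K * Lth tau z)%C.
Proof.
 destruct (classic (inH tau)) as [Ht|]; [|exists C0; tauto].
 destruct (Rth_eq_Lth_H tau Ht) as [K HK]. exists K. intros _.
 (* The Fourier expansion covers Im z > 0 only; any z is moved there by finitely many translations
    by 2 tau, under which both sides have the same nonzero multiplier. *)
 assert (P : forall k z, 0 < Im z + INR k * (2 * Im tau) -> Rth tau z = (K * Lth tau z)%C).
 { induction k; intros z Hz.
  - apply HK. unfold inH. simpl in Hz. lra.
  - rewrite S_INR in Hz.
   assert (E : Rth tau (z + ZtoC 2 * tau)%C = (K * Lth tau (z + ZtoC 2 * tau))%C) by (apply IHk; simpl; lra).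
   rewrite Rth_quasi, Lth_quasi in E by auto. pose proof (e_neq0 (- tau - z)%C).
   replace (Rth tau z) with (e (- tau - z)%C * Rth tau z / e (- tau - z)%C)%C by (field; auto).
   rewrite E. field; auto. }
 intros z. unfold inH in Ht.
 destruct (INR_unbounded (- Im z / (2 * Im tau))) as [k Hk]. apply (P k).
 apply Rlt_div_l in Hk; lra.
Qed.

(** Classically the square root of -2 i tau. Being a quotient of two series, it is holomorphic
    without any choice of branch. *)
Definition Kth (tau : Cx) : Cx := proj1_sig (constructive_indefinite_description _ (Rth_eq_Lth_ex tau)).
Lemma Kth_spec tau z : inH tau -> Rth tau z = (Kth tau * Lth tau z)%C.
Proof. intros H. unfold Kth. apply (proj2_sig (constructive_indefinite_description _ (Rth_eq_Lth_ex tau)) H). Qed.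

Lemma Kth_neq0 tau : inH tau -> Kth tau <> C0.
Proof.
 intros Ht E. destruct (Lth_nonzero (inv4 tau) (inv4_inH _ Ht)) as [z [_ Hz]]. apply Hz.
 assert (Hn := inH_neq0 _ Ht).
 pose proof (Kth_spec tau (ZtoC 2 * tau * z)%C Ht) as K. rewrite E, Rth_Lth in K by auto.
 replace (ZtoC 2 * tau * z / (ZtoC 2 * tau))%C with z in K by (field; auto).
 destruct (Cmul_integral (e (inv4 tau * (ZtoC 2 * tau * z * (ZtoC 2 * tau * z)))%C) (Lth (inv4 tau) z)) as [E'|E']; auto.
 - rewrite K. ring.
 - now apply e_neq0 in E'.
Qed.

Lemma HasSum_mod_split (f : Z -> Cx) (N : nat) s : (0 < N)%nat -> HasSum f s ->
 HasSum (fun m => Csum (map (fun j => f (Z.of_nat j + Z.of_nat N * m)%Z) (seq 0 N))) s.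
Proof.
 intros HN H.
 set (f' := fun x : Z * nat => if lt_dec (snd x) N then f (Z.of_nat (snd x) + Z.of_nat N * fst x)%Z else C0).
 apply HasSum_fubini with f'.
 - apply (HasSum_inj_conv (fun m : Z => ((m / Z.of_nat N)%Z, Z.to_nat (m mod Z.of_nat N)))).
  + intros x y E. inversion E.
   pose proof (Z.mod_pos_bound x (Z.of_nat N) ltac:(lia)). pose proof (Z.mod_pos_bound y (Z.of_nat N) ltac:(lia)).
   rewrite (Z.div_mod x (Z.of_nat N)), (Z.div_mod y (Z.of_nat N)) by lia. lia.
  + intros [m j] Hx. unfold f'; simpl. destruct (lt_dec j N); auto.
   exfalso. apply (Hx (Z.of_nat j + Z.of_nat N * m)%Z). f_equal.
   * rewrite (Z.mul_comm (Z.of_nat N)), Z.div_add, Z.div_small by lia. lia.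
   * rewrite (Z.mul_comm (Z.of_nat N)), Z.mod_add, Z.mod_small by lia. lia.
  + eapply HasSum_ext; [|apply H]. intros m. unfold f'; simpl.
   pose proof (Z.mod_pos_bound m (Z.of_nat N) ltac:(lia)).
   destruct (lt_dec _ _) as [_|h]; [|exfalso; apply h; lia].
   f_equal. rewrite Z2Nat.id by lia. pose proof (Z.div_mod m (Z.of_nat N) ltac:(lia)). lia.
 - intros m.
  assert (K : HasSum (fun j => f' (m, j)) (Csum (map (fun j => f' (m, j)) (seq 0 N)))).
  { apply HasSum_finite; [apply seq_NoDup|]. intros j Hj. unfold f'; simpl.
   destruct (lt_dec j N); auto. exfalso. apply Hj, in_seq. lia. }
  replace (Csum (map (fun j => f (Z.of_nat j + Z.of_nat N * m)%Z) (seq 0 N))) with (Csum (map (fun j => f' (m, j)) (seq 0 N))); auto.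
  f_equal. apply map_ext_in. intros j Hj. apply in_seq in Hj. unfold f'; simpl.
  destruct (lt_dec j N); auto. lia.
Qed.

(** Sum the one-variable inversion over the shifts z - j/n with j modulo n. On the right the n
    series interleave to the series at n^2 tau; on the left the characters keep only the multiples
    of n, again the series at n^2 tau, with a factor n. *)
Lemma Kth_scale (N : nat) tau : (0 < N)%nat -> inH tau ->
 Kth (ZtoC (Z.of_nat N * Z.of_nat N) * tau)%C = (ZtoC (Z.of_nat N) * Kth tau)%C.
Proof.
 intros HN Ht. set (n := Z.of_nat N). assert (Hn : (0 < n)%Z) by (unfold n; lia).
 set (tau' := (ZtoC (n * n) * tau)%C).
 assert (Ht' : inH tau').
 { unfold inH, tau', ZtoC in *. simpl. rewrite mult_IZR. apply IZR_lt in Hn. rewrite Rmult_0_l, Rplus_0_r. repeat apply Rmult_lt_0_compat; auto. }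
 assert (Hnz := inH_neq0 _ Ht). assert (Hnz' := ZtoC_neq0 n ltac:(lia)).
 destruct (Lth_nonzero tau' Ht') as [z' [_ Hz']].
 set (z := (z' / ZtoC n)%C). assert (Ez : z' = (ZtoC n * z)%C) by (unfold z; field; auto).
 set (w := fun j : nat => (z - ZtoC (Z.of_nat j) / ZtoC n)%C).
 assert (E1 : Rth tau' z' = Csum (map (fun j => Rth tau (w j)) (seq 0 N))).
 { apply (HasSum_unique _ _ _ (HasSum_mod_split (Rterm tau' z') N _ HN (Rth_spec tau' z' Ht'))).
  eapply HasSum_ext; [|apply (HasSum_Csum (fun j => Rterm tau (w j)) (fun j => Rth tau (w j)) (seq 0 N)); intros; apply Rth_spec; auto].
  intros m. cbv beta. f_equal. apply map_ext. intros j. unfold Rterm, w. fold n.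
  rewrite ZtoC_add, ZtoC_mul, Ez. unfold tau'. rewrite ZtoC_mul. f_equal. field. auto. }
 assert (W : forall i, Csum (map (fun j => Lterm tau (w j) i) (seq 0 N)) =
  (Lterm tau z i * if Z.eq_dec (- i mod n) 0 then ZtoC n else C0)%C).
 { intros i. unfold n. rewrite <- (Zrange_avg (- i) N), <- Csum_map_scal by auto. f_equal. apply map_ext.
  intros j. unfold Lterm, w. rewrite <- e_add. f_equal.
  unfold Rdiv. rewrite !RtoC_mul, RtoC_inv by (apply not_0_INR; lia).
  rewrite !RtoC_INR_Z. fold n. change (RtoC (IZR (- i))) with (ZtoC (- i)). rewrite ZtoC_opp. field. auto. }
 assert (E2 : Csum (map (fun j => Lth tau (w j)) (seq 0 N)) = (ZtoC n * Lth tau' z')%C).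
 { pose proof (HasSum_Csum (fun j => Lterm tau (w j)) (fun j => Lth tau (w j)) (seq 0 N)
   ltac:(intros; apply Lth_spec; auto)) as K.
  apply (HasSum_unique _ _ _ K).
  apply (HasSum_inj_conv (fun m : Z => (n * m)%Z)).
  - intros x y E. nia.
  - intros i Hi. rewrite W. destruct (Z.eq_dec (- i mod n) 0) as [E|_]; [|ring].
   exfalso. apply Z.mod_divide in E; [|lia]. destruct E as [q Hq]. apply (Hi (- q)%Z). lia.
  - eapply HasSum_ext; [|apply (HasSum_scal (ZtoC n) _ _ (Lth_spec tau' z' Ht'))].
   intros m. cbv beta. rewrite W. destruct (Z.eq_dec (- (n * m) mod n) 0) as [_|E].
   + unfold Lterm, tau'. rewrite Ez, !ZtoC_mul.
    replace (tau * (ZtoC n * ZtoC m * (ZtoC n * ZtoC m)) + ZtoC n * ZtoC m * z)%C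
     with (ZtoC n * ZtoC n * tau * (ZtoC m * ZtoC m) + ZtoC m * (ZtoC n * z))%C by ring. ring.
   + exfalso. apply E. replace (- (n * m))%Z with (- m * n)%Z by ring. apply Z.mod_mul. lia. }
 rewrite (Kth_spec tau' z' Ht') in E1.
 rewrite (map_ext _ (fun j => (Kth tau * Lth tau (w j))%C)) in E1 by (intros; apply Kth_spec; auto).
 rewrite Csum_map_scal, E2 in E1.
 replace (Kth tau') with (Kth tau' * Lth tau' z' / Lth tau' z')%C by (field; auto).
 rewrite E1. field; auto.
Qed.

Lemma Kth_cdiff tau : inH tau -> cdiff Kth tau.
Proof.
 intros Ht. destruct (Lth_nonzero tau Ht) as [z [_ Hz]].
 pose proof (Lth_holo_tau tau z Ht) as HL.
 assert (HC : ccts (fun t => Lth t z) tau) by (destruct HL as [d Hd]; eapply cderiv_ccts; eauto).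
 apply cdiff_near with (fun t => (Rth t z * Cinv (Lth t z))%C).
 - apply cdiff_mul; [apply Rth_holo_tau; auto|].
  apply (cdiff_comp Cinv (fun t => Lth t z)); auto. eexists. apply cderiv_Cinv; auto.
 - pose proof (Cabs_gt0 _ Hz) as P.
  destruct (HC (Cabs (Lth tau z) / 2)) as [del [Hdel K]]; [lra|].
  exists (Rmin del (Im tau)). split; [apply Rmin_glb_lt; auto|]. intros h Hh.
  destruct (Rmin_Rgt_l _ _ _ Hh) as [h1 h2].
  assert (Hi := inH_near _ _ Ht h2).
  assert (Hnz : Lth (tau + h)%C z <> C0).
  { intros E. specialize (K h h1). simpl in K. rewrite E in K. rewrite Cabs_sub_sym in K.
   replace (Lth tau z - C0)%C with (Lth tau z) in K by ring. lra. }
  rewrite (Kth_spec _ z Hi). field. auto.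
Qed.

(** The scaling law from tau/k^2, with the factors k and k + 1, gives Kth((1 + 1/k)^2 tau) = (1 +
    1/k) Kth(tau). These points tend to tau, so differentiability turns the relation into 2 tau Kth'
    = Kth. *)
Lemma Kth_deriv tau : inH tau -> cderiv Kth tau (Kth tau / (ZtoC 2 * tau))%C.
Proof.
 intros Ht. destruct (Kth_cdiff tau Ht) as [d Hd]. assert (Hnz := inH_neq0 _ Ht).
 enough (E : (ZtoC 2 * tau * d)%C = Kth tau).
 { replace (Kth tau / (ZtoC 2 * tau))%C with d; auto. rewrite <- E. field. auto. }
 apply Cx_eq_eps. intros eps He.
 pose proof (Cabs_gt0 _ Hnz) as P. pose proof (Cabs_pos d) as Pd.
 destruct (Hd (eps / (6 * Cabs tau))) as [del [Hdel K]]; [apply Rdiv_lt_0_compat; lra|].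
 set (B := 3 * Cabs tau / del + 2 * Cabs tau * Cabs d / eps + 1).
 destruct (INR_unbounded B) as [k Hk].
 assert (HB : 1 <= B).
 { unfold B. assert (0 <= 3 * Cabs tau / del) by (apply Rdiv_le_0_compat; lra).
  assert (0 <= 2 * Cabs tau * Cabs d / eps) by (apply Rdiv_le_0_compat; [repeat apply Rmult_le_pos; lra|lra]). lra. }
 assert (Hk0 : 1 < INR k) by lra. assert (Hkn : (0 < k)%nat) by (apply INR_lt; simpl; lra).
 set (x := / INR k). assert (Hx : 0 < x) by (apply Rinv_0_lt_compat; lra).
 assert (Hx1 : x < 1) by (unfold x; rewrite <- Rinv_1; apply Rinv_lt_contravar; lra).
 set (h := (tau * RtoC (2 * x + x * x))%C).
 assert (Hh : Cabs h <= 3 * Cabs tau * x).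
 { unfold h. rewrite Cabs_mul, Cabs_RtoC. assert (0 <= x * x) by (apply Rle_0_sqr). assert (x * x <= x * 1) by (apply Rmult_le_compat_l; lra). rewrite Rabs_right by lra. replace (3 * Cabs tau * x) with (Cabs tau * (3 * x)) by ring. apply Rmult_le_compat_l; lra. }
 assert (Hkx : INR k * x = 1) by (unfold x; rewrite Rinv_r; lra).
 assert (Hh1 : Cabs h < del).
 { eapply Rle_lt_trans; [apply Hh|]. apply Rmult_lt_reg_l with (INR k); [lra|].
  replace (INR k * (3 * Cabs tau * x)) with (3 * Cabs tau) by (rewrite <- (Rmult_1_r (3 * Cabs tau)) at 1; rewrite <- Hkx; ring).
  assert (3 * Cabs tau / del < INR k) by (unfold B in Hk; assert (0 <= 2 * Cabs tau * Cabs d / eps) by (apply Rdiv_le_0_compat; [repeat apply Rmult_le_pos; lra|lra]); lra).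
  apply Rlt_div_l in H; auto. }
 assert (Ekt : Kth (tau + h)%C = (Kth tau + RtoC x * Kth tau)%C).
 { set (sg := (tau / ZtoC (Z.of_nat k * Z.of_nat k))%C).
  assert (Hkz : ZtoC (Z.of_nat k) <> C0) by (apply ZtoC_neq0; lia).
  assert (Hsg : inH sg).
  { unfold sg, ZtoC. unfold Cdiv. rewrite <- RtoC_inv by (apply not_0_IZR; lia).
   unfold inH in *; simpl. assert (0 < / IZR (Z.of_nat k * Z.of_nat k)) by (apply Rinv_0_lt_compat, IZR_lt; lia). nra. }
  assert (Ex : RtoC x = Cinv (ZtoC (Z.of_nat k))) by (unfold x; rewrite RtoC_inv, RtoC_INR_Z by lra; reflexivity).
  pose proof (Kth_scale k sg Hkn Hsg) as K1. pose proof (Kth_scale (S k) sg ltac:(lia) Hsg) as K2.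
  replace (ZtoC (Z.of_nat k * Z.of_nat k) * sg)%C with tau in K1
   by (unfold sg; rewrite ZtoC_mul; field; auto).
  replace (ZtoC (Z.of_nat (S k) * Z.of_nat (S k)) * sg)%C with (tau + h)%C in K2.
  - rewrite K1, K2, Ex. rewrite Nat2Z.inj_succ. unfold Z.succ. rewrite ZtoC_add. field. auto.
  - unfold sg, h. rewrite RtoC_add, !RtoC_mul, Ex. rewrite Nat2Z.inj_succ. unfold Z.succ.
   rewrite !ZtoC_mul, !ZtoC_add. field. auto. }
 specialize (K h Hh1). rewrite Ekt in K.
 replace (Kth tau + RtoC x * Kth tau - Kth tau - d * h)%C
  with (RtoC x * - ((ZtoC 2 * tau * d - Kth tau) + RtoC x * (tau * d)))%C in K
  by (unfold h; rewrite RtoC_add, !RtoC_mul; ring).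
 rewrite Cabs_mul, Cabs_RtoC, Cabs_opp, Rabs_right in K by lra.
 assert (K' : Cabs ((ZtoC 2 * tau * d - Kth tau) + RtoC x * (tau * d))%C <= eps / 2).
 { apply Rmult_le_reg_l with x; auto. eapply Rle_trans; [apply K|].
  apply Rle_trans with (eps / (6 * Cabs tau) * (3 * Cabs tau * x)).
  - apply Rmult_le_compat_l; auto. left. apply Rdiv_lt_0_compat; lra.
  - right. field. lra. }
 replace (ZtoC 2 * tau * d - Kth tau)%C with ((ZtoC 2 * tau * d - Kth tau + RtoC x * (tau * d)) - RtoC x * (tau * d))%C by ring.
 eapply Rle_trans; [apply Cabs_sub_le|].
 rewrite (Cabs_mul (RtoC x)), Cabs_RtoC, Rabs_right, (Cabs_mul tau) by lra.
 assert (x * (Cabs tau * Cabs d) <= eps / 2); [|lra].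
 apply Rmult_le_reg_l with (INR k); [lra|]. rewrite <- Rmult_assoc, Hkx, Rmult_1_l.
 assert (2 * Cabs tau * Cabs d / eps < INR k) by (unfold B in Hk; assert (0 <= 3 * Cabs tau / del) by (apply Rdiv_le_0_compat; lra); lra).
 apply Rlt_div_l in H; lra.
Qed.

Lemma cderiv0_const (Q : Cx -> Cx) : (forall t, inH t -> cderiv Q t C0) ->
 forall t0 t1, inH t0 -> inH t1 -> Q t0 = Q t1.
Proof.
 intros H t0 t1 H0 H1.
 set (p := fun x => (t0 + RtoC x * (t1 - t0))%C).
 assert (Hp : forall x, 0 <= x <= 1 -> inH (p x)).
 { intros x Hx. unfold inH, p in *. simpl. nra. }
 pose proof (Cabs_pos (t1 - t0)%C) as PL.
 assert (D : forall x, 0 <= x <= 1 -> forall eps, 0 < eps -> exists del, 0 < del /\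
  forall h, Rabs h < del -> Cabs (Q (p (x + h)%R) - Q (p x))%C <= eps * Rabs h).
 { intros x Hx eps He. set (M := Cabs (t1 - t0)%C + 1) in *.
  destruct (H (p x) (Hp x Hx) (eps / M)) as [del [Hdel K]]; [apply Rdiv_lt_0_compat; unfold M; lra|].
  exists (del / M). split; [apply Rdiv_lt_0_compat; unfold M; lra|]. intros h Hh.
  assert (Ep : p (x + h) = (p x + RtoC h * (t1 - t0))%C) by (unfold p; rewrite RtoC_add; ring).
  assert (Hc : Cabs (RtoC h * (t1 - t0))%C = Rabs h * Cabs (t1 - t0)%C) by (rewrite Cabs_mul, Cabs_RtoC; reflexivity).
  pose proof (Rabs_pos h).
  assert (Rabs h * M < del).
  { apply Rlt_div_r in Hh; [auto|unfold M; lra]. }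
  specialize (K (RtoC h * (t1 - t0))%C). rewrite Hc in K. specialize (K ltac:(unfold M in *; nra)).
  rewrite Ep. replace (Q (p x + RtoC h * (t1 - t0)) - Q (p x))%C
   with (Q (p x + RtoC h * (t1 - t0)) - Q (p x) - C0 * (RtoC h * (t1 - t0)))%C by ring.
  eapply Rle_trans; [apply K|].
  apply Rle_trans with (eps / M * (Rabs h * M)).
  - apply Rmult_le_compat_l; [left; apply Rdiv_lt_0_compat; unfold M; lra|]. unfold M. nra.
  - right. field. unfold M. lra. }
 assert (Z : forall u : R -> R, (forall x h, Rabs (u (x + h) - u x) <= Cabs (Q (p (x + h)%R) - Q (p x))%C) -> u 0 = u 1).
 { intros u Hu.
  assert (Hd : forall x, 0 <= x <= 1 -> derivable_pt_lim u x 0).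
  { intros x Hx eps He. destruct (D x Hx (eps / 2)) as [del [Hdel K]]; [lra|].
   exists (mkposreal del Hdel). intros h Hh Hhd. simpl in Hhd. specialize (K h Hhd).
   rewrite Rminus_0_r. unfold Rdiv. rewrite Rabs_mult, Rabs_inv. specialize (Hu x h).
   pose proof (Rabs_pos_lt h Hh).
   apply Rmult_lt_reg_r with (Rabs h); auto. rewrite Rmult_assoc, Rinv_l, Rmult_1_r by lra. nra. }
  destruct (MVT_gen u 0 1 (fun _ => 0)) as [c [_ Hc]].
  - intros x Hx. rewrite Rmin_left, Rmax_right in Hx by lra. apply is_derive_Reals, Hd. lra.
  - intros x Hx. rewrite Rmin_left, Rmax_right in Hx by lra. apply derivable_continuous_pt. exists 0. apply Hd. lra.
  - lra. }
 assert (E0 : p 0 = t0) by (unfold p; change (RtoC 0) with C0; ring).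
 assert (E1 : p 1 = t1) by (unfold p; change (RtoC 1) with C1; ring).
 rewrite <- E0, <- E1. apply Cx_eq.
 - apply (Z (fun x => Re (Q (p x)))). intros x h. apply (Re_le_Cabs (Q (p (x + h)%R) - Q (p x))%C).
 - apply (Z (fun x => Im (Q (p x)))). intros x h. apply (Im_le_Cabs (Q (p (x + h)%R) - Q (p x))%C).
Qed.

(** The product divided by tau has derivative zero, since each factor contributes 1/(2 tau) to the
    logarithmic derivative. Two square roots thus combine into a linear function, which is all that
    rank 2 needs. *)
Lemma Kth_prod (c : R) : 0 < c -> exists mu, mu <> C0 /\
 forall tau, inH tau -> (Kth tau * Kth (RtoC c * tau))%C = (mu * tau)%C.
Proof.
 intros Hc.
 assert (Hs : forall t, inH t -> inH (RtoC c * t)%C) by (intros t Ht; unfold inH in *; simpl; nra).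
 set (Q := fun t => (Kth t * Kth (RtoC c * t) * Cinv t)%C).
 assert (HQ : forall t, inH t -> cderiv Q t C0).
 { intros t Ht. assert (Hn := inH_neq0 _ Ht). assert (Hcn := RtoC_neq0 c ltac:(lra)).
  pose proof (cderiv_comp Kth (fun t => (RtoC c * t)%C) t _ _ (Kth_deriv _ (Hs t Ht)) (cderiv_scal_id (RtoC c) t)) as D2.
  pose proof (cderiv_mul _ _ _ _ _ (cderiv_mul _ _ _ _ _ (Kth_deriv t Ht) D2) (cderiv_Cinv t Hn)) as D.
  match type of D with cderiv _ _ ?x => replace C0 with x; auto end. field. auto. }
 assert (HCi : inH Ci) by (unfold inH; simpl; lra).
 exists (Q Ci). split.
 - unfold Q. repeat apply Cmul_neq0; try apply Kth_neq0; auto. apply Cinv_neq0, inH_neq0; auto.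
 - intros t Ht. rewrite <- (cderiv0_const Q HQ t Ci Ht HCi). unfold Q. assert (Hn := inH_neq0 _ Ht). field. auto.
Qed.

(** * The action of integral matrices and the theta series of [O] *)

(* Action of integral matrices of positive determinant [m] on the variable [Z = (tau, z1; z2, tau')]:
 the transformation law of a Jacobi form of index 1, with [e(tau')] absorbed into the function,
 becomes plain invariance up to the factor [(c tau + d)^k]. *)
Definition Zj (g : M2 Z) (Z : M2 Cx) : Cx := (ZtoC (m21 g) * m11 Z + ZtoC (m22 g))%C.
Definition Zdet (g : M2 Z) : Z := (m11 g * m22 g - m12 g * m21 g)%Z.
Definition Zact (g : M2 Z) (Z : M2 Cx) : M2 Cx :=
 mkM2 ((ZtoC (m11 g) * m11 Z + ZtoC (m12 g)) / Zj g Z)%C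
   (ZtoC (Zdet g) * m12 Z / Zj g Z)%C
   (ZtoC (Zdet g) * m21 Z / Zj g Z)%C
   (ZtoC (Zdet g) * m22 Z - ZtoC (Zdet g) * ZtoC (m21 g) * m12 Z * m21 Z / Zj g Z)%C.
Definition Zmul (g h : M2 Z) : M2 Z :=
 mkM2 (m11 g * m11 h + m12 g * m21 h)%Z (m11 g * m12 h + m12 g * m22 h)%Z
   (m21 g * m11 h + m22 g * m21 h)%Z (m21 g * m12 h + m22 g * m22 h)%Z.
Definition Zid : M2 Z := mkM2 1%Z 0%Z 0%Z 1%Z.
Definition ZS : M2 Z := mkM2 0%Z (-1)%Z 1%Z 0%Z.
Definition ZT (n : Z) : M2 Z := mkM2 1%Z n 0%Z 1%Z.
Definition Zadj (g : M2 Z) : M2 Z := mkM2 (m22 g) (- m12 g)%Z (- m21 g)%Z (m11 g).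

Lemma M2_eq {A} (M N : M2 A) : m11 M = m11 N -> m12 M = m12 N -> m21 M = m21 N -> m22 M = m22 N -> M = N.
Proof. destruct M, N; simpl; intros; subst; reflexivity. Qed.

Lemma Zdet_mul g h : Zdet (Zmul g h) = (Zdet g * Zdet h)%Z.
Proof. unfold Zdet, Zmul; simpl; ring. Qed.
Lemma Zmul_assoc g h k : Zmul g (Zmul h k) = Zmul (Zmul g h) k.
Proof. apply M2_eq; simpl; ring. Qed.
Lemma Zmul_1_l g : Zmul Zid g = g.
Proof. apply M2_eq; unfold Zmul, Zid; mcbn; ring. Qed.
Lemma Zmul_1_r g : Zmul g Zid = g.
Proof. apply M2_eq; unfold Zmul, Zid; mcbn; ring. Qed.
Lemma Zadj_l g : Zdet g = 1%Z -> Zmul (Zadj g) g = Zid.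
Proof. unfold Zdet. intros H. apply M2_eq; simpl; lia. Qed.
Lemma Zadj_r g : Zdet g = 1%Z -> Zmul g (Zadj g) = Zid.
Proof. unfold Zdet. intros H. apply M2_eq; simpl; lia. Qed.
Lemma Zdet_adj g : Zdet (Zadj g) = Zdet g.
Proof. unfold Zdet, Zadj; simpl; ring. Qed.

Lemma Zj_neq0 g Z : (0 < Zdet g)%Z -> inH (m11 Z) -> Zj g Z <> C0.
Proof.
 intros Hd Ht E. unfold inH in Ht. unfold Zj in E.
 assert (E2 := f_equal Im E). assert (E1 := f_equal Re E). simpl in E1, E2.
 assert (IZR (m21 g) * Im (m11 Z) = 0) by lra.
 apply Rmult_integral in H. destruct H as [H|H]; [|lra].
 rewrite H in E1. assert (H2 : IZR (m22 g) = 0) by lra.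
 apply eq_IZR in H. apply eq_IZR in H2. unfold Zdet in Hd. rewrite H, H2 in Hd. lia.
Qed.

Lemma Im_mobius (a b c d : Z) t : (ZtoC c * t + ZtoC d)%C <> C0 ->
 Im ((ZtoC a * t + ZtoC b) / (ZtoC c * t + ZtoC d))%C =
 IZR (a * d - b * c) * Im t / Cnorm2 (ZtoC c * t + ZtoC d)%C.
Proof.
 intros H. assert (Hn : Cnorm2 (ZtoC c * t + ZtoC d)%C <> 0) by (intros E; apply H, Cnorm2_eq0, E).
 rewrite minus_IZR, !mult_IZR.
 unfold Cdiv, Cinv. unfold Cnorm2 in *. simpl in *. field. intros E; apply Hn; etransitivity; [|exact E]; ring.
Qed.

Lemma Zact_inH g Z : (0 < Zdet g)%Z -> inH (m11 Z) -> inH (m11 (Zact g Z)).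
Proof.
 intros Hd Ht. pose proof (Zj_neq0 g Z Hd Ht) as Hj. unfold inH, Zact. cbn [m11].
 unfold Zj in *. rewrite Im_mobius by auto. apply Rdiv_lt_0_compat.
 - apply Rmult_lt_0_compat; [apply IZR_lt; exact Hd|exact Ht].
 - now apply Cnorm2_gt0.
Qed.

Lemma Zj_mul g h Z : (0 < Zdet h)%Z -> inH (m11 Z) -> Zj (Zmul g h) Z = (Zj g (Zact h Z) * Zj h Z)%C.
Proof.
 intros Hd Ht. pose proof (Zj_neq0 h Z Hd Ht) as Hj. unfold Zj in *. unfold Zact, Zmul, Zj; mcbn.
 rewrite !ZtoC_add, !ZtoC_mul. field. exact Hj.
Qed.

Lemma Zact_mul g h Z : (0 < Zdet g)%Z -> (0 < Zdet h)%Z -> inH (m11 Z) ->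
 Zact (Zmul g h) Z = Zact g (Zact h Z).
Proof.
 intros Hg Hd Ht. pose proof (Zj_neq0 h Z Hd Ht) as Hj.
 assert (Hgh : (0 < Zdet (Zmul g h))%Z) by (rewrite Zdet_mul; nia).
 pose proof (Zj_neq0 _ Z Hgh Ht) as Hjgh. pose proof (Zj_mul g h Z Hd Ht) as Em.
 pose proof (Zj_neq0 g _ Hg (Zact_inH h Z Hd Ht)) as Hjg.
 assert (A1 : forall X, (X / (Zj g (Zact h Z) * Zj h Z))%C = (X / Zj h Z / Zj g (Zact h Z))%C) by (intros; field; auto).
 apply M2_eq.
 - unfold Zact at 1 2. cbn [m11]. rewrite Em, A1. f_equal. unfold Zact, Zmul; mcbn.
  rewrite !ZtoC_add, !ZtoC_mul. unfold Zj in *. field. auto.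
 - unfold Zact at 1 2. cbn [m12]. rewrite Em, A1, Zdet_mul. f_equal. unfold Zact; cbn [m12]. rewrite ZtoC_mul. field; auto.
 - unfold Zact at 1 2. cbn [m21]. rewrite Em, A1, Zdet_mul. f_equal. unfold Zact; cbn [m21]. rewrite ZtoC_mul. field; auto.
 - assert (Hk : (ZtoC (m21 (Zmul g h)) * Zj h Z)%C = (ZtoC (m21 h) * (Zj g (Zact h Z) * Zj h Z) + ZtoC (m21 g) * ZtoC (Zdet h))%C).
  { rewrite <- Em. unfold Zj, Zmul, Zdet; mcbn.
   rewrite ?ZtoC_add, ?ZtoC_sub, ?ZtoC_mul. rewrite ?ZtoC_add, ?ZtoC_mul. ring. }
  assert (Hk2 : ZtoC (m21 (Zmul g h)) = ((ZtoC (m21 h) * (Zj g (Zact h Z) * Zj h Z) + ZtoC (m21 g) * ZtoC (Zdet h)) / Zj h Z)%C)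
   by (rewrite <- Hk; field; auto).
  assert (E22 : forall g Z, m22 (Zact g Z) = (ZtoC (Zdet g) * m22 Z - ZtoC (Zdet g) * ZtoC (m21 g) * m12 Z * m21 Z / Zj g Z)%C) by reflexivity.
  rewrite (E22 (Zmul g h)), (E22 g), (E22 h), Em, Hk2, Zdet_mul, ZtoC_mul.
  set (jg := Zj g (Zact h Z)) in *. unfold Zact; cbn [m12 m21]. field. auto.
Qed.

Lemma Zact_id Z : Zact Zid Z = Z.
Proof.
 assert (Ej : Zj Zid Z = C1) by (unfold Zj, Zid; mcbn; ring).
 unfold Zact. rewrite Ej. change (Zdet Zid) with 1%Z. destruct Z as [za zb zc zd]. apply M2_eq; cbn [m11 m12 m21 m22 Zid]; field.
Qed.

Section Theta.
Context (D : Z) (HD0 : (0 < D)%Z) (HD4 : (D mod 4 = 3)%Z).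

Let q := qD D.
Let dl := sqrt (IZR D).

Lemma D_eq : D = (4 * q - 1)%Z.
Proof. unfold q, qD. pose proof (Z.div_mod D 4 ltac:(lia)).
 replace (1 + D)%Z with ((D / 4 + 1) * 4)%Z by lia. rewrite Z.div_mul by lia. lia. Qed.

Lemma dl_pos : 0 < dl.
Proof. apply sqrt_lt_R0, IZR_lt; auto. Qed.
Lemma dl_sqr : dl * dl = IZR D.
Proof. apply sqrt_sqrt. left. apply IZR_lt; auto. Qed.
Lemma sqrtmD_neq0 : sqrtmD D <> C0.
Proof. apply Im_neq0. simpl. pose proof dl_pos. unfold dl in H. lra. Qed.

(** The trace of x. Together with [snd x] it diagonalizes the norm form, at the price of the parity
    condition that the two be congruent modulo 2. *)
Definition Ou (x : OK) : Z := (2 * fst x + snd x)%Z.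
Lemma Onorm_Ou x : (4 * Onorm D x = Ou x * Ou x + D * (snd x * snd x))%Z.
Proof.
 destruct x as [a b]. unfold Onorm, Ou; pcbn.
 assert (E : forall Q d, (d = 4 * Q - 1 -> 4 * (a * a + a * b + Q * b * b) = (2 * a + b) * (2 * a + b) + d * (b * b))%Z)
  by (intros; subst; ring).
 apply E, D_eq.
Qed.

(* the element of the inverse different attached to [x] *)
Definition tx (x : OK) : Cx := (OtoC D x / sqrtmD D)%C.
Lemma tx_eq x : tx x = mkC (IZR (snd x) / 2) (- IZR (Ou x) / (2 * dl)).
Proof.
 pose proof dl_pos. unfold tx, Ou, dl in *. rewrite plus_IZR, mult_IZR.
 unfold OtoC, sqrtmD, Cdiv, Cinv, Cnorm2; apply Cx_eq; simpl; unfold dl in *; field; lra.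
Qed.

Definition lx (x : OK) (Z : M2 Cx) : Cx := (tx x * m21 Z + Cconj (tx x) * m12 Z)%C.
(** The summand of the theta series of the inverse different, written for x with t = x / sqrt(-D),
    so that N(t) = N(x)/D. *)
Definition qx (x : OK) (Z : M2 Cx) : Cx :=
 e (RtoC (IZR (Onorm D x) / IZR D) * m11 Z + lx x Z + m22 Z)%C.
(** Coordinates dual to the real and imaginary parts of t: in them [qx] is a product of two
    one-variable Gaussians. *)
Definition Zp (Z : M2 Cx) : Cx := (m12 Z + m21 Z)%C.
Definition Zm (Z : M2 Cx) : Cx := (Ci * (m21 Z - m12 Z))%C.

Lemma lx_eq x Z : lx x Z = (RtoC (IZR (snd x) / 2) * Zp Z - RtoC (IZR (Ou x) / (2 * dl)) * Zm Z)%C.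
Proof.
 pose proof dl_pos. unfold lx, Zp, Zm. rewrite tx_eq. apply Cx_eq; simpl; field; lra.
Qed.

Lemma norm_eq x : IZR (Onorm D x) / IZR D = (IZR (snd x) * IZR (snd x) + IZR (Ou x) * IZR (Ou x) / IZR D) / 4.
Proof.
 pose proof (IZR_lt _ _ HD0) as P. assert (E := f_equal IZR (Onorm_Ou x)).
 rewrite plus_IZR, !mult_IZR in E. replace (IZR (Onorm D x)) with (4 * IZR (Onorm D x) / 4) by field.
 rewrite E. field. lra.
Qed.

Lemma qx_eq x Z : qx x Z = (e (RtoC (IZR (snd x) * IZR (snd x) / 4) * m11 Z + RtoC (IZR (snd x) / 2) * Zp Z)%C
 * e (RtoC (IZR (Ou x) * IZR (Ou x) / (4 * IZR D)) * m11 Z - RtoC (IZR (Ou x) / (2 * dl)) * Zm Z)%C * e (m22 Z))%C.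
Proof.
 unfold qx. rewrite <- !e_add. f_equal. rewrite lx_eq, norm_eq.
 replace ((IZR (snd x) * IZR (snd x) + IZR (Ou x) * IZR (Ou x) / IZR D) / 4)
  with (IZR (snd x) * IZR (snd x) / 4 + IZR (Ou x) * IZR (Ou x) / (4 * IZR D))
  by (field; apply not_0_IZR; lia).
 rewrite RtoC_add. ring.
Qed.

Lemma gauss_term_AbsSum (al : R) (be : Cx) (t : Cx) : 0 < al -> inH t ->
 AbsSum (fun n : Z => e (RtoC (al * (IZR n * IZR n)) * t + RtoC (IZR n) * be)%C).
Proof.
 intros Ha Ht. unfold inH in Ht. pose proof PI_RGT_0.
 apply AbsSum_le with (fun n : Z => RtoC (exp (- (2 * PI * al * Im t) * (IZR n * IZR n) + (- (2 * PI * Im be)) * IZR n))) 1.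
 - apply gauss_AbsSum. apply Rmult_lt_0_compat; auto. apply Rmult_lt_0_compat; lra.
 - intros n. rewrite Cabs_RtoC, Rabs_right by (left; apply exp_pos). rewrite Cabs_e. simpl.
  rewrite Rmult_1_l. apply exp_le_mono. right. ring.
Qed.

Lemma qx_AbsSum Z : inH (m11 Z) -> AbsSum (fun x => qx x Z).
Proof.
 intros Ht. pose proof (IZR_lt _ _ HD0) as P. pose proof dl_pos as Pd.
 pose proof (gauss_term_AbsSum (/ 4) (RtoC (/ 2) * Zp Z)%C (m11 Z) ltac:(lra) Ht) as A1.
 pose proof (gauss_term_AbsSum (/ (4 * IZR D)) (RtoC (- / (2 * dl)) * Zm Z)%C (m11 Z)) as A2.
 assert (P4 : 0 < / (4 * IZR D)) by (apply Rinv_0_lt_compat; lra). specialize (A2 P4 Ht).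
 pose proof (AbsSum_scal (e (m22 Z)) _ (AbsSum_prod _ _ A1 A2)) as A3.
 apply (AbsSum_inj (fun x : OK => (snd x, Ou x))) in A3.
 - eapply AbsSum_ext; [|apply A3]. intros x. pcbn. rewrite qx_eq, <- !e_add. f_equal.
  replace (IZR (snd x) * IZR (snd x) / 4) with (/ 4 * (IZR (snd x) * IZR (snd x))) by field.
  replace (IZR (Ou x) * IZR (Ou x) / (4 * IZR D)) with (/ (4 * IZR D) * (IZR (Ou x) * IZR (Ou x))) by (field; lra).
  replace (RtoC (IZR (snd x) / 2)) with (RtoC (IZR (snd x)) * RtoC (/ 2))%C by (rewrite <- RtoC_mul; reflexivity).
  replace (RtoC (IZR (Ou x) / (2 * dl))) with (- (RtoC (IZR (Ou x)) * RtoC (- / (2 * dl))))%C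
   by (rewrite <- RtoC_mul, <- RtoC_opp; f_equal; unfold Rdiv; ring).
  ring.
 - intros [a b] [c d] E. assert (E1 := f_equal fst E). assert (E2 := f_equal snd E). cbv beta delta [Ou fst snd] iota in E1, E2. f_equal; lia.
Qed.

(* [emb y] parametrizes the coset [y + sqrt(-D) O] by [O]. *)
Definition emb (y : Z) (ab : OK) : OK := (y - fst ab - 2 * q * snd ab, 2 * fst ab + snd ab)%Z.

Lemma Ou_emb y ab : Ou (emb y ab) = (2 * y - D * snd ab)%Z.
Proof.
 unfold Ou, emb; pcbn.
 assert (E : forall Q d a b, (d = 4 * Q - 1 -> 2 * (y - a - 2 * Q * b) + (2 * a + b) = 2 * y - d * b)%Z)
  by (intros; subst; ring).
 apply E, D_eq.
Qed.

Lemma emb_y_inj y ab ab' : emb y ab = emb y ab' -> ab = ab'.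
Proof.
 intros E. assert (E1 := f_equal Ou E). rewrite !Ou_emb in E1.
 assert (snd ab = snd ab') by nia.
 destruct ab as [a b], ab' as [a' b']. simpl in *. subst b'. assert (E3 := f_equal fst E). cbv beta delta [emb fst snd] iota in E3. f_equal. lia.
Qed.

Lemma emb_inj y ab y' ab' : (0 <= y < D)%Z -> (0 <= y' < D)%Z -> emb y ab = emb y' ab' -> y = y' /\ ab = ab'.
Proof.
 intros Hy Hy' E. assert (E1 := f_equal Ou E). rewrite !Ou_emb in E1.
 assert (Ey : y = y').
 { assert (H : (2 * (y - y') = D * (snd ab - snd ab'))%Z) by lia.
  assert (Hd := D_eq).
  assert (E2 : ((4 * q) * (y - y') = D * (2 * q * (snd ab - snd ab')))%Z) by (transitivity (2 * q * (2 * (y - y')))%Z; [ring|rewrite H; ring]).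
  assert (E3 : (y - y' = D * (2 * q * (snd ab - snd ab') - (y - y')))%Z) by (rewrite Z.mul_sub_distr_l, <- E2; rewrite Hd at 1; ring).
  set (w := (2 * q * (snd ab - snd ab') - (y - y'))%Z) in *.
  assert (w = 0 \/ 1 <= Z.abs w)%Z as [Hw|Hw] by lia; [rewrite Hw in E3; lia|nia]. }
 split; auto. subst y'. now apply emb_y_inj in E.
Qed.

(** The residue y is half the trace of x modulo D; the factor 2 q inverts 2 because 4 q = D + 1. *)
Definition unemb (x : OK) : Z * OK :=
 let y := ((Ou x * (2 * q)) mod D)%Z in
 let b := ((2 * y - Ou x) / D)%Z in (y, ((snd x - b) / 2, b))%Z.

Lemma emb_unemb x : (0 <= fst (unemb x) < D)%Z /\ emb (fst (unemb x)) (snd (unemb x)) = x.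
Proof.
 unfold unemb. cbv zeta. pcbn. set (y := ((Ou x * (2 * q)) mod D)%Z).
 split; [apply Z.mod_pos_bound; auto|].
 assert (Hy : (exists k, Ou x * (2 * q) = D * k + y)%Z) by (exists (Ou x * (2 * q) / D)%Z; apply Z.div_mod; lia).
 destruct Hy as [k Hk]. assert (Hd := D_eq).
 assert (Hdiv : (2 * y - Ou x = (Ou x - 2 * k) * D)%Z).
 { replace (2 * y)%Z with (Ou x * (4 * q) - 2 * (D * k))%Z by lia.
  replace (4 * q)%Z with (D + 1)%Z by lia. ring. }
 set (b := (Ou x - 2 * k)%Z) in *.
 assert (Eb : ((2 * y - Ou x) / D = b)%Z) by (rewrite Hdiv; apply Z.div_mul; lia).
 rewrite Eb. destruct x as [X Y]. unfold emb, Ou in *; cbn [fst snd] in *.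
 assert (Ha : (Y - b = (k - X) * 2)%Z) by (unfold b; lia).
 rewrite Ha, Z.div_mul by lia. f_equal.
 - assert (2 * (y - (k - X) - 2 * q * b) = 2 * X)%Z; [|lia].
  assert (2 * y = b * D + (2 * X + Y))%Z by lia.
  rewrite Hd in H at 1. lia.
 - lia.
Qed.

Lemma class_split (g : OK -> Cx) (s : Cx) (sy : nat -> Cx) : HasSum g s ->
 (forall y, (y < Z.to_nat D)%nat -> HasSum (fun ab => g (emb (Z.of_nat y) ab)) (sy y)) ->
 s = Csum (map sy (seq 0 (Z.to_nat D))).
Proof.
 intros Hg Hy.
 set (f' := fun x : nat * OK => if lt_dec (fst x) (Z.to_nat D) then g (emb (Z.of_nat (fst x)) (snd x)) else C0).
 assert (HF : HasSum f' s).
 { apply (HasSum_inj_conv (fun x => (Z.to_nat (fst (unemb x)), snd (unemb x)))).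
  - intros x x' E. destruct (emb_unemb x) as [B1 B2], (emb_unemb x') as [B3 B4].
   assert (E1 := f_equal fst E). assert (E2 := f_equal snd E). cbn [fst snd] in E1, E2.
   rewrite <- B2, <- B4, E2. f_equal. lia.
  - intros [y ab] Hn. unfold f'; pcbn. destruct (lt_dec y (Z.to_nat D)) as [h|h]; auto.
   exfalso. apply (Hn (emb (Z.of_nat y) ab)).
   destruct (emb_unemb (emb (Z.of_nat y) ab)) as [B1 B2].
   apply emb_inj in B2; auto; [|lia]. destruct B2 as [B2 B3]. rewrite B2, B3. f_equal. apply Nat2Z.id.
  - eapply HasSum_ext; [|apply Hg]. intros x. destruct (emb_unemb x) as [B1 B2].
   unfold f'; pcbn. destruct (lt_dec _ _) as [h|h]; [|exfalso; apply h; lia].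
   rewrite Z2Nat.id by lia. now rewrite B2. }
 assert (HR : HasSum (fun y => if lt_dec y (Z.to_nat D) then sy y else C0) s).
 { apply HasSum_fubini with f'; auto. intros y. unfold f'; pcbn.
  destruct (lt_dec y (Z.to_nat D)); auto. now apply HasSum_0. }
 apply (HasSum_unique _ _ _ HR).
 replace (map sy (seq 0 (Z.to_nat D))) with (map (fun y => if lt_dec y (Z.to_nat D) then sy y else C0) (seq 0 (Z.to_nat D))).
 - apply HasSum_finite; [apply seq_NoDup|]. intros y Hn. destruct (lt_dec y (Z.to_nat D)); auto.
  exfalso. apply Hn, in_seq. lia.
 - apply map_ext_in. intros y Hin. apply in_seq in Hin. destruct (lt_dec y (Z.to_nat D)); auto. lia.
Qed.

Definition th (y : Z) (Z : M2 Cx) : Cx := Sumv (fun ab => qx (emb y ab) Z).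
Definition Th (Z : M2 Cx) : Cx := Sumv (fun x => qx x Z).

Lemma th_AbsSum y Z : inH (m11 Z) -> AbsSum (fun ab => qx (emb y ab) Z).
Proof. intros H. apply (AbsSum_inj (emb y) (fun x => qx x Z)); [apply emb_y_inj|apply qx_AbsSum; auto]. Qed.
Lemma th_spec y Z : inH (m11 Z) -> HasSum (fun ab => qx (emb y ab) Z) (th y Z).
Proof. intros H. apply Sumv_spec, th_AbsSum; auto. Qed.
Lemma Th_spec Z : inH (m11 Z) -> HasSum (fun x => qx x Z) (Th Z).
Proof. intros H. apply Sumv_spec, qx_AbsSum; auto. Qed.

Lemma Th_split Z : inH (m11 Z) -> Th Z = Csum (map (fun y => th (Z.of_nat y) Z) (seq 0 (Z.to_nat D))).
Proof. intros H. apply (class_split (fun x => qx x Z)); [apply Th_spec; auto|]. intros; apply th_spec; auto. Qed.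

(* Poisson summation over [Z + r], obtained from [Rth = Kth * Lth] by translating [z]. *)
Lemma shift_poisson (tau z : Cx) (r : R) : inH tau ->
 exists S, HasSum (fun a : Z => e (tau * (ZtoC a + RtoC r) * (ZtoC a + RtoC r) + (ZtoC a + RtoC r) * z)%C) S /\
  HasSum (fun m : Z => (e (RtoC r * ZtoC m)%C * Rterm tau z m)%C) (Kth tau * S)%C.
Proof.
 intros Ht. assert (Hn := inH_neq0 _ Ht). set (z' := (z + ZtoC 2 * tau * RtoC r)%C). set (c := e (tau * RtoC r * RtoC r + RtoC r * z)%C).
 exists (c * Lth tau z')%C. split.
 - eapply HasSum_ext; [|apply (HasSum_scal c _ _ (Lth_spec tau z' Ht))].
  intros a. unfold c, Lterm, z'. rewrite <- e_add. f_equal. ring.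
 - replace (Kth tau * (c * Lth tau z'))%C with (c * Rth tau z')%C by (rewrite (Kth_spec tau z' Ht); ring).
  eapply HasSum_ext; [|apply (HasSum_scal c _ _ (Rth_spec tau z' Ht))].
  intros m. unfold c, Rterm, z'. rewrite <- !e_add. f_equal. field. auto.
Qed.

Lemma Zact_S Z : inH (m11 Z) -> Zact ZS Z = mkM2 (ZtoC (-1) / m11 Z)%C (m12 Z / m11 Z)%C (m21 Z / m11 Z)%C
 (m22 Z - m12 Z * m21 Z / m11 Z)%C.
Proof.
 intros H. assert (Hn := inH_neq0 _ H).
 assert (Ej : Zj ZS Z = m11 Z) by (unfold Zj, ZS; mcbn; ring).
 unfold Zact. rewrite Ej. change (Zdet ZS) with 1%Z. apply M2_eq; cbn [m11 m12 m21 m22 ZS]; field; auto.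
Qed.

(** Poisson summation twice. In the coordinates (a, b) of [emb y (a, b)] the sum over a, for fixed
    b, is a Gaussian of parameter tau over Z + b/2; after dualizing it to a sum over m, the sum over
    b is a Gaussian of parameter D tau/4 over Z - 2y/D, dualized to a sum over n. The dual points
    (-n, m) run through all of O, and the two factors multiply to mu tau by [Kth_prod]. *)
Lemma theta_inversion : exists mu, mu <> C0 /\ forall (y : Z) (Z : M2 Cx), inH (m11 Z) ->
 HasSum (fun x => (e (RtoC (IZR (y * Ou x) / IZR D))%C * qx x (Zact ZS Z))%C) (mu * m11 Z * th y Z)%C.
Proof.
 pose proof (IZR_lt _ _ HD0) as P. pose proof dl_pos as Pd. pose proof dl_sqr as Sd.
 destruct (Kth_prod (IZR D / 4) ltac:(lra)) as [mu [Hmu HK]].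
 exists mu. split; auto. intros y Z Ht. assert (Hn := inH_neq0 _ Ht).
 set (tau := m11 Z) in *. set (tau2 := (RtoC (IZR D / 4) * tau)%C).
 assert (Ht2 : inH tau2) by (unfold inH, tau2 in *; simpl; nra).
 assert (Hn2 := inH_neq0 _ Ht2).
 set (B := fun b : BinNums.Z => (IZR D * IZR b - 2 * IZR y) / (2 * dl)).
 (* The family halfway, with a already replaced by m and b not yet replaced. It is absolutely
    summable, which permits the exchange of the two summations. *)
 set (G := fun x : BinNums.Z * BinNums.Z => (e (RtoC (B (fst x) * B (fst x)) * tau + RtoC (B (fst x)) * Zm Z)%C
  * (e (RtoC (IZR (fst x) / 2) * ZtoC (snd x))%C * Rterm tau (Zp Z) (snd x)))%C).
 assert (Hth : HasSum (fun x : BinNums.Z * BinNums.Z => qx (emb y (snd x, fst x)) Z) (th y Z)).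
 { pose proof (th_spec y Z Ht) as K.
  apply (HasSum_reindex (fun x : BinNums.Z * BinNums.Z => (snd x, fst x)) (fun x => (snd x, fst x))) in K; auto;
   intros [? ?]; reflexivity. }
 assert (Eq : forall b a, qx (emb y (a, b)) Z = (e (m22 Z) * e (RtoC (B b * B b) * tau + RtoC (B b) * Zm Z)%C
  * e (tau * (ZtoC a + RtoC (IZR b / 2)) * (ZtoC a + RtoC (IZR b / 2)) + (ZtoC a + RtoC (IZR b / 2)) * Zp Z)%C)%C).
 { intros b a. rewrite qx_eq, <- !e_add. f_equal. rewrite Ou_emb. unfold emb; pcbn.
  assert (E1 : IZR (2 * a + b) / 2 = IZR a + IZR b / 2) by (rewrite plus_IZR, mult_IZR; field).
  assert (E2 : IZR (2 * a + b) * IZR (2 * a + b) / 4 = (IZR a + IZR b / 2) * (IZR a + IZR b / 2))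
   by (rewrite plus_IZR, mult_IZR; field).
  assert (E3 : IZR (2 * y - D * b) / (2 * dl) = - B b)
   by (unfold B; rewrite minus_IZR, !mult_IZR; field; lra).
  assert (E4 : IZR (2 * y - D * b) * IZR (2 * y - D * b) / (4 * IZR D) = B b * B b)
   by (unfold B; rewrite minus_IZR, !mult_IZR; rewrite <- Sd; field; lra).
  rewrite E1, E2, E3, E4. rewrite RtoC_opp, RtoC_mul, RtoC_add. fold tau. unfold ZtoC. ring. }
 assert (HGa : AbsSum G).
 { pose proof (gauss_term_AbsSum (IZR D / 4) (RtoC (- IZR y) * tau + RtoC (dl / 2) * Zm Z)%C tau ltac:(lra) Ht) as A1.
  pose proof (AbsSum_prod _ _ A1 (Rterm_AbsSum tau (Zp Z) Ht)) as A2.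
  apply AbsSum_le with (1 := A2) (K := Cabs (e (RtoC (IZR y * IZR y / IZR D) * tau - RtoC (IZR y / dl) * Zm Z)%C)%C).
  intros [b m]. unfold G; pcbn. rewrite !Cabs_mul.
  replace (RtoC (IZR b / 2) * ZtoC m)%C with (RtoC (IZR b / 2 * IZR m)) by (rewrite RtoC_mul; reflexivity).
  rewrite Cabs_e_real, Rmult_1_l, <- Rmult_assoc. right. f_equal. rewrite <- Cabs_mul, <- e_add. do 2 f_equal.
  replace (B b * B b) with (IZR D / 4 * (IZR b * IZR b) + IZR b * - IZR y + IZR y * IZR y / IZR D)
   by (unfold B; rewrite <- Sd; field; lra).
  replace (B b) with (IZR b * (dl / 2) - IZR y / dl) by (unfold B; rewrite <- Sd; field; lra).
  rewrite !RtoC_add, RtoC_sub, !(RtoC_mul (IZR b)). ring. }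
 destruct (AbsSum_HasSum _ HGa) as [S HS].
 assert (HSth : S = (Kth tau * (e (- m22 Z)%C * th y Z))%C).
 { pose proof (HasSum_scal (e (- m22 Z)%C) _ _ Hth) as K1.
  assert (R1 : forall b, exists r, HasSum (fun a => (e (- m22 Z)%C * qx (emb y (a, b)) Z)%C) r /\
   HasSum (fun m => G (b, m)) (Kth tau * r)%C).
  { intros b. destruct (shift_poisson tau (Zp Z) (IZR b / 2) Ht) as [s [Hs1 Hs2]].
   exists (e (RtoC (B b * B b) * tau + RtoC (B b) * Zm Z)%C * s)%C. split.
   - eapply HasSum_ext; [|apply (HasSum_scal (e (RtoC (B b * B b) * tau + RtoC (B b) * Zm Z)%C) _ _ Hs1)].
    intros a. cbv beta. rewrite Eq. rewrite e_opp. field. apply e_neq0.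
   - replace (Kth tau * (e (RtoC (B b * B b) * tau + RtoC (B b) * Zm Z)%C * s))%C
     with (e (RtoC (B b * B b) * tau + RtoC (B b) * Zm Z)%C * (Kth tau * s))%C by ring.
    apply (HasSum_scal (e (RtoC (B b * B b) * tau + RtoC (B b) * Zm Z)%C) _ _ Hs2). }
  set (r := fun b => proj1_sig (constructive_indefinite_description _ (R1 b))).
  assert (Hr : forall b, HasSum (fun a => (e (- m22 Z)%C * qx (emb y (a, b)) Z)%C) (r b) /\ HasSum (fun m => G (b, m)) (Kth tau * r b)%C)
   by (intros b; apply (proj2_sig (constructive_indefinite_description _ (R1 b)))).
  clearbody r. assert (Hr1 : HasSum r (e (- m22 Z)%C * th y Z)%C) by (apply (HasSum_fubini _ r _ K1); intros b; exact (proj1 (Hr b))).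
  assert (Hr2 : HasSum (fun b => (Kth tau * r b)%C) S) by (apply (HasSum_fubini _ _ _ HS); intros b; apply Hr).
  apply (HasSum_unique _ _ _ Hr2 (HasSum_scal (Kth tau) _ _ Hr1)). }
 pose proof (HasSum_reindex (fun x : BinNums.Z * BinNums.Z => (snd x, fst x)) (fun x => (snd x, fst x)) G S
  ltac:(intros [? ?]; reflexivity) ltac:(intros [? ?]; reflexivity) HS) as HS'.
 (* The dual indices form the element (-n, m) of O, with trace m - 2n; the signs make the exponents
    of the two Poisson steps match [qx] at the image under S. *)
 set (T := fun x : BinNums.Z * BinNums.Z => (e (RtoC (IZR (y * Ou (- snd x, fst x)%Z) / IZR D))%C * qx (- snd x, fst x)%Z (Zact ZS Z) * e (- m22 Z)%C)%C).
 assert (HiS : inH (m11 (Zact ZS Z))) by (apply Zact_inH; auto; reflexivity).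
 assert (HT0 : AbsSum (fun x => (e (RtoC (IZR (y * Ou x) / IZR D))%C * qx x (Zact ZS Z))%C)).
 { apply AbsSum_le with (1 := qx_AbsSum _ HiS) (K := 1). intros x. rewrite Cabs_mul, Cabs_e_real. lra. }
 destruct (AbsSum_HasSum _ HT0) as [s0 Hs0].
 assert (HT : HasSum T (s0 * e (- m22 Z)%C)%C).
 { pose proof (HasSum_scal (e (- m22 Z)%C) _ _ Hs0) as K.
  apply (HasSum_reindex (fun x : BinNums.Z * BinNums.Z => (- snd x, fst x)%Z) (fun x => (snd x, - fst x)%Z)) in K.
  - replace (s0 * e (- m22 Z)%C)%C with (e (- m22 Z)%C * s0)%C by ring.
   eapply HasSum_ext; [|apply K]. intros x. unfold T. cbv beta. ring.
  - intros [m n]; simpl. f_equal. lia.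
  - intros [m n]; simpl. f_equal. lia. }
 assert (ET : forall m n, T (m, n) = (Rterm tau (Zp Z) m * e (RtoC (IZR y * IZR m / IZR D))%C
   * (e (RtoC (- (2 * IZR y / IZR D)) * ZtoC n)%C * Rterm tau2 ((RtoC dl * Zm Z + ZtoC m) / ZtoC 2)%C n))%C).
 { intros m n. unfold T. pcbn.
  assert (HZ : (m12 Z * m21 Z)%C = ((Zp Z * Zp Z + Zm Z * Zm Z) / ZtoC 4)%C).
  { unfold Zp, Zm. replace (Ci * (m21 Z - m12 Z) * (Ci * (m21 Z - m12 Z)))%C with (- ((m21 Z - m12 Z) * (m21 Z - m12 Z)))%C
    by (apply Cx_eq; simpl; ring). field. }
  rewrite qx_eq. rewrite <- !e_add. unfold Rterm. rewrite <- !e_add. f_equal.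
  rewrite Zact_S by auto. unfold Zp at 1, Zm at 1. mcbn. fold tau.
  replace (m12 Z / tau + m21 Z / tau)%C with (Zp Z / tau)%C by (unfold Zp; field; auto).
  replace (Ci * (m21 Z / tau - m12 Z / tau))%C with (Zm Z / tau)%C by (unfold Zm; field; auto).
  rewrite HZ. unfold Ou; pcbn.
  set (W := Zm Z). set (V := Zp Z).
  replace (IZR (y * (2 * - n + m)) / IZR D) with (IZR y * IZR m / IZR D - 2 * IZR y / IZR D * IZR n)
   by (rewrite mult_IZR, plus_IZR, mult_IZR, opp_IZR; field; lra).
  replace (IZR (2 * - n + m)) with (IZR m - 2 * IZR n) by (rewrite plus_IZR, mult_IZR, opp_IZR; ring).
  set (M := IZR m). set (N := IZR n).
  replace ((M - 2 * N) * (M - 2 * N) / (4 * IZR D)) with ((M - 2 * N) * (M - 2 * N) * / dl * / dl * / 4) by (rewrite <- Sd; field; lra).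
  replace ((M - 2 * N) / (2 * dl)) with ((M - 2 * N) * / dl * / 2) by (field; lra).
  replace (M * M / 4) with (M * M * / 4) by field. replace (M / 2) with (M * / 2) by field.
  unfold tau2. replace (IZR D / 4) with (dl * dl * / 4) by (rewrite Sd; field).
  unfold ZtoC at 3 4 6 7. fold M N.
  rewrite !RtoC_sub, !RtoC_opp, !RtoC_mul, !RtoC_sub, !RtoC_mul, !RtoC_inv by lra.
  assert (Hdl : RtoC dl <> C0) by (apply RtoC_neq0; lra).
  unfold ZtoC. fold M N. field. auto. }
 assert (HS2 : HasSum (fun m => Sumv (fun b => G (b, m))) S).
 { apply (HasSum_fubini_abs (fun x : BinNums.Z * BinNums.Z => G (snd x, fst x))); [|exact HS'].
  apply (AbsSum_inj (fun x : BinNums.Z * BinNums.Z => (snd x, fst x)) G); auto.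
  intros [? ?] [? ?] E; inversion E; auto. }
 (* The second Poisson summation, in b, at parameter tau2 = D tau/4. *)
 assert (Erow : forall m, HasSum (fun n => T (m, n)) (Kth tau2 * Sumv (fun b => G (b, m)))%C).
 { intros m.
  destruct (shift_poisson tau2 ((RtoC dl * Zm Z + ZtoC m) / ZtoC 2)%C (- (2 * IZR y / IZR D)) Ht2) as [s [Hs1 Hs2]].
  set (c := (Rterm tau (Zp Z) m * e (RtoC (IZR y * IZR m / IZR D))%C)%C).
  assert (Es : Sumv (fun b => G (b, m)) = (c * s)%C).
  { apply Sumv_eq. eapply HasSum_ext; [|apply (HasSum_scal c _ _ Hs1)].
   intros b. unfold c, G; pcbn. set (X := Rterm tau (Zp Z) m).
   match goal with |- (X * ?u * ?v)%C = (?w * (?t * X))%C => enough (Ee : (u * v)%C = (w * t)%C) end.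
   - transitivity (X * (e (RtoC (IZR y * IZR m / IZR D))%C * e (tau2 * (ZtoC b + RtoC (- (2 * IZR y / IZR D))) *
     (ZtoC b + RtoC (- (2 * IZR y / IZR D))) + (ZtoC b + RtoC (- (2 * IZR y / IZR D))) * ((RtoC dl * Zm Z + ZtoC m) / ZtoC 2))%C))%C; [ring|].
    rewrite Ee. ring.
   - rewrite <- !e_add. f_equal. unfold tau2, B.
    replace ((IZR D * IZR b - 2 * IZR y) / (2 * dl)) with (dl * / 2 * (IZR b - 2 * (IZR y * / dl * / dl))) by (rewrite <- Sd; field; lra).
    replace (IZR D / 4) with (dl * dl * / 4) by (rewrite Sd; field).
    replace (- (2 * IZR y / IZR D)) with (- (2 * (IZR y * / dl * / dl))) by (rewrite <- Sd; field; lra).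
    replace (IZR y * IZR m / IZR D) with (IZR y * IZR m * / dl * / dl) by (rewrite <- Sd; field; lra).
    replace (IZR b / 2) with (IZR b * / 2) by field.
    repeat rewrite ?RtoC_sub, ?RtoC_opp, ?RtoC_mul. rewrite !RtoC_inv by lra.
    assert (Hdl : RtoC dl <> C0) by (apply RtoC_neq0; lra).
    unfold ZtoC. field. auto. }
  rewrite Es. replace (Kth tau2 * (c * s))%C with (c * (Kth tau2 * s))%C by ring.
  eapply HasSum_ext; [|apply (HasSum_scal c _ _ Hs2)]. intros n. rewrite ET. reflexivity. }
 pose proof (HasSum_fubini _ _ _ HT Erow) as F1.
 pose proof (HasSum_unique _ _ _ F1 (HasSum_scal (Kth tau2) _ _ HS2)) as F2.
 replace (mu * tau * th y Z)%C with s0; auto.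
 replace s0 with (s0 * e (- m22 Z)%C * e (m22 Z))%C by (rewrite e_opp; field; apply e_neq0).
 rewrite F2, HSth, <- (HK tau Ht). unfold tau2. rewrite e_opp. field. apply e_neq0.
Qed.
End Theta.

(** * Gauss sums modulo [D] *)

Lemma prime_pos q : prime q -> (0 < q)%Z.
Proof. intros H. pose proof (prime_ge_2 q H). lia. Qed.

Section Residues.
Context (D : Z) (HD : prime D).

Lemma D_gt1 : (1 < D)%Z.
Proof. destruct HD; auto. Qed.

Lemma D_div_mul a b : (D | a * b)%Z -> (D | a)%Z \/ (D | b)%Z.
Proof. apply prime_mult; auto. Qed.

Lemma inv_mod r : ~ (D | r)%Z -> exists s, (D | r * s - 1)%Z.
Proof.
 intros H. assert (R : rel_prime D r) by (apply prime_rel_prime; auto).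
 destruct (rel_prime_bezout _ _ R) as [u v E]. exists v. exists (- u)%Z. lia.
Qed.

Lemma small_ndiv x : (0 < x < D)%Z -> ~ (D | x)%Z.
Proof. intros Hx H. apply Z.divide_pos_le in H; lia. Qed.

Lemma ndiv_1 : ~ (D | 1)%Z.
Proof. apply small_ndiv. pose proof D_gt1. lia. Qed.

Lemma sq_cong a b : (D | a - b)%Z -> (D | a * a - b * b)%Z.
Proof. intros [k Hk]. exists (k * (a + b))%Z. transitivity ((a - b) * (a + b))%Z; [ring|]. rewrite Hk. ring. Qed.

Lemma ndiv_m1 : ~ (D | -1)%Z.
Proof.
 intros H1. apply ndiv_1. now apply (proj1 (Z.divide_opp_r D 1)).
Qed.

Definition zsum (h : Z -> Cx) : Cx := Csum (map (fun y => h (Z.of_nat y)) (seq 0 (Z.to_nat D))).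
Definition zper (h : Z -> Cx) : Prop := forall a b, (D | a - b)%Z -> h a = h b.

Lemma zsum_ext h h' : (forall y, (0 <= y < D)%Z -> h y = h' y) -> zsum h = zsum h'.
Proof.
 intros H. unfold zsum. f_equal. apply map_ext_in. intros y Hy. apply in_seq in Hy. apply H. lia.
Qed.
Lemma zsum_add h h' : zsum (fun y => (h y + h' y)%C) = (zsum h + zsum h')%C.
Proof. apply Csum_map_add. Qed.
Lemma zsum_scal c h : zsum (fun y => (c * h y)%C) = (c * zsum h)%C.
Proof. apply Csum_map_scal. Qed.
Lemma zsum_const c : zsum (fun _ => c) = (ZtoC D * c)%C.
Proof.
 unfold zsum. rewrite Csum_map_const, length_seq. rewrite Z2Nat.id; [reflexivity|]. pose proof D_gt1. lia.
Qed.

Definition injmod (pi : Z -> Z) : Prop :=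
 forall x y, (0 <= x < D)%Z -> (0 <= y < D)%Z -> (D | pi x - pi y)%Z -> x = y.

Lemma injmod_perm (pi : Z -> Z) : injmod pi ->
 Permutation (map (fun y => (pi (Z.of_nat y) mod D)%Z) (seq 0 (Z.to_nat D))) (map Z.of_nat (seq 0 (Z.to_nat D))).
Proof.
 intros H. pose proof D_gt1. apply NoDup_Permutation_bis.
 - apply NoDup_map_NoDup_ForallPairs.
  + intros x y Hx Hy E. apply in_seq in Hx. apply in_seq in Hy.
   apply Nat2Z.inj, H; try lia. apply Z.mod_divide; [lia|].
   rewrite Zminus_mod, E, Z.sub_diag. apply Z.mod_0_l. lia.
  + apply seq_NoDup.
 - now rewrite !length_map.
 - intros z Hz. apply in_map_iff in Hz. destruct Hz as [y [E _]].
  pose proof (Z.mod_pos_bound (pi (Z.of_nat y)) D ltac:(lia)).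
  apply in_map_iff. exists (Z.to_nat z). split; [lia|]. apply in_seq. lia.
Qed.

Lemma mod_cong a : (D | a mod D - a)%Z.
Proof.
 pose proof D_gt1. exists (- (a / D))%Z. pose proof (Z.div_mod a D ltac:(lia)). lia.
Qed.

Lemma zsum_reindex (pi : Z -> Z) h : injmod pi -> zper h -> zsum (fun y => h (pi y)) = zsum h.
Proof.
 intros Hp Hh. unfold zsum.
 rewrite <- (map_map Z.of_nat h), <- (Csum_perm _ _ (Permutation_map h (injmod_perm pi Hp))), map_map.
 f_equal. apply map_ext. intros y. symmetry. apply Hh, mod_cong.
Qed.

Lemma injmod_surj (pi : Z -> Z) : injmod pi -> forall v, exists x, (0 <= x < D)%Z /\ (D | v - pi x)%Z.
Proof.
 intros Hp v. pose proof D_gt1. pose proof (Z.mod_pos_bound v D ltac:(lia)).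
 assert (Hin : In (v mod D)%Z (map Z.of_nat (seq 0 (Z.to_nat D)))).
 { apply in_map_iff. exists (Z.to_nat (v mod D)). split; [lia|]. apply in_seq. lia. }
 apply (Permutation_in _ (Permutation_sym (injmod_perm pi Hp))) in Hin.
 apply in_map_iff in Hin. destruct Hin as [y [E Hy]]. apply in_seq in Hy.
 exists (Z.of_nat y). split; [lia|]. apply Z.mod_divide; [lia|].
 rewrite Zminus_mod, E, Z.sub_diag. apply Z.mod_0_l. lia.
Qed.

Lemma small_div x y : (0 <= x < D)%Z -> (0 <= y < D)%Z -> (D | x - y)%Z -> x = y.
Proof.
 intros Hx Hy [k Hk]. assert (k = 0 \/ 1 <= Z.abs k)%Z as [->|H] by lia; [lia|nia].
Qed.

Lemma injmod_lin r s : ~ (D | r)%Z -> injmod (fun y => r * y + s)%Z.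
Proof.
 intros Hr x y Hx Hy H. apply small_div; auto.
 replace (r * x + s - (r * y + s))%Z with (r * (x - y))%Z in H by ring.
 destruct (D_div_mul _ _ H); tauto.
Qed.

Definition zeta (n : Z) : Cx := e (RtoC (IZR n / IZR D))%C.
Lemma zeta_add a b : zeta (a + b) = (zeta a * zeta b)%C.
Proof.
 unfold zeta. rewrite <- e_add, <- RtoC_add. do 2 f_equal. rewrite plus_IZR. unfold Rdiv. ring.
Qed.
Lemma zeta_D k : zeta (D * k) = C1.
Proof.
 pose proof D_gt1. unfold zeta. replace (IZR (D * k) / IZR D) with (IZR k); [apply (e_Z k)|].
 rewrite mult_IZR. field. apply not_0_IZR. lia.
Qed.
Lemma zeta_per : zper zeta.
Proof.
 intros a b [k Hk]. replace a with (b + D * k)%Z by lia. rewrite zeta_add, zeta_D. ring.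
Qed.
Lemma zeta_0 : zeta 0 = C1.
Proof. rewrite <- (zeta_D 0). f_equal. ring. Qed.
Lemma zeta_opp a : zeta (- a) = Cconj (zeta a).
Proof.
 unfold zeta. rewrite e_conj_real, opp_IZR, <- RtoC_opp. do 2 f_equal. unfold Rdiv. ring.
Qed.
Lemma Cabs_zeta a : Cabs (zeta a) = 1.
Proof. apply Cabs_e_real. Qed.

Lemma zsum_zeta n : zsum (fun y => zeta (n * y)) = if Z.eq_dec (n mod D) 0 then ZtoC D else C0.
Proof.
 pose proof D_gt1. pose proof (Zrange_avg n (Z.to_nat D) ltac:(lia)) as K.
 rewrite Z2Nat.id in K by lia. rewrite <- K. unfold zsum. f_equal. apply map_ext. intros y.
 unfold zeta. do 2 f_equal. rewrite mult_IZR, !INR_IZR_INZ, Z2Nat.id by lia. reflexivity.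
Qed.

Definition Gs (r : Z) : Cx := zsum (fun y => zeta (r * (y * y))).

Lemma Gs_opp r : Gs (- r) = Cconj (Gs r).
Proof.
 unfold Gs, zsum. induction (seq 0 (Z.to_nat D)) as [|y l IH]; simpl; [apply Cx_eq; simpl; ring|].
 rewrite IH. replace (- r * (Z.of_nat y * Z.of_nat y))%Z with (- (r * (Z.of_nat y * Z.of_nat y)))%Z by ring.
 rewrite zeta_opp. apply Cx_eq; simpl; ring.
Qed.

Lemma Gs_sq r s : ~ (D | s)%Z -> Gs (r * (s * s)) = Gs r.
Proof.
 intros Hs. unfold Gs. rewrite <- (zsum_reindex (fun y => s * y + 0)%Z (fun y => zeta (r * (y * y)))).
 - apply zsum_ext. intros y _. f_equal. ring.
 - now apply injmod_lin.
 - intros a b H. apply zeta_per. rewrite <- Z.mul_sub_distr_l. now apply Z.divide_mul_r, sq_cong.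
Qed.
Lemma Gs_per : zper Gs.
Proof.
 intros a b [k Hk]. unfold Gs. apply zsum_ext. intros y _. apply zeta_per.
 exists (k * (y * y))%Z. rewrite <- Z.mul_sub_distr_r, Hk. ring.
Qed.

(** For D = 3 modulo 4 this is the first supplementary law. It is a hypothesis of this part because
    [m1_nonsquare] derives it afterwards from the theta series. *)
Context (Hns : forall s, ~ (D | s * s + 1)%Z).

Lemma D_odd x : (2 * x)%Z <> D.
Proof.
 intros E. pose proof D_gt1. destruct (prime_divisors D HD 2%Z) as [h|[h|[h|h]]]; try lia.
 - exists x; lia.
 - apply (Hns 1). exists 1%Z. lia.
Qed.

(** Squares of the lower half of the residues are distinct, as are those of the upper half, and a
    square never equals minus a nonzero square. Injectivity makes this map a permutation of the
    residues, which replaces any counting of squares. *)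
Lemma sq_or_neg_pi : injmod (fun x => if Z_le_gt_dec (2 * x) D then x * x else - (x * x))%Z.
Proof.
 pose proof D_gt1 as H1.
 assert (Hss : forall x y, (D | x * x - y * y)%Z -> (D | x - y)%Z \/ (D | x + y)%Z).
 { intros x y H. apply D_div_mul. replace ((x - y) * (x + y))%Z with (x * x - y * y)%Z by ring. auto. }
 assert (Hsn : forall x y, (D | x * x + y * y)%Z -> (D | y)%Z).
 { intros x y H. destruct (Zdivide_dec D y) as [|Hn]; auto. exfalso.
  destruct (inv_mod y Hn) as [w [k Hk]]. apply (Hns (x * w)%Z).
  destruct H as [m Hm]. exists (m * (w * w) - k * (y * w + 1))%Z.
  replace (x * w * (x * w))%Z with ((x * x + y * y) * (w * w) - (y * w) * (y * w))%Z by ring.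
  rewrite Hm. replace ((y * w) * (y * w))%Z with ((y * w - 1) * (y * w + 1) + 1)%Z by ring. rewrite Hk. ring. }
 assert (small : forall x y, (0 <= x < D)%Z -> (0 <= y < D)%Z -> (D | x + y)%Z -> (x + y = 0 \/ x + y = D)%Z).
 { intros x y Hx Hy [k Hk]. assert (k = 0 \/ k = 1)%Z by nia. destruct H; subst; lia. }
 assert (small0 : forall y, (0 <= y < D)%Z -> (D | y)%Z -> y = 0%Z).
 { intros y Hy H. destruct (Z.eq_dec y 0); auto. exfalso. apply (small_ndiv y); auto. lia. }
 intros x y Hx Hy H.
 destruct (Z_le_gt_dec (2 * x) D) as [lx|gx]; destruct (Z_le_gt_dec (2 * y) D) as [ly|gy].
 - destruct (Hss _ _ H) as [h|h]; [apply small_div; auto|].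
  destruct (small x y Hx Hy h); [lia|]. exfalso. apply (D_odd x). lia.
 - replace (x * x - - (y * y))%Z with (x * x + y * y)%Z in H by ring.
  apply Hsn in H. apply small0 in H; lia.
 - replace (- (x * x) - y * y)%Z with (- (y * y + x * x))%Z in H by ring.
  apply (proj1 (Z.divide_opp_r _ _)) in H. apply Hsn in H. apply small0 in H; lia.
 - replace (- (x * x) - - (y * y))%Z with (y * y - x * x)%Z in H by ring.
  destruct (Hss _ _ H) as [h|h]; [symmetry; apply small_div; auto|].
  destruct (small y x Hy Hx h); lia.
Qed.

Lemma sq_or_neg v : exists x, (D | v - x * x)%Z \/ (D | v + x * x)%Z.
Proof.
 destruct (injmod_surj _ sq_or_neg_pi v) as [x [_ H]]. exists x.
 destruct (Z_le_gt_dec (2 * x) D); [left|right]; auto.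
 replace (v + x * x)%Z with (v - - (x * x))%Z by ring. auto.
Qed.

Lemma not_both v x y : (D | v - x * x)%Z -> (D | v + y * y)%Z -> (D | v)%Z.
Proof.
 intros [k Hk] [m Hm].
 destruct (Zdivide_dec D y) as [[j Hj]|Hn]; [exists (m - j * y)%Z; rewrite Hj in *; lia|].
 exfalso. destruct (inv_mod y Hn) as [w [i Hi]]. apply (Hns (x * w)%Z).
 exists ((m - k) * (w * w) - i * (y * w + 1))%Z.
 replace (x * w * (x * w))%Z with (((v + y * y) - (v - x * x)) * (w * w) - (y * w) * (y * w))%Z by ring.
 rewrite Hk, Hm. replace ((y * w) * (y * w))%Z with ((y * w - 1) * (y * w + 1) + 1)%Z by ring. rewrite Hi. ring.
Qed.

Lemma is_square_mod_iff n : is_square_mod D n = true <-> exists x, (D | n - x * x)%Z.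
Proof.
 pose proof D_gt1. unfold is_square_mod. rewrite existsb_exists. split.
 - intros [x [_ H0]]. apply Z.eqb_eq in H0. apply Z.mod_divide in H0; [|lia]. destruct H0 as [k Hk].
  exists (Z.of_nat x). exists (- k)%Z. lia.
 - intros [x [k Hk]]. exists (Z.to_nat (x mod D)).
  pose proof (Z.mod_pos_bound x D ltac:(lia)). split; [apply in_seq; lia|].
  apply Z.eqb_eq, Z.mod_divide; [lia|]. rewrite Z2Nat.id by lia.
  destruct (mod_cong x) as [j Hj]. exists (j * (x mod D + x) - k)%Z.
  replace (x mod D * (x mod D) - n)%Z with ((x mod D - x) * (x mod D + x) - (n - x * x))%Z by ring.
  rewrite Hj, Hk. ring.
Qed.

Lemma chi_0 n : (D | n)%Z -> chiK D n = 0%Z.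
Proof.
 intros H. pose proof D_gt1. unfold chiK. apply Z.mod_divide in H; [|lia]. rewrite H. reflexivity.
Qed.
Lemma chi_not0 n : ~ (D | n)%Z -> chiK D n = if is_square_mod D n then 1%Z else (-1)%Z.
Proof.
 intros H. pose proof D_gt1. unfold chiK. destruct (Z.eqb_spec (n mod D) 0) as [E|E]; auto.
 exfalso. apply H, Z.mod_divide; [lia|auto].
Qed.
Lemma chi_sq n x : ~ (D | n)%Z -> (D | n - x * x)%Z -> chiK D n = 1%Z.
Proof.
 intros H Hx. rewrite chi_not0 by auto. rewrite (proj2 (is_square_mod_iff n)); eauto.
Qed.
Lemma chi_nsq n x : ~ (D | n)%Z -> (D | n + x * x)%Z -> chiK D n = (-1)%Z.
Proof.
 intros H Hx. rewrite chi_not0 by auto. destruct (is_square_mod D n) eqn:E; auto.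
 apply is_square_mod_iff in E. destruct E as [y Hy]. exfalso. apply H. eapply not_both; eauto.
Qed.
Lemma chi_per a b : (D | a - b)%Z -> chiK D a = chiK D b.
Proof.
 intros [k Hk]. replace a with (b + k * D)%Z by lia. clear a Hk.
 destruct (Zdivide_dec D b) as [[m Hm]|h].
 - rewrite !chi_0; auto; [exists m; auto|exists (m + k)%Z; lia].
 - assert (h' : ~ (D | b + k * D)%Z) by (intros [m Hm]; apply h; exists (m - k)%Z; lia).
  destruct (sq_or_neg b) as [x [Hx|Hx]].
  + rewrite (chi_sq b x), (chi_sq (b + k * D) x); auto. destruct Hx as [m Hm]. exists (m + k)%Z. lia.
  + rewrite (chi_nsq b x), (chi_nsq (b + k * D) x); auto. destruct Hx as [m Hm]. exists (m + k)%Z. lia.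
Qed.
Lemma chi_mul a b : chiK D (a * b) = (chiK D a * chiK D b)%Z.
Proof.
 destruct (Zdivide_dec D a) as [ha|ha].
 { rewrite (chi_0 a) by auto. rewrite chi_0; [ring|]. now apply Z.divide_mul_l. }
 destruct (Zdivide_dec D b) as [hb|hb].
 { rewrite (chi_0 b) by auto. rewrite chi_0; [ring|]. now apply Z.divide_mul_r. }
 assert (hab : ~ (D | a * b)%Z) by (intros h; destruct (D_div_mul _ _ h); tauto).
 destruct (sq_or_neg a) as [x [[k Hk]|[k Hk]]]; destruct (sq_or_neg b) as [y [[m Hm]|[m Hm]]].
 - rewrite (chi_sq a x), (chi_sq b y), (chi_sq (a * b) (x * y)); auto; [|eexists; eauto..].
  exists (k * b + x * x * m)%Z. replace a with (k * D + x * x)%Z by lia. replace b with (m * D + y * y)%Z by lia. ring.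
 - rewrite (chi_sq a x), (chi_nsq b y), (chi_nsq (a * b) (x * y)); auto; [|eexists; eauto..].
  exists (k * b + x * x * m)%Z. replace a with (k * D + x * x)%Z by lia. replace b with (m * D - y * y)%Z by lia. ring.
 - rewrite (chi_nsq a x), (chi_sq b y), (chi_nsq (a * b) (x * y)); auto; [|eexists; eauto..].
  exists (k * b - x * x * m)%Z. replace a with (k * D - x * x)%Z by lia. replace b with (m * D + y * y)%Z by lia. ring.
 - rewrite (chi_nsq a x), (chi_nsq b y), (chi_sq (a * b) (x * y)); auto; [|eexists; eauto..].
  exists (k * b - x * x * m)%Z. replace a with (k * D - x * x)%Z by lia. replace b with (m * D - y * y)%Z by lia. ring.
Qed.
Lemma chi_1 : chiK D 1 = 1%Z.
Proof.
 apply (chi_sq 1 1); [apply ndiv_1|exists 0%Z; ring].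
Qed.
Lemma chi_m1 : chiK D (-1) = (-1)%Z.
Proof.
 apply (chi_nsq (-1) 1); [apply ndiv_m1|exists 0%Z; ring].
Qed.
Lemma chi_opp n : chiK D (- n) = (- chiK D n)%Z.
Proof. replace (- n)%Z with ((-1) * n)%Z by ring. rewrite chi_mul, chi_m1. ring. Qed.
Lemma chi_cases n : ~ (D | n)%Z -> chiK D n = 1%Z \/ chiK D n = (-1)%Z.
Proof. intros H. rewrite chi_not0 by auto. destruct (is_square_mod D n); auto. Qed.
Lemma chi_sqr n : ~ (D | n)%Z -> (chiK D n * chiK D n)%Z = 1%Z.
Proof. intros H. destruct (chi_cases n H) as [->| ->]; reflexivity. Qed.

(** The weight 1 + chi(v) is the number of square roots of v. Reindexing by [sq_or_neg_pi] gives
    weight 2 on the lower half of the residues and 0 on the upper half; the mean with the reflection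
    x -> -x is 1 everywhere. *)
Lemma zsum_chi h : zper h ->
 zsum (fun v => (ZtoC (1 + chiK D v) * h v)%C) = zsum (fun x => h (x * x)%Z).
Proof.
 intros Hh. pose proof D_gt1 as H1.
 set (pi := fun x => (if Z_le_gt_dec (2 * x) D then x * x else - (x * x))%Z).
 set (w := fun x : Z => if Z.eq_dec x 0 then C1 else if Z_le_gt_dec (2 * x) D then ZtoC 2 else C0).
 rewrite <- (zsum_reindex pi (fun v => (ZtoC (1 + chiK D v) * h v)%C)).
 2:{ apply sq_or_neg_pi. }
 2:{ intros a b Hab. rewrite (chi_per a b Hab), (Hh a b Hab). reflexivity. }
 pose proof small_ndiv as nd.
 assert (E1 : zsum (fun x => (ZtoC (1 + chiK D (pi x)) * h (pi x))%C) = zsum (fun x => (w x * h (x * x)%Z)%C)).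
 { apply zsum_ext. intros x Hx. unfold pi, w. destruct (Z.eq_dec x 0) as [->|Hx0].
  - destruct (Z_le_gt_dec (2 * 0) D); [|lia]. rewrite chi_0 by (exists 0%Z; reflexivity).
   change (ZtoC (1 + 0)) with C1. reflexivity.
  - assert (hx : ~ (D | x * x)%Z) by (intros h'; destruct (D_div_mul _ _ h') as [h''|h'']; apply (nd x); auto; lia).
   destruct (Z_le_gt_dec (2 * x) D).
   + rewrite (chi_sq (x * x) x); auto. exists 0%Z; ring.
   + rewrite (chi_nsq (- (x * x)) x); auto.
    * change (ZtoC (1 + -1)) with C0. ring.
    * intros h'. apply (proj1 (Z.divide_opp_r _ _)) in h'. auto.
    * exists 0%Z; ring. }
 rewrite E1.
 assert (E2 : zsum (fun x => (w x * h (x * x)%Z)%C) = zsum (fun x => (w ((- x) mod D)%Z * h (x * x)%Z)%C)).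
 { transitivity (zsum (fun x => (w (x mod D)%Z * h (x * x)%Z)%C)).
  - apply zsum_ext. intros x Hx. now rewrite Z.mod_small.
  - rewrite <- (zsum_reindex (fun x => (-1) * x + 0)%Z (fun x => (w (x mod D)%Z * h (x * x)%Z)%C)).
   + apply zsum_ext. intros x _. replace (-1 * x + 0)%Z with (- x)%Z by ring.
    replace (- x * - x)%Z with (x * x)%Z by ring. reflexivity.
   + apply injmod_lin, ndiv_m1.
   + intros a b [k Hk]. replace (a mod D)%Z with (b mod D)%Z.
    * f_equal. apply Hh, sq_cong. exists k. auto.
    * replace a with (b + k * D)%Z by lia. now rewrite Z.mod_add by lia. }
 assert (E3 : (zsum (fun x => (w x * h (x * x)%Z)%C) + zsum (fun x => (w ((- x) mod D)%Z * h (x * x)%Z)%C))%C = (ZtoC 2 * zsum (fun x => h (x * x)%Z))%C).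
 { rewrite <- zsum_add, <- zsum_scal. apply zsum_ext. intros x Hx.
  replace (w x * h (x * x)%Z + w ((- x) mod D)%Z * h (x * x)%Z)%C with ((w x + w ((- x) mod D)%Z) * h (x * x)%Z)%C by ring.
  f_equal. unfold w. destruct (Z.eq_dec x 0) as [->|Hx0].
  - rewrite Z.mod_0_l by lia. simpl. apply Cx_eq; simpl; ring.
  - replace ((- x) mod D)%Z with (D - x)%Z by (apply (Z.mod_unique_pos _ _ (-1)); lia).
   destruct (Z.eq_dec (D - x) 0); [lia|].
   pose proof (D_odd x).
   destruct (Z_le_gt_dec (2 * x) D), (Z_le_gt_dec (2 * (D - x)) D); try lia; apply Cx_eq; simpl; ring. }
 rewrite <- E2 in E3. set (X := zsum (fun x => (w x * h (x * x)%Z)%C)) in *.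
 set (Y := zsum (fun x => h (x * x)%Z)) in *.
 replace X with (ZtoC (1) * (X + X) / ZtoC 2)%C by field. rewrite E3. field.
Qed.

Lemma zsum_chi_zeta n : zsum (fun v => (ZtoC (chiK D v) * zeta (n * v))%C) =
 (Gs n - (if Z.eq_dec (n mod D) 0 then ZtoC D else C0))%C.
Proof.
 rewrite <- zsum_zeta. unfold Gs. rewrite <- (zsum_chi (fun v => zeta (n * v))).
 - replace (zsum (fun v => (ZtoC (1 + chiK D v) * zeta (n * v))%C))
   with (zsum (fun v => (ZtoC (chiK D v) * zeta (n * v) + zeta (n * v))%C))
   by (apply zsum_ext; intros; rewrite ZtoC_add; ring).
  rewrite zsum_add. ring.
 - intros a b [k Hk]. apply zeta_per. exists (n * k)%Z. rewrite <- Z.mul_sub_distr_l, Hk. ring.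
Qed.
End Residues.

(** Generation of SL2(Z) by S and the powers of T through right multiplication: the Euclidean
    algorithm on the bottom row decreases |c|, and for c = 0 the matrix is a translation up to the
    sign S^2. *)
Lemma SL2_ind (P : M2 Z -> Prop) : P Zid ->
 (forall g, Zdet g = 1%Z -> P g -> P (Zmul g ZS)) ->
 (forall g n, Zdet g = 1%Z -> P g -> P (Zmul g (ZT n))) ->
 forall g, Zdet g = 1%Z -> P g.
Proof.
 intros H0 HS HT.
 assert (K : forall n : nat, forall g, Zdet g = 1%Z -> (Z.abs (m21 g) <= Z.of_nat n)%Z -> P g).
 { assert (dS : Zdet ZS = 1%Z) by reflexivity.
  assert (dT : forall n, Zdet (ZT n) = 1%Z) by (intros; unfold Zdet, ZT; mcbn; ring).
  (* Since S^4 is the identity, a step by S is undone by further steps by S, so the hypothesis on S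
     can also be read backwards. *)
  assert (S4 : forall g, Zdet g = 1%Z -> P (Zmul (Zmul (Zmul g ZS) ZS) ZS) -> P g).
  { intros g Hg H. apply HS in H; [|rewrite !Zdet_mul, Hg; reflexivity].
   replace g with (Zmul (Zmul (Zmul (Zmul g ZS) ZS) ZS) ZS); auto.
   apply M2_eq; unfold Zmul, ZS; mcbn; ring. }
  assert (TT : forall g n, Zdet g = 1%Z -> P (Zmul g (ZT n)) -> P g).
  { intros g n Hg H. apply (HT _ (- n)%Z) in H; [|rewrite Zdet_mul, Hg, dT; reflexivity].
   replace g with (Zmul (Zmul g (ZT n)) (ZT (- n))); auto.
   apply M2_eq; unfold Zmul, ZT; mcbn; ring. }
  induction n; intros g Hg Hc.
  - assert (Ec : m21 g = 0%Z) by lia.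
   assert (P1 : P (Zmul (Zmul Zid ZS) ZS)) by (apply HS; [reflexivity|apply HS; auto]).
   apply (TT g (- (m12 g) * m22 g)%Z Hg).
   assert (Had : (m11 g * m22 g = 1)%Z) by (unfold Zdet in Hg; rewrite Ec in Hg; lia).
   destruct (Z.mul_eq_1 _ _ Had) as [Ea|Ea]; rewrite Ea in Had.
   + replace (Zmul g _) with Zid; auto. destruct g as [a b c d]; cbn [m11 m12 m21 m22] in *. subst.
    replace d with 1%Z by lia. apply M2_eq; unfold Zmul, ZT, Zid; mcbn; ring.
   + replace (Zmul g _) with (Zmul (Zmul Zid ZS) ZS); auto. destruct g as [a b c d]; cbn [m11 m12 m21 m22] in *. subst.
    replace d with (-1)%Z by lia. apply M2_eq; unfold Zmul, ZT, Zid, ZS; mcbn; ring.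
  - destruct (Z.eq_dec (m21 g) 0) as [E0|E0]; [apply IHn; auto; rewrite E0; simpl; lia|].
   apply (TT g (- (m22 g / m21 g))%Z Hg). apply S4; [rewrite Zdet_mul, Hg, dT; reflexivity|].
   assert (Hm : forall h, P (Zmul h ZS) -> Zdet h = 1%Z -> P (Zmul (Zmul (Zmul h ZS) ZS) ZS)).
   { intros h Hh Hd. apply HS; [rewrite !Zdet_mul, Hd; reflexivity|apply HS; auto]. rewrite Zdet_mul, Hd. reflexivity. }
   apply Hm; [|rewrite Zdet_mul, Hg, dT; reflexivity].
   apply IHn; [rewrite !Zdet_mul, Hg, dT; reflexivity|].
   unfold Zmul, ZT, ZS; mcbn.
   pose proof (Z.div_mod (m22 g) (m21 g) E0).
   destruct (Z_lt_le_dec 0 (m21 g)) as [h|h].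
   + pose proof (Z.mod_pos_bound (m22 g) (m21 g) h). lia.
   + pose proof (Z.mod_neg_bound (m22 g) (m21 g) ltac:(lia)). lia. }
 intros g Hg. apply (K (Z.to_nat (Z.abs (m21 g)))); auto. lia.
Qed.

Lemma Zact_T n Z : Zact (ZT n) Z = mkM2 (m11 Z + ZtoC n)%C (m12 Z) (m21 Z) (m22 Z).
Proof.
 assert (Ej : Zj (ZT n) Z = C1) by (unfold Zj, ZT; mcbn; ring).
 unfold Zact. rewrite Ej. replace (Zdet (ZT n)) with 1%Z by (unfold Zdet, ZT; mcbn; ring).
 apply M2_eq; cbn [m11 m12 m21 m22 ZT]; field.
Qed.

Lemma Zact_T0 Z : Zact (ZT 0) Z = Z.
Proof.
 rewrite Zact_T. destruct Z as [z1 z2 z3 z4]. apply M2_eq; mcbn; auto. change (ZtoC 0) with C0. ring.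
Qed.

Lemma HasSum_ge_term {I} (f : I -> Cx) s i0 : (forall i, 0 <= Re (f i)) -> HasSum f s -> Re (f i0) <= Re s.
Proof.
 intros Hf Hs. apply le_epsilon. intros eps He. destruct (Hs eps He) as [L0 K].
 set (L := cnodup (i0 :: L0)). assert (HL : NoDup L) by apply NoDup_nodup.
 specialize (K L HL ltac:(intros x Hx; apply nodup_In; right; auto)).
 pose proof (Re_le_Cabs (Csum (map f L) - s)%C) as B. simpl in B.
 assert (E : Re (Csum (map f L)) = Rsum (map (fun i => Re (f i)) L))
  by (clear; induction L; simpl; [reflexivity|rewrite IHL; reflexivity]).
 assert (Re (f i0) <= Re (Csum (map f L))).
 { rewrite E. apply (Rsum_ge_In (fun i => Re (f i))); auto. apply nodup_In. left; auto. }
 unfold Rabs in B. destruct Rcase_abs; lra.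
Qed.

(** * The theta series under SL2(Z), and the quadratic Gauss sum *)

Section ThetaSL2.
Context (D : Z) (HD : prime D) (HD4 : (D mod 4 = 3)%Z).
Let q := qD D.
Let HD0 : (0 < D)%Z := prime_pos D HD.
Notation zt := (zeta D).
Notation qq := (qx D).
Notation TH := (Th D).
Notation t_ := (th D).
Notation GS := (Gs D).

Lemma Onorm_emb y ab : (D | Onorm D (emb D y ab) - y * y)%Z.
Proof.
 assert (E := Onorm_Ou D HD4 (emb D y ab)). rewrite (Ou_emb D HD4) in E.
 assert (Hd := D_eq D HD4). fold q in Hd.
 set (N := Onorm D (emb D y ab)) in *. set (Y := snd (emb D y ab)) in *. set (b := snd ab) in *.
 exists (q * (- (4 * y * b) + D * (b * b) + Y * Y) - (N - y * y))%Z.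
 assert (E' : (4 * (N - y * y) = D * (- (4 * y * b) + D * (b * b) + Y * Y))%Z) by (rewrite Z.mul_sub_distr_l, E; ring).
 rewrite Z.mul_sub_distr_r.
 replace (q * (- (4 * y * b) + D * (b * b) + Y * Y) * D)%Z with (q * (4 * (N - y * y)))%Z by (rewrite E'; ring).
 rewrite Hd at 1. ring.
Qed.

Lemma Onorm_opp x : Onorm D (Oopp x) = Onorm D x.
Proof. destruct x as [a b]. unfold Onorm, Oopp; pcbn. ring. Qed.

Lemma tx_opp x : tx D (Oopp x) = (- tx D x)%C.
Proof.
 rewrite !(tx_eq D HD0). unfold Ou, Oopp; pcbn. pose proof (dl_pos D HD0).
 apply Cx_eq; cbn [Re Im Copp]; rewrite ?plus_IZR, ?mult_IZR, ?opp_IZR; field; lra.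
Qed.

Lemma qx_opp x Z : qq (Oopp x) Z = qq x (mkM2 (m11 Z) (- m12 Z)%C (- m21 Z)%C (m22 Z)).
Proof.
 unfold qx, lx. rewrite Onorm_opp, tx_opp. mcbn. f_equal.
 replace (Cconj (- tx D x)) with (- Cconj (tx D x))%C by (apply Cx_eq; simpl; ring). ring.
Qed.

Lemma Zact_SS Z : inH (m11 Z) -> Zact ZS (Zact ZS Z) = mkM2 (m11 Z) (- m12 Z)%C (- m21 Z)%C (m22 Z).
Proof.
 intros H. assert (Hn := inH_neq0 _ H).
 rewrite Zact_S by (apply Zact_inH; auto; reflexivity). rewrite Zact_S by auto. mcbn.
 apply M2_eq; mcbn; field; auto.
Qed.

Lemma qx_T n x Z : qq x (Zact (ZT n) Z) = (zt (n * Onorm D x) * qq x Z)%C.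
Proof.
 rewrite Zact_T. unfold qx, zeta, lx. mcbn. rewrite <- e_add. f_equal.
 replace (IZR (n * Onorm D x) / IZR D) with (IZR (Onorm D x) / IZR D * IZR n) by (rewrite mult_IZR; unfold Rdiv; ring).
 rewrite RtoC_mul. unfold ZtoC. ring.
Qed.

Lemma inH_T n Z : inH (m11 Z) -> inH (m11 (Zact (ZT n) Z)).
Proof. intros H. rewrite Zact_T. cbn [m11]. now apply inH_shift. Qed.
Lemma inH_S Z : inH (m11 Z) -> inH (m11 (Zact ZS Z)).
Proof. intros H. apply Zact_inH; auto. reflexivity. Qed.

Lemma th_T n y Z : inH (m11 Z) -> t_ y (Zact (ZT n) Z) = (zt (n * (y * y)) * t_ y Z)%C.
Proof.
 intros H. apply Sumv_eq. eapply HasSum_ext; [|apply (HasSum_scal (zt (n * (y * y))) _ _ (th_spec D HD0 HD4 y Z H))].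
 intros ab. cbv beta. rewrite qx_T. f_equal. apply (zeta_per D HD).
 destruct (Onorm_emb y ab) as [k Hk]. exists (- n * k)%Z. rewrite <- Z.mul_sub_distr_l.
 replace (y * y - Onorm D (emb D y ab))%Z with (- (k * D))%Z by lia. ring.
Qed.
Lemma Th_T_per n m Z : (D | n - m)%Z -> TH (Zact (ZT n) Z) = TH (Zact (ZT m) Z).
Proof.
 intros [k Hk]. unfold Th. f_equal. apply functional_extensionality. intros x. rewrite !qx_T. f_equal.
 apply (zeta_per D HD). exists (k * Onorm D x)%Z. rewrite <- Z.mul_sub_distr_r, Hk. ring.
Qed.
Lemma th0_even Z : inH (m11 Z) -> t_ 0 (mkM2 (m11 Z) (- m12 Z)%C (- m21 Z)%C (m22 Z)) = t_ 0 Z.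
Proof.
 intros H. apply Sumv_eq. pose proof (th_spec D HD0 HD4 0 Z H) as K.
 apply (HasSum_reindex Oopp Oopp) in K; try (intros [a b]; unfold Oopp; pcbn; f_equal; ring).
 eapply HasSum_ext; [|apply K]. intros x. cbv beta. rewrite <- qx_opp. f_equal.
 unfold emb, Oopp; pcbn. f_equal; ring.
Qed.

(** Theta inversion at S Z, together with the fact that S^2 acts by the sign change of the
    off-diagonal variables, which x -> -x absorbs. Only this law for C is carried on; its value is
    forced by the relations below. *)
Lemma th_S_ex : exists C, C <> C0 /\ forall y Z, inH (m11 Z) ->
 HasSum (fun x => (C * m11 Z * (zt (- (y * Ou x)) * qq x Z))%C) (t_ y (Zact ZS Z)).
Proof.
 destruct (theta_inversion D HD0 HD4) as [mu [Hmu HK]].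
 exists (- Cinv mu)%C. split.
 - intros E. apply (Cinv_neq0 mu Hmu). replace (Cinv mu) with (- - Cinv mu)%C by ring. rewrite E. ring.
 - intros y Z HZ. assert (Hn := inH_neq0 _ HZ). pose proof (HK y _ (inH_S Z HZ)) as K. rewrite Zact_SS in K by auto.
  apply (HasSum_scal (- Cinv mu * m11 Z)%C) in K.
  replace (- Cinv mu * m11 Z * (mu * m11 (Zact ZS Z) * t_ y (Zact ZS Z)))%C with (t_ y (Zact ZS Z)) in K
   by (rewrite Zact_S at 2 by auto; cbn [m11]; field; auto).
  apply (HasSum_reindex Oopp Oopp) in K; try (intros [a b]; unfold Oopp; pcbn; f_equal; ring).
  eapply HasSum_ext; [|apply K]. intros x. cbv beta. f_equal.
  rewrite qx_opp. mcbn. unfold zeta. f_equal.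
  + do 4 f_equal. unfold Ou, Oopp; pcbn. ring.
  + f_equal. destruct Z as [z1 z2 z3 z4]. apply M2_eq; mcbn; ring.
Qed.

Lemma Th_nonzero : exists Z, inH (m11 Z) /\ TH Z <> C0.
Proof.
 exists (mkM2 Ci C0 C0 C0). assert (H : inH (m11 (mkM2 Ci C0 C0 C0))) by (unfold inH; simpl; lra). split; auto.
 intros E.
 assert (Eq : forall x, qq x (mkM2 Ci C0 C0 C0) = RtoC (exp (- (2 * PI * (IZR (Onorm D x) / IZR D))))).
 { intros x. unfold qx, lx. mcbn.
  replace (RtoC (IZR (Onorm D x) / IZR D) * Ci + (tx D x * C0 + Cconj (tx D x) * C0) + C0)%C
   with (mkC 0 (IZR (Onorm D x) / IZR D)) by (apply Cx_eq; simpl; ring).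
  unfold e, Cexp. apply Cx_eq; simpl;
  replace (0 * (IZR (Onorm D x) / IZR D) + 2 * PI * 0) with 0 by ring; rewrite ?cos_0, ?sin_0; try ring.
  replace (0 * 0 - 2 * PI * (IZR (Onorm D x) / IZR D)) with (- (2 * PI * (IZR (Onorm D x) / IZR D))) by ring. ring. }
 assert (Hpos : forall x, 0 <= Re (qq x (mkM2 Ci C0 C0 C0))) by (intros x; rewrite Eq; left; apply exp_pos).
 pose proof (HasSum_ge_term _ _ (0%Z, 0%Z) Hpos (Th_spec D HD0 HD4 _ H)) as K.
 rewrite E, Eq in K. cbn [Re RtoC C0] in K. match type of K with exp ?x <= _ => pose proof (exp_pos x) end. lra.
Qed.

Context (C : Cx) (HC : C <> C0).
Context (HS : forall y Z, inH (m11 Z) ->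
 HasSum (fun x => (C * m11 Z * (zt (- (y * Ou x)) * qq x Z))%C) (t_ y (Zact ZS Z))).

Lemma th0_S Z : inH (m11 Z) -> t_ 0 (Zact ZS Z) = (C * m11 Z * TH Z)%C.
Proof.
 intros H. apply (HasSum_unique _ _ _ (HS 0%Z Z H)).
 eapply HasSum_ext; [|apply (HasSum_scal (C * m11 Z)%C _ _ (Th_spec D HD0 HD4 Z H))].
 intros x. cbv beta. rewrite Z.mul_0_l. change (- 0)%Z with 0%Z. rewrite (zeta_0 D HD). ring.
Qed.

Lemma Th_TS_sum r Z : inH (m11 Z) ->
 HasSum (fun x => (C * m11 Z * (zsum D (fun y => zt (r * (y * y) - y * Ou x)) * qq x Z))%C) (TH (Zact (ZT r) (Zact ZS Z))).
Proof.
 intros H. pose proof (inH_S Z H) as H1. pose proof (inH_T r _ H1) as H2.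
 rewrite (Th_split D HD0 HD4 _ H2).
 rewrite (map_ext _ (fun y => (zt (r * (Z.of_nat y * Z.of_nat y)) * t_ (Z.of_nat y) (Zact ZS Z))%C))
  by (intros y; apply th_T; auto).
 eapply HasSum_ext; [|apply (HasSum_Csum (fun y x => (zt (r * (Z.of_nat y * Z.of_nat y)) *
  (C * m11 Z * (zt (- (Z.of_nat y * Ou x)) * qq x Z)))%C) (fun y => (zt (r * (Z.of_nat y * Z.of_nat y)) * t_ (Z.of_nat y) (Zact ZS Z))%C));
  intros y _; apply HasSum_scal, HS; auto].
 intros x. cbv beta. unfold zsum.
 replace (C * m11 Z * (Csum (map (fun y : nat => zt (r * (Z.of_nat y * Z.of_nat y) - Z.of_nat y * Ou x)) (seq 0 (Z.to_nat D))) * qq x Z))%C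
  with ((C * m11 Z * qq x Z) * Csum (map (fun y : nat => zt (r * (Z.of_nat y * Z.of_nat y) - Z.of_nat y * Ou x)) (seq 0 (Z.to_nat D))))%C by ring.
 rewrite <- Csum_map_scal. f_equal. apply map_ext. intros y. unfold Z.sub. rewrite zeta_add. ring.
Qed.

(** For r invertible modulo D the sum over the classes y is a quadratic Gauss sum after completing
    the square, and what remains is the character of -N(x)/r, that is, a translation of [Th] by
    -1/r. So the translates of [Th] are permuted up to factors. *)
Lemma Th_TS r s Z : inH (m11 Z) -> (D | r * s - 1)%Z ->
 TH (Zact (ZT r) (Zact ZS Z)) = (C * m11 Z * GS r * TH (Zact (ZT (- s)) Z))%C.
Proof.
 intros H [k Hk]. apply (HasSum_unique _ _ _ (Th_TS_sum r Z H)).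
 eapply HasSum_ext; [|apply (HasSum_scal (C * m11 Z * GS r)%C _ _ (Th_spec D HD0 HD4 _ (inH_T (- s) Z H)))].
 intros x. cbv beta. rewrite qx_T.
 assert (Hd := D_eq D HD4). fold q in Hd. assert (En := Onorm_Ou D HD4 x).
 set (u := Ou x) in *. set (N := Onorm D x) in *. set (b := snd x) in *.
 assert (Er : ~ (D | r)%Z).
 { intros [j Hj]. apply (ndiv_1 D HD).
  exists (j * s - k)%Z. rewrite Z.mul_sub_distr_r, <- Hk, Hj. ring. }
 (* complete the square; 2 q u is half of u modulo D *)
 assert (Es : zsum D (fun y => zt (r * (y * y) - y * u)) = (GS r * zt (- s * N))%C).
 { unfold Gs. rewrite <- (zsum_reindex D HD (fun y => 1 * y + - (s * (2 * q * u)))%Z (fun y => zt (r * (y * y)))).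
  - replace (zsum D (fun y => zt (r * ((1 * y + - (s * (2 * q * u))) * (1 * y + - (s * (2 * q * u)))))) * zt (- s * N))%C
    with (zt (- s * N) * zsum D (fun y => zt (r * ((1 * y + - (s * (2 * q * u))) * (1 * y + - (s * (2 * q * u)))))))%C by ring.
   rewrite <- zsum_scal. apply zsum_ext. intros y _. rewrite <- zeta_add. apply (zeta_per D HD).
   assert (E2 : (N - 2 * q * u * (2 * q * u) = D * (- N + q * (b * b) - q * (u * u)))%Z).
   { replace (D * (- N + q * (b * b) - q * (u * u)))%Z with (- (D * N) + q * (D * (b * b)) - q * (u * u) * D)%Z by ring.
    replace (D * (b * b))%Z with (4 * N - u * u)%Z by lia. rewrite Hd. ring. }
   exists (u * y + 2 * k * (2 * q * u) * y - s * k * (2 * q * u * (2 * q * u)) + s * (- N + q * (b * b) - q * (u * u)))%Z.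
   match goal with |- _ = (?X * D)%Z => replace (X * D)%Z with (u * y * D + 2 * (2 * q * u) * y * (k * D)
    - s * (k * D) * (2 * q * u * (2 * q * u)) + s * (D * (- N + q * (b * b) - q * (u * u))))%Z by ring end.
   rewrite <- Hk, <- E2. replace (u * y * D)%Z with (u * y * (4 * q - 1))%Z by (rewrite <- Hd; ring). ring.
  - apply (injmod_lin D HD). apply (small_ndiv D). pose proof (D_gt1 D HD). lia.
  - intros a c H'. apply (zeta_per D HD). rewrite <- Z.mul_sub_distr_l. now apply Z.divide_mul_r, sq_cong. }
 rewrite Es. ring.
Qed.

(** Orthogonality over y keeps the x whose trace is divisible by D, and these are the elements of
    sqrt(-D) O. *)
Lemma Th_S Z : inH (m11 Z) -> TH (Zact ZS Z) = (C * m11 Z * ZtoC D * t_ 0 Z)%C.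
Proof.
 intros H. pose proof (Th_TS_sum 0 Z H) as K.
 rewrite Zact_T0 in K.
 assert (Ez : forall x, zsum D (fun y => zt (0 * (y * y) - y * Ou x)) = if Z.eq_dec ((- Ou x) mod D) 0 then ZtoC D else C0).
 { intros x. rewrite <- zsum_zeta by auto. apply zsum_ext. intros y _. f_equal. ring. }
 apply (HasSum_unique _ _ _ K).
 apply (HasSum_inj_conv (emb D 0)).
 - intros ab ab'. apply (emb_y_inj D HD0 HD4).
 - intros x Hx. cbv beta. rewrite Ez. destruct (Z.eq_dec (- Ou x mod D) 0) as [E|_]; [|ring].
  exfalso. destruct (emb_unemb D HD0 HD4 x) as [B1 B2]. apply (Hx (snd (unemb D x))).
  apply Z.mod_divide in E; [|lia]. destruct E as [j Hj].
  replace 0%Z with (fst (unemb D x)); auto. unfold unemb; cbv zeta; cbn [fst].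
  replace (Ou x * (2 * qD D))%Z with (- j * (2 * qD D) * D)%Z by lia. apply Z.mod_mul. lia.
 - eapply HasSum_ext; [|apply (HasSum_scal (C * m11 Z * ZtoC D)%C _ _ (th_spec D HD0 HD4 0 Z H))].
  intros ab. cbv beta. rewrite Ez, (Ou_emb D HD4).
  destruct (Z.eq_dec _ _) as [_|E]; [ring|].
  exfalso. apply E. replace (- (2 * 0 - D * snd ab))%Z with (snd ab * D)%Z by ring. apply Z.mod_mul. lia.
Qed.

(** Applying S twice passes from [th 0] to [Th] and back, while S^2 only changes the signs of z1 and
    z2, under which [th 0] is even. *)
Lemma C_sqr : (C * C * ZtoC D)%C = ZtoC (-1).
Proof.
 destruct Th_nonzero as [Z [HZ Hnz]]. assert (Hn := inH_neq0 _ HZ).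
 assert (H0 : t_ 0 (Zact ZS Z) <> C0) by (rewrite th0_S by auto; repeat apply Cmul_neq0; auto).
 set (W := Zact ZS Z) in *. assert (HW : inH (m11 W)) by (apply inH_S; auto). assert (HWn := inH_neq0 _ HW).
 pose proof (th0_S _ (inH_S W HW)) as E. rewrite Zact_SS, th0_even in E by auto.
 rewrite Th_S in E by auto. rewrite Zact_S in E by auto. cbn [m11] in E.
 replace (C * C * ZtoC D)%C with (ZtoC (-1) * (C * (ZtoC (-1) / m11 W) * (C * m11 W * ZtoC D * t_ 0 W)) / t_ 0 W)%C by (field; auto).
 rewrite <- E. field. auto.
Qed.

(** The matrix identity S T S = T^(-1) S T^(-1), evaluated on [th 0] in both ways at a point where
    [Th] does not vanish. *)
Lemma C_Gs1 : (C * GS 1)%C = C1.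
Proof.
 destruct Th_nonzero as [Z0 [HZ0 Hnz]].
 set (Z := Zact (ZT 1) Z0). assert (HZ : inH (m11 Z)) by (apply inH_T; auto).
 assert (EZ0 : Zact (ZT (-1)) Z = Z0).
 { unfold Z. rewrite !Zact_T. destruct Z0 as [w1 w2 w3 w4]. apply M2_eq; mcbn; auto. ring. }
 assert (Hn := inH_neq0 _ HZ). assert (Hn0 := inH_neq0 _ HZ0).
 assert (Et : (m11 Z - C1)%C = m11 Z0) by (unfold Z; rewrite Zact_T; cbn [m11]; ring).
 assert (H1 : inH (m11 (Zact (ZT 1) (Zact ZS Z)))) by (apply inH_T, inH_S; auto).
 pose proof (th0_S _ H1) as E1.
 rewrite (Th_TS 1 1 Z HZ) in E1 by (exists 0%Z; reflexivity). change (- (1))%Z with (-1)%Z in E1. rewrite EZ0 in E1.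
 assert (E2 : t_ 0 (Zact ZS (Zact (ZT 1) (Zact ZS Z))) = t_ 0 (Zact ZS Z0)).
 { assert (Ea : Zact ZS (Zact (ZT 1) (Zact ZS Z)) = Zact (Zmul ZS (Zmul (ZT 1) ZS)) Z)
   by (rewrite !Zact_mul; auto; try reflexivity; apply inH_S; auto).
  assert (Eb : Zact (ZT (-1)) (Zact ZS (Zact (ZT (-1)) Z)) = Zact (Zmul (ZT (-1)) (Zmul ZS (ZT (-1)))) Z)
   by (rewrite !Zact_mul; auto; try reflexivity; apply inH_T; auto).
  rewrite EZ0 in Eb.
  replace (t_ 0 (Zact ZS Z0)) with (t_ 0 (Zact (ZT (-1)) (Zact ZS Z0))).
  - rewrite Ea, Eb. reflexivity.
  - rewrite th_T by (apply inH_S; auto). replace (-1 * (0 * 0))%Z with 0%Z by ring. rewrite (zeta_0 D HD). ring. }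
 rewrite E2, th0_S in E1 by auto. rewrite Zact_T in E1. cbn [m11] in E1. rewrite Zact_S in E1 by auto. cbn [m11] in E1.
 replace (C * (ZtoC (-1) / m11 Z + ZtoC 1) * (C * m11 Z * GS 1 * TH Z0))%C
  with (C * (m11 Z - C1) * (C * GS 1) * TH Z0)%C in E1 by (field; auto).
 rewrite Et in E1.
 replace (C * GS 1)%C with ((C * m11 Z0 * (C * GS 1) * TH Z0) / (C * m11 Z0 * TH Z0))%C by (field; auto).
 rewrite <- E1. field. auto.
Qed.

Lemma Gs1_sqr : (GS 1 * GS 1)%C = (- ZtoC D)%C.
Proof.
 pose proof C_Gs1 as E1. pose proof C_sqr as E2.
 replace (GS 1 * GS 1)%C with (ZtoC (-1) * (ZtoC (-1)) * (GS 1 * GS 1))%C by ring.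
 rewrite <- E2 at 1. replace (C * C * ZtoC D * ZtoC (-1) * (GS 1 * GS 1))%C with ((C * GS 1) * (C * GS 1) * (- ZtoC D))%C by ring.
 rewrite E1. ring.
Qed.

(** A number whose square is the negative real -D is purely imaginary. *)
Lemma Gs1_conj : Cconj (GS 1) = (- GS 1)%C.
Proof.
 pose proof Gs1_sqr as E. assert (E1 := f_equal Re E). assert (E2 := f_equal Im E). simpl in E1, E2.
 assert (IZR D > 0) by (apply Rlt_gt, IZR_lt; auto).
 assert (Hr : Re (GS 1) = 0).
 { destruct (Rmult_integral (Re (GS 1)) (Im (GS 1))) as [h|h]; [lra|auto|].
  rewrite h in E1. pose proof (Rle_0_sqr (Re (GS 1))) as h2. unfold Rsqr in h2. lra. }
 apply Cx_eq; simpl; lra.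
Qed.

(** Were -1 congruent to s^2, the substitution y -> s y would give G(-1) = G(1); but G(-1) is the
    conjugate of G(1), hence -G(1), and G(1) is not zero. *)
Lemma m1_nonsquare s : ~ (D | s * s + 1)%Z.
Proof.
 intros H. assert (Hs : ~ (D | s)%Z).
 { intros [j Hj]. destruct H as [k Hk]. apply (ndiv_1 D HD).
  exists (k - j * s)%Z. rewrite Z.mul_sub_distr_r, <- Hk. rewrite Hj at 1. ring. }
 pose proof (Gs_sq D HD 1 s Hs) as E. rewrite (Gs_per D HD (1 * (s * s))%Z (-1)%Z) in E
  by (replace (1 * (s * s) - -1)%Z with (s * s + 1)%Z by ring; auto).
 change (-1)%Z with (- (1))%Z in E. rewrite Gs_opp, Gs1_conj in E.
 assert (E0 : GS 1 = C0).
 { replace (GS 1) with ((GS 1 - - GS 1) / ZtoC 2)%C by field. rewrite E. field. }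
 pose proof C_Gs1 as E1. rewrite E0 in E1. apply C1_neq_C0. rewrite <- E1. ring.
Qed.

Lemma Gs_chi n : ~ (D | n)%Z -> GS n = (ZtoC (chiK D n) * GS 1)%C.
Proof.
 intros Hn. destruct (sq_or_neg D HD m1_nonsquare n) as [x [Hx|Hx]].
 - assert (hx : ~ (D | x)%Z) by (intros [j Hj]; destruct Hx as [k Hk]; apply Hn; exists (k + j * x)%Z; lia).
  rewrite (chi_sq D HD n x), (Gs_per D HD n (1 * (x * x))%Z) by (auto; now rewrite Z.mul_1_l).
  rewrite Gs_sq by auto. ring.
 - assert (hx : ~ (D | x)%Z) by (intros [j Hj]; destruct Hx as [k Hk]; apply Hn; exists (k - j * x)%Z; lia).
  rewrite (chi_nsq D HD m1_nonsquare n x), (Gs_per D HD n (- (1) * (x * x))%Z) by (auto; replace (n - - (1) * (x * x))%Z with (n + x * x)%Z by ring; auto).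
  rewrite Gs_sq, Gs_opp, Gs1_conj by auto. ring.
Qed.

(** The bottom row (c, d) modulo D decides: for D | c the function returns to itself with the
    character chi(d), otherwise it becomes a translate of [Th] by n = d/c modulo D. The two
    statements must be proved together, since right multiplication by S exchanges the cases. *)
Theorem th0_SL2 g : Zdet g = 1%Z -> forall Z, inH (m11 Z) ->
 ((D | m21 g)%Z -> t_ 0 (Zact g Z) = (Zj g Z * ZtoC (chiK D (m22 g)) * t_ 0 Z)%C) /\
 (~ (D | m21 g)%Z -> forall n, (D | m22 g - m21 g * n)%Z ->
  t_ 0 (Zact g Z) = (Zj g Z * ZtoC (chiK D (m21 g)) * C * TH (Zact (ZT n) Z))%C).
Proof.
 intros Hg0. pose proof m1_nonsquare as Hns. pattern g. apply SL2_ind; auto; clear g Hg0.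
 - intros Z HZ. rewrite Zact_id. split.
  + intros _. cbn [Zid m22]. rewrite (chi_1 D HD). unfold Zj, Zid; cbn [m21 m22]. ring.
  + intros H. exfalso. apply H. exists 0%Z. reflexivity.
 - intros g Hg IH Z HZ. destruct (IH _ (inH_S Z HZ)) as [IH1 IH2].
  assert (Ej : (Zj g (Zact ZS Z) * m11 Z)%C = Zj (Zmul g ZS) Z).
  { rewrite Zj_mul by (auto; reflexivity). f_equal. unfold Zj, ZS; cbn [m21 m22]. ring. }
  rewrite Zact_mul by (auto; rewrite ?Hg; reflexivity).
  assert (Ec : m21 (Zmul g ZS) = m22 g) by (unfold Zmul, ZS; mcbn; ring).
  assert (Ed : m22 (Zmul g ZS) = (- m21 g)%Z) by (unfold Zmul, ZS; mcbn; ring).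
  rewrite Ec, Ed, <- Ej. unfold Zdet in Hg. split.
  + intros Hd. assert (Hc : ~ (D | m21 g)%Z).
   { intros [j Hj]. destruct Hd as [i Hi]. apply (ndiv_1 D HD).
    exists (m11 g * i - m12 g * j)%Z. rewrite <- Hg, Hi, Hj. ring. }
   rewrite (IH2 Hc 0%Z) by (rewrite Z.mul_0_r, Z.sub_0_r; auto).
   rewrite Zact_T0, Th_S, (chi_opp D HD Hns), ZtoC_opp by auto.
    replace (Zj g (Zact ZS Z) * ZtoC (chiK D (m21 g)) * C * (C * m11 Z * ZtoC D * t_ 0 Z))%C
     with (Zj g (Zact ZS Z) * m11 Z * ZtoC (chiK D (m21 g)) * (C * C * ZtoC D) * t_ 0 Z)%C by ring.
   rewrite C_sqr. ring.
  + intros Hd n Hn. destruct (Zdivide_dec D (m21 g)) as [Hc|Hc].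
   * rewrite (IH1 Hc), th0_S by auto.
    rewrite (Th_T_per n 0); [rewrite Zact_T0; ring|].
    rewrite Z.sub_0_r. destruct Hc as [j Hj], Hn as [i Hi].
    assert (Hdn : (D | m22 g * n)%Z) by (exists (- i - j)%Z; lia).
     destruct (D_div_mul D HD _ _ Hdn); tauto.
   * destruct (inv_mod D HD _ Hc) as [c' [k Hk]].
    (* Here r is d/c modulo D and n is -c/d, so [Th_TS] applies with r and -n; chi(c) chi(r) =
       chi(d) and C G(1) = 1 then give the constant. *)
    set (r := (m22 g * c')%Z).
    assert (Hr : (D | m22 g - m21 g * r)%Z) by (exists (- (m22 g * k))%Z; unfold r; replace (m22 g - m21 g * (m22 g * c'))%Z with (- m22 g * (m21 g * c' - 1))%Z by ring; rewrite Hk; ring).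
    rewrite (IH2 Hc r Hr).
    assert (Hrn : (D | r * - n - 1)%Z).
    { destruct Hn as [i Hi]. exists (c' * i + k)%Z. unfold r.
     replace (m22 g * c' * - n - 1)%Z with (c' * (- m21 g - m22 g * n) + (m21 g * c' - 1))%Z by ring.
     rewrite Hi, Hk. ring. }
    rewrite (Th_TS r (- n)%Z Z HZ Hrn), Z.opp_involutive.
    assert (Hrd : ~ (D | r)%Z).
    { clearbody r. intros [j Hj]. destruct Hr as [i Hi]. apply Hd. exists (i + m21 g * j)%Z. rewrite Hj in Hi. lia. }
    rewrite (Gs_chi r Hrd). rewrite <- (chi_per D HD Hns (m21 g * r) (m22 g)), (chi_mul D HD Hns), ZtoC_mul.
    -- replace (Zj g (Zact ZS Z) * ZtoC (chiK D (m21 g)) * C * (C * m11 Z * (ZtoC (chiK D r) * GS 1) * TH (Zact (ZT n) Z)))%C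
      with (Zj g (Zact ZS Z) * m11 Z * (ZtoC (chiK D (m21 g)) * ZtoC (chiK D r)) * C * (C * GS 1) * TH (Zact (ZT n) Z))%C by ring.
     rewrite C_Gs1. ring.
    -- destruct Hr as [i Hi]. exists (- i)%Z. lia.
 - intros g m Hg IH Z HZ. destruct (IH _ (inH_T m Z HZ)) as [IH1 IH2].
  assert (HT : Zdet (ZT m) = 1%Z) by (unfold Zdet, ZT; mcbn; ring).
  assert (Ej : Zj g (Zact (ZT m) Z) = Zj (Zmul g (ZT m)) Z).
  { rewrite Zj_mul by (auto; rewrite HT; reflexivity). replace (Zj (ZT m) Z) with C1; [ring|]. unfold Zj, ZT; cbn [m21 m22]. ring. }
  rewrite Zact_mul by (auto; rewrite ?Hg, ?HT; reflexivity). rewrite <- Ej.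
  assert (Ec : m21 (Zmul g (ZT m)) = m21 g) by (unfold Zmul, ZT; mcbn; ring).
  assert (Ed : m22 (Zmul g (ZT m)) = (m21 g * m + m22 g)%Z) by (unfold Zmul, ZT; mcbn; ring).
  rewrite Ec, Ed. split.
  + intros Hc. rewrite (IH1 Hc), th_T by auto. replace (m * (0 * 0))%Z with 0%Z by ring. rewrite (zeta_0 D HD).
   rewrite (chi_per D HD Hns (m21 g * m + m22 g) (m22 g)); [ring|]. destruct Hc as [j Hj]. exists (j * m)%Z. rewrite Hj. ring.
  + intros Hc n Hn. rewrite (IH2 Hc (n - m)%Z).
   * do 2 f_equal. rewrite !Zact_T. apply M2_eq; mcbn; auto. rewrite ZtoC_sub. ring.
   * destruct Hn as [i Hi]. exists i. lia.
Qed.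
End ThetaSL2.

(** * Cusp forms *)

Definition nser (a : nat -> Cx) (t : Cx) (n : nat) : Cx := (a n * e (ZtoC (Z.of_nat n) * t)%C)%C.

Lemma cusp_expansion (h : Cx -> Cx) : holo1 h -> (forall t, inH t -> h (t + C1)%C = h t) ->
 (forall eps, 0 < eps -> exists Y, forall t, inH t -> Y < Im t -> Cabs (h t) < eps) ->
 exists a : nat -> Cx, a 0%nat = C0 /\
  (forall t, inH t -> ASum (nser a t) (h t)) /\
  (forall n y M, 0 < y -> (forall x, 0 <= x <= 1 -> Cabs (h (mkC x y)) <= M) ->
   Cabs (a n) <= 2 * M * exp (2 * PI * INR n * y)).
Proof.
 intros Hh Hp Hc. destruct (fourier_H h Hh Hp) as [a [Ha Hb]].
 (* For n <= 0 the coefficient is at most twice the supremum of |h| at height y, which tends to 0 as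
    y grows. *)
 assert (H0 : forall n, (n <= 0)%Z -> a n = C0).
 { intros n Hn. apply Cabs_eq0, Rle_antisym; [|apply Cabs_pos]. apply le_epsilon. intros eps He.
  destruct (Hc (eps / 2)) as [Y HY]; [lra|].
  set (y := Rmax 1 (Y + 1)). assert (1 <= y) by apply Rmax_l. assert (Y + 1 <= y) by apply Rmax_r.
  assert (K : Cabs (a n) <= 2 * (eps / 2) * exp (2 * PI * IZR n * y)).
  { apply Hb; [lra|]. intros x _. left. apply HY; unfold inH; simpl; lra. }
  assert (exp (2 * PI * IZR n * y) <= 1).
  { rewrite <- exp_0. apply exp_le_mono. apply IZR_le in Hn. pose proof PI_RGT_0.
   assert (0 <= 2 * PI * y) by nra. nra. }
  nra. }
 exists (fun n => a (Z.of_nat n)). split; [apply H0; lia|]. split.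
 - intros t Ht. destruct (Ha t Ht) as [A1 A2]. split.
  + apply (AbsSum_inj Z.of_nat _ Nat2Z.inj A1).
  + apply (HasSum_inj Z.of_nat _ _ Nat2Z.inj) in A2; auto.
   intros i Hi. rewrite (H0 i); [ring|]. destruct (Z_le_gt_dec i 0); auto.
   exfalso. apply (Hi (Z.to_nat i)). apply Z2Nat.id. lia.
 - intros n y M Hy HM. rewrite INR_IZR_INZ. apply Hb; auto.
Qed.

(** Each term decreases in absolute value as Im t grows, so the absolute sum at height y0 bounds the
    function on the whole half-plane above it. *)
Lemma nser_bounded (a : nat -> Cx) (h : Cx -> Cx) y0 : 0 < y0 ->
 (forall t, inH t -> ASum (nser a t) (h t)) ->
 exists B, forall t, y0 <= Im t -> Cabs (h t) <= B.
Proof.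
 intros Hy H. destruct (H (mkC 0 y0) Hy) as [[B HB] _]. exists B. intros t Ht.
 destruct (H t ltac:(unfold inH; lra)) as [_ HS]. apply (HasSum_le _ _ B HS).
 intros L HL. eapply Rle_trans; [|apply (HB L HL)]. apply Rsum_le. intros n _.
 unfold nser. rewrite !Cabs_mul, !Cabs_e_ZtoC. apply Rmult_le_compat_l; [apply Cabs_pos|].
 apply exp_le_mono. simpl. pose proof PI_RGT_0. rewrite <- INR_IZR_INZ. pose proof (pos_INR n).
 assert (0 <= 2 * PI * INR n) by nra. nra.
Qed.

Lemma HasSum_nat_Cconv (f : nat -> Cx) s : HasSum f s -> Cconv (fun n => Csum (map f (seq 0 n))) s.
Proof.
 intros H. apply (HasSum_Cconv _ _ (fun n => seq 0 n) H); [intros; apply seq_NoDup|].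
 intros i. exists (S i). intros n Hn. apply in_seq. lia.
Qed.

Lemma qexp_nser f a : (forall t, inH t -> HasSum (nser a t) (f t)) -> qexp f a.
Proof.
 intros H t Ht. pose proof (HasSum_nat_Cconv _ _ (H t Ht)) as K2.
 intros eps He. destruct (K2 eps He) as [N HN]. exists N. intros n Hn. specialize (HN n Hn).
 erewrite map_ext; [exact HN|]. intros i. unfold nser. now rewrite RtoC_INR_Z.
Qed.

(** [qexp] only asserts convergence of ordered partial sums. Convergence at half the height bounds
    the terms there, and doubling the height contributes a geometric factor. *)
Lemma qexp_AbsSum f a : qexp f a -> forall t, inH t -> ASum (nser a t) (f t).
Proof.
 intros H t Ht. unfold inH in Ht. pose proof PI_RGT_0.
 assert (HA : AbsSum (nser a t)).
 { set (t2 := mkC 0 (Im t / 2)). destruct (H t2 ltac:(unfold inH; simpl; lra) 1 Rlt_0_1) as [N HN].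
  set (s := fun n => Csum (map (fun n => (a n * e (RtoC (INR n) * t2)%C)%C) (seq 0 n))) in *.
  assert (Hterm : forall n, (N <= n)%nat -> Cabs (a n * e (RtoC (INR n) * t2)%C)%C <= 2).
  { intros n Hn. assert (Es : s (S n) = (s n + a n * e (RtoC (INR n) * t2)%C)%C).
   { unfold s. rewrite seq_S, map_app, Csum_app. simpl. ring. }
   replace (a n * e (RtoC (INR n) * t2)%C)%C with ((s (S n) - f t2) - (s n - f t2))%C by (rewrite Es; ring).
   eapply Rle_trans; [apply Cabs_sub_le|]. pose proof (HN n Hn). pose proof (HN (S n) ltac:(lia)). unfold s in *. lra. }
  set (M := 2 + Rsum (map (fun n => Cabs (a n * e (RtoC (INR n) * t2)%C)%C) (seq 0 N))).
  assert (HM : forall n, Cabs (a n * e (RtoC (INR n) * t2)%C)%C <= M).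
  { intros n. unfold M. pose proof (Rsum_nonneg (fun n => Cabs (a n * e (RtoC (INR n) * t2)%C)%C) (seq 0 N) (fun _ => Cabs_pos _)).
   destruct (le_lt_dec N n) as [h|h]; [specialize (Hterm n h); lra|].
   pose proof (Rsum_ge_In (fun n => Cabs (a n * e (RtoC (INR n) * t2)%C)%C) (seq 0 N) n (fun _ => Cabs_pos _) ltac:(apply in_seq; lia)).
   simpl in H2. lra. }
  set (r := exp (- (PI * Im t))).
  assert (Hr : 0 <= r < 1).
  { unfold r. split; [left; apply exp_pos|]. rewrite <- exp_0. apply exp_increasing. nra. }
  apply AbsSum_le with (1 := AbsSum_geom_nat r Hr) (K := M). intros n.
  rewrite Cabs_RtoC, (Rabs_right (r ^ n)) by (apply Rle_ge, pow_le; lra).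
  specialize (HM n). rewrite Cabs_mul in HM. unfold nser. rewrite Cabs_mul. rewrite RtoC_INR_Z, Cabs_e_ZtoC in HM.
  rewrite Cabs_e_ZtoC. unfold t2 in HM. simpl in HM.
  assert (Er : exp (- (2 * PI * IZR (Z.of_nat n) * Im t)) = exp (- (2 * PI * IZR (Z.of_nat n) * (Im t / 2))) * r ^ n).
  { unfold r. rewrite <- INR_IZR_INZ. replace (exp (- (PI * Im t)) ^ n) with (exp (INR n * - (PI * Im t))).
   - rewrite <- exp_plus. f_equal. field.
   - clear. induction n; [simpl; rewrite Rmult_0_l; apply exp_0|].
    rewrite S_INR, Rmult_plus_distr_r, exp_plus, IHn, Rmult_1_l. simpl. ring. }
  rewrite Er, <- Rmult_assoc. apply Rmult_le_compat_r; [apply pow_le; lra|auto]. }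
 split; auto. destruct (AbsSum_HasSum _ HA) as [s Hs].
 replace (f t) with s; auto.
 pose proof (HasSum_nat_Cconv _ _ Hs) as K2.
 apply Cx_eq_eps. intros eps He. destruct (K2 (eps / 2)) as [N1 HN1]; [lra|].
 destruct (H t Ht (eps / 2)) as [N2 HN2]; [lra|].
 specialize (HN1 (N1 + N2)%nat ltac:(lia)). specialize (HN2 (N1 + N2)%nat ltac:(lia)).
 erewrite map_ext in HN2; [|intros i; rewrite RtoC_INR_Z; reflexivity].
 fold (nser a t) in HN2. change (fun n => (a n * e (ZtoC (Z.of_nat n) * t)%C)%C) with (nser a t) in HN2.
 set (S0 := Csum (map (nser a t) (seq 0 (N1 + N2)))) in *.
 replace (s - f t)%C with ((S0 - f t) - (S0 - s))%C by ring.
 eapply Rle_trans; [apply Cabs_sub_le|]. lra.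
Qed.

Lemma qexp_unique f a b : qexp f a -> qexp f b -> forall n, a n = b n.
Proof.
 intros Ha Hb n.
 set (ext := fun (c : nat -> Cx) (z : Z) => if Z_le_gt_dec 0 z then c (Z.to_nat z) else C0).
 assert (K : forall c, qexp f c -> forall t, inH t -> ASum (fun n => (ext c n * e (ZtoC n * t)%C)%C) (f t)).
 { intros c Hc t Ht. apply (ASum_inj_conv Z.of_nat).
  - apply Nat2Z.inj.
  - intros i Hi. unfold ext. destruct (Z_le_gt_dec 0 i); [|ring].
   exfalso. apply (Hi (Z.to_nat i)). apply Z2Nat.id. auto.
  - eapply ASum_ext; [|apply (qexp_AbsSum f c Hc t Ht)]. intros i. unfold ext, nser.
   destruct (Z_le_gt_dec 0 (Z.of_nat i)); [|lia]. now rewrite Nat2Z.id. }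
 pose proof (Zseries_uniq _ _ f (K a Ha) (K b Hb) (Z.of_nat n)) as E. unfold ext in E.
 destruct (Z_le_gt_dec 0 (Z.of_nat n)); [|lia]. now rewrite Nat2Z.id in E.
Qed.

Definition mob (g : M2 Z) (t : Cx) : Cx := mobius (m11 g) (m12 g) (m21 g) (m22 g) t.
Definition jf (g : M2 Z) (t : Cx) : Cx := (ZtoC (m21 g) * t + ZtoC (m22 g))%C.
Definition zt0 (t : Cx) : M2 Cx := mkM2 t C0 C0 C0.
Lemma mob_Zact g t : mob g t = m11 (Zact g (zt0 t)).
Proof. reflexivity. Qed.
Lemma jf_Zj g t : jf g t = Zj g (zt0 t).
Proof. reflexivity. Qed.
Lemma Zact_mob g Z : m11 (Zact g Z) = mob g (m11 Z).
Proof. reflexivity. Qed.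
Lemma mob_inH g t : (0 < Zdet g)%Z -> inH t -> inH (mob g t).
Proof. intros. rewrite mob_Zact. apply Zact_inH; auto. Qed.
Lemma jf_neq0 g t : (0 < Zdet g)%Z -> inH t -> jf g t <> C0.
Proof. intros. rewrite jf_Zj. apply Zj_neq0; auto. Qed.
Lemma mob_mul g h t : (0 < Zdet g)%Z -> (0 < Zdet h)%Z -> inH t -> mob (Zmul g h) t = mob g (mob h t).
Proof. intros. rewrite !mob_Zact, Zact_mul by auto. reflexivity. Qed.
Lemma jf_mul g h t : (0 < Zdet h)%Z -> inH t -> jf (Zmul g h) t = (jf g (mob h t) * jf h t)%C.
Proof. intros. rewrite !jf_Zj, Zj_mul by auto. reflexivity. Qed.
Lemma mob_id t : mob Zid t = t.
Proof. rewrite mob_Zact, Zact_id. reflexivity. Qed.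
Lemma mob_T n t : mob (ZT n) t = (t + ZtoC n)%C.
Proof. rewrite mob_Zact, Zact_T. reflexivity. Qed.
Lemma Im_mob g t : (0 < Zdet g)%Z -> inH t -> Im (mob g t) * Cnorm2 (jf g t) = IZR (Zdet g) * Im t.
Proof.
 intros Hg Ht. pose proof (jf_neq0 g t Hg Ht) as Hj. unfold mob, mobius, jf in *.
 rewrite Im_mobius by auto. unfold Zdet. field. intros E. apply Hj, Cnorm2_eq0, E.
Qed.

Definition Gam0 (N : Z) (g : M2 Z) : Prop := Zdet g = 1%Z /\ (N | m21 g)%Z.

(** * Growth of cusp forms and of their coefficients *)

Section CuspForm.
Context (D : Z) (HD : prime D) (w : nat) (N : Z) (HN : (0 < N)%Z) (HDN : (D | N)%Z).
Context (f : Cx -> Cx) (Hf : is_cusp_form D w N f).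
Context (Hns : forall s, ~ (D | s * s + 1)%Z).

Lemma cusp_mod g t : Gam0 N g -> inH t ->
 f (mob g t) = (ZtoC (chiK D (m22 g)) * (Cpow (jf g t) w * f t))%C.
Proof.
 intros [Hg Hc] Ht. destruct Hf as [_ [H _]]. unfold mob, jf. apply H; auto.
Qed.

Lemma cusp_periodic t : inH t -> f (t + C1)%C = f t.
Proof.
 intros Ht. pose proof (cusp_mod (ZT 1) t) as K. rewrite mob_T in K. change (ZtoC 1) with C1 in K.
 rewrite K; auto.
 - cbn [ZT m22]. rewrite (chi_1 D HD). unfold jf, ZT; cbn [m21 m22].
  replace (ZtoC 0 * t + ZtoC 1)%C with C1 by ring. rewrite Cpow_1_l. ring.
 - split; [reflexivity|exists 0%Z; reflexivity].
Qed.

Lemma cusp_nser : exists a : nat -> Cx, a 0%nat = C0 /\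
  (forall t, inH t -> ASum (nser a t) (f t)) /\
  (forall n y M, 0 < y -> (forall x, 0 <= x <= 1 -> Cabs (f (mkC x y)) <= M) ->
   Cabs (a n) <= 2 * M * exp (2 * PI * INR n * y)).
Proof.
 apply cusp_expansion; [apply Hf|apply cusp_periodic|].
 intros eps He. destruct Hf as [_ [_ H]]. destruct (H 1%Z 0%Z 0%Z 1%Z ltac:(reflexivity) eps He) as [Y HY].
 exists Y. intros t Ht Hy. specialize (HY t Ht Hy).
 replace (mobius 1 0 0 1 t) with t in HY by (symmetry; apply (mob_id t)).
 replace (ZtoC 0 * t + ZtoC 1)%C with C1 in HY by ring. rewrite Cpow_1_l in HY.
 replace (f t / C1)%C with (f t) in HY by field. auto.
Qed.

(** If the bottom rows agree modulo N, then g g0^(-1) is in Gamma_0(N) with lower right entry 1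
    modulo D, where the character is trivial. So a translate of f depends, up to the automorphy
    factor, only on finitely many data. *)
Lemma cusp_cong g g0 t : Zdet g = 1%Z -> Zdet g0 = 1%Z -> (N | m21 g - m21 g0)%Z -> (N | m22 g - m22 g0)%Z ->
 inH t -> f (mob g t) = (Cpow (jf g t / jf g0 t) w * f (mob g0 t))%C.
Proof.
 intros Hg H0 [k3 K3] [k4 K4] Ht. set (dl := Zmul g (Zadj g0)).
 assert (Hdl : Zdet dl = 1%Z) by (unfold dl; rewrite Zdet_mul, Zdet_adj, Hg, H0; reflexivity).
 assert (Edl : Zmul dl g0 = g) by (unfold dl; rewrite <- Zmul_assoc, Zadj_l, Zmul_1_r; auto).
 assert (Hdl2 : Gam0 N dl).
 { split; auto. exists (k3 * m22 g0 - k4 * m21 g0)%Z.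
  unfold dl, Zmul, Zadj; mcbn. transitivity (m22 g0 * (k3 * N) - m21 g0 * (k4 * N))%Z; [|ring].
  rewrite <- K3, <- K4. ring. }
 assert (Hdl3 : (D | m22 dl - 1)%Z).
 { destruct HDN as [j Hj]. exists (j * (k4 * m11 g0 - k3 * m12 g0))%Z. rewrite <- H0.
  unfold dl, Zmul, Zadj, Zdet; mcbn. transitivity (m11 g0 * (k4 * (j * D)) - m12 g0 * (k3 * (j * D)))%Z; [|ring].
  rewrite <- Hj, <- K3, <- K4. ring. }
 assert (P2 : (0 < Zdet dl)%Z) by lia. assert (P0 : (0 < Zdet g0)%Z) by lia.
 pose proof (jf_neq0 g0 t P0 Ht). rewrite <- Edl, mob_mul, jf_mul, (cusp_mod dl) by (auto; apply mob_inH; auto).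
 rewrite (chi_per D HD Hns (m22 dl) 1 Hdl3), (chi_1 D HD). change (ZtoC 1) with C1.
 replace (jf dl (mob g0 t) * jf g0 t / jf g0 t)%C with (jf dl (mob g0 t)) by (field; auto). ring.
Qed.

(* Each translate of [f] has an expansion in [q^(1/N)] without constant term. *)
Lemma cusp_translate_bound g : Zdet g = 1%Z -> exists B, forall t, / 2 <= Im t ->
 Cabs (f (mob g t)) <= B * Cabs (jf g t) ^ w.
Proof.
 intros Hg. assert (Hg0 : (0 < Zdet g)%Z) by lia.
 pose proof (IZR_lt _ _ HN) as PN.
 set (h := fun t => (f (mob g (ZtoC N * t)) * Cinv (Cpow (jf g (ZtoC N * t)) w))%C).
 assert (HNt : forall t, inH t -> inH (ZtoC N * t)%C) by (intros t Ht; unfold inH in *; simpl; nra).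
 assert (Hh : holo1 h).
 { intros t Ht. change (cdiff h t). pose proof (HNt t Ht) as Ht'.
  assert (Hjd : cdiff (fun t => jf g (ZtoC N * t)%C) t).
  { exists (ZtoC (m21 g) * ZtoC N)%C. apply cderiv_lin. intros; unfold jf; ring. }
  assert (Hjp : forall n, cdiff (fun t => Cpow (jf g (ZtoC N * t)%C) n) t).
  { induction n; simpl; [exists C0; apply cderiv_const|apply cdiff_mul; auto]. }
  unfold h. apply cdiff_mul.
  - apply (cdiff_comp f (fun t => mob g (ZtoC N * t)%C)).
   + destruct Hf as [Hh _]. destruct (Hh (mob g (ZtoC N * t)%C)) as [c Hc]; [apply mob_inH; auto|]. exists c. exact Hc.
   + unfold mob, mobius, Cdiv. apply cdiff_mul.
    * exists (ZtoC (m11 g) * ZtoC N)%C. apply cderiv_lin. intros; ring.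
    * apply (cdiff_comp Cinv (fun t => jf g (ZtoC N * t)%C)); auto.
     eexists. apply cderiv_Cinv, jf_neq0; auto.
  - apply (cdiff_comp Cinv (fun t => Cpow (jf g (ZtoC N * t)%C) w)); auto.
   eexists. apply cderiv_Cinv, Cpow_neq0, jf_neq0; auto. }
 assert (Hp : forall t, inH t -> h (t + C1)%C = h t).
 { intros t Ht. pose proof (HNt t Ht) as Ht'. unfold h.
  replace (ZtoC N * (t + C1))%C with (mob (ZT N) (ZtoC N * t)) by (rewrite mob_T; ring).
  set (u := (ZtoC N * t)%C) in *.
  assert (HT : Zdet (ZT N) = 1%Z) by (unfold Zdet, ZT; mcbn; ring).
  assert (P1 : (0 < Zdet (ZT N))%Z) by lia.
  assert (Ej : jf (Zmul g (ZT N)) u = jf g (mob (ZT N) u)).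
  { rewrite jf_mul by auto. unfold jf, ZT; cbn [m21 m22]. ring. }
  rewrite <- mob_mul, (cusp_cong (Zmul g (ZT N)) g) by
   (rewrite ?Zdet_mul, ?Hg, ?HT; auto; try reflexivity; unfold Zmul, ZT; mcbn; first [exists 0%Z; ring|exists (m21 g); ring]).
  rewrite Ej. pose proof (jf_neq0 g u Hg0 Ht') as J1. pose proof (jf_neq0 g _ Hg0 (mob_inH _ u P1 Ht')) as J2.
  unfold Cdiv. rewrite Cpow_mul. pose proof (Cpow_neq0 _ w J1). pose proof (Cpow_neq0 _ w J2).
  rewrite (Cpow_inv (jf g u)) by auto. field. auto. }
 destruct (cusp_expansion h Hh Hp) as [a [_ [Ha _]]].
 { intros eps He. destruct Hf as [_ [_ H]].
  destruct (H (m11 g) (m12 g) (m21 g) (m22 g) Hg eps He) as [Y HY].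
  exists (Y / IZR N). intros t Ht Hy. apply (HY (ZtoC N * t)%C (HNt t Ht)). simpl.
  apply Rlt_div_l in Hy; lra. }
 destruct (nser_bounded a h (/ (2 * IZR N))) as [B HB].
 - apply Rinv_0_lt_compat. lra.
 - exact Ha.
 - exists B. intros t Ht.
  assert (Hn := ZtoC_neq0 N ltac:(lia)).
  set (t' := (RtoC (/ IZR N) * t)%C).
  assert (Et : (ZtoC N * t')%C = t) by (unfold t'; rewrite RtoC_inv by lra; fold (ZtoC N); field; auto).
  assert (HBt : Cabs (h t') <= B).
  { apply HB. unfold t'. simpl. replace (/ (2 * IZR N)) with (/ IZR N * / 2) by (field; lra).
   assert (0 < / IZR N) by (apply Rinv_0_lt_compat; lra). nra. }
  unfold h in HBt. rewrite Et in HBt.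
  assert (HtH : inH t) by (unfold inH; lra).
  pose proof (jf_neq0 g t Hg0 HtH) as Hj. pose proof (Cabs_gt0 _ Hj).
  rewrite Cabs_mul, Cabs_inv, Cabs_pow in HBt by (apply Cpow_neq0; auto).
  assert (0 < Cabs (jf g t) ^ w) by (apply pow_lt; auto).
  apply Rmult_le_compat_r with (r := Cabs (jf g t) ^ w) in HBt; [|lra].
  rewrite Rmult_assoc, Rinv_l, Rmult_1_r in HBt; lra.
Qed.

Definition zr := map Z.of_nat (seq 0 (Z.to_nat N)).

(** [cusp_cong] reduces all translates to one representative for each class of bottom rows modulo N,
    and a finite sum of the corresponding bounds works for all. *)
Lemma cusp_uniform_bound : exists B, 0 <= B /\ forall g, Zdet g = 1%Z -> forall t, / 2 <= Im t ->
 Cabs (f (mob g t)) <= B * Cabs (jf g t) ^ w.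
Proof.
 set (L := list_prod zr zr). set (cls := fun g : M2 Z => (m21 g mod N, m22 g mod N)%Z).
 assert (HL : forall g, In (cls g) L).
 { intros g. assert (Hz : forall x, In (x mod N)%Z zr).
  { intros x. pose proof (Z.mod_pos_bound x N HN). unfold zr. apply in_map_iff. exists (Z.to_nat (x mod N)).
   split; [lia|]. apply in_seq. lia. }
  apply in_prod; auto. }
 assert (K : forall r, exists B, 0 <= B /\ forall g, cls g = r -> Zdet g = 1%Z -> forall t, / 2 <= Im t ->
  Cabs (f (mob g t)) <= B * Cabs (jf g t) ^ w).
 { intros r. destruct (classic (exists g0, cls g0 = r /\ Zdet g0 = 1%Z)) as [[g0 [E0 H0]]|Hn].
  2:{ exists 0. split; [lra|]. intros g Hg1 Hg2. exfalso. apply Hn. eauto. }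
  destruct (cusp_translate_bound g0 H0) as [B HB]. exists (Rabs B). split; [apply Rabs_pos|].
  intros g Eg Hg t Ht. assert (HtH : inH t) by (unfold inH; lra).
  assert (Ecls : cls g = cls g0) by congruence. unfold cls in Ecls.
  assert (Hcong : forall x y, (x mod N = y mod N)%Z -> (N | x - y)%Z).
  { intros x y E. apply Z.mod_divide; [lia|]. rewrite Zminus_mod, E, Z.sub_diag. apply Z.mod_0_l. lia. }
  injection Ecls as e3 e4. apply Hcong in e3, e4.
  pose proof (jf_neq0 g0 t ltac:(lia) HtH) as J. pose proof (Cabs_gt0 _ J) as PJ. pose proof (Rle_abs B).
  rewrite (cusp_cong g g0), Cabs_mul, Cabs_pow, Cabs_div by auto. specialize (HB t Ht).
  pose proof (Cabs_pos (jf g t)) as PX. set (X := Cabs (jf g t)) in *. set (Y := Cabs (jf g0 t)) in *.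
  replace (X ^ w) with ((X / Y) ^ w * Y ^ w) by (rewrite <- Rpow_mult_distr; f_equal; field; lra).
  assert (0 <= (X / Y) ^ w) by (apply pow_le, Rdiv_le_0_compat; lra). assert (0 <= Y ^ w) by (apply pow_le; lra).
  replace (Rabs B * ((X / Y) ^ w * Y ^ w)) with ((X / Y) ^ w * (Rabs B * Y ^ w)) by ring.
  apply Rmult_le_compat_l; nra. }
 assert (K2 : exists B, 0 <= B /\ forall r, In r L -> forall g, cls g = r -> Zdet g = 1%Z -> forall t, / 2 <= Im t ->
  Cabs (f (mob g t)) <= B * Cabs (jf g t) ^ w).
 { clear HL. induction L as [|r L [B [HB0 HB]]]; [exists 0; split; [lra|intros r []]|].
  destruct (K r) as [B' [HB'0 HB']]. exists (B + B'). split; [lra|].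
  intros r' [<-|Hr'] g Hg1 Hg2 t Ht; assert (0 <= Cabs (jf g t) ^ w) by (apply pow_le, Cabs_pos).
  - specialize (HB' g Hg1 Hg2 t Ht). nra.
  - specialize (HB r' Hr' g Hg1 Hg2 t Ht). nra. }
 destruct K2 as [B [HB0 HB]]. exists B. split; auto. intros g Hg t Ht. eapply HB; eauto.
Qed.

(** While Im t < 1/2, translate to |Re t| <= 1/2; then |t|^2 <= 1/2 and S at least doubles the
    height. The height 1/2, lower than that of the usual fundamental domain, makes the number of
    steps a logarithm to base 2. *)
Lemma SL2_reduce t : inH t -> exists g, Zdet g = 1%Z /\ / 2 <= Im (mob g t).
Proof.
 intros Ht.
 assert (K : forall n t, inH t -> / 2 <= Im t * 2 ^ n -> exists g, Zdet g = 1%Z /\ / 2 <= Im (mob g t)).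
 { clear. induction n; intros t Ht Hn.
  - exists Zid. split; [reflexivity|]. rewrite mob_id. simpl in Hn. lra.
  - destruct (Rle_dec (/ 2) (Im t)) as [h|h]; [exists Zid; split; [reflexivity|now rewrite mob_id]|].
   set (k := (up (Re t - / 2))%Z). destruct (archimed (Re t - / 2)) as [A1 A2]. fold k in A1, A2.
   set (t1 := mob (ZT (- k)) t). assert (E1 : t1 = (t + ZtoC (- k))%C) by apply mob_T.
   assert (HT : Zdet (ZT (- k)) = 1%Z) by (unfold Zdet, ZT; mcbn; ring).
   assert (Ht1 : inH t1) by (apply mob_inH; auto; lia).
   assert (I1 : Im t1 = Im t) by (rewrite E1; simpl; ring).
   assert (R1 : Rabs (Re t1) <= / 2) by (rewrite E1; unfold ZtoC; rewrite opp_IZR; simpl; apply Rabs_le; lra).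
   pose proof (Im_mob ZS t1 ltac:(reflexivity) Ht1) as E2.
   change (IZR (Zdet ZS)) with 1 in E2.
   replace (jf ZS t1) with t1 in E2 by (unfold jf, ZS; cbn [m21 m22]; ring).
   assert (N1 : Cnorm2 t1 <= / 2).
   { unfold Cnorm2. assert (Re t1 * Re t1 <= / 4).
    { rewrite <- (Rabs_right (Re t1 * Re t1)) by nra. rewrite Rabs_mult. pose proof (Rabs_pos (Re t1)). nra. }
    unfold inH in Ht. rewrite I1. nra. }
   assert (Ht2 : inH (mob ZS t1)) by (apply mob_inH; auto; reflexivity).
   assert (I2 : 2 * Im t <= Im (mob ZS t1)).
   { unfold inH in Ht2. rewrite I1 in E2. nra. }
   destruct (IHn (mob ZS t1) Ht2) as [g [Hg1 Hg2]].
   { simpl in Hn. assert (0 <= 2 ^ n) by (apply pow_le; lra). nra. }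
   exists (Zmul (Zmul g ZS) (ZT (- k))). split; [rewrite !Zdet_mul, Hg1, HT; reflexivity|].
   rewrite !mob_mul; auto; try (rewrite ?Zdet_mul, ?Hg1, ?HT; reflexivity). }
 unfold inH in Ht. destruct (Pow_x_infinity 2 ltac:(rewrite Rabs_right; lra) (/ 2 / Im t)) as [n Hn].
 specialize (Hn n (le_n n)). rewrite Rabs_right in Hn by (apply Rle_ge, pow_le; lra).
 apply (K n t Ht). apply Rge_le in Hn. apply Rmult_le_compat_l with (r := Im t) in Hn; [|lra].
 replace (Im t * (/ 2 / Im t)) with (/ 2) in Hn by (field; lra). auto.
Qed.

(** With t' = g t of height at least 1/2, the factor of g^(-1) at t' has squared absolute value Im
    t' / Im t, and Im t * Im t' <= 1: for c nonzero because |ct + d| >= Im t, for c = 0 because both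
    heights are Im t <= 1. The resulting exponent w, twice that of Hecke's estimate, is good
    enough. *)
Lemma cusp_growth : exists B, 0 <= B /\ forall t, inH t -> Im t <= 1 -> Cabs (f t) <= B * (/ Im t) ^ w.
Proof.
 destruct cusp_uniform_bound as [B [HB0 HB]]. exists B. split; auto. intros t Ht Ht1.
 destruct (SL2_reduce t Ht) as [g [Hg1 Hg2]].
 set (t' := mob g t) in *. assert (Ht' : inH t') by (unfold inH; lra).
 assert (Hg : (0 < Zdet g)%Z) by lia. assert (Hga : (0 < Zdet (Zadj g))%Z) by (rewrite Zdet_adj; lia).
 assert (Et : mob (Zadj g) t' = t) by (unfold t'; rewrite <- mob_mul, Zadj_l, mob_id; auto).
 specialize (HB (Zadj g) ltac:(rewrite Zdet_adj; auto) t' Hg2). rewrite Et in HB.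
 eapply Rle_trans; [apply HB|]. apply Rmult_le_compat_l; auto.
 apply pow_incr. split; [apply Cabs_pos|].
 unfold inH in Ht. assert (Pi : 0 < / Im t) by (apply Rinv_0_lt_compat; auto).
 apply Rsqr_incr_0_var; [|lra]. unfold Rsqr. rewrite Cabs_sqr.
 pose proof (Im_mob (Zadj g) t' Hga Ht') as E. rewrite Et, Zdet_adj, Hg1, Rmult_1_l in E.
 pose proof (Im_mob g t Hg Ht) as E2. fold t' in E2. rewrite Hg1, Rmult_1_l in E2.
 assert (Hi : Im t * / Im t = 1) by (apply Rinv_r; lra).
 assert (Hup : Im t * Im t' <= 1).
 { destruct (Z.eq_dec (m21 g) 0) as [Ec|Ec].
  - unfold Zdet in Hg1. rewrite Ec in Hg1. assert (Hd : (m22 g * m22 g = 1)%Z).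
   { assert (m11 g * m22 g = 1)%Z by lia. destruct (Z.mul_eq_1 _ _ H) as [h|h]; rewrite h in H; nia. }
   assert (EN : Cnorm2 (jf g t) = 1).
   { unfold jf. rewrite Ec. unfold Cnorm2; simpl. apply (f_equal IZR) in Hd. rewrite mult_IZR in Hd. nra. }
   rewrite EN in E2. nra.
  - assert (Im t * Im t <= Cnorm2 (jf g t)).
   { unfold jf, Cnorm2; simpl. set (c := IZR (m21 g)) in *.
    assert (1 <= c * c) by (unfold c; rewrite <- mult_IZR; apply IZR_le; nia).
    assert (0 <= Im t * Im t) by nra.
    set (u := (c * Re t - 0 * Im t + (IZR (m22 g)))).
    pose proof (Rle_0_sqr u) as Hu. unfold Rsqr in Hu.
    pose proof (Rmult_le_compat_r (Im t * Im t) 1 (c * c) ltac:(auto) ltac:(auto)).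
    replace ((c * Im t + 0 * Re t + 0) * (c * Im t + 0 * Re t + 0)) with (c * c * (Im t * Im t)) by ring. lra. }
   unfold inH in Ht'.
   assert (Im t' * (Im t * Im t) <= Im t) by
    (eapply Rle_trans; [apply Rmult_le_compat_l; [lra|exact H]|lra]).
   apply Rmult_le_reg_r with (Im t); [auto|]. rewrite Rmult_1_l.
   replace (Im t * Im t' * Im t) with (Im t' * (Im t * Im t)) by ring. auto. }
 assert (EC : Cnorm2 (jf (Zadj g) t') = Im t' * / Im t) by (rewrite <- E; field; lra).
 rewrite EC. apply Rmult_le_compat_r; [lra|]. apply Rmult_le_reg_l with (Im t); lra.
Qed.

(** The coefficient integral at height 1/n, where [cusp_growth] gives n^w and the exponential is the
    constant exp(2 pi). *)
Lemma cusp_coeff_bound (a : nat -> Cx) : qexp f a -> a 0%nat = C0 /\ exists K, 0 <= K /\ forall n, Cabs (a n) <= K * INR n ^ w.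
Proof.
 intros Ha. destruct cusp_nser as [a' [H0 [H1 H2]]].
 assert (E : forall n, a n = a' n) by (apply (qexp_unique f); auto; apply qexp_nser; intros; apply H1; auto).
 split; [rewrite E; auto|]. destruct cusp_growth as [B [HB0 HB]].
 exists (2 * B * exp (2 * PI)). split.
 { apply Rmult_le_pos; [lra|left; apply exp_pos]. }
 intros n. rewrite E. destruct n as [|n].
 - rewrite H0, Cabs_0. apply Rmult_le_pos; [apply Rmult_le_pos; [lra|left; apply exp_pos]|apply pow_le; simpl; lra].
 - set (m := INR (S n)). assert (Hm : 1 <= m) by (unfold m; rewrite S_INR; pose proof (pos_INR n); lra).
  assert (Hmi : 0 < / m) by (apply Rinv_0_lt_compat; lra).
  assert (/ m <= 1) by (rewrite <- Rinv_1; apply Rinv_le_contravar; lra).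
  pose proof (H2 (S n) (/ m) (B * m ^ w) Hmi) as K. fold m in K.
  replace (2 * PI * m * / m) with (2 * PI) in K by (field; lra).
  eapply Rle_trans; [apply K|right; ring].
  intros x _. eapply Rle_trans; [apply HB; simpl; auto|]. simpl. rewrite Rinv_inv. lra.
Qed.
End CuspForm.


(** * Shifts of a plus form by fractions v/D *)

Section OldForm.
Context (D : Z) (HD : prime D) (HD4 : (D mod 4 = 3)%Z) (p : Z) (Hp0 : (0 < p)%Z) (HpD : ~ (D | p)%Z).
Context (C : Cx) (HC : C <> C0) (HS : forall y Z, inH (m11 Z) ->
 HasSum (fun x => (C * m11 Z * (zeta D (- (y * Ou x)) * qx D x Z))%C) (th D y (Zact ZS Z))).
Context (w : nat) (f : Cx -> Cx) (Hf : is_cusp_form D w (D * p) f).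
Context (a : nat -> Cx) (Ha : qexp f a) (Hplus : forall n, chiK D (Z.of_nat n) = 1%Z -> a n = C0).
Let HD0 : (0 < D)%Z := prime_pos D HD.
Let Hns := m1_nonsquare D HD HD4 C HC HS.
Let g := Gs D 1.
Let eta := ZtoC (chiK D p).
Notation zt := (zeta D).

Definition fsh (v : Z) (t : Cx) : Cx := f (t + RtoC (IZR v / IZR D))%C.

Lemma fsh_per t : inH t -> zper D (fun v => fsh v t).
Proof.
 intros Ht a1 b1 [k Hk]. unfold fsh.
 replace (RtoC (IZR a1 / IZR D)) with (RtoC (IZR b1 / IZR D) + ZtoC k)%C.
 2:{ replace a1 with (b1 + k * D)%Z by lia. unfold ZtoC. rewrite <- RtoC_add. f_equal.
   rewrite plus_IZR, mult_IZR. field. apply not_0_IZR. lia. }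
 replace (t + (RtoC (IZR b1 / IZR D) + ZtoC k))%C with (t + RtoC (IZR b1 / IZR D) + ZtoC k)%C by ring.
 rewrite <- mob_T. rewrite (cusp_mod D w (D * p) f Hf).
 - cbn [ZT m22]. rewrite (chi_1 D HD). unfold jf, ZT; cbn [m21 m22].
  match goal with |- context [Cpow ?x _] => replace x with C1 by ring end. rewrite Cpow_1_l. ring.
 - split; [unfold Zdet, ZT; mcbn; ring|exists 0%Z; reflexivity].
 - unfold inH in *. simpl. lra.
Qed.

Lemma fsh_HasSum v t : inH t -> HasSum (fun n => (zt (Z.of_nat n * v) * nser a t n)%C) (fsh v t).
Proof.
 intros Ht. destruct (qexp_AbsSum f a Ha (t + RtoC (IZR v / IZR D))%C) as [_ H].
 { unfold inH in *. simpl. lra. }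
 eapply HasSum_ext; [|apply H]. intros n. unfold nser, zeta.
 replace (ZtoC (Z.of_nat n) * (t + RtoC (IZR v / IZR D)))%C with
  (ZtoC (Z.of_nat n) * t + RtoC (IZR (Z.of_nat n * v) / IZR D))%C.
 - rewrite e_add. ring.
 - rewrite mult_IZR. unfold Rdiv. rewrite Rmult_assoc, RtoC_mul. unfold ZtoC. ring.
Qed.

(** The operator U_D: the q-expansion of this function has the coefficients a(D n). *)
Definition ft (t : Cx) : Cx := (zsum D (fun v => fsh v (t / ZtoC D)%C) / ZtoC D)%C.

(** Compare coefficients. At n the left side has g chi(n), the right side g ([D | n] - 1). They
    agree if D | n, or if chi(n) = -1, and where chi(n) = 1 the coefficient of f is zero. *)
Lemma plus_twist t : inH t ->
 zsum D (fun v => (ZtoC (chiK D v) * fsh v t)%C) = (g * (zsum D (fun v => fsh v t) / ZtoC D - f t))%C.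
Proof.
 intros Ht. assert (DN := ZtoC_neq0 D ltac:(lia)).
 destruct (qexp_AbsSum f a Ha t Ht) as [_ HF].
 assert (HB : HasSum (fun n => zsum D (fun v => (zt (Z.of_nat n * v) * nser a t n)%C)) (zsum D (fun v => fsh v t))).
 { apply HasSum_Csum. intros. apply fsh_HasSum; auto. }
 assert (HA : HasSum (fun n => zsum D (fun v => (ZtoC (chiK D v) * (zt (Z.of_nat n * v) * nser a t n))%C))
  (zsum D (fun v => (ZtoC (chiK D v) * fsh v t)%C))).
 { apply HasSum_Csum. intros. apply HasSum_scal, fsh_HasSum; auto. }
 apply (HasSum_unique _ _ _ HA).
 replace (g * (zsum D (fun v => fsh v t) / ZtoC D - f t))%C with (g * (Cinv (ZtoC D) * zsum D (fun v => fsh v t) - f t))%C by (unfold Cdiv; ring).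
 pose proof (HasSum_scal g _ _ (HasSum_sub _ _ _ _ (HasSum_scal (Cinv (ZtoC D)) _ _ HB) HF)) as K.
 eapply HasSum_ext; [|exact K].
 intros n. cbv beta.
 rewrite (zsum_ext D _ (fun v => (nser a t n * (zt (Z.of_nat n * v)))%C)) by (intros; ring).
 rewrite (zsum_scal D (nser a t n) (fun v => zt (Z.of_nat n * v))), (zsum_zeta D HD).
 rewrite (zsum_ext D (fun v => (ZtoC (chiK D v) * (zt (Z.of_nat n * v) * nser a t n))%C) (fun v => (nser a t n * (ZtoC (chiK D v) * zt (Z.of_nat n * v)))%C)) by (intros; ring).
 rewrite (zsum_scal D (nser a t n) (fun v => (ZtoC (chiK D v) * zt (Z.of_nat n * v))%C)), (zsum_chi_zeta D HD Hns).
 destruct (Z.eq_dec (Z.of_nat n mod D) 0) as [h|h].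
 - apply Z.mod_divide in h; [|lia]. rewrite (Gs_per D HD (Z.of_nat n) 0%Z) by (rewrite Z.sub_0_r; auto).
  unfold Gs. rewrite (zsum_ext D _ (fun _ => C1)) by (intros; rewrite Z.mul_0_l; apply (zeta_0 D HD)).
  rewrite (zsum_const D HD C1). unfold Cdiv. field. auto.
 - assert (hn : ~ (D | Z.of_nat n)%Z) by (intros hd; apply h; apply Z.mod_divide; auto; lia).
  rewrite (Gs_chi D HD HD4 C HC HS) by auto. fold g.
  destruct (chi_cases D HD (Z.of_nat n) hn) as [E|E]; rewrite E.
  + unfold nser. rewrite (Hplus n E). field. auto.
  + unfold ZtoC. simpl. change (RtoC (-1)) with (ZtoC (-1)). field; auto.
Qed.

Definition Mv (v : Z) : M2 Z := mkM2 1%Z v 0%Z D.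

Lemma mob_Mv v t : mob (Mv v) t = (t / ZtoC D + RtoC (IZR v / IZR D))%C.
Proof.
 assert (DN := ZtoC_neq0 D ltac:(lia)).
 unfold mob, mobius, Mv; mcbn. unfold Rdiv. rewrite RtoC_mul, RtoC_inv by (apply not_0_IZR; lia).
 fold (ZtoC v) (ZtoC D). change (ZtoC 0) with C0. change (ZtoC 1) with C1. field. auto.
Qed.

Lemma fsh_mul gm h v s t : Gam0 (D * p) gm -> Zdet h = 1%Z -> Zmul (Mv v) h = Zmul gm (Mv s) -> inH t ->
 fsh v (mob h t / ZtoC D)%C = (ZtoC (chiK D (m22 gm)) * (Cpow (jf h t) w * fsh s (t / ZtoC D)%C))%C.
Proof.
 intros Hgm Hh E Ht. assert (Dv : forall v, (0 < Zdet (Mv v))%Z) by (intros; unfold Zdet, Mv; mcbn; lia).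
 assert (Hh' : (0 < Zdet h)%Z) by lia. assert (Hg' : (0 < Zdet gm)%Z) by (destruct Hgm; lia).
 assert (DN := ZtoC_neq0 D ltac:(lia)).
 unfold fsh. rewrite <- !mob_Mv, <- mob_mul, E, mob_mul by auto.
 rewrite (cusp_mod D w (D * p) f Hf) by (auto; apply mob_inH; auto). do 3 f_equal.
 assert (Ej : jf (Zmul gm (Mv s)) t = jf (Zmul (Mv v) h) t) by now rewrite E.
 assert (Ec : forall v t, jf (Mv v) t = ZtoC D) by (intros; unfold jf, Mv; cbn [m21 m22]; ring).
 rewrite !jf_mul, !Ec in Ej by auto.
 replace (jf gm (mob (Mv s) t)) with (jf gm (mob (Mv s) t) * ZtoC D / ZtoC D)%C by (field; auto).
 rewrite Ej. field. auto.
Qed.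

(** For a matrix (a, b; c, d) the products of (1, v; 0, D) with it are rewritten with (1, s; 0, D)
    on the right, where s = d^2 v + d b. As d is invertible modulo D, s permutes the residues. *)
Lemma ft_Gam0 gm t : Gam0 (D * p) gm -> inH t ->
 ft (mob gm t) = (ZtoC (chiK D (m22 gm)) * (Cpow (jf gm t) w * ft t))%C.
Proof.
 intros [Hdet [c Hc]] Ht. assert (DN := ZtoC_neq0 D ltac:(lia)).
 assert (Dn : D <> 0%Z) by lia.
 destruct gm as [ga gb gc gd]. unfold Zdet in Hdet. cbn [m11 m12 m21 m22] in *. subst gc.
 assert (Htd : inH (t / ZtoC D)%C).
 { replace (t / ZtoC D)%C with (mob (Mv 0) t); [apply mob_inH; auto; unfold Zdet, Mv; mcbn; lia|].
  rewrite mob_Mv. unfold Rdiv. rewrite Rmult_0_l. change (RtoC 0) with C0. ring. }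
 unfold ft. rewrite <- (zsum_reindex D HD (fun v => gd * gd * v + gd * gb)%Z (fun v => fsh v (t / ZtoC D)%C)).
 2:{ apply (injmod_lin D HD). intros Hd. destruct (D_div_mul D HD _ _ Hd) as [[k Hk]|[k Hk]];
  apply (ndiv_1 D HD); exists (ga * k - gb * c * p)%Z; rewrite Hk in Hdet; lia. }
 2:{ apply fsh_per; auto. }
 set (gm := mkM2 ga gb (c * (D * p))%Z gd).
 rewrite (zsum_ext D _ (fun v => ((ZtoC (chiK D gd) * Cpow (jf gm t) w) * fsh (gd * gd * v + gd * gb) (t / ZtoC D))%C)).
 { rewrite zsum_scal. unfold Cdiv. ring. }
 intros v _. set (s := (gd * gd * v + gd * gb)%Z).
 (* Solved from [Mv v] times gm = gm' times [Mv s]. Division by D in the upper right entry is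
    possible because a d = 1 modulo D, and the lower right entry is d modulo D. *)
 set (gm' := (mkM2 (ga + v * (c * (D * p))) (- (c * p) * (gb * gb + 2 * gb * gd * v + v * v * gd * gd)) (D * (c * (D * p))) (gd - s * (c * (D * p))))%Z).
 rewrite (fsh_mul gm' gm v s t).
 - unfold gm'; cbn [m22]. rewrite (chi_per D HD Hns _ gd); [ring|]. exists (- (s * c * p))%Z. ring.
 - split.
  + assert (E : Zdet gm' = (ga * gd - gb * (c * (D * p)))%Z); [|lia].
   assert (Ea : (ga * gd = 1 + gb * (c * (D * p)))%Z) by lia.
   unfold gm', Zdet; mcbn. unfold s.
   transitivity ((ga * gd) - (ga * gd) * c * D * p * gd * v - (ga * gd) * gb * c * D * p + v * gd * c * D * p - v * c*c*D*p*D*p * gd * gd * v - v * gd * gb * c * c * D * D * p * p + c * c * p * p * D * D * (gb * gb + 2 * gb * gd * v + v * v * gd * gd))%Z; [ring|].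
   rewrite Ea. ring.
  + exists (D * c)%Z. unfold gm'; cbn [m21]. ring.
 - unfold gm, Zdet; mcbn. lia.
 - unfold gm', gm, Mv, Zmul; mcbn.
  assert (Ea : (ga * gd = 1 + gb * (c * (D * p)))%Z) by lia.
  apply M2_eq; mcbn; try ring. unfold s.
  transitivity ((ga * gd) * (gd * v) + (ga * gd) * gb + v * (c * (D * p)) * (gd * gd * v + gd * gb) + - (c * p) * (gb * gb + 2 * gb * gd * v + v * v * gd * gd) * D)%Z; [|ring].
  rewrite Ea. ring.
 - auto.
Qed.

Context (a0 b0 : Z) (Hab : (D * D * a0 - p * b0 = 1)%Z).
(** Multiplied on the right by diag(D, 1) this is an Atkin-Lehner matrix at D for level Dp; as it
    stands it belongs to Gamma_0(p) and represents a coset other than that of the identity. *)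
Definition Wm : M2 Z := mkM2 (D * a0)%Z b0 p D.
Lemma Wm_det : Zdet Wm = 1%Z.
Proof. unfold Zdet, Wm; mcbn. lia. Qed.

(** The permutation of the nonzero shifts effected by [Wm], namely v -> -1/(p^2 v) modulo D. Zero is
    made a fixed point so that sums over all residues can be reindexed; the terms at zero are
    separated in [ft_W]. *)
Lemma inv_neg_sq : exists si : Z -> Z, injmod D si /\ (forall v, ~ (D | v)%Z -> (D | si v * (v * (p * p)) + 1)%Z) /\ forall v, (D | v)%Z -> si v = 0%Z.
Proof.
 assert (K : forall v, exists s, if Zdivide_dec D v then s = 0%Z else (D | s * (v * (p * p)) + 1)%Z).
 { intros v. destruct (Zdivide_dec D v); [eauto|].
  destruct (inv_mod D HD (v * (p * p))) as [s [k Hs]].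
  - intros h. repeat (apply (D_div_mul D HD) in h; destruct h as [h|h]; auto).
  - exists (- s)%Z. exists (- k)%Z. lia. }
 set (si := fun v => proj1_sig (constructive_indefinite_description _ (K v))).
 assert (Hsi : forall v, if Zdivide_dec D v then si v = 0%Z else (D | si v * (v * (p * p)) + 1)%Z).
 { intros v. unfold si. destruct (constructive_indefinite_description _ (K v)); auto. }
 exists si. repeat split.
 - intros x y Hx Hy Hxy. apply (small_div D x y Hx Hy).
  pose proof (Hsi x) as Kx. pose proof (Hsi y) as Ky.
  assert (h1 : forall z, (D | z * 0 + 1)%Z -> False).
  { intros z Hz. rewrite Z.mul_0_r in Hz. now apply (ndiv_1 D HD). }
  destruct Hxy as [k Hk].
  destruct (Zdivide_dec D x) as [[i Hi]|hx], (Zdivide_dec D y) as [[j Hj]|hy].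
  + exists (i - j)%Z. lia.
  + exfalso. rewrite Kx in Hk. apply (h1 0%Z). destruct Ky as [m Hm]. exists (m + k * y * p * p)%Z.
   replace (si y) with (- k * D)%Z in Hm by lia. lia.
  + exfalso. rewrite Ky in Hk. apply (h1 0%Z). destruct Kx as [m Hm]. exists (m - k * x * p * p)%Z.
   replace (si x) with (k * D)%Z in Hm by lia. lia.
  + destruct Kx as [m Hm], Ky as [n Hn].
   assert (h : (D | si x * ((p * p) * (x - y)))%Z).
   { exists (m - n - k * y * p * p)%Z. replace (si y) with (si x - k * D)%Z in Hn by lia. lia. }
   apply (D_div_mul D HD) in h as [[i Hi]|h].
   * exfalso. apply (h1 0%Z). exists (m - i * x * p * p)%Z. rewrite Hi in Hm. lia.
   * apply (D_div_mul D HD) in h as [h|h]; auto. apply (D_div_mul D HD) in h. tauto.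
 - intros v hv. pose proof (Hsi v) as Kv. destruct (Zdivide_dec D v); tauto.
 - intros v hv. pose proof (Hsi v) as Kv. destruct (Zdivide_dec D v); tauto.
Qed.

(* Both [f] and its twist are exchanged by [Wm]: writing [B] for the sum of all shifts, [(B - f)|W]
 and [A|W] are multiples of [A] and [B - f]; with [A = g (B/D - f)] this determines [B|W]. *)
Lemma ft_W t : inH t -> ft (mob Wm t) = (eta * g / ZtoC D * (Cpow (jf Wm t) w * f (t / ZtoC D)%C))%C.
Proof.
 intros Ht. assert (DN := ZtoC_neq0 D ltac:(lia)).
 assert (HM : forall t, inH t -> inH (t / ZtoC D)%C).
 { intros u Hu. replace (u / ZtoC D)%C with (mob (Mv 0) u); [apply mob_inH; auto; unfold Zdet, Mv; mcbn; lia|].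
  rewrite mob_Mv. unfold Rdiv. rewrite Rmult_0_l. change (RtoC 0) with C0. ring. }
 assert (HWt : inH (mob Wm t)) by (apply mob_inH; auto; rewrite Wm_det; lia).
 destruct inv_neg_sq as [si [Hsi [Hs1 Hs0]]].
 set (J := Cpow (jf Wm t) w). set (u := (t / ZtoC D)%C). set (u1 := (mob Wm t / ZtoC D)%C).
 assert (Hu : inH u) by (apply HM; auto). assert (Hu1 : inH u1) by (apply HM; auto).
 assert (Key : forall v, ~ (D | v)%Z -> fsh v u1 = (eta * ZtoC (chiK D v) * J * fsh (si v) u)%C /\ chiK D (si v) = (- chiK D v)%Z).
 { intros v hv. destruct (Hs1 v hv) as [k Hk]. set (s := si v) in *.
  assert (hp : forall x, (D | x)%Z -> (D | x * p)%Z) by (intros x [z ->]; exists (z * p)%Z; ring).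
  assert (Db : (D | b0 - s * v * p)%Z).
  { assert (h : (D | p * (b0 - s * v * p))%Z).
   { exists (D * a0 - k)%Z. lia. }
   apply (D_div_mul D HD) in h. tauto. }
  destruct Db as [m Hm].
  assert (Ec : chiK D s = (- chiK D v)%Z).
  { assert (E : chiK D (s * (v * (p * p))) = chiK D (-1)) by (apply (chi_per D HD Hns); exists k; lia).
   rewrite !(chi_mul D HD Hns), (chi_m1 D HD Hns), (chi_sqr D HD p HpD), Z.mul_1_r in E.
   pose proof (chi_sqr D HD v hv). nia. }
  (* Solved from [Mv v] times [Wm] = gm times [Mv s]. Integrality of the upper right entry is the
     condition s v p^2 = -1 modulo D, through p b0 = -1 modulo D, and m is the quotient (b0 - s v
     p)/D. *)
  set (gm := (mkM2 (D * a0 + v * p) (m + v - s * a0) (D * p) (D - p * s))%Z).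
  split; auto. unfold u1. rewrite (fsh_mul gm Wm v s t).
  - replace (chiK D (m22 gm)) with (chiK D p * chiK D v)%Z.
   + rewrite ZtoC_mul. unfold eta, J, u. ring.
   + unfold gm; cbn [m22]. rewrite (chi_per D HD Hns (D - p * s)%Z (- (p * s))%Z) by (exists 1%Z; ring).
    rewrite (chi_opp D HD Hns), (chi_mul D HD Hns), Ec. ring.
  - split; [|exists 1%Z; unfold gm; cbn [m21]; ring].
   unfold gm, Zdet; mcbn.
   assert (Hm' : (m * D * p = (b0 - s * v * p) * p)%Z) by (rewrite Hm; ring). lia.
  - apply Wm_det.
  - unfold gm, Wm, Mv, Zmul; mcbn. apply M2_eq; mcbn; try ring. lia.
  - auto. }
 set (F := f u). set (F1 := f u1). set (B := zsum D (fun v => fsh v u)). set (B1 := zsum D (fun v => fsh v u1)).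
 assert (f0 : forall x, fsh 0 x = f x).
 { intros x. unfold fsh, Rdiv. rewrite Rmult_0_l. f_equal. change (RtoC 0) with C0. ring. }
 set (dl0 := fun v : Z => if Zdivide_dec D v then C1 else C0).
 assert (S0 : forall h, zsum D (fun v => (dl0 v * h v)%C) = h 0%Z).
 { intros h. unfold zsum. pose proof (D_gt1 D HD). destruct (Z.to_nat D) as [|n] eqn:En; [lia|]. cbn [seq map Csum fold_right].
  unfold dl0 at 1. destruct (Zdivide_dec D (Z.of_nat 0)) as [_|n0]; [|destruct n0; exists 0%Z; reflexivity].
  change (fold_right Cadd C0) with Csum. rewrite Csum_map_0; [change (Z.of_nat 0) with 0%Z; ring|].
  intros i Hi. apply in_seq in Hi. unfold dl0. destruct (Zdivide_dec D (Z.of_nat i)) as [h'|h']; [|ring].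
  exfalso. apply (small_ndiv D (Z.of_nat i)); auto. lia. }
 assert (RB : zsum D (fun v => ((C1 - dl0 v) * fsh (si v) u)%C) = (B - F)%C).
 { rewrite (zsum_ext D _ (fun v => (fsh (si v) u + ZtoC (-1) * (dl0 v * fsh (si v) u))%C)) by (intros; ring).
  rewrite zsum_add, zsum_scal, S0, (zsum_reindex D HD si (fun v => fsh v u) Hsi (fsh_per u Hu)).
  rewrite (Hs0 0%Z) by (exists 0%Z; reflexivity). rewrite f0. unfold B, F. ring. }
 assert (I1 : (g * (B1 / ZtoC D - F1))%C = (eta * J * (B - F))%C).
 { unfold B1, F1. rewrite <- plus_twist by auto. rewrite <- RB, <- zsum_scal. apply zsum_ext. intros v _.
  unfold dl0. destruct (Zdivide_dec D v) as [h|h].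
  - rewrite (chi_0 D HD v h). change (ZtoC 0) with C0. ring.
  - destruct (Key v h) as [-> _].
   replace (ZtoC (chiK D v) * (eta * ZtoC (chiK D v) * J * fsh (si v) u))%C with (ZtoC (chiK D v * chiK D v) * (eta * J * fsh (si v) u))%C by (rewrite ZtoC_mul; ring).
   rewrite (chi_sqr D HD v h). change (ZtoC 1) with C1. ring. }
 assert (I2 : (B1 - F1)%C = (- (eta * J * (g * (B / ZtoC D - F))))%C).
 { unfold B, F. rewrite <- plus_twist by auto.
  rewrite <- (zsum_reindex D HD si (fun v => (ZtoC (chiK D v) * fsh v u)%C) Hsi).
  2:{ intros x y Hxy. rewrite (chi_per D HD Hns x y Hxy), (fsh_per u Hu x y Hxy). reflexivity. }
  transitivity (zsum D (fun v => (fsh v u1 + ZtoC (-1) * (dl0 v * fsh v u1))%C)).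
  { rewrite zsum_add, zsum_scal, S0, f0. unfold B1, F1. ring. }
  transitivity (ZtoC (-1) * (eta * J) * zsum D (fun v => (ZtoC (chiK D (si v)) * fsh (si v) u)%C))%C; [|ring].
  rewrite <- zsum_scal. apply zsum_ext. intros v _. unfold dl0. destruct (Zdivide_dec D v) as [h|h].
  - rewrite (Hs0 v h), (chi_0 D HD 0%Z) by (exists 0%Z; reflexivity). change (ZtoC 0) with C0. ring.
  - destruct (Key v h) as [-> ->]. rewrite ZtoC_opp. ring. }
 assert (G2 := Gs1_sqr D HD HD4 C HC HS). fold g in G2.
 (* Since g^2 = -D, the combination D (B1 - F1) + g^2 (F1 - B1/D) in the form used here removes both
    F1 and the shift sum B and leaves D - 1 times the claim; D - 1 is not zero. *)
 assert (EB : (B1 * (ZtoC D - C1))%C = (eta * J * g * F * (ZtoC D - C1))%C).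
 { replace (B1 * (ZtoC D - C1))%C with (ZtoC D * (B1 - F1) - ZtoC D * (B1 / ZtoC D - F1))%C by (field; auto).
  replace (ZtoC D * (B1 / ZtoC D - F1))%C with (- (g * (g * (B1 / ZtoC D - F1))))%C
   by (transitivity ((- (g * g)) * (B1 / ZtoC D - F1))%C; [ring|rewrite G2; ring]).
  rewrite I1, I2. field. auto. }
 assert (Hne : (ZtoC D - C1)%C <> C0).
 { change C1 with (ZtoC 1). rewrite <- ZtoC_sub. apply ZtoC_neq0. pose proof (D_gt1 D HD). lia. }
 unfold ft. fold u1. fold B1. replace B1 with (B1 * (ZtoC D - C1) / (ZtoC D - C1))%C by (field; auto).
 rewrite EB. unfold J, F, u. field. auto.
Qed.
End OldForm.

(** * The Jacobi form of index 1 *)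

(** Translation sends each representative into the class of exactly one representative, and
    injectivity on a finite list makes this a permutation. Used both for the trace from level Dp to
    level p and for the Hecke operators. *)
Lemma coset_sum_shift {X} (L : list X) (act : X -> X) (rel : X -> X -> Prop) (phi : X -> Cx) : NoDup L ->
 (forall x, In x L -> exists y, In y L /\ rel (act x) y) ->
 (forall x x' y, In x L -> In x' L -> In y L -> rel (act x) y -> rel (act x') y -> x = x') ->
 (forall x y, In x L -> In y L -> rel (act x) y -> phi (act x) = phi y) ->
 Csum (map (fun x => phi (act x)) L) = Csum (map phi L).
Proof.
 intros HL He Hi Hphi.
 assert (K : forall x, exists y, In x L -> In y L /\ rel (act x) y).
 { intros x. destruct (classic (In x L)) as [h|h]; [|exists x; tauto]. destruct (He x h) as [y Hy]; eauto. }
 set (sg := fun x => proj1_sig (constructive_indefinite_description _ (K x))).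
 assert (Hsg : forall x, In x L -> In (sg x) L /\ rel (act x) (sg x)).
 { intros x. unfold sg. destruct (constructive_indefinite_description _ (K x)); auto. }
 assert (P : Permutation (map sg L) L).
 { apply NoDup_Permutation_bis.
  - apply NoDup_map_NoDup_ForallPairs; auto. intros x x' Hx Hx' E. destruct (Hsg x Hx), (Hsg x' Hx').
   apply (Hi x x' (sg x)); auto. now rewrite E.
  - rewrite length_map. auto.
  - intros y Hy. apply in_map_iff in Hy as [x [<- Hx]]. apply Hsg; auto. }
 rewrite <- (Csum_perm _ _ (Permutation_map phi P)), map_map. f_equal. apply map_ext_in.
 intros x Hx. destruct (Hsg x Hx). auto.
Qed.

(** The weight k slash action on functions of the Jacobi variables, without a power of the
    determinant. *)
Definition sl (k : nat) (psi : M2 Cx -> Cx) (Z : M2 Cx) (g : M2 BinNums.Z) : Cx := (Cinv (Cpow (Zj g Z) k) * psi (Zact g Z))%C.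
Lemma sl_mul k psi Z g h : (0 < Zdet g)%Z -> (0 < Zdet h)%Z -> inH (m11 Z) ->
 sl k psi Z (Zmul g h) = (Cinv (Cpow (Zj h Z) k) * sl k psi (Zact h Z) g)%C.
Proof.
 intros Hg Hh HZ. unfold sl. rewrite Zj_mul, Zact_mul by auto. rewrite Cpow_mul.
 pose proof (Cpow_neq0 _ k (Zj_neq0 h Z Hh HZ)). pose proof (Cpow_neq0 _ k (Zj_neq0 g _ Hg (Zact_inH h Z Hh HZ))). field. auto.
Qed.
Lemma sl_invariant k psi N Z g h : (forall g Z, Gam0 N g -> inH (m11 Z) -> psi (Zact g Z) = (Cpow (Zj g Z) k * psi Z)%C) ->
 Gam0 N g -> (0 < Zdet h)%Z -> inH (m11 Z) -> sl k psi Z (Zmul g h) = sl k psi Z h.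
Proof.
 intros H Hg Hh HZ. assert (Hg0 : (0 < Zdet g)%Z) by (destruct Hg; lia). rewrite sl_mul by auto.
 unfold sl. pose proof (Zact_inH h Z Hh HZ). rewrite H by auto. pose proof (Cpow_neq0 _ k (Zj_neq0 g _ Hg0 H0)).
 pose proof (Cpow_neq0 _ k (Zj_neq0 h Z Hh HZ)). field. auto.
Qed.
Lemma Gam0_mul N g h : Gam0 N g -> Gam0 N h -> Gam0 N (Zmul g h).
Proof.
 intros [Hg [a Ha]] [Hh [b Hb]]. split; [rewrite Zdet_mul, Hg, Hh; reflexivity|].
 exists (a * m11 h + m22 g * b)%Z. unfold Zmul; cbn [m21]. rewrite Ha, Hb. ring.
Qed.
Lemma Gam0_adj N g : Gam0 N g -> Gam0 N (Zadj g).
Proof. intros [Hg [a Ha]]. split; [rewrite Zdet_adj; auto|]. exists (- a)%Z. unfold Zadj; cbn [m21]. rewrite Ha. ring. Qed.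

Lemma coset_cancel g d1 d2 x x' y : Zdet g = 1%Z -> Zdet d2 = 1%Z ->
 Zmul x g = Zmul d1 y -> Zmul x' g = Zmul d2 y -> x = Zmul (Zmul d1 (Zadj d2)) x'.
Proof.
 intros Hg H2 E1 E2. assert (Ey : y = Zmul (Zadj d2) (Zmul x' g)) by (rewrite E2, Zmul_assoc, Zadj_l, Zmul_1_l; auto).
 rewrite Ey in E1. apply (f_equal (fun z => Zmul z (Zadj g))) in E1.
 rewrite <- !Zmul_assoc, Zadj_r, !Zmul_1_r in E1 by auto. now rewrite <- Zmul_assoc.
Qed.

(** The function alpha, extended by zero to z <= 0 so that determinants can be inserted without case
    distinctions. Where a_D vanishes the quotient is zero, because [Cinv C0] is. *)
Definition alz (D : Z) (a : nat -> Cx) (z : Z) : Cx :=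
 if Z_le_gt_dec z 0 then C0 else (RtoC (sqrt (IZR D)) * a (Z.to_nat z) / (Ci * RtoC (INR (aD D (Z.to_nat z)))))%C.
Definition jterm (D : Z) (a : nat -> Cx) (Z : M2 Cx) (nx : BinNums.Z * OK) : Cx :=
 (alz D a (D * fst nx - Onorm D (snd nx)) * e (ZtoC (fst nx) * m11 Z + lx D (snd nx) Z + m22 Z)%C)%C.

Section Jacobi.
Context (D : Z) (HD : prime D) (HD4 : (D mod 4 = 3)%Z) (p : Z) (Hp : prime p) (HpD : ~ (D | p)%Z).
Context (C : Cx) (HC : C <> C0) (HS : forall y Z, inH (m11 Z) ->
 HasSum (fun x => (C * m11 Z * (zeta D (- (y * Ou x)) * qx D x Z))%C) (th D y (Zact ZS Z))).
Context (k : nat) (Hk : (0 < k)%nat) (f : Cx -> Cx) (Hf : is_cusp_form D (k - 1) (D * p) f).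
Context (a : nat -> Cx) (Ha : qexp f a) (Hplus : forall n, chiK D (Z.of_nat n) = 1%Z -> a n = C0).
Let HD0 : (0 < D)%Z := prime_pos D HD.
Let Hp0 : (0 < p)%Z := prime_pos p Hp.
Let Hns := m1_nonsquare D HD HD4 C HC HS.
Let Ek : k = S (k - 1).
Proof. lia. Qed.

Let ps (Z : M2 Cx) : Cx := (ft D f (m11 Z) * th D 0 Z)%C.

(** Both factors transform with the character chi(d), of weights k - 1 and 1; the characters cancel
    since d is prime to D. *)
Lemma psi_Gam0 g Z : Gam0 (D * p) g -> inH (m11 Z) -> ps (Zact g Z) = (Cpow (Zj g Z) k * ps Z)%C.
Proof.
 intros Hg HZ. unfold ps. rewrite Zact_mob, (ft_Gam0 D HD HD4 p C HC HS (k - 1) f Hf g) by auto.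
 destruct Hg as [Hdet [c Hc]].
 pose proof (th0_SL2 D HD HD4 C HC HS g Hdet Z HZ) as [K _]. rewrite K by (exists (c * p)%Z; lia).
 rewrite Ek at 2. cbn [Cpow]. change (jf g (m11 Z)) with (Zj g Z).
 assert (hd : ~ (D | m22 g)%Z).
 { intros [j Hj]. apply (ndiv_1 D HD). unfold Zdet in Hdet. rewrite Hj, Hc in Hdet.
  exists (m11 g * j - m12 g * c * p)%Z. lia. }
 transitivity (ZtoC (chiK D (m22 g) * chiK D (m22 g)) * (Zj g Z * Cpow (Zj g Z) (k - 1) * (ft D f (m11 Z) * th D 0 Z)))%C.
 - rewrite ZtoC_mul. ring.
 - rewrite (chi_sqr D HD _ hd). change (ZtoC 1) with C1. ring.
Qed.

Lemma bezout_W : exists a0 b0, (D * D * a0 - p * b0 = 1)%Z.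
Proof.
 clear - HD Hp HpD. assert (R : rel_prime (D * D) p).
 { assert (rel_prime D p) by (apply prime_rel_prime; auto).
  apply rel_prime_sym. apply rel_prime_mult; apply rel_prime_sym; auto. }
 destruct (rel_prime_bezout _ _ R) as [u v E]. exists u, (- v)%Z. lia.
Qed.

Let fth (Z : M2 Cx) : Cx := (f (m11 Z / ZtoC D) * Th D Z / ZtoC D)%C.

(** The constants collapse: chi(p) g / D from [ft_W] times chi(p) C from [th0_SL2] is C g / D = 1/D,
    independently of p. *)
Lemma psi_W a0 b0 v Z : (D * D * a0 - p * b0 = 1)%Z -> inH (m11 Z) ->
 sl k ps Z (Zmul (Wm D p a0 b0) (ZT v)) = fth (Zact (ZT v) Z).
Proof.
 intros Hab HZ. assert (DN := ZtoC_neq0 D ltac:(lia)). pose proof (Wm_det D p a0 b0 Hab) as HW.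
 assert (HT : Zdet (ZT v) = 1%Z) by (unfold Zdet, ZT; mcbn; ring).
 assert (HZv : inH (m11 (Zact (ZT v) Z))) by (apply Zact_inH; auto; lia).
 rewrite sl_mul by (auto; lia). set (Y := Zact (ZT v) Z) in *.
 replace (Zj (ZT v) Z) with C1 by (unfold Zj, ZT; cbn [m21 m22]; ring). rewrite Cpow_1_l.
 unfold sl, ps, fth. rewrite Zact_mob, (ft_W D HD HD4 p HpD C HC HS (k - 1) f Hf a Ha Hplus a0 b0 Hab) by auto.
 pose proof (th0_SL2 D HD HD4 C HC HS (Wm D p a0 b0) HW Y HZv) as [_ K].
 assert (K2 : th D 0 (Zact (Wm D p a0 b0) Y) = (Zj (Wm D p a0 b0) Y * ZtoC (chiK D p) * C * Th D Y)%C).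
 { rewrite (K HpD 0%Z) by (exists 1%Z; cbn [Wm m21 m22]; ring). cbn [Wm m21].
  replace (Zact (ZT 0) Y) with Y; auto. symmetry. apply (Zact_id Y). }
 rewrite K2. rewrite Ek at 1. cbn [Cpow]. change (jf (Wm D p a0 b0) (m11 Y)) with (Zj (Wm D p a0 b0) Y).
 assert (HJ := Zj_neq0 (Wm D p a0 b0) Y ltac:(lia) HZv). pose proof (Cpow_neq0 _ (k - 1) HJ).
 pose proof (C_Gs1 D HD HD4 C HC HS) as E1. pose proof (chi_sqr D HD p HpD) as E2. apply (f_equal ZtoC) in E2. rewrite ZtoC_mul in E2.
 change (ZtoC 1) with C1 in E2.
 transitivity ((C * Gs D 1) * (ZtoC (chiK D p) * ZtoC (chiK D p)) * (f (m11 Y / ZtoC D) * Th D Y / ZtoC D))%C.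
 - unfold Zj in *. field. auto.
 - rewrite E1, E2. ring.
Qed.

Definition Ph2 (Z : M2 Cx) : Cx := (ps Z + zsum D (fun v => fth (Zact (ZT v) Z)))%C.

(** [Ph2] is a trace: Gamma_0(Dp) has index D + 1 in Gamma_0(p), with representatives the identity
    and [Wm] T^v for v modulo D, and by [psi_W] the v-th summand is the slash of [ps] by the
    latter. *)
Lemma Ph2_Gam0 g Z : Gam0 p g -> inH (m11 Z) -> Ph2 (Zact g Z) = (Cpow (Zj g Z) k * Ph2 Z)%C.
Proof using All.
 intros Hg HZ. destruct bezout_W as [a0 [b0 Hab]]. set (W := Wm D p a0 b0).
 pose proof (Wm_det D p a0 b0 Hab) as HW. fold W in HW.
 assert (HT : forall v, Zdet (ZT v) = 1%Z) by (intros; unfold Zdet, ZT; mcbn; ring).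
 assert (Hg1 : Zdet g = 1%Z) by apply Hg.
 set (wv := fun y => Zmul W (ZT (Z.of_nat y))). set (L := Zid :: map wv (seq 0 (Z.to_nat D))).
 assert (EP : forall Y, inH (m11 Y) -> Ph2 Y = Csum (map (sl k ps Y) L)).
 { intros Y HY. unfold L. cbn [map Csum fold_right]. unfold Ph2, zsum. change (fold_right Cadd C0) with Csum. f_equal.
  - unfold sl. rewrite Zact_id. replace (Zj Zid Y) with C1 by (unfold Zj, Zid; cbn [m21 m22]; ring).
   rewrite Cpow_1_l. field.
  - rewrite map_map. f_equal. apply map_ext. intros y. symmetry. apply psi_W; auto. }
 assert (HZg : inH (m11 (Zact g Z))) by (apply Zact_inH; auto; lia).
 rewrite !EP by auto.
 assert (L1 : forall x, In x L -> Gam0 p x).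
 { intros x [<-|Hx]; [split; [reflexivity|exists 0%Z; reflexivity]|]. apply in_map_iff in Hx as [y [<- _]].
  split; [unfold wv; rewrite Zdet_mul, HW, HT; reflexivity|]. exists 1%Z. unfold wv, W, Wm, ZT, Zmul; mcbn. ring. }
 assert (irr : forall dl x x', In x L -> In x' L -> Gam0 (D * p) dl -> x = Zmul dl x' -> x = x').
 { assert (dW : forall dl y, Gam0 (D * p) dl -> m21 (Zmul dl (wv y)) <> 0%Z).
  { intros dl y [H1 [c Hc]] E. unfold wv, W, Wm, ZT, Zmul in E; cbn [m11 m12 m21 m22] in E. rewrite Hc in E. unfold Zdet in H1. rewrite Hc in H1.
   destruct (D_div_mul D HD (m22 dl) p) as [[j Hj]|h]; auto.
   - exists (- (c * p * D * a0))%Z. lia.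
   - rewrite Hj in H1. apply (ndiv_1 D HD). exists (m11 dl * j - m12 dl * c * p)%Z. lia. }
  intros dl x x' [<-|Hx] [<-|Hx'] Hdl E; auto.
  - apply in_map_iff in Hx' as [y [<- _]]. exfalso. apply (dW dl y Hdl). rewrite <- E. reflexivity.
  - apply in_map_iff in Hx as [y [<- _]]. exfalso. apply (dW (Zadj dl) y (Gam0_adj _ _ Hdl)). rewrite E.
   rewrite Zmul_assoc, Zadj_l by apply Hdl. reflexivity.
  - apply in_map_iff in Hx as [y [<- Hy]]. apply in_map_iff in Hx' as [y' [<- Hy']]. apply in_seq in Hy, Hy'.
   destruct Hdl as [H1 [c Hc]].
   assert (E1 := f_equal m21 E). assert (E2 := f_equal m22 E).
   unfold wv, W, Wm, ZT, Zmul in E1, E2; cbn [m11 m12 m21 m22] in E1, E2. rewrite Hc in E1, E2.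
   set (v := Z.of_nat y) in *. set (v' := Z.of_nat y') in *.
   assert (Ev : (p * (p * (v' - v)) = D * (c * p))%Z).
   { transitivity (p * (D + v' * p) - (p * v + D) * p)%Z; [ring|].
    replace (p * v + D * 1)%Z with (p * v + D)%Z in E2 by ring. rewrite E2.
    replace (p * (D + v' * p))%Z with ((p * 1 + D * 0) * (D + v' * p))%Z by ring. rewrite E1.
    transitivity (c * (D * p) * (D * D * a0 - p * b0))%Z; [ring|]. rewrite Hab. ring. }
   assert (hv : (D | v' - v)%Z).
   { destruct (D_div_mul D HD p (p * (v' - v))) as [h|h]; [exists (c * p)%Z; lia|tauto|].
    apply (D_div_mul D HD) in h. tauto. }
   assert (Evv : v' = v) by (apply (small_div D); auto; lia).
   f_equal. lia. }
 pose proof (coset_sum_shift L (fun x => Zmul x g) (fun x y => exists dl, Gam0 (D * p) dl /\ x = Zmul dl y) (sl k ps Z)) as CS.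
 transitivity (Cpow (Zj g Z) k * Csum (map (fun x => sl k ps Z (Zmul x g)) L))%C.
 - rewrite <- Csum_map_scal. f_equal. apply map_ext_in. intros x Hx. rewrite sl_mul; auto; try lia.
  + pose proof (Cpow_neq0 _ k (Zj_neq0 g Z ltac:(lia) HZ)). field. auto.
  + destruct (L1 x Hx). lia.
 - f_equal. apply CS; clear CS.
  + constructor.
   * intros h. apply in_map_iff in h as [y [E _]]. apply (f_equal m21) in E.
    unfold wv, W, Wm, ZT, Zmul, Zid in E; cbn [m11 m12 m21 m22] in E. lia.
   * apply NoDup_map_NoDup_ForallPairs; [|apply seq_NoDup]. intros y y' _ _ E. apply (f_equal m22) in E.
    unfold wv, W, Wm, ZT, Zmul in E; cbn [m11 m12 m21 m22] in E. nia.
  + intros x Hx. pose proof (Gam0_mul _ _ _ (L1 x Hx) Hg) as Hh. set (h := Zmul x g) in *. destruct Hh as [H1 [c Hc]].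
   (* The coset of h is read off its bottom row: the identity if D | c, otherwise the v with c v = d
      modulo D. *)
   destruct (Zdivide_dec D (m21 h)) as [hd|hd].
   * exists Zid. split; [left; auto|]. exists h. rewrite Zmul_1_r. split; auto. split; auto.
    rewrite Hc in hd. apply (D_div_mul D HD) in hd as [[j Hj]|hd]; [|tauto]. exists j. rewrite Hc, Hj. ring.
   * destruct (injmod_surj D HD (fun y => m21 h * y + 0)%Z (injmod_lin D HD _ _ hd) (m22 h)) as [v [Hv [j Hj]]].
    exists (wv (Z.to_nat v)). split; [right; apply in_map, in_seq; lia|].
    exists (Zmul h (Zadj (wv (Z.to_nat v)))).
    assert (Hwv : Zdet (wv (Z.to_nat v)) = 1%Z) by (unfold wv; rewrite Zdet_mul, HW, HT; reflexivity).
    split; [split|rewrite <- Zmul_assoc, Zadj_l, Zmul_1_r; auto].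
    -- rewrite Zdet_mul, Zdet_adj, Hwv, H1. reflexivity.
    -- exists (c - j)%Z. unfold wv, W, Wm, ZT, Zmul, Zadj; mcbn. rewrite Z2Nat.id by lia.
     replace (m22 h) with (m21 h * v + j * D)%Z by lia. rewrite Hc. ring.
  + intros x x' y Hx Hx' Hy [d1 [Hd1 E1]] [d2 [Hd2 E2]]. apply (irr (Zmul d1 (Zadj d2)) x x' Hx Hx').
   * apply Gam0_mul; auto. apply Gam0_adj; auto.
   * apply (coset_cancel g d1 d2 x x' y); auto. apply Hd2.
  + intros x y Hx Hy [dl [Hdl E]]. rewrite E. apply (sl_invariant k ps (D * p)); auto.
   * intros. apply psi_Gam0; auto.
   * destruct (L1 y Hy). lia.
Qed.

Definition ddiv (z : Z) : Cx := if Z.eq_dec (z mod D) 0 then C1 else C0.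
Lemma ddiv_1 z : (D | z)%Z -> ddiv z = C1.
Proof. clear - HD0. intros h. unfold ddiv. destruct (Z.eq_dec (z mod D) 0); auto. exfalso. apply n, Z.mod_divide; auto. lia. Qed.
Lemma ddiv_0 z : ~ (D | z)%Z -> ddiv z = C0.
Proof. clear - HD0. intros h. unfold ddiv. destruct (Z.eq_dec (z mod D) 0); auto. exfalso. apply h, Z.mod_divide; auto. lia. Qed.

Lemma Cabs_ddiv z : Cabs (ddiv z) <= 1.
Proof. clear. unfold ddiv. destruct (Z.eq_dec (z mod D) 0); rewrite ?Cabs_1, ?Cabs_0; lra. Qed.

(** When -l is a norm modulo D, hence a square, it has one root if D | l and two roots y, D - y
    otherwise. This is how the weights coming from the cosets become 1/a_D(l). *)
Lemma aD_count l x : (D | Z.of_nat l + Onorm D x)%Z ->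
 (C1 + ddiv (Z.of_nat l))%C = (ZtoC 2 / RtoC (INR (aD D l)))%C.
Proof.
 clear - HD HD4 HD0 Hns. intros [j Hj].
 set (fl := filter (fun a => Z.eqb ((Onorm D (Z.of_nat a, 0%Z) + Z.of_nat l) mod D) 0) (seq 0 (Z.to_nat D))).
 assert (HN : NoDup fl) by apply NoDup_filter, seq_NoDup.
 assert (Hin : forall b, In b fl <-> (Z.of_nat b < D)%Z /\ (D | Z.of_nat b * Z.of_nat b + Z.of_nat l)%Z).
 { intros b. unfold fl. rewrite filter_In, in_seq, Z.eqb_eq, Z.mod_divide by lia. unfold Onorm.
  rewrite !Z.mul_0_r, !Z.add_0_r. split; intros []; split; auto; lia. }
 destruct (Z.eq_dec (Z.of_nat l mod D) 0) as [h|h].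
 - apply Z.mod_divide in h; [|lia]. rewrite ddiv_1 by auto.
  assert (E : aD D l = 1%nat).
  { change (length fl = length (0%nat :: nil)). apply Permutation_length, NoDup_Permutation; auto.
   - repeat constructor. auto.
   - intros b. rewrite Hin. split.
    + intros [H1 H2]. left. assert (hb : (D | Z.of_nat b * Z.of_nat b)%Z) by (apply (Z.divide_add_cancel_r D (Z.of_nat l)); auto; now rewrite Z.add_comm).
     apply (D_div_mul D HD) in hb. assert (hb' : (D | Z.of_nat b - 0)%Z) by (rewrite Z.sub_0_r; tauto).
     apply (small_div D) in hb'; lia.
    + intros [<-|[]]. split; [lia|]. now rewrite Z.add_0_l. }
  rewrite E. change (RtoC (INR 1)) with C1. replace (ZtoC 2 / C1)%C with (ZtoC 2) by field. apply Cx_eq; simpl; lra.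
 - assert (hl : ~ (D | Z.of_nat l)%Z) by (intros hd; apply h; apply Z.mod_divide; auto; lia). rewrite ddiv_0 by auto.
  destruct (emb_unemb D HD0 HD4 x) as [Hy0 Ex]. set (y := fst (unemb D x)) in *.
  destruct (Onorm_emb D HD4 y (snd (unemb D x))) as [m Hm]. rewrite Ex in Hm.
  assert (hy : (D | y * y + Z.of_nat l)%Z) by (exists (j - m)%Z; lia).
  assert (y <> 0)%Z by (intros E0; apply hl; rewrite E0 in hy; exact hy).
  assert (E : aD D l = 2%nat).
  { change (length fl = length (Z.to_nat y :: Z.to_nat (D - y) :: nil)). apply Permutation_length, NoDup_Permutation; auto.
   - constructor; [|repeat constructor; auto]. intros [E0|[]]. apply Z2Nat.inj in E0; try lia.
    apply (D_odd D HD Hns y). lia.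
   - intros b. rewrite Hin. split.
    + intros [H1 [i Hi]]. destruct hy as [i' Hi'].
     assert (hb : (D | (Z.of_nat b - y) * (Z.of_nat b - (D - y)))%Z) by (exists (i - i' - Z.of_nat b + y)%Z; lia).
     apply (D_div_mul D HD) in hb as [hb|hb]; apply (small_div D) in hb; try lia; [left|right; left]; lia.
    + destruct hy as [i Hi]. intros [<-|[<-|[]]]; rewrite Z2Nat.id by lia; (split; [lia|]); [exists i; lia|exists (i + D - 2 * y)%Z; lia]. }
  rewrite E. replace (RtoC (INR 2)) with (ZtoC 2) by (apply Cx_eq; simpl; lra). field.
Qed.

Definition Phi (Z : M2 Cx) : Cx := (RtoC (sqrt (IZR D)) / (Ci * ZtoC 2) * Ph2 Z)%C.

Lemma th0_HasSum Z : inH (m11 Z) -> HasSum (fun x => (ddiv (Onorm D x) * qx D x Z)%C) (th D 0 Z).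
Proof.
 clear - HD HD4 HD0. intros HZ. apply (HasSum_inj_conv (emb D 0)).
 - intros x y. apply (emb_y_inj D HD0 HD4).
 - intros x Hx. rewrite ddiv_0; [ring|]. intros hd. destruct (emb_unemb D HD0 HD4 x) as [Hy0 Ex].
  apply (Hx (snd (unemb D x))). rewrite <- Ex at 2. f_equal. symmetry.
  destruct (Onorm_emb D HD4 (fst (unemb D x)) (snd (unemb D x))) as [m Hm]. rewrite Ex in Hm. destruct hd as [j Hj].
  assert (h : (D | fst (unemb D x) * fst (unemb D x))%Z) by (exists (j - m)%Z; lia).
  apply (small_div D); try lia. rewrite Z.sub_0_r. apply (D_div_mul D HD) in h. tauto.
 - eapply HasSum_ext; [|apply (th_spec D HD0 HD4 0 Z HZ)]. intros ab. cbv beta. rewrite ddiv_1; [ring|].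
  destruct (Onorm_emb D HD4 0 ab) as [m Hm]. exists m. lia.
Qed.

(** [ft] keeps the l divisible by D and [th 0] the x of norm divisible by D; in the sum over the
    translates, orthogonality over v keeps the pairs with D | l + N(x). Absolute convergence is
    stated for the unweighted product, which dominates both. *)
Lemma Ph2_HasSum Z : inH (m11 Z) -> AbsSum (fun lx : nat * OK => (nser a (m11 Z / ZtoC D) (fst lx) * qx D (snd lx) Z)%C) /\
 HasSum (fun lx : nat * OK => ((ddiv (Z.of_nat (fst lx)) * ddiv (Onorm D (snd lx)) + ddiv (Z.of_nat (fst lx) + Onorm D (snd lx)))
  * (nser a (m11 Z / ZtoC D) (fst lx) * qx D (snd lx) Z))%C) (Ph2 Z).
Proof.
 clear HC HS Hns Hplus. intros HZ. assert (DN := ZtoC_neq0 D ltac:(lia)). set (u := (m11 Z / ZtoC D)%C).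
 assert (Hu : inH u).
 { unfold u. replace (m11 Z / ZtoC D)%C with (mob (Mv D 0) (m11 Z)); [apply mob_inH; auto; unfold Zdet, Mv; mcbn; lia|].
  rewrite mob_Mv by (auto; lia). unfold Rdiv. rewrite Rmult_0_l. change (RtoC 0) with C0. ring. }
 destruct (qexp_AbsSum f a Ha u Hu) as [A1 _]. pose proof (qx_AbsSum D HD0 HD4 Z HZ) as A2.
 split; [apply (AbsSum_prod _ _ A1 A2)|].
 assert (S1 : HasSum (fun l => (ddiv (Z.of_nat l) * nser a u l)%C) (ft D f (m11 Z))).
 { unfold ft, Cdiv. rewrite Cmul_comm. eapply HasSum_ext; [|apply HasSum_scal, HasSum_Csum; intros v _; apply (fsh_HasSum D f a Ha (Z.of_nat v) u Hu)].
  intros l. cbv beta. change (Cinv (ZtoC D) * zsum D (fun v => (zeta D (Z.of_nat l * v) * nser a u l)%C) = ddiv (Z.of_nat l) * nser a u l)%C.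
  rewrite (zsum_ext D _ (fun v => (nser a u l * zeta D (Z.of_nat l * v))%C)) by (intros; ring).
  rewrite zsum_scal, (zsum_zeta D HD). unfold ddiv. destruct (Z.eq_dec (Z.of_nat l mod D) 0); field; auto. }
 assert (S2 := th0_HasSum Z HZ).
 assert (dd : forall z, Cabs (ddiv z) <= 1) by apply Cabs_ddiv.
 assert (B1 : AbsSum (fun l => (ddiv (Z.of_nat l) * nser a u l)%C)).
 { apply (AbsSum_le _ _ 1 A1). intros i. rewrite Cabs_mul. apply Rmult_le_compat_r; auto. apply Cabs_pos. }
 assert (B2 : AbsSum (fun x => (ddiv (Onorm D x) * qx D x Z)%C)).
 { apply (AbsSum_le _ _ 1 A2). intros i. rewrite Cabs_mul. apply Rmult_le_compat_r; auto. apply Cabs_pos. }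
 assert (S3 : forall v, HasSum (fun lx : nat * OK => (Cinv (ZtoC D) * ((zeta D (Z.of_nat (fst lx) * v) * nser a u (fst lx)) * (zeta D (v * Onorm D (snd lx)) * qx D (snd lx) Z)))%C)
  (f (m11 (Zact (ZT v) Z) / ZtoC D) * Th D (Zact (ZT v) Z) / ZtoC D)%C).
 { intros v. replace (f (m11 (Zact (ZT v) Z) / ZtoC D) * Th D (Zact (ZT v) Z) / ZtoC D)%C with
   (Cinv (ZtoC D) * (f (m11 (Zact (ZT v) Z) / ZtoC D)%C * Th D (Zact (ZT v) Z)))%C by (unfold Cdiv; ring). apply HasSum_scal.
  assert (Hz1 : forall z, Cabs (zeta D z) <= 1) by (intros; rewrite (Cabs_zeta D); lra).
  apply (HasSum_prod (fun l => (zeta D (Z.of_nat l * v) * nser a u l)%C) (fun x => (zeta D (v * Onorm D x) * qx D x Z)%C)).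
  - apply (AbsSum_le _ _ 1 A1). intros i. rewrite Cabs_mul. apply Rmult_le_compat_r; auto. apply Cabs_pos.
  - apply (AbsSum_le _ _ 1 A2). intros i. rewrite Cabs_mul. apply Rmult_le_compat_r; auto. apply Cabs_pos.
  - rewrite Zact_T. cbn [m11]. replace ((m11 Z + ZtoC v) / ZtoC D)%C with (u + RtoC (IZR v / IZR D))%C; [apply (fsh_HasSum D f a Ha v u Hu)|].
   unfold u, Rdiv. rewrite RtoC_mul, RtoC_inv by (apply not_0_IZR; lia). unfold Cdiv. fold (ZtoC v) (ZtoC D). ring.
  - eapply HasSum_ext; [|apply (Th_spec D HD0 HD4)]; [intros x; cbv beta; apply qx_T|]. apply inH_T; auto. }
 pose proof (HasSum_add _ _ _ _ (HasSum_prod _ _ _ _ B1 B2 S1 S2)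
  (HasSum_Csum _ _ (seq 0 (Z.to_nat D)) (fun v _ => S3 (Z.of_nat v)))) as K.
 eapply HasSum_ext; [|exact K]. intros [l x]. pcbn.
 set (G := (nser a u l * qx D x Z)%C).
 assert (E : Csum (map (fun v => (Cinv (ZtoC D) * ((zeta D (Z.of_nat l * Z.of_nat v) * nser a u l) * (zeta D (Z.of_nat v * Onorm D x) * qx D x Z)))%C) (seq 0 (Z.to_nat D)))
  = (Cinv (ZtoC D) * (G * (ddiv (Z.of_nat l + Onorm D x) * ZtoC D)))%C).
 { rewrite Csum_map_scal. f_equal.
  transitivity (G * zsum D (fun v => zeta D ((Z.of_nat l + Onorm D x) * v)))%C.
  - unfold zsum. rewrite <- Csum_map_scal. f_equal. apply map_ext. intros v. unfold G.
   rewrite Z.mul_add_distr_r, (zeta_add D), (Z.mul_comm (Onorm D x)). ring.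
  - rewrite (zsum_zeta D HD). unfold ddiv. destruct (Z.eq_dec ((Z.of_nat l + Onorm D x) mod D) 0); ring. }
 rewrite E. unfold G. field. auto.
Qed.

(** On pairs with D | l + N(x) the first weight reduces to [D | l], so the total is 1 + [D | l] =
    2/a_D(l), and the normalization sqrt(D)/(2i) makes the coefficient the prescribed alpha. Other
    pairs have weight zero, so n = (l + N(x))/D can serve as the index. *)
Lemma Phi_HasSum Z : inH (m11 Z) -> AbsSum (jterm D a Z) /\ HasSum (jterm D a Z) (Phi Z).
Proof.
 intros HZ. assert (DN := ZtoC_neq0 D ltac:(lia)). destruct (Ph2_HasSum Z HZ) as [A S].
 assert (a00 : a 0%nat = C0).
 { apply (cusp_coeff_bound D HD (k - 1) (D * p) ltac:(nia) ltac:(exists p; ring) f Hf Hns a Ha). }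
 (* An intermediate family with an integer first index: l in nat embeds into it by [h], and (n, x)
    by [h2], and it vanishes outside both images. *)
 set (tr := fun zx : BinNums.Z * OK => (ddiv (fst zx + Onorm D (snd zx)) * alz D a (fst zx) *
  e (ZtoC ((fst zx + Onorm D (snd zx)) / D) * m11 Z + lx D (snd zx) Z + m22 Z)%C)%C).
 set (h := fun lx : nat * OK => (Z.of_nat (fst lx), snd lx)).
 assert (Hh : forall x y, h x = h y -> x = y).
 { intros [l x] [l' x'] E. unfold h in E. cbn [fst snd] in E. pose proof (f_equal fst E) as E1. pose proof (f_equal snd E) as E2.
  cbn [fst snd] in E1, E2. f_equal; auto. lia. }
 assert (Hh0 : forall i, (forall j, h j <> i) -> tr i = C0).
 { intros [z x] Hi. unfold tr, alz; pcbn. destruct (Z_le_gt_dec z 0); [ring|].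
  exfalso. apply (Hi (Z.to_nat z, x)). unfold h; pcbn. f_equal. lia. }
 assert (Etr : forall lx : nat * OK, tr (h lx) = (RtoC (sqrt (IZR D)) / (Ci * ZtoC 2) * ((ddiv (Z.of_nat (fst lx)) * ddiv (Onorm D (snd lx)) + ddiv (Z.of_nat (fst lx) + Onorm D (snd lx)))
  * (nser a (m11 Z / ZtoC D) (fst lx) * qx D (snd lx) Z)))%C).
 { intros [l x]. unfold tr, h; pcbn. destruct (classic (D | Z.of_nat l + Onorm D x)%Z) as [hd|hd].
  - rewrite (ddiv_1 _ hd).
   assert (Ec : (ddiv (Z.of_nat l) * ddiv (Onorm D x))%C = ddiv (Z.of_nat l)).
   { destruct (classic (D | Z.of_nat l)%Z) as [h1|h1]; [|rewrite (ddiv_0 _ h1); ring].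
    rewrite (ddiv_1 _ h1), ddiv_1; [ring|]. apply (Z.divide_add_cancel_r D (Z.of_nat l)); auto. }
   rewrite Ec. replace (ddiv (Z.of_nat l) + C1)%C with (C1 + ddiv (Z.of_nat l))%C by ring. rewrite (aD_count l x hd).
   assert (Ee : (e (ZtoC (Z.of_nat l) * (m11 Z / ZtoC D))%C * qx D x Z)%C = e (ZtoC ((Z.of_nat l + Onorm D x) / D) * m11 Z + lx D x Z + m22 Z)%C).
   { unfold qx. rewrite <- e_add. f_equal. destruct hd as [j Hj]. rewrite Hj, Z.div_mul by lia.
    unfold Rdiv. rewrite RtoC_mul, RtoC_inv by (apply not_0_IZR; lia). fold (ZtoC (Onorm D x)) (ZtoC D).
    replace (ZtoC (Onorm D x)) with (ZtoC j * ZtoC D - ZtoC (Z.of_nat l))%C by (rewrite <- ZtoC_mul, <- Hj, ZtoC_add; ring). field. auto. }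
   unfold nser. rewrite <- Ee. unfold alz. destruct (Z_le_gt_dec (Z.of_nat l) 0) as [h1|h1].
   + replace l with 0%nat by lia. rewrite a00. ring.
   + rewrite Nat2Z.id. unfold Cdiv. rewrite !Cinv_mul.
    replace (Cinv (ZtoC 2)) with (RtoC (/ 2)) by (unfold ZtoC; rewrite RtoC_inv by lra; reflexivity).
    assert (E2 : (RtoC (/ 2) * ZtoC 2)%C = C1) by (apply Cx_eq; simpl; field).
    transitivity ((RtoC (/ 2) * ZtoC 2) * (RtoC (sqrt (IZR D)) * a l * (Cinv Ci * Cinv (RtoC (INR (aD D l)))) *
     (e (ZtoC (Z.of_nat l) * (m11 Z * Cinv (ZtoC D))) * qx D x Z)))%C; [rewrite E2|]; ring.
  - rewrite (ddiv_0 _ hd). replace (ddiv (Z.of_nat l) * ddiv (Onorm D x))%C with C0; [ring|].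
   destruct (classic (D | Z.of_nat l)%Z) as [h1|h1]; [|rewrite (ddiv_0 _ h1); ring].
   rewrite (ddiv_0 (Onorm D x)); [ring|]. intros h2. apply hd. apply Z.divide_add_r; auto. }
 assert (tA : AbsSum tr).
 { apply (AbsSum_inj_conv h); auto. eapply AbsSum_ext; [intros; symmetry; apply Etr|]. apply AbsSum_scal.
  apply (AbsSum_le _ _ 2 A). intros i. rewrite Cabs_mul. apply Rmult_le_compat_r; [apply Cabs_pos|].
  eapply Rle_trans; [apply Cabs_triang|]. rewrite Cabs_mul.
  pose proof (Cabs_ddiv (Z.of_nat (fst i))). pose proof (Cabs_ddiv (Onorm D (snd i))).
  pose proof (Cabs_ddiv (Z.of_nat (fst i) + Onorm D (snd i))). pose proof (Cabs_pos (ddiv (Z.of_nat (fst i)))). pose proof (Cabs_pos (ddiv (Onorm D (snd i)))). nra. }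
 assert (tS : HasSum tr (Phi Z)).
 { apply (HasSum_inj_conv h); auto. eapply HasSum_ext; [intros; symmetry; apply Etr|]. apply HasSum_scal, S. }
 set (h2 := fun nx : BinNums.Z * OK => ((D * fst nx - Onorm D (snd nx))%Z, snd nx)).
 assert (Hh2 : forall x y, h2 x = h2 y -> x = y).
 { intros [n x] [n' x'] E. unfold h2 in E. cbn [fst snd] in E. pose proof (f_equal fst E) as E1. pose proof (f_equal snd E) as E2.
  cbn [fst snd] in E1, E2. subst x'. f_equal. nia. }
 assert (E2 : forall nx, tr (h2 nx) = jterm D a Z nx).
 { intros [n x]. unfold tr, h2, jterm; pcbn. replace (D * n - Onorm D x + Onorm D x)%Z with (n * D)%Z by ring.
  rewrite Z.div_mul by lia. rewrite ddiv_1 by (exists n; ring). ring. }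
 split.
 - eapply AbsSum_ext; [apply E2|]. apply (AbsSum_inj h2); auto.
 - eapply HasSum_ext; [apply E2|]. apply HasSum_inj; auto.
  intros [z x] Hi. unfold tr; pcbn. rewrite ddiv_0; [ring|]. intros [j Hj].
  apply (Hi (j, x)). unfold h2; pcbn. f_equal. lia.
Qed.

Lemma Phi_Gam0 g Z : Gam0 p g -> inH (m11 Z) -> Phi (Zact g Z) = (Cpow (Zj g Z) k * Phi Z)%C.
Proof using All. intros. unfold Phi. rewrite Ph2_Gam0 by auto. ring. Qed.
End Jacobi.

(** * The Maass lift *)

Lemma Csum_flat_map {A B} (f : A -> list B) (g : B -> Cx) l :
 Csum (map g (flat_map f l)) = Csum (map (fun x => Csum (map g (f x))) l).
Proof. induction l; simpl; auto. rewrite map_app, Csum_app, IHl. reflexivity. Qed.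
Lemma NoDup_flat_map {A B} (f : A -> list B) l : NoDup l -> (forall x, In x l -> NoDup (f x)) ->
 (forall x y z, In x l -> In y l -> In z (f x) -> In z (f y) -> x = y) -> NoDup (flat_map f l).
Proof.
 induction l as [|x l IH]; intros Hl Hf Hd; [constructor|]. apply NoDup_cons_iff in Hl as [Hx Hl]. simpl.
 apply NoDup_app; [apply Hf; left; auto|apply IH; auto|].
 - intros; apply Hf; right; auto.
 - intros y y' z Hy Hy'. apply Hd; right; auto.
 - intros z Hz Hz'. apply in_flat_map in Hz' as [y [Hy Hz']]. assert (x = y) by (apply (Hd x y z); simpl; auto). congruence.
Qed.
Lemma gcd_prime p a : prime p -> (Z.gcd a p = 1)%Z <-> ~ (p | a)%Z.
Proof.
 intros Hp. pose proof (prime_ge_2 p Hp). split.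
 - intros E Hd. assert (h : (p | Z.gcd a p)%Z) by (apply Z.gcd_greatest; auto; apply Z.divide_refl).
  rewrite E in h. apply Z.divide_1_r_nonneg in h; lia.
 - intros Hn. apply Zgcd_1_rel_prime. apply rel_prime_sym, prime_rel_prime; auto.
Qed.

Definition Ozs (z : Z) (x : OK) : OK := (z * fst x, z * snd x)%Z.
Definition tex (D : Z) (T : Sidx) (Z : M2 Cx) : Cx :=
 (ZtoC (fst (fst T)) * m11 Z + lx D (snd T) Z + ZtoC (snd (fst T)) * m22 Z)%C.

Lemma epsT_div T d : (d | epsT T)%Z <-> (d | fst (fst T))%Z /\ (d | snd (fst T))%Z /\ Omultiple d (snd T).
Proof.
 destruct T as [[l m] x]. unfold epsT, Omultiple; pcbn. split.
 - intros H. pose proof (Z.divide_trans _ _ _ H (Z.gcd_divide_l _ _)) as A.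
  pose proof (Z.divide_trans _ _ _ H (Z.gcd_divide_r _ _)) as B.
  repeat split; [eapply Z.divide_trans; [apply A|apply Z.gcd_divide_l]|eapply Z.divide_trans; [apply A|apply Z.gcd_divide_r]
   |eapply Z.divide_trans; [apply B|apply Z.gcd_divide_l]|eapply Z.divide_trans; [apply B|apply Z.gcd_divide_r]].
 - intros [H1 [H2 [H3 H4]]]. repeat apply Z.gcd_greatest; auto.
Qed.
Lemma epsT_nonneg T : (0 <= epsT T)%Z.
Proof. destruct T as [[l m] x]. apply Z.gcd_nonneg. Qed.

Section Lift.
Context (D p : Z) (HD0 : (0 < D)%Z) (Hp : prime p) (k : nat) (Hk : (0 < k)%nat) (cf : nat -> Cx) (Ph : M2 Cx -> Cx).
Context (HJ : forall Z, inH (m11 Z) -> ASum (jterm D cf Z) (Ph Z)).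
Context (HG : forall g Z, Gam0 p g -> inH (m11 Z) -> Ph (Zact g Z) = (Cpow (Zj g Z) k * Ph Z)%C).

Lemma lx_Ozs z x Z : lx D (Ozs z x) Z = (ZtoC z * lx D x Z)%C.
Proof.
 unfold lx. rewrite !(tx_eq D HD0). unfold Ou, Ozs; pcbn. pose proof (dl_pos D HD0).
 rewrite !plus_IZR, !mult_IZR. apply Cx_eq; cbn [Re Im Cadd Cmul Cconj ZtoC RtoC]; field; lra.
Qed.
Lemma Onorm_Ozs z x : Onorm D (Ozs z x) = (z * z * Onorm D x)%Z.
Proof. destruct x. unfold Onorm, Ozs; pcbn. ring. Qed.

Definition okd (T : Sidx) (d : nat) : bool := (Z.eqb (epsT T mod Z.of_nat d) 0 && Z.eqb (Z.gcd (Z.of_nat d) p) 1)%bool.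
Definition dterm (T : Sidx) (d : nat) : Cx :=
 (Cpow (RtoC (INR d)) (k - 1) * alz D cf (DdetT D T / (Z.of_nat d * Z.of_nat d)))%C.
(** The cut at m <= 0 excludes negative definite indices, whose determinant is positive. At
    semidefinite indices with m = 0 the determinant is not positive, so [alz] would give zero
    anyway. *)
Definition Cf (T : Sidx) : Cx := if Z_le_gt_dec (snd (fst T)) 0 then C0 else
 Csum (map (dterm T) (filter (okd T) (seq 1 (Z.to_nat (epsT T))))).
Definition Fterm (Z : M2 Cx) (T : Sidx) : Cx := (Cf T * e (tex D T Z))%C.

(** For m > 0 the content eps(T) divides m, so the divisor sum may run up to any n >= m: a range
    that no longer depends on T, as needed for exchanging it with the sum over T. *)
Lemma Cf_long T n : (0 < snd (fst T))%Z -> (snd (fst T) <= Z.of_nat n)%Z ->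
 Cf T = Csum (map (fun d => if okd T d then dterm T d else C0) (seq 1 n)).
Proof.
 intros H0 Hn. unfold Cf. destruct (Z_le_gt_dec (snd (fst T)) 0); [lia|].
 rewrite Csum_filter. set (N := Z.to_nat (epsT T)). pose proof (epsT_nonneg T).
 assert (He : (epsT T <= snd (fst T))%Z) by (apply Z.divide_pos_le; auto; apply (epsT_div T); apply Z.divide_refl).
 assert (He0 : epsT T <> 0%Z).
 { intros E. pose proof (proj1 (epsT_div T 0%Z)) as K. rewrite E in K. destruct K as [_ [[z Hz] _]]; [apply Z.divide_refl|]. lia. }
 replace n with (N + (n - N))%nat by lia. rewrite seq_app, map_app, Csum_app.
 rewrite (Csum_map_0 _ (seq (1 + N) (n - N))); [ring|].
 intros d Hd. apply in_seq in Hd. unfold okd. destruct (Z.eqb_spec (epsT T mod Z.of_nat d) 0) as [E|E]; [|reflexivity].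
 apply Z.mod_divide in E; [|lia]. apply Z.divide_pos_le in E; lia.
Qed.

Definition hecke_row (a d : nat) : list (M2 Z) := map (fun b => mkM2 (Z.of_nat a) (Z.of_nat b) 0%Z (Z.of_nat d)) (seq 0 d).
(** For the matrices (a, b; 0, d) the average over b modulo d keeps the indices (n, x) with d | n,
    and scaling by a sends (n, x) = (d n', x) to T = (a n', a d, a x), with D det T / a^2 = D d n' -
    N(x). This is the contribution of the divisor a to the coefficients with m = a d. *)
Lemma fj_row (a d : nat) Z : (0 < a)%nat -> (0 < d)%nat -> inH (m11 Z) ->
 ASum (fun lx : BinNums.Z * OK => let T := (fst lx, Z.of_nat (a * d), snd lx) in
   if Z.eqb (epsT T mod Z.of_nat a) 0 then (dterm T a * e (tex D T Z))%C else C0)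
  (Cpow (ZtoC (Z.of_nat (a * d))) (k - 1) * Csum (map (sl k Ph Z) (hecke_row a d)))%C.
Proof using All.
 intros Ha Hd HZ. assert (Da := ZtoC_neq0 (Z.of_nat a) ltac:(lia)). assert (Dd := ZtoC_neq0 (Z.of_nat d) ltac:(lia)).
 set (h := fun nx : BinNums.Z * OK => ((Z.of_nat a * fst nx)%Z, Ozs (Z.of_nat a) (snd nx))).
 apply (ASum_inj_conv h).
 { intros [n [x1 x2]] [n' [y1 y2]] E. unfold h, Ozs in E; cbn [fst snd] in E. pose proof (f_equal fst E) as E1. apply (f_equal snd) in E.
  pose proof (f_equal fst E) as E2. pose proof (f_equal snd E) as E3. cbn [fst snd] in E1, E2, E3.
  f_equal; [|f_equal]; nia. }
 { intros [l [x1 x2]] Hi. cbv zeta. pcbn. match goal with |- context [Z.eqb ?u 0] => destruct (Z.eqb_spec u 0) as [E|] end; auto.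
  exfalso. apply Z.mod_divide in E; [|lia]. apply epsT_div in E; cbn [fst snd] in E. destruct E as [[l' ->] [_ [[y1 E1] [y2 E2]]]].
  cbn [fst snd] in E1, E2. apply (Hi (l', (y1, y2))). unfold h, Ozs; pcbn. subst. f_equal; [|f_equal]; ring. }
 set (h3 := fun nx : BinNums.Z * OK => ((Z.of_nat d * fst nx)%Z, snd nx)).
 set (Mb := fun b : nat => mkM2 (Z.of_nat a) (Z.of_nat b) 0%Z (Z.of_nat d)).
 assert (DMb : forall b, Zdet (Mb b) = Z.of_nat (a * d)) by (intros; unfold Zdet, Mb; mcbn; lia).
 assert (JMb : forall b, Zj (Mb b) Z = ZtoC (Z.of_nat d)) by (intros; unfold Zj, Mb; cbn [m21 m22]; ring).
 assert (Hq : forall b, inH (m11 (Zact (Mb b) Z))) by (intros; apply Zact_inH; auto; rewrite DMb; lia).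
 set (G := fun nx : BinNums.Z * OK => (alz D cf (D * fst nx - Onorm D (snd nx)) *
  e (ZtoC (fst nx) * (ZtoC (Z.of_nat a) * m11 Z / ZtoC (Z.of_nat d)) + ZtoC (Z.of_nat a) * lx D (snd nx) Z + ZtoC (Z.of_nat (a * d)) * m22 Z)%C)%C).
 assert (K : ASum (fun nx => (Cpow (ZtoC (Z.of_nat a)) (k - 1) * if Z.eq_dec (fst nx mod Z.of_nat d) 0 then G nx else C0)%C)
  (Cpow (ZtoC (Z.of_nat (a * d))) (k - 1) * Csum (map (sl k Ph Z) (hecke_row a d)))%C).
 { pose proof (ASum_Csum _ _ (seq 0 d) (fun b _ => HJ _ (Hq b))) as K.
  apply (ASum_scal (Cpow (ZtoC (Z.of_nat (a * d))) (k - 1) * Cinv (Cpow (ZtoC (Z.of_nat d)) k))%C) in K.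
  replace (Cpow (ZtoC (Z.of_nat (a * d))) (k - 1) * Csum (map (sl k Ph Z) (hecke_row a d)))%C with
   (Cpow (ZtoC (Z.of_nat (a * d))) (k - 1) * Cinv (Cpow (ZtoC (Z.of_nat d)) k) * Csum (map (fun b => Ph (Zact (Mb b) Z)) (seq 0 d)))%C.
  2:{ unfold hecke_row. rewrite map_map. change (fun b => mkM2 (Z.of_nat a) (Z.of_nat b) 0%Z (Z.of_nat d)) with Mb.
    transitivity (Cpow (ZtoC (Z.of_nat (a * d))) (k - 1) * (Cinv (Cpow (ZtoC (Z.of_nat d)) k) * Csum (map (fun b => Ph (Zact (Mb b) Z)) (seq 0 d))))%C; [ring|].
    f_equal. rewrite <- Csum_map_scal. f_equal. apply map_ext. intros b. unfold sl. rewrite <- (JMb b). reflexivity. }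
  eapply ASum_ext; [|exact K]. intros [n x]. pcbn.
  rewrite (map_ext _ (fun b => (G (n, x) * e (RtoC (IZR n * INR b / INR d)))%C)).
  - rewrite Csum_map_scal, Zrange_avg by auto. destruct (Z.eq_dec (n mod Z.of_nat d) 0); [|ring].
   rewrite Nat2Z.inj_mul, ZtoC_mul, Cpow_mul.
   replace (Cpow (ZtoC (Z.of_nat d)) k) with (ZtoC (Z.of_nat d) * Cpow (ZtoC (Z.of_nat d)) (k - 1))%C by (destruct k; [lia|simpl; now rewrite Nat.sub_0_r]).
   pose proof (Cpow_neq0 _ (k - 1) Dd). field. auto.
  - intros b. unfold jterm, G; pcbn. rewrite <- Cmul_assoc, <- e_add. do 2 f_equal.
   assert (El : lx D x (Zact (Mb b) Z) = (ZtoC (Z.of_nat a) * lx D x Z)%C).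
   { unfold lx, Zact. cbn [m12 m21]. rewrite JMb, DMb, Nat2Z.inj_mul, ZtoC_mul. field. auto. }
   rewrite El. unfold Zact; cbn [m11 m22]. rewrite JMb, DMb. unfold Mb; cbn [m11 m12 m21].
   replace (RtoC (IZR n * INR b / INR d)) with (ZtoC n * ZtoC (Z.of_nat b) / ZtoC (Z.of_nat d))%C.
   + change (ZtoC 0) with C0. field. auto.
   + rewrite RtoC_div by (apply not_0_INR; lia). rewrite RtoC_mul, !RtoC_INR_Z. reflexivity. }
 apply (ASum_inj h3) in K.
 - eapply ASum_ext; [|exact K]. intros [n x]. unfold h3, h; pcbn. cbv zeta.
  destruct (Z.eq_dec ((Z.of_nat d * n) mod Z.of_nat d) 0) as [_|E]; [|exfalso; apply E; rewrite Z.mul_comm; apply Z.mod_mul; lia].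
  set (T := (Z.of_nat a * n, Z.of_nat (a * d), Ozs (Z.of_nat a) x)%Z).
  assert (ET : (epsT T mod Z.of_nat a)%Z = 0%Z).
  { apply Z.mod_divide; [lia|]. apply epsT_div. unfold T, Omultiple, Ozs; pcbn.
   repeat split; [exists n; ring|exists (Z.of_nat d); lia|exists (fst x); ring|exists (snd x); ring]. }
  rewrite ET, Z.eqb_refl. unfold dterm, G, tex, T; pcbn. rewrite lx_Ozs, RtoC_INR_Z, <- Cmul_assoc. f_equal. f_equal.
  + f_equal. unfold DdetT. rewrite Onorm_Ozs.
   replace (D * (Z.of_nat a * n) * Z.of_nat (a * d) - Z.of_nat a * Z.of_nat a * Onorm D x)%Z with
    ((D * (Z.of_nat d * n) - Onorm D x) * (Z.of_nat a * Z.of_nat a))%Z by (rewrite Nat2Z.inj_mul; ring).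
   rewrite Z.div_mul by nia. reflexivity.
  + f_equal. rewrite !ZtoC_mul. field. auto.
 - intros [n x] [n' x'] E. unfold h3 in E; cbn [fst snd] in E. pose proof (f_equal fst E) as E1. apply (f_equal snd) in E.
  cbn [fst snd] in E1, E. f_equal; [nia|auto].
 - intros [n x] Hi. pcbn. destruct (Z.eq_dec (n mod Z.of_nat d) 0) as [E|]; [|ring].
  exfalso. apply Z.mod_divide in E; [|lia]. destruct E as [j ->]. apply (Hi (j, x)). unfold h3; pcbn. f_equal. ring.
Qed.

Definition fj_div (m : nat) : list nat :=
 filter (fun a => Z.eqb (Z.of_nat m mod Z.of_nat a) 0 && Z.eqb (Z.gcd (Z.of_nat a) p) 1)%bool (seq 1 m).
Definition hecke (m : nat) : list (M2 Z) := flat_map (fun a => hecke_row a (m / a)) (fj_div m).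
(** The index-raising operator V_m at level p: only divisors a prime to p occur, and m^(k-1)
    supplies the normalization that [sl] leaves out. *)
Definition Vm (m : nat) (Z : M2 Cx) : Cx := (Cpow (ZtoC (Z.of_nat m)) (k - 1) * Csum (map (sl k Ph Z) (hecke m)))%C.

Lemma fj_div_in m a : In a (fj_div m) <-> (0 < a <= m)%nat /\ m = (a * (m / a))%nat /\ ~ (p | Z.of_nat a)%Z.
Proof.
 unfold fj_div. rewrite filter_In, in_seq, Bool.andb_true_iff, !Z.eqb_eq, (gcd_prime p _ Hp). split.
 - intros [H1 [H2 H3]]. split; [lia|]. split; auto. rewrite <- Nat2Z.inj_mod in H2.
  apply Nat.Div0.div_exact. lia.
 - intros [H1 [H2 H3]]. split; [lia|]. split; auto. rewrite <- Nat2Z.inj_mod.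
  apply Nat.Div0.div_exact in H2. lia.
Qed.

Lemma Vm_ASum m Z : (0 < m)%nat -> inH (m11 Z) ->
 ASum (fun lx : BinNums.Z * OK => Fterm Z (fst lx, Z.of_nat m, snd lx)) (Vm m Z).
Proof using All.
 intros Hm HZ. unfold Vm, hecke. rewrite Csum_flat_map, <- Csum_map_scal.
 eapply ASum_ext.
 2:{ apply (ASum_Csum (fun a lx => let T := (fst lx, Z.of_nat m, snd lx) in
   if Z.eqb (epsT T mod Z.of_nat a) 0 then (dterm T a * e (tex D T Z))%C else C0)).
   intros a Ha. apply fj_div_in in Ha as [H1 [H2 _]].
   assert (0 < m / a)%nat by (apply Nat.div_str_pos; lia).
   pose proof (fj_row a (m / a) Z ltac:(lia) ltac:(lia) HZ) as K. rewrite <- H2 in K. exact K. }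
 intros [l x]. pcbn. cbv zeta. set (T := (l, Z.of_nat m, x)). unfold Fterm.
 rewrite (Cf_long T m) by (unfold T; pcbn; lia). unfold fj_div. rewrite Csum_filter, Cmul_comm, <- Csum_map_scal.
 f_equal. apply map_ext_in. intros a Ha. apply in_seq in Ha. unfold okd.
 destruct (Z.eqb_spec (epsT T mod Z.of_nat a) 0) as [E|E].
 - apply Z.mod_divide in E; [|lia]. apply epsT_div in E. destruct E as [_ [E _]]. unfold T in E; cbn [fst snd] in E.
  apply Z.mod_divide in E; [|lia]. rewrite E. simpl. destruct (Z.eqb (Z.gcd (Z.of_nat a) p) 1); ring.
 - simpl. destruct (_ && _)%bool; ring.
Qed.

Lemma hecke_in m M : (0 < m)%nat -> In M (hecke m) <->
 (0 < m11 M)%Z /\ m21 M = 0%Z /\ (m11 M * m22 M = Z.of_nat m)%Z /\ (0 <= m12 M < m22 M)%Z /\ ~ (p | m11 M)%Z.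
Proof.
 intros Hm. unfold hecke. rewrite in_flat_map. split.
 - intros [a [Ha HM]]. apply fj_div_in in Ha as [H1 [H2 H3]]. apply in_map_iff in HM as [b [<- Hb]]. apply in_seq in Hb.
  mcbn. repeat split; auto; lia.
 - destruct M as [a b c d]. mcbn. intros [H1 [H2 [H3 [H4 H5]]]]. subst c.
  exists (Z.to_nat a). assert (E : (m / Z.to_nat a)%nat = Z.to_nat d).
  { replace m with (Z.to_nat d * Z.to_nat a)%nat by nia. apply Nat.div_mul. lia. }
  split.
  + apply fj_div_in. rewrite E, Z2Nat.id by lia. repeat split; auto; nia.
  + unfold hecke_row. rewrite E. apply in_map_iff. exists (Z.to_nat b). rewrite !Z2Nat.id by lia. split; auto. apply in_seq. lia.
Qed.
Lemma hecke_NoDup m : NoDup (hecke m).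
Proof.
 apply NoDup_flat_map.
 - apply NoDup_filter, seq_NoDup.
 - intros a _. apply NoDup_map_NoDup_ForallPairs; [|apply seq_NoDup]. intros x y _ _ E. apply (f_equal m12) in E. cbn [m12] in E. lia.
 - intros x y z _ _ Hx Hy. apply in_map_iff in Hx as [b [<- _]]. apply in_map_iff in Hy as [b' [E _]].
  apply (f_equal m11) in E. cbn [m11] in E. lia.
Qed.

(** Hermite normal form: the first column is reduced to its gcd by a unimodular matrix on the left,
    and the upper right entry modulo the lower right one. *)
Lemma hecke_complete m N : (0 < m)%nat -> Zdet N = Z.of_nat m -> (p | m21 N)%Z -> ~ (p | m11 N)%Z ->
 exists y, In y (hecke m) /\ exists dl, Gam0 p dl /\ N = Zmul dl y.
Proof.
 intros Hm HN [c Hc] Hn1. destruct N as [n1 n2 n3 n4]. unfold Zdet in HN. cbn [m11 m12 m21 m22] in *.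
 assert (Hn10 : n1 <> 0%Z) by (intros ->; apply Hn1; exists 0%Z; reflexivity).
 set (g := Z.gcd n1 n3).
 assert (Hg : (0 < g)%Z).
 { unfold g. pose proof (Z.gcd_nonneg n1 n3). destruct (Z.eq_dec (Z.gcd n1 n3) 0) as [E|]; [|lia].
  apply Z.gcd_eq_0 in E. lia. }
 destruct (Z.gcd_divide_l n1 n3) as [v Hv]. destruct (Z.gcd_divide_r n1 n3) as [u Hu]. fold g in Hv, Hu.
 destruct (Zis_gcd_bezout n1 n3 g (Zgcd_is_gcd _ _)) as [s t Hst].
 assert (Hb : (s * v + t * u = 1)%Z) by (apply Z.mul_cancel_r with g; [lia|];
  transitivity (s * (v * g) + t * (u * g))%Z; [ring|]; rewrite <- Hv, <- Hu; lia).
 (* The left factor lies in Gamma_0(p): p divides n3 = u g but not n1, so it does not divide g. *)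
 assert (Hpu : (p | u)%Z).
 { assert (h : (p | u * g)%Z) by (exists c; lia). apply prime_mult in h; auto. destruct h as [h|[j h]]; auto.
  exfalso. apply Hn1. exists (v * j)%Z. rewrite Hv, h. ring. }
 set (b' := (s * n2 + t * n4)%Z). set (d' := (v * n4 - u * n2)%Z).
 assert (Hd' : (g * d' = Z.of_nat m)%Z) by (unfold d'; rewrite <- HN;
  transitivity ((v * g) * n4 - n2 * (u * g))%Z; [ring|]; rewrite <- Hv, <- Hu; reflexivity).
 assert (Hd0 : (0 < d')%Z) by nia.
 pose proof (Z.div_mod b' d' ltac:(lia)) as Hbm. set (j := (b' / d')%Z) in *.
 exists (mkM2 g (b' mod d') 0 d')%Z. split.
 - apply hecke_in; auto. mcbn. repeat split; auto; try (apply Z.mod_pos_bound; auto).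
  intros [i h]. apply Hn1. exists (v * i)%Z. rewrite Hv, h. ring.
 - exists (mkM2 v (v * j - t) u (u * j + s))%Z. split.
  + split; auto. unfold Zdet; mcbn. lia.
  + unfold Zmul; mcbn. apply M2_eq; mcbn.
   * lia.
   * transitivity (v * (d' * j + b' mod d') - t * d')%Z; [|ring]. rewrite <- Hbm. unfold b', d'.
    transitivity (n2 * (s * v + t * u))%Z; [rewrite Hb; ring|ring].
   * lia.
   * transitivity (u * (d' * j + b' mod d') + s * d')%Z; [|ring]. rewrite <- Hbm. unfold b', d'.
    transitivity (n4 * (s * v + t * u))%Z; [rewrite Hb; ring|ring].
Qed.

Lemma Vm_Gam0 m g Z : (0 < m)%nat -> Gam0 p g -> inH (m11 Z) -> Vm m (Zact g Z) = (Cpow (Zj g Z) k * Vm m Z)%C.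
Proof using All.
 intros Hm Hg HZ. assert (Hg1 : Zdet g = 1%Z) by apply Hg.
 assert (Hdet : forall x, In x (hecke m) -> Zdet x = Z.of_nat m).
 { intros x Hx. apply hecke_in in Hx; auto. unfold Zdet. destruct Hx as [_ [-> [H _]]]. lia. }
 unfold Vm. rewrite (map_ext_in _ (fun x => (Cpow (Zj g Z) k * sl k Ph Z (Zmul x g))%C)).
 2:{ intros x Hx. specialize (Hdet x Hx). rewrite sl_mul by (auto; lia). pose proof (Cpow_neq0 _ k (Zj_neq0 g Z ltac:(lia) HZ)). field. auto. }
 rewrite Csum_map_scal.
 rewrite (coset_sum_shift (hecke m) (fun x => Zmul x g) (fun x y => exists dl, Gam0 p dl /\ x = Zmul dl y) (sl k Ph Z)).
 - ring.
 - apply hecke_NoDup.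
 - intros x Hx. apply hecke_complete; auto.
  + rewrite Zdet_mul, (Hdet x Hx), Hg1. lia.
  + apply hecke_in in Hx; auto. destruct Hx as [_ [E _]]. destruct Hg as [_ [c Hc]]. exists (m22 x * c)%Z.
   unfold Zmul; cbn [m21]. rewrite E, Hc. ring.
  + apply hecke_in in Hx; auto. destruct Hx as [_ [E [_ [_ Hx]]]]. destruct Hg as [Hd [c Hc]].
   unfold Zmul; cbn [m11]. rewrite Hc. intros [j Hj]. assert (h : (p | m11 x * m11 g)%Z) by (exists (j - m12 x * c)%Z; lia).
   apply prime_mult in h; auto. destruct h as [h|[i h]]; auto.
   unfold Zdet in Hd. rewrite Hc, h in Hd. pose proof (prime_ge_2 p Hp).
   assert (h1 : (p | 1)%Z) by (exists (i * m22 g - m12 g * c)%Z; lia). apply Z.divide_1_r_nonneg in h1; lia.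
 - intros x x' y Hx Hx' Hy [d1 [Hd1 E1]] [d2 [Hd2 E2]].
  assert (E : x = Zmul (Zmul d1 (Zadj d2)) x').
  { apply (coset_cancel g d1 d2 x x' y); auto. apply Hd2. }
  assert (Hdl := Gam0_mul _ _ _ Hd1 (Gam0_adj _ _ Hd2)). set (dl := Zmul d1 (Zadj d2)) in *. destruct Hdl as [Hdl _].
  apply hecke_in in Hx; auto. apply hecke_in in Hx'; auto. destruct x as [a b c d], x' as [a' b' c' d'], dl as [al be ga de].
  (* Between two triangular representatives the matrix dl must be unipotent by the signs of the
     diagonals, and the range of the upper right entries then leaves only the identity. *)
  unfold Zmul, Zdet in *; cbn [m11 m12 m21 m22] in *. destruct Hx as [X1 [X2 [X3 [X4 _]]]], Hx' as [Y1 [Y2 [Y3 [Y4 _]]]].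
  subst c c'. injection E as e1 e2 e3 e4. assert (ga = 0)%Z by nia. subst ga.
  assert (Hu : (al * de = 1)%Z) by lia. assert (al = 1)%Z by (destruct (Z.mul_eq_1 _ _ Hu); nia). subst al. assert (de = 1)%Z by lia. subst de.
  assert (Ed : d = d') by lia. assert (Hbd : (- d' < be * d' < d')%Z) by lia. clear - Hbd e1 e2 Ed.
  assert (be = 0)%Z by nia. subst be. f_equal; lia.
 - intros x y Hx Hy [dl [Hdl E]]. rewrite E. apply (sl_invariant k Ph p); auto. rewrite (Hdet y Hy). lia.
Qed.

Definition Fl (Z : M2 Cx) : Cx := Sumv (Fterm Z).

(** The Fourier-Jacobi expansion: grouping the terms by the lower right entry m of T. *)
Lemma Fl_FJ Z : AbsSum (Fterm Z) -> inH (m11 Z) ->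
 HasSum (fun m : BinNums.Z => if Z_le_gt_dec m 0 then C0 else Vm (Z.to_nat m) Z) (Fl Z).
Proof using All.
 intros HA HZ. pose proof (Sumv_spec _ HA) as HS.
 apply (HasSum_reindex (fun mlx : BinNums.Z * (BinNums.Z * OK) => (fst (snd mlx), fst mlx, snd (snd mlx)) : Sidx)
  (fun T : Sidx => (snd (fst T), (fst (fst T), snd T)))) in HS; [|intros [m [l x]]; reflexivity|intros [[l m] x]; reflexivity].
 eapply HasSum_fubini; [exact HS|]. intros m. pcbn. destruct (Z_le_gt_dec m 0) as [h|h].
 - apply HasSum_0. intros [l x]. unfold Fterm, Cf; pcbn. destruct (Z_le_gt_dec m 0); [ring|lia].
 - pose proof (Vm_ASum (Z.to_nat m) Z ltac:(lia) HZ) as [_ K]. rewrite Z2Nat.id in K by lia. exact K.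
Qed.

Lemma Fl_Gam0 g Z : Gam0 p g -> inH (m11 Z) -> AbsSum (Fterm Z) -> AbsSum (Fterm (Zact g Z)) ->
 Fl (Zact g Z) = (Cpow (Zj g Z) k * Fl Z)%C.
Proof using All.
 intros Hg HZ A1 A2. assert (HZg : inH (m11 (Zact g Z))) by (apply Zact_inH; auto; destruct Hg; lia).
 apply (HasSum_unique _ _ _ (Fl_FJ _ A2 HZg)).
 eapply HasSum_ext; [|apply (HasSum_scal (Cpow (Zj g Z) k) _ _ (Fl_FJ _ A1 HZ))].
 intros m. cbv beta. destruct (Z_le_gt_dec m 0); [ring|]. symmetry. apply Vm_Gam0; auto. lia.
Qed.
End Lift.


(** * The Hermitian upper half-space and convergence of the lift *)

Lemma Hquad Z v1 v2 : Re (Mquad (Mscal (Cinv (mkC 0 2)) (Msub Z (Mstar Z))) v1 v2) =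
 Im (m11 Z) * Cnorm2 v1 + Im (m22 Z) * Cnorm2 v2 + Re (Cconj v1 * v2 * (- Ci * (m12 Z - Cconj (m21 Z))))%C.
Proof.
 replace (Cinv (mkC 0 2)) with (mkC 0 (- / 2)) by (unfold Cinv, Cnorm2; apply Cx_eq; cbn [Re Im]; field).
 unfold Mquad, Mscal, Msub, Mstar, Madd, M2map, Cnorm2; cbn [m11 m12 m21 m22 Re Im Cmul Cadd Csub Copp Cconj Ci]. field.
Qed.

Lemma inH2_facts Z : inH2 Z -> 0 < Im (m11 Z) /\ 0 < Im (m22 Z) /\
 Cnorm2 (m12 Z - Cconj (m21 Z))%C < 4 * (Im (m11 Z) * Im (m22 Z)).
Proof.
 intros H. unfold inH2, posdef in H.
 assert (H1 := H C1 C0 ltac:(left; apply C1_neq_C0)). assert (H2 := H C0 C1 ltac:(right; apply C1_neq_C0)).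
 rewrite Hquad in H1, H2. unfold Cnorm2 in H1, H2. simpl in H1, H2.
 assert (P1 : 0 < Im (m11 Z)) by lra. assert (P2 : 0 < Im (m22 Z)) by lra. split; [auto|split; auto].
 set (b := (- Ci * (m12 Z - Cconj (m21 Z)))%C) in *.
 assert (Eb : Cnorm2 (m12 Z - Cconj (m21 Z))%C = Cnorm2 b) by (unfold b, Cnorm2; simpl; ring).
 (* For v2 = 2 Im(m11 Z) this v1 minimizes the form; its value there is Im(m11 Z) times the
    discriminant to be bounded. *)
 assert (H3 := H (- b)%C (RtoC (2 * Im (m11 Z))) ltac:(right; apply RtoC_neq0; lra)).
 rewrite Hquad in H3. fold b in H3. rewrite Eb.
 replace (Re (Cconj (- b) * RtoC (2 * Im (m11 Z)) * b)%C) with (- (2 * Im (m11 Z) * Cnorm2 b)) in H3 by (unfold Cnorm2; simpl; ring).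
 replace (Cnorm2 (- b)%C) with (Cnorm2 b) in H3 by (unfold Cnorm2; simpl; ring).
 replace (Cnorm2 (RtoC (2 * Im (m11 Z)))) with (4 * (Im (m11 Z) * Im (m11 Z))) in H3 by (unfold Cnorm2; simpl; ring).
 apply Rmult_lt_reg_l with (Im (m11 Z)); auto. lra.
Qed.
Lemma inH2_inH Z : inH2 Z -> inH (m11 Z).
Proof. intros H. apply inH2_facts in H. apply H. Qed.

Lemma pow_le_exp n c : 0 < c -> exists K, 0 <= K /\ forall x, 0 <= x -> x ^ n <= K * exp (c * x).
Proof.
 revert c. induction n as [|n IH]; intros c Hc.
 - exists 1. split; [lra|]. intros x Hx. simpl. rewrite Rmult_1_l, <- exp_0. apply exp_le_mono. apply Rmult_le_pos; lra.
 - destruct (IH (c / 2)) as [K [HK H]]; [lra|]. exists (2 / c * K).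
  assert (0 < 2 / c) by (apply Rdiv_lt_0_compat; lra).
  split; [apply Rmult_le_pos; lra|]. intros x Hx. specialize (H x Hx).
  replace (c * x) with (c / 2 * x + c / 2 * x) by field. rewrite exp_plus.
  assert (x <= 2 / c * exp (c / 2 * x)).
  { pose proof (exp_ge_1_x (c / 2 * x)). apply Rmult_le_reg_l with (c / 2); [lra|].
   replace (c / 2 * (2 / c * exp (c / 2 * x))) with (exp (c / 2 * x)) by (field; lra). lra. }
  simpl. replace (2 / c * K * (exp (c / 2 * x) * exp (c / 2 * x))) with ((2 / c * exp (c / 2 * x)) * (K * exp (c / 2 * x))) by ring.
  apply Rmult_le_compat; auto. apply pow_le; auto.
Qed.

Lemma Rsum_le_const {I} (f : I -> R) l B : (forall i, In i l -> f i <= B) -> Rsum (map f l) <= INR (length l) * B.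
Proof.
 induction l as [|i l IH]; intros H; [simpl; lra|]. cbn [map Rsum fold_right length]. rewrite S_INR.
 pose proof (H i (or_introl eq_refl)). pose proof (IH (fun j Hj => H j (or_intror Hj))). unfold Rsum in *. lra.
Qed.

Section Convergence.
Context (D p : Z) (HD0 : (0 < D)%Z) (HD4 : (D mod 4 = 3)%Z) (k : nat) (cf : nat -> Cx).
Context (K1 : R) (HK1 : 0 <= K1) (Hcf : forall n, Cabs (cf n) <= K1 * INR n ^ (k - 1)).

Lemma Cnorm2_tx x : Cnorm2 (tx D x) = IZR (Onorm D x) / IZR D.
Proof.
 rewrite (norm_eq D HD0 HD4), (tx_eq D HD0). pose proof (dl_pos D HD0). pose proof (dl_sqr D HD0) as E.
 unfold Cnorm2; cbn [Re Im]. set (dl := sqrt (IZR D)) in *. clearbody dl. rewrite <- E. field. lra.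
Qed.

Definition tsize (T : Sidx) : R := IZR (fst (fst T) + snd (fst T)).
Lemma T_pos (T : Sidx) : (0 < snd (fst T))%Z -> (0 < DdetT D T)%Z -> (0 < fst (fst T))%Z.
Proof.
 destruct T as [[l m] x]. unfold DdetT; pcbn. intros Hm H.
 pose proof (Onorm_Ou D HD4 x). nia.
Qed.

Lemma Im_tex (T : Sidx) Z : Im (tex D T Z) = IZR (fst (fst T)) * Im (m11 Z) + IZR (snd (fst T)) * Im (m22 Z)
 + Im (Cconj (tx D (snd T)) * (m12 Z - Cconj (m21 Z)))%C.
Proof. unfold tex, lx. set (t := tx D (snd T)). simpl. ring. Qed.
Lemma tex_add T Z H : tex D T (Madd Z H) = (tex D T Z + tex D T H)%C.
Proof. unfold tex, lx, Madd; mcbn. ring. Qed.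

Lemma tx_size (T : Sidx) : (0 < snd (fst T))%Z -> (0 < DdetT D T)%Z ->
 Cnorm2 (tx D (snd T)) < IZR (fst (fst T)) * IZR (snd (fst T)).
Proof.
 intros Hm HT. rewrite Cnorm2_tx. destruct T as [[l m] x]. unfold DdetT in HT; cbn [fst snd] in *.
 pose proof (IZR_lt _ _ HD0) as P. apply Rmult_lt_reg_r with (IZR D); auto.
 unfold Rdiv. rewrite Rmult_assoc, Rinv_l, Rmult_1_r by lra. rewrite <- !mult_IZR. apply IZR_lt. lia.
Qed.

(** The imaginary part of tr(TZ) is at least a multiple of the trace of T, uniformly near Z. This
    uniformity, rather than pointwise convergence, is what differentiation of the series
    requires. *)
Lemma tex_lower Z : inH2 Z -> exists c rho, 0 < c /\ 0 < rho /\ forall H, Mnorm H <= rho -> forall T,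
 (0 < snd (fst T))%Z -> (0 < DdetT D T)%Z -> c * tsize T <= Im (tex D T (Madd Z H)).
Proof.
 intros HZ. apply inH2_facts in HZ as [P1 [P2 P3]]. set (y1 := Im (m11 Z)) in *. set (y2 := Im (m22 Z)) in *.
 set (B := (m12 Z - Cconj (m21 Z))%C) in *.
 (* Determinant over trace of the imaginary part Y of Z, a number below the least eigenvalue. Then Y
    - c0 is still positive definite, as (y1 - c0)(y2 - c0) = |B|^2/4 + c0^2 shows; half of c0 is
    given up to the perturbation H. *)
 set (c0 := (y1 * y2 - Cnorm2 B / 4) / (y1 + y2)).
 assert (Hc0 : 0 < c0) by (apply Rdiv_lt_0_compat; lra).
 pose proof (Cnorm2_pos B) as PB.
 assert (Ec : c0 * (y1 + y2) = y1 * y2 - Cnorm2 B / 4) by (unfold c0; field; lra).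
 assert (E1 : (y1 - c0) * (y2 - c0) = Cnorm2 B / 4 + c0 * c0) by (replace ((y1 - c0) * (y2 - c0)) with (y1 * y2 - c0 * (y1 + y2) + c0 * c0) by ring; rewrite Ec; ring).
 assert (H1 : 0 < y1 - c0).
 { apply Rmult_lt_reg_r with (y1 + y2); [lra|]. rewrite Rmult_0_l, Rmult_minus_distr_r, Ec. pose proof (Rmult_lt_0_compat y1 y1 P1 P1). lra. }
 assert (H2 : 0 < y2 - c0).
 { apply Rmult_lt_reg_r with (y1 + y2); [lra|]. rewrite Rmult_0_l, Rmult_minus_distr_r, Ec. pose proof (Rmult_lt_0_compat y2 y2 P2 P2). lra. }
 exists (c0 / 2), (c0 / 2). split; [lra|]. split; [lra|]. intros H HH T Hm HT.
 pose proof (T_pos T Hm HT) as Hl. pose proof (tx_size T Hm HT) as Ht.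
 apply IZR_lt in Hm, Hl. unfold tsize. rewrite plus_IZR. set (L := IZR (fst (fst T))) in *. set (M := IZR (snd (fst T))) in *.
 set (t := tx D (snd T)) in *. pose proof (Cnorm2_pos t) as Pt.
 assert (Sq : forall z, Im z * Im z <= Cnorm2 z) by (intros z; unfold Cnorm2; pose proof (Rle_0_sqr (Re z)) as h; unfold Rsqr in h; lra).
 assert (N2 : forall z w, Cnorm2 (z * w)%C = Cnorm2 z * Cnorm2 w) by (intros; unfold Cnorm2; simpl; ring).
 assert (Nc : Cnorm2 (Cconj t) = Cnorm2 t) by (unfold Cnorm2; simpl; ring).
 assert (A : c0 * (L + M) <= Im (tex D T Z)).
 { rewrite Im_tex. fold L M t y1 y2 B. set (X := Im (Cconj t * B)%C).
  assert (Q : X * X <= Cnorm2 t * Cnorm2 B) by (rewrite <- Nc, <- N2; apply Sq).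
  set (U := L * (y1 - c0)). set (V := M * (y2 - c0)).
  assert (PU : 0 < U) by (apply Rmult_lt_0_compat; auto). assert (PV : 0 < V) by (apply Rmult_lt_0_compat; auto).
  assert (Q2 : Cnorm2 t * Cnorm2 B <= 4 * (U * V)).
  { replace (4 * (U * V)) with (L * M * (4 * ((y1 - c0) * (y2 - c0)))) by (unfold U, V; ring). rewrite E1.
   pose proof (Rmult_lt_0_compat c0 c0 Hc0 Hc0). apply Rmult_le_compat; lra. }
  assert (Q3 : Rsqr X <= Rsqr (U + V)).
  { unfold Rsqr. pose proof (Rle_0_sqr (U - V)) as h. unfold Rsqr in h. lra. }
  apply Rsqr_neg_pos_le_0 in Q3; [|lra]. unfold U, V in Q3. lra. }
 assert (Bt : Cabs t <= L + M).
 { apply Rsqr_incr_0_var; [|lra]. unfold Rsqr. rewrite Cabs_sqr. pose proof (Rmult_lt_0_compat L M Hl Hm).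
  pose proof (Rmult_lt_0_compat L L Hl Hl). pose proof (Rmult_lt_0_compat M M Hm Hm). lra. }
 assert (Bh : - (c0 / 2 * (L + M)) <= Im (tex D T H)).
 { assert (Cabs (tex D T H) <= (L + M) * Mnorm H).
  { unfold tex, lx. fold t. unfold ZtoC. fold L M. unfold Mnorm.
   eapply Rle_trans; [apply Cabs_triang|]. eapply Rle_trans; [apply Rplus_le_compat_r, Cabs_triang|].
   eapply Rle_trans; [apply Rplus_le_compat_r, Rplus_le_compat_l, Cabs_triang|].
   rewrite !Cabs_mul, Cabs_conj, !Cabs_RtoC, !Rabs_right by lra.
   pose proof (Cabs_pos (m11 H)). pose proof (Cabs_pos (m12 H)). pose proof (Cabs_pos (m21 H)). pose proof (Cabs_pos (m22 H)).
   pose proof (Rmult_le_compat_r _ _ _ H0 (ltac:(lra) : L <= L + M)). pose proof (Rmult_le_compat_r _ _ _ H5 (ltac:(lra) : M <= L + M)).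
   pose proof (Rmult_le_compat_r _ _ _ H3 Bt). pose proof (Rmult_le_compat_r _ _ _ H4 Bt). lra. }
  pose proof (Im_le_Cabs (tex D T H)) as h. apply Rabs_le_between in h.
  pose proof (Rmult_le_compat_l (L + M) _ _ ltac:(lra) HH). lra. }
 rewrite tex_add. cbn [Im Cadd]. lra.
Qed.

Lemma Cf_nonzero T : Cf D p k cf T <> C0 -> (0 < snd (fst T))%Z /\ (0 < DdetT D T)%Z.
Proof.
 intros H. unfold Cf in H. destruct (Z_le_gt_dec (snd (fst T)) 0) as [h|h]; [tauto|]. split; [lia|].
 destruct (Z_le_gt_dec (DdetT D T) 0) as [h2|h2]; [|lia]. exfalso. apply H. apply Csum_map_0.
 intros d Hd. apply filter_In in Hd as [Hd _]. apply in_seq in Hd. unfold dterm, alz.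
 destruct (Z_le_gt_dec (DdetT D T / (Z.of_nat d * Z.of_nat d)) 0) as [h3|h3]; [ring|].
 exfalso. assert (DdetT D T / (Z.of_nat d * Z.of_nat d) < 1)%Z by (apply Z.div_lt_upper_bound; nia). lia.
Qed.

Lemma alz_bound z : (0 < z)%Z -> Cabs (alz D cf z) <= sqrt (IZR D) * K1 * IZR z ^ (k - 1).
Proof.
 intros Hz. unfold alz. destruct (Z_le_gt_dec z 0); [lia|]. specialize (Hcf (Z.to_nat z)).
 rewrite INR_IZR_INZ, Z2Nat.id in Hcf by lia. pose proof (sqrt_pos (IZR D)) as Ps.
 assert (P0 : 0 <= IZR z ^ (k - 1)) by (apply pow_le, IZR_le; lia).
 destruct (Nat.eq_dec (aD D (Z.to_nat z)) 0) as [E|E].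
 - rewrite E. change (RtoC (INR 0)) with C0. replace (Ci * C0)%C with C0 by ring.
  match goal with |- Cabs ?u <= _ => replace u with C0 by (apply Cx_eq; simpl; unfold Rdiv; ring) end.
  rewrite Cabs_0. repeat apply Rmult_le_pos; auto.
 - assert (h1 : 1 <= INR (aD D (Z.to_nat z))) by (change 1 with (INR 1); apply le_INR; lia).
  pose proof Ci_neq0 as hC.
  rewrite Cabs_div by (apply Cmul_neq0; auto; apply RtoC_neq0; lra).
  rewrite !Cabs_mul, !Cabs_RtoC, !Rabs_right by lra.
  rewrite Cabs_Ci, Rmult_1_l. apply Rmult_le_reg_r with (INR (aD D (Z.to_nat z))); [lra|].
  unfold Rdiv. rewrite !Rmult_assoc, Rinv_l, Rmult_1_r by lra. apply Rmult_le_compat_l; auto.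
  rewrite <- Rmult_assoc. eapply Rle_trans; [apply Hcf|]. rewrite <- (Rmult_1_r (K1 * _)) at 1.
  apply Rmult_le_compat_l; auto. apply Rmult_le_pos; auto.
Qed.

(** At most eps(T) <= m divisors occur, which gives one factor l + m; each term is at most a
    constant times (D det T)^(k-1), and D det T <= D (l + m)^2. *)
Lemma Cf_bound T : (0 < snd (fst T))%Z -> (0 < DdetT D T)%Z ->
 Cabs (Cf D p k cf T) <= sqrt (IZR D) * K1 * IZR D ^ (k - 1) * tsize T ^ (S (2 * (k - 1))).
Proof.
 intros Hm HT. pose proof (T_pos T Hm HT) as Hl. unfold Cf. destruct (Z_le_gt_dec (snd (fst T)) 0); [lia|].
 pose proof (sqrt_pos (IZR D)) as Ps. assert (Pk : 0 <= sqrt (IZR D) * K1) by (apply Rmult_le_pos; auto).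
 set (De := DdetT D T) in *.
 eapply Rle_trans; [apply Cabs_Csum|]. eapply Rle_trans.
 { apply (Rsum_le_const _ _ (sqrt (IZR D) * K1 * IZR De ^ (k - 1))). intros d Hd. apply filter_In in Hd as [Hd _]. apply in_seq in Hd.
  unfold dterm. fold De. set (q := (De / (Z.of_nat d * Z.of_nat d))%Z).
  rewrite Cabs_mul, Cabs_pow, Cabs_RtoC, Rabs_right by (apply Rle_ge, pos_INR).
  destruct (Z_le_gt_dec q 0) as [h|h].
  - unfold alz. destruct (Z_le_gt_dec q 0); [|lia]. rewrite Cabs_0, Rmult_0_r. apply Rmult_le_pos; auto. apply pow_le, IZR_le; lia.
  - eapply Rle_trans; [apply Rmult_le_compat_l, alz_bound; [apply pow_le, pos_INR|lia]|].
   replace (INR d ^ (k - 1) * (sqrt (IZR D) * K1 * IZR q ^ (k - 1))) with (sqrt (IZR D) * K1 * (INR d * IZR q) ^ (k - 1)) by (rewrite Rpow_mult_distr; ring).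
   apply Rmult_le_compat_l; auto. apply pow_incr. rewrite INR_IZR_INZ, <- mult_IZR. split; apply IZR_le; [nia|].
   pose proof (Z.mul_div_le De (Z.of_nat d * Z.of_nat d) ltac:(nia)). fold q in H. nia. }
 set (Lf := filter _ _).
 assert (Hlen : INR (length Lf) <= tsize T).
 { unfold tsize. rewrite INR_IZR_INZ. apply IZR_le.
  assert (length Lf <= Z.to_nat (epsT T))%nat by (unfold Lf; eapply Nat.le_trans; [apply filter_length_le|rewrite length_seq; auto]).
  assert (epsT T <= snd (fst T))%Z by (apply Z.divide_pos_le; auto; apply (epsT_div T); apply Z.divide_refl).
  pose proof (epsT_nonneg T). lia. }
 assert (Hs : 0 <= tsize T) by (unfold tsize; apply IZR_le; lia).
 assert (HDe : IZR De <= IZR D * (tsize T * tsize T)).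
 { unfold tsize. rewrite <- !mult_IZR. apply IZR_le. unfold De. destruct T as [[l m] x]. unfold DdetT; cbn [fst snd] in *.
  pose proof (Onorm_Ou D HD4 x). assert (0 <= Onorm D x)%Z by nia. assert (l * m <= (l + m) * (l + m))%Z by nia. nia. }
 assert (HDp : IZR De ^ (k - 1) <= IZR D ^ (k - 1) * tsize T ^ (2 * (k - 1))).
 { rewrite pow_mult, <- Rpow_mult_distr. apply pow_incr. split; [apply IZR_le; lia|]. simpl. lra. }
 pose proof (IZR_lt _ _ HD0). assert (0 <= IZR De ^ (k - 1)) by (apply pow_le, IZR_le; lia).
 replace (sqrt (IZR D) * K1 * IZR D ^ (k - 1) * tsize T ^ S (2 * (k - 1))) with (tsize T * (sqrt (IZR D) * K1 * (IZR D ^ (k - 1) * tsize T ^ (2 * (k - 1))))) by (cbn [pow]; ring).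
 apply Rmult_le_compat; auto; [apply pos_INR|apply Rmult_le_pos; auto|apply Rmult_le_compat_l; auto].
Qed.

(** The exponential decay in the trace of T controls all four integer coordinates of T, since a
    positive definite T has its off-diagonal entry bounded by its trace. The majorant is a product
    of four geometric families. *)
Lemma Fterm_AbsSum Z : inH2 Z -> exists rho, 0 < rho /\ forall H, Mnorm H <= rho -> AbsSum (Fterm D p k cf (Madd Z H)).
Proof.
 intros HZ. destruct (tex_lower Z HZ) as [c [rho [Hc [Hrho HL]]]]. exists rho. split; auto. intros H HH. specialize (HL H HH).
 destruct (pow_le_exp (S (2 * (k - 1))) c Hc) as [K2 [HK2 Hp2]].
 (* With s = l + m one has |x2| <= s and |2 x1 + x2| <= D s, so |x1| <= D s, and the four absolute
    values add up to at most 3 D s. *)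
 pose proof (IZR_lt _ _ HD0) as PD. set (c2 := c / (3 * IZR D)). assert (Hc2 : 0 < c2) by (apply Rdiv_lt_0_compat; lra).
 set (E := fun n : BinNums.Z => RtoC (exp (- c2 * Rabs (IZR n)))). assert (AE : AbsSum E) by (apply AbsSum_exp_Z; auto).
 apply (AbsSum_le _ (fun T : Sidx => (E (fst (fst T)) * E (snd (fst T)) * (E (fst (snd T)) * E (snd (snd T))))%C) (sqrt (IZR D) * K1 * IZR D ^ (k - 1) * K2)).
 { apply (AbsSum_prod (fun lm : BinNums.Z * BinNums.Z => (E (fst lm) * E (snd lm))%C) (fun x : OK => (E (fst x) * E (snd x))%C)); apply AbsSum_prod; auto. }
 intros T.
 assert (EE : Cabs (E (fst (fst T)) * E (snd (fst T)) * (E (fst (snd T)) * E (snd (snd T))))%C =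
  exp (- c2 * IZR (Z.abs (fst (fst T)) + Z.abs (snd (fst T)) + Z.abs (fst (snd T)) + Z.abs (snd (snd T))))).
 { unfold E. rewrite !Cabs_mul, !Cabs_RtoC, !(Rabs_right (exp _)) by (left; apply exp_pos). rewrite <- !exp_plus, !plus_IZR, !abs_IZR. f_equal. ring. }
 rewrite EE. set (Q := sqrt (IZR D) * K1 * IZR D ^ (k - 1)).
 assert (HQ : 0 <= Q) by (unfold Q; repeat apply Rmult_le_pos; auto; [apply sqrt_pos|apply pow_le; lra]).
 unfold Fterm. rewrite Cabs_mul.
 destruct (excluded_middle_informative (Cf D p k cf T = C0)) as [E0|E0].
 { rewrite E0, Cabs_0, Rmult_0_l. apply Rmult_le_pos; [apply Rmult_le_pos; auto|left; apply exp_pos]. }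
 apply Cf_nonzero in E0 as [Hm HT]. pose proof (T_pos T Hm HT) as Hl. pose proof (Cf_bound T Hm HT) as HB. fold Q in HB.
 rewrite Cabs_e. specialize (HL T Hm HT).
 assert (Hs : 0 <= tsize T) by (unfold tsize; apply IZR_le; lia).
 assert (H3 : c2 * IZR (Z.abs (fst (fst T)) + Z.abs (snd (fst T)) + Z.abs (fst (snd T)) + Z.abs (snd (snd T))) <= c * tsize T).
 { replace (c * tsize T) with (c2 * (3 * IZR D * tsize T)) by (unfold c2; field; lra). apply Rmult_le_compat_l; [lra|].
  unfold tsize. rewrite <- !mult_IZR. apply IZR_le. clear - Hm HT Hl HD4 HD0. destruct T as [[l m] x]. unfold DdetT in HT; cbn [fst snd] in *.
  pose proof (Onorm_Ou D HD4 x) as E. unfold Ou in *. destruct x as [x1 x2]. cbn [fst snd] in *.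
  set (N := Onorm D (x1, x2)) in *. set (s := (l + m)%Z).
  assert (S0 : (4 * (l * m) <= s * s)%Z) by (unfold s; pose proof (Z.square_nonneg (l - m)); lia).
  assert (Hs : (0 < s)%Z) by (unfold s; lia). set (u := (2 * x1 + x2)%Z) in *.
  pose proof (Z.square_nonneg u) as U0. pose proof (Z.square_nonneg x2) as U1.
  pose proof (Z.mul_le_mono_nonneg_l _ _ D ltac:(lia) S0) as S1. pose proof (Z.mul_le_mono_nonneg_l _ _ D ltac:(lia) U1) as U2.
  assert (S2 : (x2 * x2 <= s * s)%Z) by (apply Z.mul_le_mono_pos_l with D; lia).
  assert (S3 : (u * u <= (D * s) * (D * s))%Z).
  { assert (h : (D * (s * s) * 1 <= D * (s * s) * D)%Z) by (apply Z.mul_le_mono_nonneg_l; lia). lia. }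
  assert (S4 : (Z.abs x2 <= s)%Z) by (apply Z.square_le_simpl_nonneg; lia).
  assert (S5 : (Z.abs u <= D * s)%Z) by (apply Z.square_le_simpl_nonneg; lia).
  assert (h : (1 * s <= D * s)%Z) by (apply Z.mul_le_mono_nonneg_r; lia). unfold u, s in *. lia. }
 eapply Rle_trans; [apply Rmult_le_compat; [apply Cabs_pos|left; apply exp_pos|exact HB|]|].
 (* As 2 pi >= 2, the decay is at least exp(-2 c (l + m)): one half absorbs the polynomial growth of
    the coefficient, the other is compared with the majorant. *)
 { apply exp_le_mono. apply Ropp_le_contravar. instantiate (1 := c * tsize T + c * tsize T).
  pose proof PI_RGT_0. pose proof PI2_1. assert (0 <= c * tsize T) by (apply Rmult_le_pos; lra).
  assert (1 * (c * tsize T) <= PI * (c * tsize T)) by (apply Rmult_le_compat_r; lra).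
  pose proof (Rmult_le_compat_l PI _ _ ltac:(lra) HL). lra. }
 rewrite Rmult_assoc. rewrite Rmult_assoc. apply Rmult_le_compat_l; auto.
 eapply Rle_trans; [apply Rmult_le_compat_r; [left; apply exp_pos|apply (Hp2 _ Hs)]|].
 rewrite Rmult_assoc. apply Rmult_le_compat_l; auto. rewrite <- exp_plus. apply exp_le_mono. lra.
Qed.

Lemma Madd_0 Z : Madd Z (mkM2 C0 C0 C0 C0) = Z.
Proof. destruct Z as [z1 z2 z3 z4]. apply M2_eq; cbn [m11 m12 m21 m22 Madd]; ring. Qed.

Lemma Fterm_AbsSum0 Z : inH2 Z -> AbsSum (Fterm D p k cf Z).
Proof.
 intros HZ. destruct (Fterm_AbsSum Z HZ) as [rho [Hr HA]]. rewrite <- (Madd_0 Z). apply HA.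
 unfold Mnorm; mcbn. rewrite Cabs_0. lra.
Qed.

Lemma Fl_holo2 : holo2 (Fl D p k cf).
Proof.
 intros Z HZ. destruct (Fterm_AbsSum Z HZ) as [rho [Hr HA]].
 set (lT := fun T : Sidx => Mscal (mkC 0 (2 * PI)) (mkM2 (ZtoC (fst (fst T))) (Cconj (tx D (snd T))) (tx D (snd T)) (ZtoC (snd (fst T))))).
 assert (E : forall W T, (Cf D p k cf T * Cexp (Mdot (lT T) W))%C = Fterm D p k cf W T).
 { intros W T. unfold Fterm, e. do 2 f_equal. unfold Mdot, lT, Mscal, M2map, tex, lx; cbn [m11 m12 m21 m22 Csum fold_right]. ring. }
 destruct (expseries_deriv (Cf D p k cf) lT Z rho (Fl D p k cf) Hr) as [L HL].
 - intros H HH. eapply ASum_ext; [intros; symmetry; apply E|]. split; [|apply Sumv_spec]; auto.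
 - now rewrite Madd_0.
 - exists L. intros eps He. destruct (HL eps He) as [del [Hd K]]. exists del. split; auto. intros H HH.
  replace (Csum _) with (Mdot L H) by (unfold Mdot; cbn [Csum fold_right]; ring). auto.
Qed.
End Convergence.

(** * The unitary group *)

Lemma Cconj_add z w : Cconj (z + w) = (Cconj z + Cconj w)%C.
Proof. apply Cx_eq; simpl; ring. Qed.
Lemma Cconj_mul z w : Cconj (z * w) = (Cconj z * Cconj w)%C.
Proof. apply Cx_eq; simpl; ring. Qed.
Lemma Cconj_opp z : Cconj (- z) = (- Cconj z)%C.
Proof. apply Cx_eq; simpl; ring. Qed.
Lemma Cconj_conj z : Cconj (Cconj z) = z.
Proof. apply Cx_eq; simpl; ring. Qed.
Lemma Cconj_Z z : Cconj (ZtoC z) = ZtoC z.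
Proof. apply Cx_eq; simpl; ring. Qed.
Ltac mx := unfold Msub, Mstar, Mmul, Madd, Mscal, M2map, Mtr, Mdet, Csub; try apply M2_eq; cbn [m11 m12 m21 m22 fst snd];
 rewrite ?Cconj_add, ?Cconj_mul, ?Cconj_opp, ?Cconj_conj; try ring.
Definition M1 : M2 Cx := mkM2 C1 C0 C0 C1.
Lemma Mmul_assoc X Y Z : Mmul X (Mmul Y Z) = Mmul (Mmul X Y) Z.
Proof. mx. Qed.
Lemma Mmul_1_l X : Mmul M1 X = X.
Proof. unfold M1. mx. Qed.
Lemma Mmul_1_r X : Mmul X M1 = X.
Proof. unfold M1. mx. Qed.
Lemma Mmul_add_l X Y Z : Mmul (Madd X Y) Z = Madd (Mmul X Z) (Mmul Y Z).
Proof. mx. Qed.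
Lemma Mdet_mul X Y : Mdet (Mmul X Y) = (Mdet X * Mdet Y)%C.
Proof. mx. Qed.
Lemma Minv_lr X : Mdet X <> C0 -> Mmul (Minv X) X = M1 /\ Mmul X (Minv X) = M1.
Proof.
 intros H. unfold Minv, M1. set (d := Mdet X) in *. assert (E : d = Mdet X) by reflexivity. unfold Mdet in E.
 split; unfold Mmul; apply M2_eq; mcbn; try (field; auto);
 (transitivity ((m11 X * m22 X - m12 X * m21 X) / d)%C; [field; auto|rewrite <- E; field; auto]).
Qed.
Lemma Minv_l X : Mdet X <> C0 -> Mmul (Minv X) X = M1.
Proof. apply Minv_lr. Qed.
Lemma Minv_r X : Mdet X <> C0 -> Mmul X (Minv X) = M1.
Proof. apply Minv_lr. Qed.
Lemma Mdet_1 : Mdet M1 = C1.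
Proof. unfold M1. mx. Qed.
Lemma Mdet_unit X Y : Mmul X Y = M1 -> Mdet X <> C0 /\ Mdet Y <> C0.
Proof. intros H. apply (f_equal Mdet) in H. rewrite Mdet_mul, Mdet_1 in H.
 split; intros E; rewrite E in H; apply C1_neq_C0; rewrite <- H; ring. Qed.
Lemma Minv_unique X Y : Mmul X Y = M1 -> Minv X = Y.
Proof. intros H. destruct (Mdet_unit X Y H) as [H1 _]. rewrite <- (Mmul_1_r (Minv X)), <- H, Mmul_assoc, Minv_l, Mmul_1_l; auto. Qed.
Lemma Mmul_comm1 X Y : Mmul X Y = M1 -> Mmul Y X = M1.
Proof. intros H. rewrite <- (Minv_unique X Y H). apply Minv_l. apply (Mdet_unit X Y H). Qed.
Lemma Minv_mul X Y : Mdet X <> C0 -> Mdet Y <> C0 -> Minv (Mmul X Y) = Mmul (Minv Y) (Minv X).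
Proof. intros HX HY. apply Minv_unique. rewrite <- Mmul_assoc, (Mmul_assoc Y), Minv_r, Mmul_1_l, Minv_r; auto. Qed.
Lemma Mstar_mul X Y : Mstar (Mmul X Y) = Mmul (Mstar Y) (Mstar X).
Proof. mx. Qed.
Lemma Mstar_star X : Mstar (Mstar X) = X.
Proof. destruct X as [a b c d]. mx. Qed.
Lemma Mstar_1 : Mstar M1 = M1.
Proof. unfold M1, Mstar. apply M2_eq; mcbn; apply Cx_eq; simpl; ring. Qed.

Definition vmul (M : M2 Cx) (v : Cx * Cx) : Cx * Cx := (m11 M * fst v + m12 M * snd v, m21 M * fst v + m22 M * snd v)%C.
Definition dotc (x y : Cx * Cx) : Cx := (Cconj (fst x) * fst y + Cconj (snd x) * snd y)%C.
Definition skew (x y : Cx * Cx) : Cx := (dotc x y - dotc y x)%C.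
Lemma vmul_mul X Y v : vmul (Mmul X Y) v = vmul X (vmul Y v).
Proof. unfold vmul, Mmul; cbn [m11 m12 m21 m22 fst snd]. f_equal; ring. Qed.
(** Positivity expressed through the skew-Hermitian form on the columns (Zv; v), which unitary
    matrices preserve; this is the form in which their action can be followed. *)
Lemma inH2_skew Z : inH2 Z <-> forall v, v <> (C0, C0) -> 0 < Re (Cinv (mkC 0 2) * skew v (vmul Z v))%C.
Proof.
 assert (E : forall v, Mquad (Mscal (Cinv (mkC 0 2)) (Msub Z (Mstar Z))) (fst v) (snd v) = (Cinv (mkC 0 2) * skew v (vmul Z v))%C).
 { intros v. unfold Mquad, skew, dotc, vmul. mx. }
 unfold inH2, posdef. split.
 - intros H v Hv. rewrite <- E. apply H. destruct v as [a b]; pcbn.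
  destruct (classic (a = C0)) as [->|]; [right; intros ->; auto|left; auto].
 - intros H a b Hab. pose proof (E (a, b)) as E1. cbn [fst snd] in E1. rewrite E1. apply H. intros E2. injection E2 as -> ->. tauto.
Qed.

Definition Osub (x y : OK) : OK := Oadd x (Oopp y).
Lemma OK_ring D : ring_theory O0 O1 Oadd (Omul D) Osub Oopp (@eq OK).
Proof.
 constructor; repeat intros [? ?]; try intros; unfold O0, O1, Osub, Oadd, Oopp, Omul; pcbn; repeat match goal with x : OK |- _ => destruct x end; pcbn; f_equal; ring.
Qed.

Section OKalg.
Context (D : Z) (HD0 : (0 < D)%Z) (HD4 : (D mod 4 = 3)%Z).
Add Ring OKr : (OK_ring D).
Let oc := OtoC D.
Notation "x ** y" := (Omul D x y) (at level 40, left associativity).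

Lemma Oconj_add x y : Oconj (Oadd x y) = Oadd (Oconj x) (Oconj y).
Proof. unfold Oconj, Oadd; pcbn. f_equal; ring. Qed.
Lemma Oconj_opp x : Oconj (Oopp x) = Oopp (Oconj x).
Proof. unfold Oconj, Oopp; pcbn. f_equal; ring. Qed.
Lemma Oconj_conj x : Oconj (Oconj x) = x.
Proof. destruct x. unfold Oconj; pcbn. f_equal; ring. Qed.
Lemma Oconj_mul x y : Oconj (x ** y) = Oconj x ** Oconj y.
Proof. destruct x, y. unfold Oconj, Omul; pcbn. f_equal; ring. Qed.

Lemma oc_add x y : oc (Oadd x y) = (oc x + oc y)%C.
Proof. unfold oc, OtoC, Oadd; pcbn. rewrite !plus_IZR. apply Cx_eq; cbn [Re Im Cadd]; field. Qed.
Lemma oc_opp x : oc (Oopp x) = (- oc x)%C.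
Proof. unfold oc, OtoC, Oopp; pcbn. rewrite !opp_IZR. apply Cx_eq; cbn [Re Im Copp]; field. Qed.
Lemma oc_mul x y : oc (x ** y) = (oc x * oc y)%C.
Proof.
 destruct x as [a b], y as [c d]. pose proof (dl_sqr D HD0) as E. pose proof (f_equal IZR (D_eq D HD4)) as E2. rewrite minus_IZR, mult_IZR in E2.
 unfold oc, OtoC, Omul; pcbn. set (s := sqrt (IZR D)) in *. clearbody s. rewrite ?minus_IZR, ?plus_IZR, ?mult_IZR.
 assert (Eq : IZR (qD D) = (s * s + 1) / 4) by lra. rewrite Eq. apply Cx_eq; cbn [Re Im Cmul]; field.
Qed.
Lemma oc_conj x : oc (Oconj x) = Cconj (oc x).
Proof. unfold oc, OtoC, Oconj; pcbn. rewrite plus_IZR, opp_IZR. apply Cx_eq; cbn [Re Im Cconj]; field. Qed.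
Lemma oc_Z n : oc (n, 0%Z) = ZtoC n.
Proof. unfold oc, OtoC; pcbn. apply Cx_eq; simpl; field. Qed.
Lemma oc_inj x y : oc x = oc y -> x = y.
Proof.
 destruct x as [a b], y as [c d]. unfold oc, OtoC; pcbn. intros E. pose proof (dl_pos D HD0).
 assert (E1 := f_equal Re E). assert (E2 := f_equal Im E). cbn [Re Im] in E1, E2.
 assert (Eb : IZR b = IZR d) by (apply Rmult_eq_reg_r with (sqrt (IZR D)); lra). rewrite Eb in E1.
 f_equal; apply eq_IZR; lra.
Qed.
Lemma oc_norm x : (Cconj (oc x) * oc x)%C = ZtoC (Onorm D x).
Proof.
 rewrite <- oc_conj, <- oc_mul, <- oc_Z. f_equal. destruct x as [a b]. unfold Omul, Oconj, Onorm; pcbn. f_equal; ring.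
Qed.
Lemma O_fixed x : Oconj x = x -> x = (fst x, 0%Z).
Proof. destruct x as [a b]. unfold Oconj; pcbn. intros E. injection E as E1 E2. f_equal. lia. Qed.
Lemma O_integral x y : x ** y = O0 -> x = O0 \/ y = O0.
Proof.
 intros E. apply (f_equal oc) in E. rewrite oc_mul in E. replace (oc O0) with C0 in E by (symmetry; apply (oc_Z 0)).
 apply Cmul_integral in E as [E|E]; [left|right]; apply oc_inj; rewrite E; symmetry; apply (oc_Z 0).
Qed.

Ltac mo := unfold MOsub, MOstar, MOmul, MO0, MO1; try apply M2_eq; mcbn;
 rewrite ?Oconj_add, ?Oconj_mul, ?Oconj_opp, ?Oconj_conj; try ring.
Definition MOadd (M N : M2O) : M2O := mkM2 (Oadd (m11 M) (m11 N)) (Oadd (m12 M) (m12 N)) (Oadd (m21 M) (m21 N)) (Oadd (m22 M) (m22 N)).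
Notation mc := (MOtoC D).
Lemma mc_add X Y : mc (MOadd X Y) = Madd (mc X) (mc Y).
Proof. unfold MOtoC, MOadd, Madd, M2map; apply M2_eq; mcbn; apply oc_add. Qed.
Lemma mc_mul X Y : mc (MOmul D X Y) = Mmul (mc X) (mc Y).
Proof. unfold MOtoC, MOmul, Mmul, M2map; apply M2_eq; mcbn; fold oc; rewrite oc_add, !oc_mul; reflexivity. Qed.
Lemma mc_star X : mc (MOstar X) = Mstar (mc X).
Proof. unfold MOtoC, MOstar, Mstar, M2map; apply M2_eq; mcbn; apply oc_conj. Qed.
Lemma mc_sub X Y : mc (MOsub X Y) = Msub (mc X) (mc Y).
Proof. unfold MOtoC, MOsub, Msub, Madd, M2map; apply M2_eq; mcbn; fold oc; rewrite oc_add, oc_opp; reflexivity. Qed.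
Lemma mc_1 : mc MO1 = M1.
Proof. unfold MOtoC, MO1, M1, M2map; apply M2_eq; mcbn; first [apply (oc_Z 1)|apply (oc_Z 0)]. Qed.
Lemma mc_0 : mc MO0 = mkM2 C0 C0 C0 C0.
Proof. unfold MOtoC, MO0, M2map; apply M2_eq; mcbn; apply (oc_Z 0). Qed.
Lemma mc_inj X Y : mc X = mc Y -> X = Y.
Proof.
 intros E. unfold MOtoC, M2map in E. pose proof (f_equal m11 E) as E1. pose proof (f_equal m12 E) as E2.
 pose proof (f_equal m21 E) as E3. pose proof (f_equal m22 E) as E4. cbn [m11 m12 m21 m22] in *. apply M2_eq; apply oc_inj; auto.
Qed.

Definition U22 (M : M2 M2O) : Prop := inU22 D (m11 M) (m12 M) (m21 M) (m22 M).
Definition Bmul (M N : M2 M2O) : M2 M2O :=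
 mkM2 (MOadd (MOmul D (m11 M) (m11 N)) (MOmul D (m12 M) (m21 N))) (MOadd (MOmul D (m11 M) (m12 N)) (MOmul D (m12 M) (m22 N)))
   (MOadd (MOmul D (m21 M) (m11 N)) (MOmul D (m22 M) (m21 N))) (MOadd (MOmul D (m21 M) (m12 N)) (MOmul D (m22 M) (m22 N))).
Definition Jm (M : M2 M2O) (Z : M2 Cx) : M2 Cx := Madd (Mmul (mc (m21 M)) Z) (mc (m22 M)).
Definition Pm (M : M2 M2O) (Z : M2 Cx) : M2 Cx := Madd (Mmul (mc (m11 M)) Z) (mc (m12 M)).
Definition act (M : M2 M2O) (Z : M2 Cx) : M2 Cx := Mmul (Pm M Z) (Minv (Jm M Z)).

(* The four blocks of [M^* J M], sandwiched between the columns [(X; Y)] and [(X2; Y2)]. *)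
Lemma U22_sandwich A B Cb E X Y X2 Y2 : inU22 D A B Cb E ->
 MOsub (MOmul D (MOstar (MOadd (MOmul D Cb X) (MOmul D E Y))) (MOadd (MOmul D A X2) (MOmul D B Y2)))
    (MOmul D (MOstar (MOadd (MOmul D A X) (MOmul D B Y))) (MOadd (MOmul D Cb X2) (MOmul D E Y2)))
 = MOsub (MOmul D (MOstar Y) X2) (MOmul D (MOstar X) Y2).
Proof.
 intros [R1 [R2 [R3 R4]]].
 transitivity (MOadd (MOadd (MOmul D (MOstar X) (MOmul D (MOsub (MOmul D (MOstar Cb) A) (MOmul D (MOstar A) Cb)) X2))
  (MOmul D (MOstar X) (MOmul D (MOsub (MOmul D (MOstar Cb) B) (MOmul D (MOstar A) E)) Y2)))
  (MOadd (MOmul D (MOstar Y) (MOmul D (MOsub (MOmul D (MOstar E) A) (MOmul D (MOstar B) Cb)) X2))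
  (MOmul D (MOstar Y) (MOmul D (MOsub (MOmul D (MOstar E) B) (MOmul D (MOstar B) E)) Y2)))).
 - unfold MOadd. mo.
 - rewrite R1, R2, R3, R4. unfold MOadd. mo.
Qed.
Lemma U22_mul M N : U22 M -> U22 N -> U22 (Bmul M N).
Proof.
 intros HM [N1 [N2 [N3 N4]]]. unfold U22, inU22, Bmul; mcbn.
 repeat split; rewrite (U22_sandwich _ _ _ _ _ _ _ _ HM); auto.
Qed.

(** For M in U(2,2) the pair (P u, J u) has the same skew form as (Z u, u). A kernel vector u of J
    would make it zero, against positivity; once J is invertible, v = J u transports positivity to P
    J^(-1). *)
Lemma act_facts M Z : U22 M -> inH2 Z -> Mdet (Jm M Z) <> C0 /\ inH2 (act M Z).
Proof.
 intros HM HZ.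
 assert (K : forall u, skew (vmul (Jm M Z) u) (vmul (Pm M Z) u) = skew u (vmul Z u)).
 { intros u. destruct HM as [R1 [R2 [R3 R4]]].
  apply (f_equal mc) in R1, R2, R3, R4. rewrite !mc_sub, !mc_mul, !mc_star, ?mc_0, ?mc_1 in R1, R2, R3, R4.
  set (A := mc (m11 M)) in *. set (B := mc (m12 M)) in *. set (Cb := mc (m21 M)) in *. set (E := mc (m22 M)) in *.
  set (z := vmul Z u).
  transitivity (dotc z (vmul (Msub (Mmul (Mstar Cb) A) (Mmul (Mstar A) Cb)) z) + dotc z (vmul (Msub (Mmul (Mstar Cb) B) (Mmul (Mstar A) E)) u)
   + dotc u (vmul (Msub (Mmul (Mstar E) A) (Mmul (Mstar B) Cb)) z) + dotc u (vmul (Msub (Mmul (Mstar E) B) (Mmul (Mstar B) E)) u))%C.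
  - assert (EJ : vmul (Jm M Z) u = (fst (vmul Cb z) + fst (vmul E u), snd (vmul Cb z) + snd (vmul E u))%C)
    by (unfold Jm, z; fold Cb E; unfold vmul, Madd, Mmul; cbn [m11 m12 m21 m22 fst snd]; f_equal; ring).
   assert (EP : vmul (Pm M Z) u = (fst (vmul A z) + fst (vmul B u), snd (vmul A z) + snd (vmul B u))%C)
    by (unfold Pm, z; fold A B; unfold vmul, Madd, Mmul; cbn [m11 m12 m21 m22 fst snd]; f_equal; ring).
   rewrite EJ, EP. clearbody z. unfold skew, dotc, vmul. mx.
  - rewrite R1, R2, R3, R4, mc_sub, mc_0, mc_1. clearbody z. unfold skew, dotc, vmul, M1. mx. }
 assert (HJ : Mdet (Jm M Z) <> C0).
 (* A singular 2 x 2 matrix kills the vector read off a nonzero row with entries exchanged and one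
    sign changed; the zero matrix kills everything. *)
 { intros E0. set (J := Jm M Z) in *. assert (exists u, u <> (C0, C0) /\ vmul J u = (C0, C0)) as [u [Hu1 Hu2]].
  { unfold Mdet in E0. destruct J as [a b c d]; cbn [m11 m12 m21 m22] in *.
   destruct (classic ((b, a) = (C0, C0))) as [E1|E1].
   - injection E1 as -> ->. destruct (classic ((d, c) = (C0, C0))) as [E2|E2].
    + injection E2 as -> ->. exists (C1, C0). split; [intros E; injection E; intros; apply C1_neq_C0, Cx_eq; auto|].
     unfold vmul; cbn [m11 m12 m21 m22 fst snd]. f_equal; ring.
    + exists (- d, c)%C. split; [|unfold vmul; cbn [m11 m12 m21 m22 fst snd]; f_equal; ring].
     intros E. apply E2. pose proof (f_equal fst E) as e1. pose proof (f_equal snd E) as e2. cbn [fst snd] in e1, e2.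
     rewrite e2. replace d with (- - d)%C by ring. rewrite e1. f_equal; ring.
   - exists (- b, a)%C. split.
    + intros E. apply E1. pose proof (f_equal fst E) as e1. pose proof (f_equal snd E) as e2. cbn [fst snd] in e1, e2.
     rewrite e2. replace b with (- - b)%C by ring. rewrite e1. f_equal; ring.
    + unfold vmul; cbn [m11 m12 m21 m22 fst snd]. f_equal; [ring|]. rewrite <- E0. ring. }
  apply (proj1 (inH2_skew Z)) with (v := u) in HZ; auto. rewrite <- K, Hu2 in HZ.
  match type of HZ with 0 < Re ?x => replace x with C0 in HZ end; [simpl in HZ; lra|].
  unfold skew, dotc; pcbn. replace (Cconj C0) with C0 by (apply Cx_eq; simpl; ring). ring. }
 split; auto. apply (proj2 (inH2_skew _)). intros v Hv. set (u := vmul (Minv (Jm M Z)) v).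
 assert (Ev : vmul (Jm M Z) u = v).
 { unfold u. rewrite <- vmul_mul, Minv_r by auto. unfold vmul, M1; mcbn. destruct v; pcbn; f_equal; ring. }
 assert (EP : vmul (act M Z) v = vmul (Pm M Z) u) by (unfold act, u; apply vmul_mul).
 rewrite EP, <- Ev, K. apply (proj1 (inH2_skew Z) HZ). intros E. apply Hv. rewrite <- Ev, E. unfold vmul; pcbn. f_equal; ring.
Qed.

Lemma act_mul M N Z : U22 M -> U22 N -> inH2 Z ->
 act (Bmul M N) Z = act M (act N Z) /\ Mdet (Jm (Bmul M N) Z) = (Mdet (Jm M (act N Z)) * Mdet (Jm N Z))%C.
Proof.
 intros HM HN HZ. destruct (act_facts N Z HN HZ) as [JN HW]. destruct (act_facts M _ HM HW) as [JM _].
 assert (EW : Mmul (act N Z) (Jm N Z) = Pm N Z) by (unfold act; rewrite <- Mmul_assoc, Minv_l, Mmul_1_r; auto).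
 assert (EJ : Jm (Bmul M N) Z = Mmul (Jm M (act N Z)) (Jm N Z)).
 { unfold Jm at 2. rewrite Mmul_add_l, <- Mmul_assoc, EW. unfold Jm, Pm, Bmul; mcbn. rewrite !mc_add, !mc_mul. mx. }
 assert (EP : Pm (Bmul M N) Z = Mmul (Pm M (act N Z)) (Jm N Z)).
 { unfold Pm at 2. rewrite Mmul_add_l, <- Mmul_assoc, EW. unfold Jm, Pm, Bmul; mcbn. rewrite !mc_add, !mc_mul. mx. }
 split; [|rewrite EJ; apply Mdet_mul]. unfold act at 1. rewrite EJ, EP, Minv_mul by auto.
 rewrite <- Mmul_assoc, (Mmul_assoc (Jm N Z)), Minv_r, Mmul_1_l by auto. reflexivity.
Qed.

Definition Good (F : M2 Cx -> Cx) (k : nat) (M : M2 M2O) : Prop :=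
 U22 M /\ forall Z, inH2 Z -> F (act M Z) = (Cpow (Mdet (Jm M Z)) k * F Z)%C.
Lemma good_mul F k M N : Good F k M -> Good F k N -> Good F k (Bmul M N).
Proof.
 intros [UM HM] [UN HN]. split; [apply U22_mul; auto|]. intros Z HZ. destruct (act_mul M N Z UM UN HZ) as [-> ->].
 rewrite HM, HN, Cpow_mul by (auto; apply act_facts; auto). ring.
Qed.

Lemma Bmul_assoc M N P : Bmul M (Bmul N P) = Bmul (Bmul M N) P.
Proof. unfold Bmul, MOadd. apply M2_eq; mcbn; mo. Qed.
End OKalg.

(** * Units of O and the action of GL_2(O) on Fourier indices *)

Section Units.
Context (D : Z) (HD0 : (0 < D)%Z) (HD4 : (D mod 4 = 3)%Z).

(** Multiplication by u permutes the units; comparing the products of all units gives u^n = 1 for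
    their number n, which divides k. *)
Lemma unit_pow k u : card_units_divides D k -> Ounit D u -> Cpow (OtoC D u) k = C1.
Proof.
 intros [L [HL [Hin [j Hj]]]] [v Hv].
 assert (oc1 : OtoC D O1 = C1) by apply (oc_Z D 1).
 assert (Ouc : OtoC D u <> C0).
 { intros E. apply (f_equal (OtoC D)) in Hv. rewrite (oc_mul D HD0 HD4), E, oc1 in Hv. apply C1_neq_C0. rewrite <- Hv. ring. }
 set (pr := fun l => fold_right Cmul C1 (map (OtoC D) l)).
 assert (Hnz : pr L <> C0).
 { assert (HU : forall x, In x L -> Ounit D x) by (intros; apply Hin; auto). clear - HU HD0 HD4 oc1. induction L as [|x L IH]; [apply C1_neq_C0|].
  apply Cmul_neq0; [|apply IH; intros; apply HU; right; auto]. destruct (HU x (or_introl eq_refl)) as [y Hy]. intros E.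
  apply (f_equal (OtoC D)) in Hy. rewrite (oc_mul D HD0 HD4), E, oc1 in Hy. apply C1_neq_C0. rewrite <- Hy. ring. }
 assert (P : Permutation (map (Omul D u) L) L).
 { apply NoDup_Permutation_bis.
  - apply NoDup_map_NoDup_ForallPairs; auto. intros x y _ _ E. apply (f_equal (OtoC D)) in E. rewrite !(oc_mul D HD0 HD4) in E.
   apply (oc_inj D HD0). replace (OtoC D x) with (OtoC D u * OtoC D x / OtoC D u)%C by (field; auto). rewrite E. field. auto.
  - rewrite length_map. auto.
  - intros y Hy. apply in_map_iff in Hy as [x [<- Hx]]. apply Hin. apply Hin in Hx as [x' Hx']. exists (Omul D v x').
   apply (oc_inj D HD0). apply (f_equal (OtoC D)) in Hv, Hx'. rewrite !(oc_mul D HD0 HD4), oc1 in *.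
   transitivity ((OtoC D u * OtoC D v) * (OtoC D x * OtoC D x'))%C; [ring|]. rewrite Hv, Hx'. ring. }
 assert (E : (Cpow (OtoC D u) (length L) * pr L)%C = pr L).
 { transitivity (pr (map (Omul D u) L)).
  - unfold pr. clear - HD0 HD4. induction L; simpl; [ring|]. rewrite <- IHL. change (map (fun x => OtoC D x) L) with (map (OtoC D) L). rewrite (oc_mul D HD0 HD4). ring.
  - unfold pr. clear - P. induction P; simpl; auto; [rewrite IHP; auto|ring|congruence]. }
 assert (E1 : Cpow (OtoC D u) (length L) = C1).
 { replace (Cpow (OtoC D u) (length L)) with (Cpow (OtoC D u) (length L) * pr L / pr L)%C by (field; auto). rewrite E. field. auto. }
 assert (Ek : exists i, k = (length L * i)%nat).
 { destruct (Nat.eq_dec (length L) 0) as [E0|E0]; [exists 0%nat; rewrite E0 in Hj; lia|].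
  exists (Z.to_nat j). nia. }
 destruct Ek as [i ->]. clear - E1. induction i; [now rewrite Nat.mul_0_r|].
 rewrite Nat.mul_succ_r, Cpow_add, IHi, E1. ring.
Qed.

(** The trace of t y for t = x / sqrt(-D), in coordinates. That it is an integer is the defining
    property of the inverse different. *)
Definition Otr (x y : OK) : Z := (snd x * fst y + fst x * snd y + snd x * snd y)%Z.
Lemma tx_trace x y : (tx D x * OtoC D y + Cconj (tx D x) * Cconj (OtoC D y))%C = ZtoC (Otr x y).
Proof.
 rewrite (tx_eq D HD0). pose proof (dl_pos D HD0). unfold OtoC, Otr, Ou, ZtoC. destruct x as [a b], y as [c d]; pcbn.
 rewrite !plus_IZR, !mult_IZR. apply Cx_eq; cbn [Re Im Cadd Cmul Cconj RtoC]; field; lra.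
Qed.

Lemma tex_Mtr T Z : tex D T Z = Mtr (Mmul (Tmat D T) Z).
Proof. destruct T as [[l m] x]. unfold tex, lx, Tmat, Mtr, Mmul, tx; cbn [m11 m12 m21 m22 fst snd]. ring. Qed.

Definition sqO : OK := (-1, 2)%Z.
Lemma oc_sqO : OtoC D sqO = sqrtmD D.
Proof. unfold OtoC, sqO, sqrtmD; pcbn. apply Cx_eq; cbn [Re Im]; field. Qed.

(* [A^* T A], with the off-diagonal entry [x' = sqrt(-D) t'] expressed in [O]. *)
Definition Tconj (A : M2O) (T : Sidx) : Sidx :=
 let '(l, m, x) := T in
 let al := m11 A in let be := m12 A in let ga := m21 A in let de := m22 A in
 (l * Onorm D al + m * Onorm D ga + Otr x (Omul D (Oconj al) ga),
 l * Onorm D be + m * Onorm D de + Otr x (Omul D (Oconj be) de),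
 Oadd (Omul D sqO (Oadd (Ozs l (Omul D (Oconj al) be)) (Ozs m (Omul D (Oconj ga) de))))
  (Oadd (Omul D x (Omul D (Oconj al) de)) (Oopp (Omul D (Oconj x) (Omul D (Oconj ga) be)))))%Z.

Lemma oc_Ozs z x : OtoC D (Ozs z x) = (ZtoC z * OtoC D x)%C.
Proof. unfold OtoC, Ozs, ZtoC; pcbn. rewrite !mult_IZR. apply Cx_eq; cbn [Re Im Cmul RtoC]; field. Qed.

Lemma Tmat_conj A T : Tmat D (Tconj A T) = Mmul (Mstar (MOtoC D A)) (Mmul (Tmat D T) (MOtoC D A)).
Proof.
 destruct T as [[l m] x]. unfold Tconj, Tmat. set (t := (OtoC D x / sqrtmD D)%C).
 pose proof (sqrtmD_neq0 D HD0) as Hs.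
 assert (Et : forall y, (t * OtoC D y + Cconj t * Cconj (OtoC D y))%C = ZtoC (Otr x y)) by (intros; apply tx_trace).
 assert (Ex : OtoC D x = (t * sqrtmD D)%C) by (unfold t; field; auto).
 assert (Exc : Cconj (OtoC D x) = (- (Cconj t * sqrtmD D))%C).
 { rewrite Ex, Cconj_mul. replace (Cconj (sqrtmD D)) with (- sqrtmD D)%C by (apply Cx_eq; simpl; ring). ring. }
 assert (E12 : (OtoC D (Oadd (Omul D sqO (Oadd (Ozs l (Omul D (Oconj (m11 A)) (m12 A))) (Ozs m (Omul D (Oconj (m21 A)) (m22 A)))))
  (Oadd (Omul D x (Omul D (Oconj (m11 A)) (m22 A))) (Oopp (Omul D (Oconj x) (Omul D (Oconj (m21 A)) (m12 A)))))) / sqrtmD D)%C =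
  (Cconj (OtoC D (m11 A)) * (ZtoC l * OtoC D (m12 A) + t * OtoC D (m22 A)) + Cconj (OtoC D (m21 A)) * (Cconj t * OtoC D (m12 A) + ZtoC m * OtoC D (m22 A)))%C).
 { repeat rewrite ?oc_add, ?oc_opp, ?(oc_mul D HD0 HD4), ?oc_Ozs, ?oc_conj, ?oc_sqO. rewrite Exc, Ex. field. auto. }
 rewrite E12. unfold Mstar, Mmul, MOtoC, M2map; apply M2_eq; mcbn.
 - rewrite !ZtoC_add, !ZtoC_mul, <- Et, <- !(oc_norm D HD0 HD4), (oc_mul D HD0 HD4), oc_conj, Cconj_mul, Cconj_conj. ring.
 - ring.
 - repeat rewrite ?Cconj_add, ?Cconj_mul, ?Cconj_conj, ?Cconj_Z. ring.
 - rewrite !ZtoC_add, !ZtoC_mul, <- Et, <- !(oc_norm D HD0 HD4), (oc_mul D HD0 HD4), oc_conj, Cconj_mul, Cconj_conj. ring.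
Qed.
Lemma Tmat_inj T T' : Tmat D T = Tmat D T' -> T = T'.
Proof.
 destruct T as [[l m] x], T' as [[l' m'] x']. intros E. pose proof (sqrtmD_neq0 D HD0) as Hs.
 pose proof (f_equal m11 E) as E1. pose proof (f_equal m12 E) as E2. pose proof (f_equal m22 E) as E3. cbn [Tmat m11 m12 m22] in E1, E2, E3.
 apply ZtoC_inj in E1, E3. subst. f_equal. apply (oc_inj D HD0).
 replace (OtoC D x) with (OtoC D x / sqrtmD D * sqrtmD D)%C by (field; auto). rewrite E2. field. auto.
Qed.
Lemma DdetT_det T : ZtoC (DdetT D T) = (ZtoC D * Mdet (Tmat D T))%C.
Proof.
 destruct T as [[l m] x]. unfold DdetT, Tmat, Mdet; mcbn.
 rewrite ZtoC_sub, !ZtoC_mul, <- (oc_norm D HD0 HD4). pose proof (sqrtmD_neq0 D HD0) as Hs. pose proof (dl_sqr D HD0) as E.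
 assert (E2 : ZtoC D = (sqrtmD D * Cconj (sqrtmD D))%C) by (unfold ZtoC; rewrite <- E at 1; apply Cx_eq; simpl; ring).
 assert (Ec : Cconj (OtoC D x / sqrtmD D) = (Cconj (OtoC D x) / Cconj (sqrtmD D))%C).
 { unfold Cdiv. rewrite Cconj_mul. f_equal. unfold Cinv, Cnorm2; apply Cx_eq; cbn [Re Im Cconj sqrtmD];
   rewrite ?Rmult_opp_opp; unfold Rdiv; ring. }
 assert (Hs2 : Cconj (sqrtmD D) <> C0) by (intros E0; apply Hs; rewrite <- (Cconj_conj (sqrtmD D)), E0; apply Cx_eq; simpl; ring).
 rewrite Ec, E2. field. auto.
Qed.

Context (A E : M2O) (HE : MOmul D (MOstar E) A = MO1).
Let Ac := MOtoC D A.
Let Ec := MOtoC D E.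
Lemma EA : Mmul (Mstar Ec) Ac = M1.
Proof. unfold Ac, Ec. rewrite <- mc_star, <- (mc_mul D HD0 HD4), HE. apply mc_1. Qed.
Definition Odet (M : M2O) : OK := Oadd (Omul D (m11 M) (m22 M)) (Oopp (Omul D (m12 M) (m21 M))).
Lemma oc_det M : OtoC D (Odet M) = Mdet (MOtoC D M).
Proof. unfold Odet. rewrite oc_add, oc_opp, !(oc_mul D HD0 HD4). unfold Mdet, MOtoC, M2map; mcbn. ring. Qed.
Lemma Mdet_star X : Mdet (Mstar X) = Cconj (Mdet X).
Proof. mx. rewrite !Cconj_mul. ring. Qed.
Lemma unit_detE : Ounit D (Odet E).
Proof.
 exists (Oconj (Odet A)). apply (oc_inj D HD0). rewrite (oc_mul D HD0 HD4), oc_conj, !oc_det, <- Mdet_star.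
 replace (OtoC D O1) with C1 by (symmetry; apply (oc_Z D 1)). fold Ac Ec. rewrite <- Mdet_mul.
 pose proof EA as h. apply (f_equal Mstar) in h. rewrite Mstar_mul, Mstar_star, Mstar_1 in h.
 apply Mmul_comm1 in h. rewrite h. apply Mdet_1.
Qed.
(** The norms of det A and det E are nonnegative integers with product 1. *)
Lemma normdet1 : (Cconj (Mdet Ac) * Mdet Ac)%C = C1.
Proof.
 pose proof EA as h. apply (f_equal Mdet) in h. rewrite Mdet_mul, Mdet_star, Mdet_1 in h.
 unfold Ac, Ec in *. rewrite <- !oc_det in *.
 assert (h2 : (ZtoC (Onorm D (Odet E)) * ZtoC (Onorm D (Odet A)))%C = C1).
 { rewrite <- !(oc_norm D HD0 HD4). transitivity ((Cconj (OtoC D (Odet E)) * OtoC D (Odet A)) * Cconj (Cconj (OtoC D (Odet E)) * OtoC D (Odet A)))%C.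
  - rewrite Cconj_mul, Cconj_conj. ring.
  - rewrite h. apply Cx_eq; simpl; ring. }
 rewrite (oc_norm D HD0 HD4). rewrite <- ZtoC_mul in h2. change C1 with (ZtoC 1) in *. apply ZtoC_inj in h2. f_equal.
 assert (P : (0 <= Onorm D (Odet A))%Z) by (pose proof (Onorm_Ou D HD4 (Odet A)); nia).
 destruct (Z.mul_eq_1 _ _ h2); nia.
Qed.

Lemma Tconj_inv T : Tconj (MOstar E) (Tconj A T) = T /\ Tconj A (Tconj (MOstar E) T) = T.
Proof.
 pose proof EA as h. pose proof (Mmul_comm1 _ _ h) as h2.
 pose proof (f_equal Mstar h) as h3. pose proof (f_equal Mstar h2) as h4. rewrite Mstar_mul, Mstar_star, Mstar_1 in h3, h4.
 split; apply Tmat_inj; rewrite !Tmat_conj, mc_star; fold Ac Ec; rewrite Mstar_star.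
 - rewrite <- !Mmul_assoc, h2, Mmul_1_r, Mmul_assoc, h4, Mmul_1_l. reflexivity.
 - rewrite <- !Mmul_assoc, h, Mmul_1_r, Mmul_assoc, h3, Mmul_1_l. reflexivity.
Qed.
Lemma DdetT_conj T : DdetT D (Tconj A T) = DdetT D T.
Proof.
 apply ZtoC_inj. rewrite !DdetT_det, Tmat_conj, !Mdet_mul, Mdet_star. fold Ac.
 transitivity (ZtoC D * Mdet (Tmat D T) * (Cconj (Mdet Ac) * Mdet Ac))%C; [ring|]. rewrite normdet1. ring.
Qed.
(** The new entry m' is the value of the Hermitian form T at the second column (b, d) of A, and m m'
    = |m d + conj(t) b|^2 + det(T) |b|^2; the column is not zero since A is invertible. *)
Lemma Tconj_pos T : (0 < DdetT D T)%Z -> (0 < snd (fst T))%Z -> (0 < snd (fst (Tconj A T)))%Z.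
Proof.
 destruct T as [[l m] x]. intros HT Hm. cbn [fst snd] in Hm.
 pose proof (Tmat_conj A (l, m, x)) as HTc. set (m' := snd (fst (Tconj A (l, m, x)))) in *.
 assert (Em : ZtoC m' = m22 (Tmat D (Tconj A (l, m, x)))) by reflexivity. rewrite HTc in Em. clear HTc.
 unfold Mstar, Mmul, Tmat in Em; cbn [m11 m12 m21 m22] in Em. fold Ac in Em.
 set (t := (OtoC D x / sqrtmD D)%C) in *. set (b := m12 Ac) in *. set (d := m22 Ac) in *.
 assert (Ht : Cnorm2 t < IZR l * IZR m) by (apply (tx_size D HD0 HD4 (l, m, x)); auto).
 assert (Pm : 0 < IZR m) by (apply IZR_lt; auto).
 assert (Key : IZR m * IZR m' = Cnorm2 (ZtoC m * d + Cconj t * b)%C + (IZR l * IZR m - Cnorm2 t) * Cnorm2 b).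
 { apply (f_equal Re) in Em. change (Re (ZtoC m')) with (IZR m') in Em. rewrite Em. unfold Cnorm2; simpl. ring. }
 assert (Hbd : b <> C0 \/ d <> C0).
 { destruct (classic (b = C0)) as [Eb|]; [right|auto]. intros Ed. destruct (Mdet_unit _ _ EA) as [_ H]. apply H.
  unfold Mdet. fold b d. rewrite Eb, Ed. ring. }
 apply lt_IZR. apply Rmult_lt_reg_l with (IZR m); auto. rewrite Rmult_0_r, Key.
 pose proof (Cnorm2_pos (ZtoC m * d + Cconj t * b)%C) as P1. pose proof (Cnorm2_pos b) as P2.
 destruct (Rlt_dec 0 (Cnorm2 b)) as [h|h].
 - assert (0 < (IZR l * IZR m - Cnorm2 t) * Cnorm2 b) by (apply Rmult_lt_0_compat; lra). lra.
 - assert (Eb : b = C0) by (apply Cnorm2_eq0; lra). rewrite Eb in *. destruct Hbd as [?|Hd]; [tauto|].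
  replace (ZtoC m * d + Cconj t * C0)%C with (ZtoC m * d)%C by ring.
  replace (Cnorm2 (ZtoC m * d)%C) with (IZR m * IZR m * Cnorm2 d) by (unfold Cnorm2; simpl; ring).
  pose proof (Cnorm2_gt0 d Hd).
  replace (Cnorm2 C0) with 0 by (unfold Cnorm2; simpl; ring). rewrite Rmult_0_r, Rplus_0_r. repeat apply Rmult_lt_0_compat; auto.
Qed.
End Units.

Lemma epsT_conj D A T d : (d | epsT T)%Z -> (d | epsT (Tconj D A T))%Z.
Proof.
 rewrite !epsT_div. destruct T as [[l m] [x y]]. unfold Omultiple; pcbn. intros [[l' ->] [[m' ->] [[x' ->] [y' ->]]]].
 set (T0 := Tconj D A (l', m', (x', y'))).
 assert (E : Tconj D A (l' * d, m' * d, (x' * d, y' * d))%Z = (fst (fst T0) * d, snd (fst T0) * d, (fst (snd T0) * d, snd (snd T0) * d))%Z).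
 { unfold T0, Tconj, Ozs, Oadd, Omul, Oopp, Oconj, Otr, sqO. destruct A as [[a1 a2] [b1 b2] [c1 c2] [d1 d2]]; cbn [m11 m12 m21 m22 fst snd].
  f_equal; [f_equal; ring|f_equal; ring]. }
 match goal with |- context [Tconj D A ?u] => replace (Tconj D A u) with ((fst (fst T0) * d, snd (fst T0) * d, (fst (snd T0) * d, snd (snd T0) * d))%Z : Sidx) by (symmetry; exact E) end.
 pcbn. repeat split; eexists; reflexivity.
Qed.

Section Generators.
Context (D p : Z) (HD0 : (0 < D)%Z) (HD4 : (D mod 4 = 3)%Z) (k : nat) (cf : nat -> Cx).
Context (K1 : R) (HK1 : 0 <= K1) (Hcf : forall n, Cabs (cf n) <= K1 * INR n ^ (k - 1)).
Notation F := (Fl D p k cf).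

(** [Cf] depends on T through the determinant, the content and the sign of m only. The content is
    preserved because [Tconj] and its inverse are linear; the sign is preserved for positive
    determinant, and otherwise both coefficients vanish. *)
Lemma Cf_conj A E T : MOmul D (MOstar E) A = MO1 -> Cf D p k cf (Tconj D A T) = Cf D p k cf T.
Proof.
 intros HE. destruct (Tconj_inv D HD0 HD4 A E HE T) as [I1 _].
 assert (HE2 : MOmul D (MOstar (MOstar A)) (MOstar E) = MO1).
 { apply (mc_inj D HD0). rewrite (mc_mul D HD0 HD4), !mc_star, mc_1, Mstar_star. apply Mmul_comm1, (EA D HD0 HD4 A E HE). }
 pose proof (DdetT_conj D HD0 HD4 A E HE T) as Ed.
 assert (Ee : epsT (Tconj D A T) = epsT T).
 { apply Z.divide_antisym_nonneg; try apply epsT_nonneg.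
  - rewrite <- I1 at 2. apply epsT_conj, Z.divide_refl.
  - apply epsT_conj, Z.divide_refl. }
 destruct (Z_le_gt_dec (DdetT D T) 0) as [h|h].
 { assert (K : forall T, (DdetT D T <= 0)%Z -> Cf D p k cf T = C0).
  { intros T0 H0. destruct (excluded_middle_informative (Cf D p k cf T0 = C0)) as [|n]; auto. apply Cf_nonzero in n; auto. lia. }
  rewrite !K; auto. lia. }
 assert (Es : (0 < snd (fst T))%Z <-> (0 < snd (fst (Tconj D A T)))%Z).
 { split; intros H; [apply (Tconj_pos D HD0 HD4 A E HE); auto; lia|]. rewrite <- I1.
  apply (Tconj_pos D HD0 HD4 (MOstar E) (MOstar A)); auto. lia. }
 unfold Cf. destruct (Z_le_gt_dec (snd (fst T)) 0), (Z_le_gt_dec (snd (fst (Tconj D A T))) 0); try lia; auto.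
 unfold okd, dterm. rewrite Ee, Ed. reflexivity.
Qed.

(** Since tr(T A Z A^* ) = tr(A^* T A Z), the substitution reindexes the Fourier series. The
    automorphy factor is a k-th power of the unit det E, hence 1. *)
Lemma good_diag A E : MOmul D (MOstar E) A = MO1 -> card_units_divides D k -> Good D F k (mkM2 A MO0 MO0 E).
Proof.
 intros HE Hu. assert (UM : U22 D (mkM2 A MO0 MO0 E)).
 { assert (h : MOmul D (MOstar A) E = MO1).
  { apply (mc_inj D HD0). rewrite (mc_mul D HD0 HD4), mc_star, mc_1. pose proof (EA D HD0 HD4 A E HE) as h.
   apply (f_equal Mstar) in h. rewrite Mstar_mul, Mstar_star, Mstar_1 in h. exact h. }
  unfold U22, inU22; mcbn. rewrite HE, h.
  repeat split; apply (mc_inj D HD0); rewrite ?mc_sub, ?(mc_mul D HD0 HD4), ?mc_star, ?mc_sub, ?mc_0, ?mc_1; unfold M1; mx;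
   rewrite ?(Cconj_Z 0); try (apply Cx_eq; simpl; ring). }
 split; auto. intros Z HZ. destruct (act_facts D HD0 HD4 _ Z UM HZ) as [_ HZ'].
 assert (EJ : Jm D (mkM2 A MO0 MO0 E) Z = MOtoC D E) by (unfold Jm; cbn [m21 m22]; rewrite mc_0; destruct (MOtoC D E); mx).
 assert (EP : Pm D (mkM2 A MO0 MO0 E) Z = Mmul (MOtoC D A) Z) by (unfold Pm; cbn [m11 m12]; rewrite mc_0; mx).
 pose proof (EA D HD0 HD4 A E HE) as h1. pose proof (f_equal Mstar h1) as h2. rewrite Mstar_mul, Mstar_star, Mstar_1 in h2.
 assert (Ea : act D (mkM2 A MO0 MO0 E) Z = Mmul (Mmul (MOtoC D A) Z) (Mstar (MOtoC D A))).
 { unfold act. rewrite EJ, EP, (Minv_unique _ _ (Mmul_comm1 _ _ h2)). reflexivity. }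
 rewrite EJ, <- (oc_det D HD0 HD4), (unit_pow D HD0 HD4 k) by (auto; apply (unit_detE D HD0 HD4 A E HE)).
 replace (C1 * F Z)%C with (F Z) by ring.
 rewrite Ea in *. apply Sumv_eq. pose proof (Sumv_spec _ (Fterm_AbsSum0 D p HD0 HD4 k cf K1 HK1 Hcf Z HZ)) as K.
 apply (HasSum_reindex (Tconj D A) (Tconj D (MOstar E))) in K; try (intros; apply (Tconj_inv D HD0 HD4 A E HE)).
 eapply HasSum_ext; [|exact K]. intros T. unfold Fterm. rewrite (Cf_conj A E T HE). do 2 f_equal.
 rewrite !tex_Mtr, (Tmat_conj D HD0 HD4). set (X := Tmat D T). set (Y := MOtoC D A). mx.
Qed.

(** For S Hermitian over O the trace of T S is an integer, by duality between O and the inverse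
    different. *)
Lemma good_trans S : MOstar S = S -> Good D F k (mkM2 MO1 S MO0 MO1).
Proof.
 intros HS.
 assert (UM : U22 D (mkM2 MO1 S MO0 MO1)).
 { unfold U22, inU22; mcbn. rewrite HS.
  repeat split; apply (mc_inj D HD0); rewrite ?mc_sub, ?(mc_mul D HD0 HD4), ?mc_star, ?mc_sub, ?mc_0, ?mc_1; unfold M1; set (X := MOtoC D S); mx;
   rewrite ?(Cconj_Z 0), ?(Cconj_Z 1); try (apply Cx_eq; simpl; ring). }
 split; auto. intros Z HZ. destruct (act_facts D HD0 HD4 _ Z UM HZ) as [_ HZ'].
 assert (EJ : Jm D (mkM2 MO1 S MO0 MO1) Z = M1) by (unfold Jm; cbn [m21 m22]; rewrite mc_0, mc_1; unfold M1; mx).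
 assert (EP : Pm D (mkM2 MO1 S MO0 MO1) Z = Madd Z (MOtoC D S)) by (unfold Pm; cbn [m11 m12]; rewrite mc_1, Mmul_1_l; reflexivity).
 unfold act in *. rewrite EJ, EP, (Minv_unique M1 M1 (Mmul_1_l M1)), Mmul_1_r in *. rewrite Mdet_1, Cpow_1_l.
 replace (C1 * F Z)%C with (F Z) by ring. unfold Fl. f_equal. apply functional_extensionality. intros T. unfold Fterm. f_equal.
 pose proof (f_equal m11 HS) as S1. pose proof (f_equal m21 HS) as S2. pose proof (f_equal m22 HS) as S3. cbn [MOstar m11 m21 m22] in S1, S2, S3.
 apply O_fixed in S1, S3. rewrite tex_add.
 assert (Es : tex D T (MOtoC D S) = ZtoC (fst (fst T) * fst (m11 S) + Otr (snd T) (m21 S) + snd (fst T) * fst (m22 S))%Z).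
 { unfold tex, lx, MOtoC, M2map; mcbn. rewrite S1, S3 at 1. rewrite !oc_Z, !ZtoC_add, !ZtoC_mul, <- (tx_trace D HD0).
  assert (S4 : OtoC D (m12 S) = Cconj (OtoC D (m21 S))) by (rewrite <- S2, oc_conj, Cconj_conj; reflexivity).
  rewrite S4. pcbn. ring. }
 rewrite Es. apply e_add_Z.
Qed.
End Generators.

(** * Generators of the congruence subgroup *)

Section Generation.
Context (D p : Z) (HD0 : (0 < D)%Z) (HD4 : (D mod 4 = 3)%Z) (Hh : class_number_one D) (Hp : prime p).
Context (k : nat) (Hk : (0 < k)%nat) (Hu : card_units_divides D k) (cf : nat -> Cx).
Context (K1 : R) (HK1 : 0 <= K1) (Hcf : forall n, Cabs (cf n) <= K1 * INR n ^ (k - 1)).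
Context (Ph : M2 Cx -> Cx) (HJ : forall Z, inH (m11 Z) -> ASum (jterm D cf Z) (Ph Z)).
Context (HG : forall g Z, Gam0 p g -> inH (m11 Z) -> Ph (Zact g Z) = (Cpow (Zj g Z) k * Ph Z)%C).
Notation F := (Fl D p k cf).
Notation good := (Good D F k).
Add Ring OKr2 : (OK_ring D).
Notation "x ** y" := (Omul D x y) (at level 40, left associativity).
Notation "x +o y" := (Oadd x y) (at level 50, left associativity).
Definition oz (n : Z) : OK := (n, 0%Z).
Lemma oz_mul m n : oz (m * n) = oz m ** oz n.
Proof. unfold oz, Omul. f_equal; ring. Qed.
Lemma oz_add m n : oz (m + n) = oz m +o oz n.
Proof. unfold oz, Oadd; pcbn. f_equal; ring. Qed.
Lemma oz_conj n : Oconj (oz n) = oz n.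
Proof. unfold oz, Oconj; pcbn. f_equal; ring. Qed.

Definition odv (x : OK) : Prop := exists y, x = oz p ** y.
Lemma odv_mult x : Omultiple p x <-> odv x.
Proof.
 destruct x as [a b]. unfold Omultiple, odv, oz, Omul; pcbn. split.
 - intros [[a' ->] [b' ->]]. exists (a', b'). f_equal; ring.
 - intros [[y z] E]. injection E as -> ->. split; [exists y|exists z]; ring.
Qed.
Lemma odv_add x y : odv x -> odv y -> odv (x +o y).
Proof. intros [u ->] [v ->]. exists (u +o v). ring. Qed.
Lemma odv_mul r x : odv x -> odv (r ** x).
Proof. intros [u ->]. exists (r ** u). ring. Qed.
Lemma odv_1 : ~ odv O1.
Proof. rewrite <- odv_mult. intros [H _]. cbn [O1 fst] in H. pose proof (prime_ge_2 p Hp). apply Z.divide_1_r_nonneg in H; lia. Qed.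

Definition inG (M : M2 M2O) : Prop := U22 D M /\
 odv (m11 (m21 M)) /\ odv (m12 (m21 M)) /\ odv (m21 (m21 M)) /\ odv (m22 (m21 M)).
Lemma inG_mul M N : inG M -> inG N -> inG (Bmul D M N).
Proof.
 intros [UM [M1' [M2' [M3 M4]]]] [UN [N1 [N2 [N3 N4]]]]. split; [apply U22_mul; auto|].
 unfold Bmul, MOadd, MOmul; mcbn.
 assert (comm : forall x y, odv x -> odv (x ** y)) by (intros x y [u ->]; exists (u ** y); ring).
 repeat split; repeat apply odv_add; auto using odv_mul.
Qed.

Definition BI : M2 M2O := mkM2 MO1 MO0 MO0 MO1.
Lemma Bmul_1_l M : Bmul D BI M = M.
Proof. destruct M as [A B Cb E]. unfold Bmul, BI, MOadd, MOmul, MO0, MO1. apply M2_eq; mcbn; apply M2_eq; mcbn; ring. Qed.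
(** Left multiplication by such a G can be undone by a matrix under which F is already known to be
    modular. Hence modularity of M may be tested after row operations, by [elem_back]. *)
Definition Elem (G : M2 M2O) : Prop := inG G /\ exists G', good G' /\ Bmul D G' G = BI.
Lemma elem_back G M : Elem G -> good (Bmul D G M) -> good M.
Proof.
 intros [_ [G' [H1 H2]]] H. rewrite <- (Bmul_1_l M), <- H2, <- Bmul_assoc. apply good_mul; auto.
Qed.

Definition E1 (g : M2 Z) : M2 M2O :=
 mkM2 (mkM2 (oz (m11 g)) O0 O0 O1) (mkM2 (oz (m12 g)) O0 O0 O0) (mkM2 (oz (m21 g)) O0 O0 O0) (mkM2 (oz (m22 g)) O0 O0 O1).
Definition E2 (g : M2 Z) : M2 M2O :=
 mkM2 (mkM2 O1 O0 O0 (oz (m11 g))) (mkM2 O0 O0 O0 (oz (m12 g))) (mkM2 O0 O0 O0 (oz (m21 g))) (mkM2 O1 O0 O0 (oz (m22 g))).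
Definition wm : M2O := mkM2 O0 O1 O1 O0.
Definition wB : M2 M2O := mkM2 wm MO0 MO0 wm.
Ltac obr := unfold Bmul, MOadd, MOmul, MOstar, MOsub, MO0, MO1; mcbn.
Ltac ob := obr; repeat (apply M2_eq; mcbn); try ring.

Lemma Oconj_O01 : Oconj O0 = O0 /\ Oconj O1 = O1.
Proof. split; reflexivity. Qed.
Lemma E1_U22 g : Zdet g = 1%Z -> U22 D (E1 g).
Proof.
 intros Hg. unfold U22, inU22, E1; mcbn. destruct Oconj_O01 as [e0 e1].
 assert (E : oz (m11 g) ** oz (m22 g) = oz (m12 g) ** oz (m21 g) +o O1).
 { rewrite <- !oz_mul. change O1 with (oz 1). rewrite <- oz_add. f_equal. unfold Zdet in Hg. lia. }
 assert (E' : oz (m22 g) ** oz (m11 g) = oz (m12 g) ** oz (m21 g) +o O1) by (rewrite <- E; ring).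
 repeat split; ob; rewrite ?oz_conj, ?e0, ?e1, ?E, ?E'; ring.
Qed.
Lemma E1_good g : Gam0 p g -> good (E1 g).
Proof using All.
 intros Hg. assert (Hg1 : Zdet g = 1%Z) by apply Hg. pose proof (E1_U22 g Hg1) as UM. split; auto. intros Z HZ.
 destruct (act_facts D HD0 HD4 _ Z UM HZ) as [HJ1 HZ']. assert (Hi := inH2_inH Z HZ).
 pose proof (Zj_neq0 g Z ltac:(lia) Hi) as Hj.
 assert (e1 : OtoC D O1 = C1) by apply (oc_Z D 1). assert (e0 : OtoC D O0 = C0) by apply (oc_Z D 0).
 assert (EJ : Jm D (E1 g) Z = mkM2 (Zj g Z) (ZtoC (m21 g) * m12 Z)%C C0 C1).
 { unfold Jm, E1, MOtoC, M2map, Zj, oz; mcbn. rewrite !oc_Z, e0, e1. mx. }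
 assert (Ed : Mdet (Jm D (E1 g) Z) = Zj g Z) by (rewrite EJ; unfold Mdet; mcbn; ring).
 assert (Ea : act D (E1 g) Z = Zact g Z).
 { unfold act. rewrite (Minv_unique _ (mkM2 (C1 / Zj g Z) (- (ZtoC (m21 g) * m12 Z / Zj g Z)) C0 C1)%C).
  - unfold Pm, E1, MOtoC, M2map, Zact, oz; mcbn. rewrite !oc_Z, e0, e1, Hg1. change (ZtoC 1) with C1.
   assert (Hd : (ZtoC (m11 g) * ZtoC (m22 g) = C1 + ZtoC (m12 g) * ZtoC (m21 g))%C)
    by (rewrite <- !ZtoC_mul; change C1 with (ZtoC 1); rewrite <- ZtoC_add; f_equal; unfold Zdet in Hg1; lia).
   unfold Mmul, Madd; apply M2_eq; mcbn; try (field; auto).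
   replace (C1 * m12 Z / Zj g Z)%C with ((ZtoC (m11 g) * ZtoC (m22 g) - ZtoC (m12 g) * ZtoC (m21 g)) * m12 Z / Zj g Z)%C by (rewrite Hd; field; auto).
   unfold Zj in *. field. auto.
  - rewrite EJ. unfold Mmul, M1; apply M2_eq; mcbn; field; auto. }
 rewrite Ea in HZ' |- *. rewrite Ed. apply (Fl_Gam0 D p HD0 Hp k Hk cf Ph HJ HG); auto;
  apply (Fterm_AbsSum0 D p HD0 HD4 k cf K1 HK1 Hcf); auto.
Qed.
Lemma wB_good : good wB.
Proof. apply (good_diag D p HD0 HD4 k cf K1 HK1 Hcf); auto. Qed.
Lemma E2_good g : Gam0 p g -> good (E2 g).
Proof using All.
 intros Hg. replace (E2 g) with (Bmul D wB (Bmul D (E1 g) wB)) by (unfold E2, E1, wB, wm; ob).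
 apply good_mul; auto; [apply wB_good|]. apply good_mul; auto; [apply E1_good; auto|apply wB_good].
Qed.
Lemma E12_inv g : Zdet g = 1%Z -> Bmul D (E1 (Zadj g)) (E1 g) = BI /\ Bmul D (E2 (Zadj g)) (E2 g) = BI.
Proof.
 intros Hg. pose proof (Zadj_l g Hg) as E. unfold Zmul, Zid in E.
 pose proof (f_equal m11 E) as e1. pose proof (f_equal m12 E) as e2. pose proof (f_equal m21 E) as e3. pose proof (f_equal m22 E) as e4.
 cbn [m11 m12 m21 m22] in e1, e2, e3, e4.
 apply (f_equal oz) in e1, e2, e3, e4. rewrite oz_add, !oz_mul in e1, e2, e3, e4.
 split; unfold E1, E2, BI; ob;
  match goal with |- ?l = O1 => first [transitivity (oz 1); [rewrite <- e1; ring|reflexivity]|transitivity (oz 1); [rewrite <- e4; ring|reflexivity]]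
  | |- ?l = O0 => first [transitivity (oz 0); [rewrite <- e2; ring|reflexivity]|transitivity (oz 0); [rewrite <- e3; ring|reflexivity]] end.
Qed.
Lemma E12_Elem g : Gam0 p g -> Elem (E1 g) /\ Elem (E2 g).
Proof using All.
 intros Hg. assert (Hg1 : Zdet g = 1%Z) by apply Hg. destruct (E12_inv g Hg1) as [I1 I2].
 assert (d0 : odv O0) by (exists O0; ring). assert (dc : odv (oz (m21 g))) by (destruct Hg as [_ [c ->]]; exists (oz c); rewrite oz_mul; ring).
 split; (split; [split; [|cbn [E1 E2 m11 m12 m21 m22]; auto]|]).
 - apply E1_good; auto.
 - exists (E1 (Zadj g)). split; auto. apply E1_good, Gam0_adj; auto.
 - apply E2_good; auto.
 - exists (E2 (Zadj g)). split; auto. apply E2_good, Gam0_adj; auto.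
Qed.

Definition Oadj (V : M2O) : M2O := mkM2 (m22 V) (Oopp (m12 V)) (Oopp (m21 V)) (m11 V).
Definition dgE (V : M2O) : M2 M2O := mkM2 V MO0 MO0 (MOstar (Oadj V)).
Lemma Oadj_l V : Odet D V = O1 -> MOmul D (Oadj V) V = MO1 /\ MOmul D V (Oadj V) = MO1.
Proof.
 intros H. assert (H' : m22 V ** m11 V +o Oopp (m12 V) ** m21 V = O1) by (rewrite <- H; unfold Odet; ring).
 split; unfold Oadj; ob; try (rewrite <- H at 1; unfold Odet; ring).
Qed.
Lemma MOstar_star X : MOstar (MOstar X) = X.
Proof. destruct X as [a b c d]. ob; rewrite ?Oconj_conj; reflexivity. Qed.
Lemma dgE_good V : Odet D V = O1 -> good (dgE V).
Proof.
 intros H. apply (good_diag D p HD0 HD4 k cf K1 HK1 Hcf); auto. rewrite MOstar_star. apply Oadj_l; auto.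
Qed.
Lemma dgE_Elem V : Odet D V = O1 -> Elem (dgE V).
Proof.
 intros H. assert (d0 : odv O0) by (exists O0; ring). destruct (Oadj_l V H) as [H1 H2]. split; [split; [|cbn [dgE m11 m12 m21 m22 MO0]; auto]|].
 - apply dgE_good; auto.
 - exists (dgE (Oadj V)). split.
  + apply dgE_good. rewrite <- H. unfold Odet, Oadj; mcbn. ring.
  + assert (H3 : MOmul D (MOstar (Oadj (Oadj V))) (MOstar (Oadj V)) = MO1).
   { apply (f_equal MOstar) in H1. replace (Oadj (Oadj V)) with V by (destruct V as [a b c d]; unfold Oadj; mcbn; f_equal; ring).
    transitivity (MOstar MO1); [rewrite <- H1; ob; rewrite !Oconj_add, !Oconj_mul; ring|reflexivity]. }
   unfold Bmul, dgE, BI; mcbn. rewrite H1, H3. ob.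
Qed.

(** The ideal generated by c1 and c2 has a generator g = x c1 + y c2 with c1 = g u1, c2 = g u2; for
    g nonzero the rows (x, y) and (-u2, u1) have determinant 1 and the second kills the column. The
    zero column is left alone. *)
Lemma pid_row c1 c2 : exists V, Odet D V = O1 /\ m21 V ** c1 +o m22 V ** c2 = O0.
Proof.
 destruct (Hh (fun z => exists x y, z = x ** c1 +o y ** c2)) as [g Hg].
 { split; [exists O0, O0; ring|split].
  - intros z z' [x [y ->]] [x' [y' ->]]. exists (x +o x'), (y +o y'). ring.
  - intros r z [x [y ->]]. exists (r ** x), (r ** y). ring. }
 destruct (proj1 (Hg c1)) as [u1 E1']; [exists O1, O0; ring|]. destruct (proj1 (Hg c2)) as [u2 E2']; [exists O0, O1; ring|].
 destruct (proj2 (Hg g)) as [x [y Eg]]; [exists O1; ring|].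
 destruct (classic (g = O0)) as [E0|E0].
 - exists MO1. split; [unfold Odet, MO1; mcbn; ring|]. rewrite E1', E2', E0. ring.
 - exists (mkM2 x y (Oopp u2) u1). unfold Odet; mcbn. split.
  + destruct (O_integral D HD0 HD4 g (x ** u1 +o y ** u2 +o Oopp O1)) as [h|h]; [|tauto|].
   * transitivity (x ** (g ** u1) +o y ** (g ** u2) +o Oopp g); [ring|]. rewrite <- E1', <- E2', <- Eg. ring.
   * transitivity (x ** u1 +o y ** u2 +o Oopp O1 +o O1); [ring|]. rewrite h. ring.
  + rewrite E1', E2'. ring.
Qed.

(* [conj c * a] is a rational integer, so [a : c] is a point of the rational projective line;
 clearing denominators stays inside [O] because the rational coordinates are coprime. *)
Lemma hermitian_pair a c : Oconj c ** a = Oconj a ** c ->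
 exists h x y u v, a = h ** oz x /\ c = h ** oz y /\ (u * x + v * y = 1)%Z.
Proof.
 intros H. destruct (classic (c = O0)) as [E0|E0].
 { exists a, 1%Z, 0%Z, 1%Z, 0%Z. change (oz 1) with O1. change (oz 0) with O0. rewrite E0. repeat split; ring. }
 assert (Hr : Oconj c ** a = oz (fst (Oconj c ** a))).
 { apply O_fixed. rewrite Oconj_mul, Oconj_conj, H. ring. }
 assert (Hn : Oconj c ** c = oz (fst (Oconj c ** c))).
 { apply O_fixed. rewrite Oconj_mul, Oconj_conj. ring. }
 set (r := fst (Oconj c ** a)) in *. set (n := fst (Oconj c ** c)) in *.
 assert (Hc : Oconj c <> O0) by (intros E; apply E0; rewrite <- (Oconj_conj c), E; reflexivity).
 assert (n0 : n <> 0%Z).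
 { intros E. rewrite E in Hn. change (oz 0) with O0 in Hn. apply (O_integral D HD0 HD4) in Hn. tauto. }
 set (d := Z.gcd r n). assert (Hd : d <> 0%Z) by (intros E; apply Z.gcd_eq_0 in E; tauto).
 destruct (Z.gcd_divide_l r n) as [x Hx]. destruct (Z.gcd_divide_r r n) as [y Hy]. fold d in Hx, Hy.
 destruct (Zis_gcd_bezout r n d (Zgcd_is_gcd _ _)) as [u v Huv]. clearbody d.
 assert (Hb : (u * x + v * y = 1)%Z).
 { apply Z.mul_cancel_r with d; auto. transitivity (u * (x * d) + v * (y * d))%Z; [ring|]. rewrite <- Hx, <- Hy. lia. }
 assert (Hxy : oz y ** a = oz x ** c).
 { assert (h : Oconj c ** (oz y ** a +o Oopp (oz x ** c)) = O0).
  { transitivity (oz y ** (Oconj c ** a) +o Oopp (oz x ** (Oconj c ** c))); [ring|]. rewrite Hr, Hn, Hx, Hy, !oz_mul. ring. }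
  apply (O_integral D HD0 HD4) in h as [h|h]; [tauto|].
  transitivity (oz y ** a +o Oopp (oz x ** c) +o oz x ** c); [ring|]. rewrite h. ring. }
 assert (H1 : oz u ** oz x +o oz v ** oz y = O1) by (rewrite <- !oz_mul, <- oz_add, Hb; reflexivity).
 exists (oz u ** a +o oz v ** c), x, y, u, v. repeat split; auto.
 - transitivity (oz u ** oz x ** a +o oz v ** (oz x ** c)); [rewrite <- Hxy|ring].
  transitivity ((oz u ** oz x +o oz v ** oz y) ** a); [rewrite H1|]; ring.
 - transitivity (oz u ** (oz y ** a) +o oz v ** oz y ** c); [rewrite Hxy|ring].
  transitivity ((oz u ** oz x +o oz v ** oz y) ** c); [rewrite H1|]; ring.
Qed.
Lemma odv_split h y : odv (h ** oz y) -> (p | y)%Z \/ odv h.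
Proof.
 rewrite <- !odv_mult. destruct h as [h1 h2]. unfold Omultiple, oz, Omul; pcbn. intros [H1 H2].
 replace (h1 * y - h2 * 0 * qD D)%Z with (h1 * y)%Z in H1 by ring. replace (h1 * 0 + h2 * y + h2 * 0)%Z with (h2 * y)%Z in H2 by ring.
 apply prime_mult in H1, H2; auto. tauto.
Qed.
Definition sl2 (x y u v : Z) : M2 Z := mkM2 u v (- y)%Z x.
Lemma sl2_Gam0 x y u v : (u * x + v * y = 1)%Z -> (p | y)%Z -> Gam0 p (sl2 x y u v).
Proof. intros H [j Hj]. split; [unfold Zdet, sl2; mcbn; lia|]. exists (- j)%Z. cbn [sl2 m21]. lia. Qed.
Lemma sl2_kill x y h : oz (- y) ** (h ** oz x) +o oz x ** (h ** oz y) = O0.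
Proof. replace (oz (- y)) with (Oopp (oz y)) by (unfold oz, Oopp; pcbn; f_equal; ring). ring. Qed.

(** With lower left block zero, unitarity makes S = B A^* Hermitian and E the inverse of A^* , so M
    is the translation by S times a diagonal block matrix. *)
Lemma parabolic_good M : inG M -> m21 M = MO0 -> good M.
Proof.
 intros [UM _] H0. destruct M as [A B Cb E]. cbn [m21] in H0. subst Cb. destruct UM as [_ [_ [R3 R4]]]. cbn [m11 m12 m21 m22] in R3, R4.
 assert (R3' : MOmul D (MOstar E) A = MO1) by (rewrite <- R3; ob).
 pose proof (EA D HD0 HD4 A E R3') as h. pose proof (Mmul_comm1 _ _ h) as h2.
 pose proof (f_equal Mstar h) as h3. pose proof (f_equal Mstar h2) as h4. rewrite Mstar_mul, Mstar_star, Mstar_1 in h3, h4.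
 apply (f_equal (MOtoC D)) in R4. rewrite mc_sub, !(mc_mul D HD0 HD4), !mc_star, mc_0 in R4.
 set (S := MOmul D B (MOstar A)).
 assert (R4' : Mmul (Mstar (MOtoC D E)) (MOtoC D B) = Mmul (Mstar (MOtoC D B)) (MOtoC D E)).
 { set (X := Mmul _ _) in *. set (Y := Mmul (Mstar (MOtoC D B)) _) in *. transitivity (Madd (Msub X Y) Y); [destruct X, Y; mx|rewrite R4; destruct Y; mx]. }
 assert (HS : MOstar S = S).
 { apply (mc_inj D HD0). unfold S. rewrite mc_star, !(mc_mul D HD0 HD4), mc_star, Mstar_mul, Mstar_star.
  transitivity (Mmul (MOtoC D A) (Mmul (Mmul (Mstar (MOtoC D B)) (MOtoC D E)) (Mstar (MOtoC D A)))).
  - rewrite <- Mmul_assoc, h4, Mmul_1_r. reflexivity.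
  - rewrite <- R4', <- Mmul_assoc, Mmul_assoc, h2, Mmul_1_l. reflexivity. }
 assert (EB : B = MOmul D S E).
 { apply (mc_inj D HD0). unfold S. rewrite !(mc_mul D HD0 HD4), mc_star, <- Mmul_assoc, h3, Mmul_1_r. reflexivity. }
 replace (mkM2 A B MO0 E) with (Bmul D (mkM2 MO1 S MO0 MO1) (mkM2 A MO0 MO0 E)).
 - apply good_mul; auto; [apply (good_trans D p HD0 HD4 k cf); auto|apply (good_diag D p HD0 HD4 k cf K1 HK1 Hcf); auto].
 - rewrite EB. clearbody S. clear. destruct A as [a1 a2 a3 a4], E as [e1 e2 e3 e4], S as [s1 s2 s3 s4]. ob.
Qed.

(** A row operation brings the first column of A to (g, 0). Unitarity then forces the remaining
    entries c12 and e12 to vanish, so the second coordinate carries a Hermitian pair (a, c), which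
    an embedded SL2(Z) matrix of level p reduces; the parabolic case remains. *)
Lemma column0_good M : inG M -> m11 (m21 M) = O0 -> m21 (m21 M) = O0 -> good M.
Proof using All.
 intros HM C11 C21. destruct (pid_row (m11 (m11 M)) (m21 (m11 M))) as [V [HV HVa]].
 pose proof (dgE_Elem V HV) as EV. apply (elem_back _ _ EV). pose proof (inG_mul _ _ (proj1 EV) HM) as HM'.
 set (N := Bmul D (dgE V) M) in *.
 assert (A21 : m21 (m11 N) = O0) by (rewrite <- HVa; unfold N, dgE; obr; ring).
 assert (D11 : m11 (m21 N) = O0) by (unfold N, dgE; obr; rewrite C11, C21; ring).
 assert (D21 : m21 (m21 N) = O0) by (unfold N, dgE; obr; rewrite C11, C21; ring).
 clearbody N. clear M HM C11 C21 HVa EV V HV.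
 pose proof HM' as [[R1 [_ [R3 _]]] [_ [_ [_ P22]]]].
 pose proof (f_equal m12 R1) as Ra. pose proof (f_equal m22 R1) as Rb. pose proof (f_equal m11 R3) as Rc. pose proof (f_equal m21 R3) as Rd. pose proof (f_equal m22 R3) as Re'.
 unfold MOsub, MOmul, MOstar, MO0, MO1 in Ra, Rb, Rc, Rd, Re'. cbn [m11 m12 m21 m22] in Ra, Rb, Rc, Rd, Re'.
 destruct Oconj_O01 as [e0 _]. let kl H := (repeat rewrite ?A21, ?D11, ?D21, ?e0 in H) in kl Ra; kl Rb; kl Rc; kl Rd; kl Re'.
 set (g := m11 (m11 N)) in *. set (c12 := m12 (m21 N)) in *. set (a := m22 (m11 N)) in *. set (c := m22 (m21 N)) in *. set (e12 := m12 (m22 N)) in *.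
 assert (Hg : g <> O0).
 { intros E. rewrite E in Rc. assert (E' : O0 = O1) by (rewrite <- Rc; ring). discriminate. }
 assert (cj0 : forall x, Oconj x = O0 -> x = O0) by (intros x E; rewrite <- (Oconj_conj x), E; reflexivity).
 assert (Hc12 : c12 = O0).
 { destruct (O_integral D HD0 HD4 (Oconj g) c12) as [h|h]; auto; [|exfalso; auto].
  transitivity (Oopp (O0 ** m12 (m11 N) +o O0 ** a +o Oopp (Oconj g ** c12 +o O0 ** c))); [ring|rewrite Ra; ring]. }
 assert (He12 : e12 = O0).
 { destruct (O_integral D HD0 HD4 (Oconj e12) g) as [h|h]; auto; [|tauto].
  etransitivity; [|exact Rd]. ring. }
 rewrite Hc12, ?e0 in Rb. rewrite Hc12, He12, ?e0 in Re'.
 destruct (hermitian_pair a c) as [h [x [y [u [v [Ha [Hc Hb]]]]]]].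
 { transitivity (O0 ** m12 (m11 N) +o Oconj c ** a +o Oopp (Oconj (m12 (m11 N)) ** O0 +o Oconj a ** c) +o Oconj a ** c); [ring|rewrite Rb; ring]. }
 (* If p divided the common factor h of a and c, the relation conj(e22) a - conj(b22) c = 1 would
    make p a unit. *)
 assert (Hy : (p | y)%Z).
 { destruct (odv_split h y) as [Hy|Hy]; [rewrite <- Hc; exact P22|auto|]. exfalso. apply odv_1. rewrite <- Re', Ha, Hc.
  destruct Hy as [z ->]. eexists (Oconj (m22 (m22 N)) ** z ** oz x +o Oopp (Oconj (m22 (m12 N)) ** z ** oz y)). ring. }
 pose proof (E12_Elem _ (sl2_Gam0 x y u v Hb Hy)) as [_ EE]. apply (elem_back _ _ EE). apply parabolic_good; [apply inG_mul; auto; apply EE|].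
 unfold E2, sl2; obr. rewrite A21, D11, D21. fold a c c12. rewrite Hc12. apply M2_eq; mcbn; try ring.
 rewrite Ha, Hc. etransitivity; [|exact (sl2_kill x y h)]. ring.
Qed.

(** When the first column of the lower left block is (c, 0), a and c are h x and h y with x, y
    coprime integers. Since p | h y, either p | y and a matrix of level p clears c, or p | h and so
    p | a. *)
Lemma column_step M : inG M -> m21 (m21 M) = O0 -> good M \/ odv (m11 (m11 M)).
Proof using All.
 intros HM C21. pose proof HM as [[R1 _] [P11 _]]. pose proof (f_equal m11 R1) as Ra.
 unfold MOsub, MOmul, MOstar, MO0 in Ra. cbn [m11 m12 m21 m22] in Ra. destruct Oconj_O01 as [e0 _]. rewrite C21, e0 in Ra.
 set (a := m11 (m11 M)) in *. set (c := m11 (m21 M)) in *.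
 destruct (hermitian_pair a c) as [h [x [y [u [v [Ha [Hc Hb]]]]]]].
 { transitivity (Oconj c ** a +o O0 ** m21 (m11 M) +o Oopp (Oconj a ** c +o Oconj (m21 (m11 M)) ** O0) +o Oconj a ** c); [ring|rewrite Ra; ring]. }
 destruct (odv_split h y) as [Hy|Hy]; [rewrite <- Hc; exact P11| |].
 - left. pose proof (E12_Elem _ (sl2_Gam0 x y u v Hb Hy)) as [EE _]. apply (elem_back _ _ EE).
  apply column0_good; [apply inG_mul; auto; apply EE| |].
  + unfold E1, sl2; obr. fold a c. rewrite Ha, Hc. etransitivity; [|exact (sl2_kill x y h)]. ring.
  + unfold E1, sl2; obr. rewrite C21. ring.
 - right. rewrite Ha. destruct Hy as [z ->]. exists (z ** oz x). ring.
Qed.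

Lemma clear_c2 M : inG M -> exists V, Odet D V = O1 /\ m21 (m21 (Bmul D (dgE V) M)) = O0.
Proof.
 intros _. destruct (pid_row (m11 (m21 M)) (m21 (m21 M))) as [V0 [H1 H2]].
 exists (MOstar (Oadj V0)). split.
 - transitivity (Oconj (Odet D V0)); [|rewrite H1; reflexivity].
  unfold Odet, MOstar, Oadj; mcbn. rewrite !Oconj_add, !Oconj_opp, !Oconj_mul. ring.
 - rewrite <- H2. unfold dgE, Oadj; obr. rewrite !Oconj_opp, !Oconj_conj. ring.
Qed.

(** [column_step] fails only if p | a1. Then the lower unipotent matrix with entry p in the second
    coordinate changes c2 to p a2, and the column is cleared once more. A second failure would give
    p | N(a2), while unitarity says that a2 is invertible modulo p. Norms are needed because p may
    divide N(a2) without dividing a2. *)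
Theorem inG_good M : inG M -> good M.
Proof using All.
 intros HM. destruct (clear_c2 M HM) as [V [HV HC]]. pose proof (dgE_Elem V HV) as EV. apply (elem_back _ _ EV).
 pose proof (inG_mul _ _ (proj1 EV) HM) as HN. set (N := Bmul D (dgE V) M) in *. clearbody N. clear M HM V HV EV.
 destruct (column_step N HN HC) as [|Pa]; auto.
 set (g := mkM2 1%Z 0%Z p 1%Z). assert (Hg : Gam0 p g) by (split; [unfold Zdet, g; mcbn; ring|exists 1%Z; cbn [g m21]; ring]).
 pose proof (E12_Elem g Hg) as [_ EE]. apply (elem_back _ _ EE). pose proof (inG_mul _ _ (proj1 EE) HN) as HN2.
 set (N2 := Bmul D (E2 g) N) in *.
 assert (B1 : m11 (m11 N2) = m11 (m11 N)) by (unfold N2, E2, g; obr; change (oz 1) with O1; change (oz 0) with O0; ring).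
 assert (B2 : m21 (m21 N2) = oz p ** m21 (m11 N2)) by (unfold N2, E2, g; obr; rewrite HC; change (oz 1) with O1; change (oz 0) with O0; ring).
 rewrite <- B1 in Pa. clearbody N2. clear B1 EE HN HC N.
 destruct (clear_c2 N2 HN2) as [V [HV HC]]. pose proof (dgE_Elem V HV) as EV. apply (elem_back _ _ EV).
 pose proof (inG_mul _ _ (proj1 EV) HN2) as HN3.
 destruct (column_step _ HN3 HC) as [|Pa3]; auto. exfalso.
 destruct HN3 as [_ [Pc3 _]]. destruct HN2 as [[_ [_ [R3 _]]] [Pc [_ [_ _]]]].
 set (a1 := m11 (m11 N2)) in *. set (a2 := m21 (m11 N2)) in *. set (c1 := m11 (m21 N2)) in *.
 (* The product of the first columns of the lower and upper left blocks is unchanged by diagonal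
    block matrices. Before clearing it is conj(c1) a1 + p N(a2) with p^2 dividing the first term;
    afterwards, in the bad case, it is divisible by p^2. *)
 assert (Inv : Oconj (m11 (m21 (Bmul D (dgE V) N2))) ** m11 (m11 (Bmul D (dgE V) N2)) +o Oconj (m21 (m21 (Bmul D (dgE V) N2))) ** m21 (m11 (Bmul D (dgE V) N2))
  = Oconj c1 ** a1 +o Oconj (oz p ** a2) ** a2).
 { rewrite <- B2. unfold dgE, Oadj; obr. fold a1 a2 c1. rewrite !Oconj_add, !Oconj_mul, !Oconj_conj. destruct Oconj_O01 as [-> _].
  transitivity (Odet D V ** (Oconj c1 ** a1 +o Oconj (m21 (m21 N2)) ** a2)); [unfold Odet|rewrite HV; ring]. rewrite ?Oconj_opp, ?Oconj_conj. ring. }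
 rewrite HC in Inv. destruct Pa as [z1 Pa], Pa3 as [z3 Pa3], Pc3 as [w3 Pc3], Pc as [w1 Pc].
 rewrite Pa3, Pc3, Pa, Pc, !Oconj_mul, !oz_conj in Inv. destruct Oconj_O01 as [e0 _]. rewrite e0 in Inv.
 assert (Hz : oz p <> O0) by (intros E; apply (f_equal fst) in E; cbn [oz fst] in E; pose proof (prime_ge_2 p Hp); cbn in E; lia).
 assert (HN : odv (Oconj a2 ** a2)).
 { exists (Oconj w3 ** z3 +o Oopp (Oconj w1 ** z1)).
  destruct (O_integral D HD0 HD4 (oz p) (Oconj a2 ** a2 +o Oopp (oz p ** (Oconj w3 ** z3 +o Oopp (Oconj w1 ** z1))))) as [h|h]; [|tauto|].
  - transitivity (oz p ** Oconj w1 ** (oz p ** z1) +o oz p ** Oconj a2 ** a2 +o Oopp (oz p ** Oconj w3 ** (oz p ** z3) +o O0 ** m21 (m11 (Bmul D (dgE V) N2)))); [ring|]. rewrite Inv. ring.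
  - transitivity (Oconj a2 ** a2 +o Oopp (oz p ** (Oconj w3 ** z3 +o Oopp (Oconj w1 ** z1))) +o oz p ** (Oconj w3 ** z3 +o Oopp (Oconj w1 ** z1))); [ring|]. rewrite h. ring. }
 (* Modulo p the upper left entry of E^* A - B^* C = 1 reads f2 a2 = 1, because a1, c1 and c2 are
    divisible by p; taking norms contradicts p | N(a2). *)
 pose proof (f_equal m11 R3) as Rc. unfold MOsub, MOmul, MOstar, MO1 in Rc. cbn [m11 m12 m21 m22] in Rc.
 fold a1 a2 c1 in Rc. rewrite B2, Pa, Pc in Rc. set (f2 := Oconj (m21 (m22 N2))) in *.
 assert (U1 : odv (O1 +o Oopp (f2 ** a2))).
 { rewrite <- Rc. exists (Oconj (m11 (m22 N2)) ** z1 +o Oopp (Oconj (m11 (m12 N2)) ** w1 +o Oconj (m21 (m12 N2)) ** a2)). ring. }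
 apply odv_1. destruct U1 as [r Hr], HN as [s Hs].
 assert (E : f2 ** a2 = O1 +o Oopp (oz p ** r)) by (rewrite <- Hr; ring).
 pose proof (f_equal Oconj E) as Ec. rewrite Oconj_mul, Oconj_add, Oconj_opp, Oconj_mul, oz_conj in Ec. destruct Oconj_O01 as [_ e1]. rewrite e1 in Ec.
 exists (f2 ** Oconj f2 ** s +o r +o Oconj r +o Oopp (oz p ** r ** Oconj r)).
 transitivity (f2 ** a2 ** (Oconj f2 ** Oconj a2) +o oz p ** r +o oz p ** Oconj r +o Oopp (oz p ** oz p ** r ** Oconj r)); [rewrite E, Ec; ring|].
 transitivity (f2 ** Oconj f2 ** (Oconj a2 ** a2) +o oz p ** r +o oz p ** Oconj r +o Oopp (oz p ** oz p ** r ** Oconj r)); [ring|]. rewrite Hs. ring.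
Qed.

Lemma Fl_herm_form : is_herm_form D k p F.
Proof using All.
 split; [apply (Fl_holo2 D p HD0 HD4 k cf K1 HK1 Hcf)|].
 intros A B Cb E [HU [H1 [H2 [H3 H4]]]] Z HZ. destruct (inG_good (mkM2 A B Cb E)) as [_ K].
 - split; auto. mcbn. rewrite <- !odv_mult. auto.
 - exact (K Z HZ).
Qed.
End Generation.

(** * Coefficients and injectivity *)

Fixpoint twist {I} (nus : list (I -> Z)) (rs : list (nat * nat)) (i : I) : Cx :=
 match nus, rs with
 | nu :: nus, (j, M) :: rs => (e (RtoC (IZR (nu i) * INR j / INR M)) * twist nus rs i)%C
 | _, _ => C1
 end.
Lemma Cabs_twist {I} nus rs (i : I) : Cabs (twist nus rs i) = 1.
Proof.
 revert rs. induction nus as [|nu nus IH]; intros [|[j M] rs]; simpl; try apply Cabs_1.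
 rewrite Cabs_mul, Cabs_e_real, IH. ring.
Qed.
(** One frequency is isolated at a time; the characters of the frequencies not yet treated have
    absolute value 1 and are absorbed into the coefficients. *)
Lemma freq_isolate_list {I} (nus : list (I -> Z)) : forall c : I -> Cx, AbsSum c ->
 (forall rs, (forall jM, In jM rs -> (0 < snd jM)%nat) -> length rs = length nus -> HasSum (fun i => (c i * twist nus rs i)%C) C0) ->
 forall i0, HasSum (fun i => if forallb (fun nu => Z.eqb (nu i) (nu i0)) nus then c i else C0) C0.
Proof.
 induction nus as [|nu nus IH]; intros c Hc H i0.
 - eapply HasSum_ext; [|apply (H nil); [intros ? []|reflexivity]]. intros i. simpl. ring.
 - eapply HasSum_ext; [|apply (IH (fun i => if Z.eq_dec (nu i) (nu i0) then c i else C0)) with (i0 := i0)].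
  + intros i. cbv beta. cbn [forallb]. destruct (Z.eq_dec (nu i) (nu i0)) as [E|E].
   * rewrite E, Z.eqb_refl. reflexivity.
   * apply Z.eqb_neq in E. rewrite E. simpl. destruct (forallb _ nus); reflexivity.
  + apply (AbsSum_restrict c (fun i => nu i = nu i0)). auto.
  + intros rs Hrs Hl.
   assert (K : HasSum (fun i => if Z.eq_dec (nu i) (nu i0) then (c i * twist nus rs i)%C else C0) C0).
   { apply freq_isolate.
    - apply (AbsSum_le _ _ 1 Hc). intros i. rewrite Cabs_mul, Cabs_twist. lra.
    - intros j M HM. eapply HasSum_ext; [|apply (H ((j, M) :: rs)); [|simpl; lia]].
     + intros i. simpl. ring.
     + intros jM [<-|h]; auto. }
   eapply HasSum_ext; [|exact K]. intros i. cbv beta. destruct (Z.eq_dec (nu i) (nu i0)); ring.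
Qed.

Lemma Zrange_in z N : (Z.abs z <= Z.of_nat N)%Z -> In z (Zrange N).
Proof. intros H. apply in_map_iff. exists (Z.to_nat (z + Z.of_nat N)). split; [lia|]. apply in_seq. lia. Qed.
Lemma Zrange_NoDup N : NoDup (Zrange N).
Proof. apply NoDup_map_NoDup_ForallPairs; [|apply seq_NoDup]. intros x y _ _. lia. Qed.
Lemma Sbox_NoDup N : NoDup (Sbox N).
Proof.
 pose proof (Zrange_NoDup N) as HZ. unfold Sbox. apply NoDup_flat_map; auto.
 - intros l _. apply NoDup_flat_map; auto.
  + intros m _. apply NoDup_flat_map; auto.
   * intros a _. apply NoDup_map_NoDup_ForallPairs; auto. intros b b' _ _ E. congruence.
   * intros a a' z _ _ H1 H2. apply in_map_iff in H1 as [b [<- _]]. apply in_map_iff in H2 as [b' [E _]]. congruence.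
  + intros m m' z _ _ H1 H2. apply in_flat_map in H1 as [a [_ H1]]. apply in_flat_map in H2 as [a' [_ H2]].
   apply in_map_iff in H1 as [b [<- _]]. apply in_map_iff in H2 as [b' [E _]]. congruence.
 - intros l l' z _ _ H1 H2. apply in_flat_map in H1 as [m [_ H1]]. apply in_flat_map in H2 as [m' [_ H2]].
  apply in_flat_map in H1 as [a [_ H1]]. apply in_flat_map in H2 as [a' [_ H2]].
  apply in_map_iff in H1 as [b [<- _]]. apply in_map_iff in H2 as [b' [E _]]. congruence.
Qed.
Lemma Sbox_exhaust T : exists N, forall n, (N <= n)%nat -> In T (Sbox n).
Proof.
 destruct T as [[l m] [a b]]. exists (Z.to_nat (Z.abs l + Z.abs m + Z.abs a + Z.abs b)). intros n Hn. unfold Sbox.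
 apply in_flat_map. exists l. split; [apply Zrange_in; lia|]. apply in_flat_map. exists m. split; [apply Zrange_in; lia|].
 apply in_flat_map. exists a. split; [apply Zrange_in; lia|]. apply in_map_iff. exists b. split; [reflexivity|apply Zrange_in; lia].
Qed.

Lemma alz_linear D c a b z : alz D (fun n => (c * a n + b n)%C) z = (c * alz D a z + alz D b z)%C.
Proof. unfold alz, Cdiv. destruct (Z_le_gt_dec z 0); ring. Qed.
Lemma alz_nonpos D a z : (z <= 0)%Z -> alz D a z = C0.
Proof. unfold alz. destruct (Z_le_gt_dec z 0); [auto|lia]. Qed.
Lemma alz_to_nat D a z : alz D a (Z.of_nat (Z.to_nat z)) = alz D a z.
Proof. destruct (Z_le_gt_dec z 0); [rewrite !alz_nonpos by lia|rewrite Z2Nat.id by lia]; reflexivity. Qed.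
Lemma Cf_linear D p k c a b T : Cf D p k (fun n => (c * a n + b n)%C) T = (c * Cf D p k a T + Cf D p k b T)%C.
Proof.
 unfold Cf. destruct (Z_le_gt_dec (snd (fst T)) 0); [ring|]. rewrite <- Csum_map_scal, <- Csum_map_add.
 f_equal. apply map_ext. intros d. unfold dterm. rewrite alz_linear. ring.
Qed.

(** * The lift as a linear injective map *)

Section Main.
Context (D p : Z) (k : nat) (HD : prime D) (HD4 : (D mod 4 = 3)%Z) (Hh : class_number_one D)
 (Hp : prime p) (HpD : ~ (D | p)%Z) (Hk : (0 < k)%nat) (Hu : card_units_divides D k).
Let HD0 : (0 < D)%Z := prime_pos D HD.

Lemma nonsquare_m1 : forall s, ~ (D | s * s + 1)%Z.
Proof. clear - HD HD4. destruct (th_S_ex D HD HD4) as [C [HC HS]]. exact (m1_nonsquare D HD HD4 C HC HS). Qed.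

(** The coefficients are chosen from f alone, so that the lift is a function of f; uniqueness of
    expansions makes the choice irrelevant. *)
Definition qcoef (f : Cx -> Cx) : nat -> Cx := epsilon (inhabits (fun _ => C0)) (qexp f).
Lemma qcoef_eq f a : qexp f a -> qcoef f = a.
Proof. intros H. apply functional_extensionality. intros n. apply (qexp_unique f); auto. unfold qcoef. apply epsilon_spec. eauto. Qed.

Section OneForm.
Context (f : Cx -> Cx) (Hf : is_plus_cusp_form D (k - 1) (D * p) f).
Lemma plus_qexp : exists a, qexp f a /\ qcoef f = a /\ a 0%nat = C0 /\ (exists K, 0 <= K /\ forall n, Cabs (a n) <= K * INR n ^ (k - 1)) /\
 (forall n, chiK D (Z.of_nat n) = 1%Z -> a n = C0) /\
 exists Ph, (forall Z, inH (m11 Z) -> ASum (jterm D a Z) (Ph Z)) /\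
  (forall g Z, Gam0 p g -> inH (m11 Z) -> Ph (Zact g Z) = (Cpow (Zj g Z) k * Ph Z)%C).
Proof.
 destruct Hf as [Hc Hpl]. pose proof (prime_pos p Hp) as Hp0. pose proof (prime_pos D HD) as HDp.
 destruct (cusp_nser D HD (k - 1) (D * p) f Hc) as [a [_ [Ha _]]].
 assert (Hq : qexp f a) by (apply qexp_nser; intros; apply Ha; auto).
 destruct (cusp_coeff_bound D HD (k - 1) (D * p) ltac:(nia) ltac:(exists p; ring) f Hc nonsquare_m1 a Hq) as [H0 HB].
 exists a. split; [auto|]. split; [apply qcoef_eq; auto|]. split; auto. split; auto. split; [apply Hpl; auto|].
 destruct (th_S_ex D HD HD4) as [C [HC HS]]. exists (Phi D f). split.
 - intros Z HZ. apply (Phi_HasSum D HD HD4 p Hp C HC HS k Hk f Hc a Hq Z HZ).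
 - intros g Z. apply (Phi_Gam0 D HD HD4 p Hp HpD C HC HS k Hk f Hc a Hq (Hpl a Hq)).
Qed.

Lemma lift_herm_form : is_herm_form D k p (Fl D p k (qcoef f)).
Proof using All.
 destruct plus_qexp as [a [Hq [-> [_ [[K1 [HK1 HB]] [_ [Ph [H1 H2]]]]]]]].
 exact (Fl_herm_form D p HD0 HD4 Hh Hp k Hk Hu a K1 HK1 HB Ph H1 H2).
Qed.
Lemma Fterm_sum Z : inH2 Z -> AbsSum (Fterm D p k (qcoef f) Z).
Proof using All.
 destruct plus_qexp as [a [Hq [-> [_ [[K1 [HK1 HB]] _]]]]]. apply (Fterm_AbsSum0 D p HD0 HD4 k a K1 HK1 HB).
Qed.
Lemma lift_fourier : fourier D (Fl D p k (qcoef f)) (Cf D p k (qcoef f)).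
Proof using All.
 split.
 - intros T HT. destruct (excluded_middle_informative (Cf D p k (qcoef f) T = C0)) as [|n]; auto. exfalso. apply HT.
  apply Cf_nonzero in n as [Hm Hd]; auto. pose proof (T_pos D HD0 HD4 T Hm Hd) as Hl. pose proof (tx_size D HD0 HD4 T Hm Hd) as Ht.
  intros v1 v2. destruct T as [[l m] x]. cbn [fst snd] in *. unfold Tmat, Mquad; mcbn. fold (tx D x). set (t := tx D x) in *.
  apply IZR_lt in Hl. apply Rmult_le_reg_l with (IZR l); auto. rewrite Rmult_0_r.
  (* Completing the square: l times the value of the form is |l v1 + t v2|^2 + (l m - |t|^2)
     |v2|^2. *)
  match goal with |- _ <= IZR l * ?X => replace (IZR l * X) with (Cnorm2 (ZtoC l * v1 + t * v2)%C + (IZR l * IZR m - Cnorm2 t) * Cnorm2 v2)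
   by (unfold Cnorm2; simpl; ring) end.
  pose proof (Cnorm2_pos (ZtoC l * v1 + t * v2)%C). pose proof (Cnorm2_pos v2).
  assert (0 <= (IZR l * IZR m - Cnorm2 t) * Cnorm2 v2) by (apply Rmult_le_pos; lra). lra.
 - intros Z HZ term. assert (Et : term = Fterm D p k (qcoef f) Z).
  { apply functional_extensionality. intros T. unfold term, Fterm. rewrite tex_Mtr. reflexivity. }
  pose proof (Fterm_sum Z HZ) as HA. split.
  + destruct HA as [B HB]. exists B. intros N. rewrite Et. apply HB, Sbox_NoDup.
  + rewrite Et. apply HasSum_Cconv; [apply Sumv_spec; auto|apply Sbox_NoDup|apply Sbox_exhaust].
Qed.
End OneForm.

(** For m > 0 the relation is the definition of [Cf]. A semidefinite T has m >= 0, and for m = 0 its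
    determinant is not positive, so every term of the divisor sum vanishes as well. *)
Lemma lift_maass a : maass_rel D k p (Cf D p k a) (fun n => alz D a (Z.of_nat n)).
Proof.
 clear - HD0 HD4. intros T HT _.
 assert (Hm0 : (0 <= snd (fst T))%Z).
 { specialize (HT C0 C1). destruct T as [[l m] x]. unfold Tmat, Mquad in HT; cbn [m11 m12 m21 m22 fst snd] in *. apply le_IZR.
  match type of HT with 0 <= ?X => replace X with (IZR m) in HT; [auto|simpl; ring] end. }
 unfold Cf. destruct (Z_le_gt_dec (snd (fst T)) 0) as [h|h].
 - symmetry. apply Csum_map_0. intros d Hd.
  assert (Hd0 : (0 < d)%nat) by (apply filter_In in Hd as [Hd _]; apply in_seq in Hd; lia).
  (* [Z.to_nat] sends a negative quotient to 0, where [alz] is zero too, so the truncation does not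
     disturb the relation. *)
  rewrite alz_to_nat, alz_nonpos; [ring|].
  assert (DdetT D T <= 0)%Z.
  { destruct T as [[l m] x]. unfold DdetT; cbn [fst snd] in *. assert (m = 0)%Z by lia. subst m. pose proof (Onorm_Ou D HD4 x).
   pose proof (Z.square_nonneg (Ou x)). pose proof (Z.mul_nonneg_nonneg D (snd x * snd x) ltac:(lia) (Z.square_nonneg _)). lia. }
  assert (DdetT D T / (Z.of_nat d * Z.of_nat d) < 1)%Z by (apply Z.div_lt_upper_bound; nia). lia.
 - f_equal. apply map_ext. intros d. unfold dterm. now rewrite alz_to_nat.
Qed.

Lemma aD_solution l : aD D l <> 0%nat -> exists y, (D | y * y + Z.of_nat l)%Z.
Proof.
 clear - HD0. intros H. unfold aD in H. destruct (filter _ _) as [|y L] eqn:E; [tauto|].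
 assert (Hy : In y (y :: L)) by (left; auto). rewrite <- E in Hy. apply filter_In in Hy as [_ Hy]. apply Z.eqb_eq, Z.mod_divide in Hy; [|lia].
 exists (Z.of_nat y). unfold Onorm in Hy. destruct Hy as [j Hj]. exists j. lia.
Qed.
(** If -l is not a square modulo D, then l is nonzero and, every residue being a square or minus a
    square, l itself is a square. Hence the coefficients that the formula for alpha cannot recover
    vanish by the plus condition. *)
Lemma aD_zero l : aD D l = 0%nat -> chiK D (Z.of_nat l) = 1%Z.
Proof.
 clear - HD HD0 HD4. intros H.
 assert (K : forall y, ~ (D | y * y + Z.of_nat l)%Z).
 { intros y [j Hj]. pose proof (Z.mod_pos_bound y D HD0) as Hb. destruct (mod_cong D HD y) as [i Hi].
  assert (Hin : In (Z.to_nat (y mod D)) (filter (fun a => Z.eqb ((Onorm D (Z.of_nat a, 0%Z) + Z.of_nat l) mod D) 0) (seq 0 (Z.to_nat D)))).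
  { apply filter_In. split; [apply in_seq; lia|]. apply Z.eqb_eq, Z.mod_divide; [lia|]. rewrite Z2Nat.id by lia.
   exists (j + i * (y mod D + y))%Z. unfold Onorm. nia. }
  unfold aD in H. apply length_zero_iff_nil in H. rewrite H in Hin. destruct Hin. }
 destruct (sq_or_neg D HD nonsquare_m1 (Z.of_nat l)) as [x [Hx|Hx]].
 - apply (chi_sq D HD) with x; auto. intros hl. apply (K 0%Z). now rewrite Z.mul_0_l, Z.add_0_l.
 - exfalso. apply (K x). now rewrite Z.add_comm.
Qed.

Lemma Cf_determines f g : is_plus_cusp_form D (k - 1) (D * p) f -> is_plus_cusp_form D (k - 1) (D * p) g ->
 (forall T, Cf D p k (qcoef f) T = Cf D p k (qcoef g) T) -> forall t, inH t -> f t = g t.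
Proof using All.
 intros Hf Hg H t Ht. destruct (plus_qexp f Hf) as [a [Ha [Ea [a0 [_ [Pa _]]]]]]. destruct (plus_qexp g Hg) as [b [Hb [Eb [b0 [_ [Pb _]]]]]].
 rewrite Ea, Eb in H. apply (HasSum_unique (nser a t)); [apply (qexp_AbsSum f a Ha t Ht)|].
 eapply HasSum_ext; [|apply (qexp_AbsSum g b Hb t Ht)]. intros n. unfold nser. f_equal.
 destruct (Nat.eq_dec n 0) as [->|Hn]; [congruence|].
 destruct (Nat.eq_dec (aD D n) 0) as [E|E]; [rewrite Pa, Pb; auto using aD_zero|].
 (* With D j = y^2 + n, the index with diagonal (j, 1) and off-diagonal y has D det T = n; as m = 1
    its content is 1, and the divisor sum is the single value alpha(n). *)
 destruct (aD_solution n E) as [y [j Hj]]. specialize (H (j, 1%Z, (y, 0%Z))).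
 assert (K : forall c, Cf D p k c (j, 1%Z, (y, 0%Z)) = alz D c (Z.of_nat n)).
 { intros c. rewrite (Cf_long D p k Hk c _ 1%nat) by (pcbn; lia). cbn [seq map Csum fold_right].
  assert (Ee : epsT (j, 1%Z, (y, 0%Z)) = 1%Z) by (unfold epsT; rewrite Z.gcd_1_r, Z.gcd_1_l; reflexivity).
  unfold okd. rewrite Ee. change (Z.of_nat 1) with 1%Z. rewrite Z.gcd_1_l. change ((1 mod 1 =? 0) && (1 =? 1))%Z%bool with true. unfold dterm.
  replace (DdetT D (j, 1%Z, (y, 0%Z)) / (Z.of_nat 1 * Z.of_nat 1))%Z with (Z.of_nat n).
  - change (INR 1) with 1. change (RtoC 1) with C1. rewrite Cpow_1_l. ring.
  - change (Z.of_nat 1 * Z.of_nat 1)%Z with 1%Z. rewrite Z.div_1_r. unfold DdetT, Onorm. lia. }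
 rewrite !K in H. unfold alz in H. destruct (Z_le_gt_dec (Z.of_nat n) 0); [lia|]. rewrite Nat2Z.id in H.
 pose proof Ci_neq0 as hC.
 assert (hs : RtoC (sqrt (IZR D)) <> C0) by (apply RtoC_neq0; pose proof (dl_pos D HD0); lra).
 assert (ha : RtoC (INR (aD D n)) <> C0) by (apply RtoC_neq0, not_0_INR; auto).
 assert (R : forall c, c = (RtoC (sqrt (IZR D)) * c / (Ci * RtoC (INR (aD D n))) * (Ci * RtoC (INR (aD D n)) / RtoC (sqrt (IZR D))))%C) by (intros; field; auto).
 rewrite (R (a n)), (R (b n)), H. reflexivity.
Qed.

(** Real translations of the variable around i times the identity turn the Fourier series into a
    family of characters in l, m, [snd x] and the trace of x. These four integers determine T, so
    all coefficients are recovered. *)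
Lemma lift_injective f g : is_plus_cusp_form D (k - 1) (D * p) f -> is_plus_cusp_form D (k - 1) (D * p) g ->
 (forall Z, inH2 Z -> Fl D p k (qcoef f) Z = Fl D p k (qcoef g) Z) -> forall t, inH t -> f t = g t.
Proof using All.
 intros Hf Hg H. apply Cf_determines; auto. intros T0.
 (* The off-diagonal entries r3 - i sqrt(D) r4 and r3 + i sqrt(D) r4 are conjugate, so the imaginary
    part stays the identity, and the scaling by sqrt(D) makes r4 rotate exactly the integer
    frequency [Ou x]. *)
 set (sh := fun r1 r2 r3 r4 : R => mkM2 (mkC r1 1) (mkC r3 (- (sqrt (IZR D) * r4))) (mkC r3 (sqrt (IZR D) * r4)) (mkC r2 1)).
 assert (Hsh : forall r1 r2 r3 r4, inH2 (sh r1 r2 r3 r4)).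
 { intros. intros v1 v2 Hv. rewrite Hquad. unfold sh; mcbn.
  match goal with |- 0 < ?X => replace X with (Cnorm2 v1 + Cnorm2 v2) by (unfold Cnorm2; simpl; ring) end.
  pose proof (Cnorm2_pos v1). pose proof (Cnorm2_pos v2). destruct Hv as [hv|hv]; apply Cnorm2_gt0 in hv; lra. }
 set (Z0 := sh 0 0 0 0). set (df := fun T => (Fterm D p k (qcoef f) Z0 T - Fterm D p k (qcoef g) Z0 T)%C).
 set (nus := (fun T : Sidx => fst (fst T)) :: (fun T : Sidx => snd (fst T)) :: (fun T : Sidx => snd (snd T)) :: (fun T : Sidx => Ou (snd T)) :: nil).
 assert (K : HasSum (fun T => if forallb (fun nu => Z.eqb (nu T) (nu T0)) nus then df T else C0) C0).
 { apply freq_isolate_list.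
  - unfold df. apply AbsSum_ext with (fun T => (Fterm D p k (qcoef f) Z0 T + ZtoC (-1) * Fterm D p k (qcoef g) Z0 T)%C); [intros; ring|].
   apply AbsSum_add; [|apply AbsSum_scal]; apply Fterm_sum; auto; apply Hsh.
  - intros [|[j1 M1'] [|[j2 M2'] [|[j3 M3] [|[j4 M4] [|? ?]]]]] _ Hl; try discriminate.
   set (r1 := INR j1 / INR M1'). set (r2 := INR j2 / INR M2'). set (r3 := INR j3 / INR M3). set (r4 := INR j4 / INR M4).
   pose proof (HasSum_sub _ _ _ _ (Sumv_spec _ (Fterm_sum f Hf _ (Hsh r1 r2 r3 r4))) (Sumv_spec _ (Fterm_sum g Hg _ (Hsh r1 r2 r3 r4)))) as HS.
   change (Sumv (Fterm D p k (qcoef f) (sh r1 r2 r3 r4))) with (Fl D p k (qcoef f) (sh r1 r2 r3 r4)) in HS.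
   change (Sumv (Fterm D p k (qcoef g) (sh r1 r2 r3 r4))) with (Fl D p k (qcoef g) (sh r1 r2 r3 r4)) in HS.
   rewrite (H _ (Hsh r1 r2 r3 r4)) in HS.
   replace C0 with (Fl D p k (qcoef g) (sh r1 r2 r3 r4) - Fl D p k (qcoef g) (sh r1 r2 r3 r4))%C by ring.
   eapply HasSum_ext; [|exact HS]. intros [[l m] x]. unfold df, Fterm, nus. cbn [twist fst snd].
   assert (Et : tex D (l, m, x) (sh r1 r2 r3 r4) = (tex D (l, m, x) Z0 + RtoC (IZR l * INR j1 / INR M1') + RtoC (IZR m * INR j2 / INR M2')
    + RtoC (IZR (snd x) * INR j3 / INR M3) + RtoC (IZR (Ou x) * INR j4 / INR M4))%C).
   { unfold tex, lx; pcbn. rewrite (tx_eq D HD0).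
    assert (Er : forall z j M, IZR z * INR j / INR M = IZR z * (INR j / INR M)) by (intros; unfold Rdiv; ring).
    rewrite !Er. fold r1 r2 r3 r4. clearbody r1 r2 r3 r4. unfold Z0, sh; mcbn. pose proof (dl_pos D HD0). apply Cx_eq; cbn [Re Im Cadd Cmul Cconj ZtoC RtoC]; field; lra. }
   rewrite Et, !e_add. ring. }
 assert (Ed : df T0 = C0).
 { pose proof (HasSum_finite (fun T => if forallb (fun nu => Z.eqb (nu T) (nu T0)) nus then df T else C0) (T0 :: nil) ltac:(repeat constructor; auto)) as K2.
  refine (eq_trans _ (HasSum_unique _ _ _ (K2 _) K)).
  - simpl. rewrite !Z.eqb_refl. simpl. ring.
  - intros [[l m] [x1 x2]] Hn. destruct (forallb _ nus) eqn:Eb; auto. exfalso. apply Hn. left. destruct T0 as [[l' m'] [y1 y2]].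
   unfold nus, Ou in Eb. cbn [forallb fst snd] in Eb. rewrite !Bool.andb_true_iff, !Z.eqb_eq in Eb.
   destruct Eb as [E1 [E2 [E3 [E4 _]]]]. subst. f_equal. f_equal. lia. }
 unfold df, Fterm in Ed. pose proof (e_neq0 (tex D T0 Z0)) as He.
 replace (Cf D p k (qcoef f) T0) with ((Cf D p k (qcoef f) T0 * e (tex D T0 Z0) - Cf D p k (qcoef g) T0 * e (tex D T0 Z0)) / e (tex D T0 Z0) + Cf D p k (qcoef g) T0)%C by (field; auto).
 rewrite Ed. field. auto.
Qed.

Lemma lift_linear f g c : is_plus_cusp_form D (k - 1) (D * p) f -> is_plus_cusp_form D (k - 1) (D * p) g -> forall Z, inH2 Z ->
 Fl D p k (qcoef (fun t => c * f t + g t)%C) Z = (c * Fl D p k (qcoef f) Z + Fl D p k (qcoef g) Z)%C.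
Proof using All.
 intros Hf Hg Z HZ. pose proof (Fterm_sum f Hf Z HZ) as Af. pose proof (Fterm_sum g Hg Z HZ) as Ag.
 destruct (plus_qexp f Hf) as [a [Ha [Ea _]]]. destruct (plus_qexp g Hg) as [b [Hb [Eb _]]].
 rewrite (qcoef_eq _ (fun n => (c * a n + b n)%C)).
 - rewrite Ea, Eb in *. apply Sumv_eq. eapply HasSum_ext; [|apply HasSum_add; [apply HasSum_scal, (Sumv_spec _ Af)|apply (Sumv_spec _ Ag)]].
  intros T. cbv beta. unfold Fterm. rewrite Cf_linear. ring.
 - apply qexp_nser. intros t Ht. eapply HasSum_ext; [|apply HasSum_add; [apply HasSum_scal, (qexp_AbsSum f a Ha t Ht)|apply (qexp_AbsSum g b Hb t Ht)]].
  intros n. unfold nser. ring.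
Qed.
End Main.

Theorem theorem4p4 (D p : Z) (k : nat)
  (HD : prime D) (HD4 : (D mod 4 = 3)%Z) (Hh : class_number_one D)
  (Hp : prime p) (Hp2 : (2 < p)%Z) (Hsplit : splits_in_K D p)
  (Hk : (0 < k)%nat) (Hunits : card_units_divides D k) :
  exists Phi : (Cx -> Cx) -> (M2 Cx -> Cx),
    (* Phi maps S^+_{k-1}(Dp, chi_K)^{p-old} into M^*_k(p) *)
    (forall f, is_plus_pold D p (k - 1) f -> is_maass_form D k p (Phi f)) /\
    (* Cx-linearity *)
    (forall f g c, is_plus_pold D p (k - 1) f -> is_plus_pold D p (k - 1) g ->
       forall Z, inH2 Z ->
         Phi (fun t => Cadd (Cmul c (f t)) (g t)) Z = Cadd (Cmul c (Phi f Z)) (Phi g Z)) /\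
    (* injectivity *)
    (forall f g, is_plus_pold D p (k - 1) f -> is_plus_pold D p (k - 1) g ->
       (forall Z, inH2 Z -> Phi f Z = Phi g Z) -> forall t, inH t -> f t = g t) /\
    (* the formula for alpha^*_{F_f} *)
    (forall f a, is_plus_pold D p (k - 1) f -> qexp f a ->
       exists Cf alpha, fourier D (Phi f) Cf /\ maass_rel D k p Cf alpha /\
         forall l : nat, aD D l <> 0%nat ->
           alpha l = Cdiv (Cmul (RtoC (sqrt (IZR D))) (a l)) (Cmul Ci (RtoC (INR (aD D l))))).
Proof.
 assert (HpD : ~ (D | p)%Z).
 { destruct Hsplit as [h _]. intros hD. apply h. pose proof (prime_ge_2 D HD). pose proof (prime_ge_2 p Hp).
  destruct (prime_divisors p Hp D hD) as [E|[E|[E|E]]]; try lia. rewrite E. apply Z.divide_refl. }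
 pose proof (prime_pos D HD) as HD0.
 exists (fun f => Fl D p k (qcoef f)). split; [|split; [|split]].
 - intros f [Hf _]. split; [apply lift_herm_form; auto|].
  exists (Cf D p k (qcoef f)), (fun n => alz D (qcoef f) (Z.of_nat n)). split; [apply lift_fourier; auto|apply lift_maass; auto].
 - intros f g c [Hf _] [Hg _]. apply lift_linear; auto.
 - intros f g [Hf _] [Hg _]. apply (lift_injective D p k); auto.
 - intros f a [Hf _] Ha. exists (Cf D p k (qcoef f)), (fun n => alz D (qcoef f) (Z.of_nat n)).
  split; [apply lift_fourier; auto|]. split; [apply lift_maass; auto|].
  destruct (plus_qexp D p k HD HD4 Hp HpD Hk f Hf) as [a' [_ [Ea [H0 _]]]]. rewrite (qcoef_eq f a Ha) in *. subst a'.
  intros l _. unfold alz. rewrite Nat2Z.id. destruct (Z_le_gt_dec (Z.of_nat l) 0) as [h|h]; [|reflexivity].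
  (* At l = 0 both sides vanish: [alz] by convention, and the constant coefficient because f is a
     cusp form. *)
  replace l with 0%nat by lia. rewrite H0. unfold Cdiv. ring.
Qed.
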